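(* Let $X$ be a scheme of finite type over a field $k$. Let $U$ be any dense open subset of $X$. Let $x_0\in X$ be a closed point. Let $Q$ be an $\mathfrak m_{X,x_0}$-primary ideal of $\mathcal O_{X,x_0}$, and let $e(Q)=e(Q,\mathcal O_{X,x_0})$. Then $e(Q)\deg_k(x_0)$ is the degree of some $0$-cycle $Z$ with support in $U$. If in addition $X$ is separated, then $Z$ can be chosen to be rationally equivalent in $X$ to $e(Q)[x_0]$. It follows that when $X$ is reduced, $\delta(X^{\mathrm{reg}}/k)$ divides $\gamma(\mathcal O_{X,x_0})\deg_k(x_0)$.
   Context: A $0$-cycle on $X/k$ is an integral combination $\sum n_P[P]$ of closed points; its degree is $\sum n_P\deg_k(P)$ with $\deg_k(P)=[k(P):k]$. Two cycles on $X$ are rationally equivalent if their difference is a finite sum $\sum_i[\operatorname{div}(g_i)]$ with $Y_i$ integral closed subschemes of $X$ and $g_i\in k(Y_i)^*$, where $[\operatorname{div}(g)]=\sum_x\operatorname{ord}_x(g)[\overline{\{x\}}]$ over the codimension-$1$ points $x$ of $Y$, and $\operatorname{ord}_x(a/b)=\ell(\mathcal O_{Y,x}/(a))-\ell(\mathcal O_{Y,x}/(b))$ for $a,b\in\mathcal O_{Y,x}\setminus\{0\}$. For a noetherian local ring $(A,\mathfrak m)$ of dimension $d$ and an $\mathfrak m$-primary ideal $Q$, the Hilbert-Samuel multiplicity $e(Q,A)$ is $d!$ times the coefficient of $n^d$ in the polynomial which agrees with $\ell_A(A/Q^n)$ for large $n$. $\gamma(A)$ is the greatest common divisor of all the $e(Q,A)$,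 over all $\mathfrak m$-primary ideals $Q$ of $A$. For a non-empty scheme $W$ of finite type over a field $k$, the index $\delta(W/k)$ is the greatest common divisor of the degrees over $k$ of the closed points of $W$. $X^{\mathrm{reg}}$ is the regular locus of $X$. *)

(* Defs.v *)
From HB Require Import structures.
From mathcomp Require Import all_boot all_order all_algebra.
From mathcomp Require Import generic_quotient.
From mathcomp Require Import mathcomp_extra boolp classical_sets functions.
From mathcomp Require Import cardinality fsbigop filter topology_structure.

Set Implicit Arguments.
Unset Strict Implicit.
Unset Printing Implicit Defensive.

Import GRing.Theory.
Local Open Scope classical_set_scope.
Local Open Scope quotient_scope.
Local Open Scope ring_scope.

(** * Commutative algebra *)

(* The numerical invariants below (gcd of a set, lengths, degrees, e(Q), ...)
   are the unique natural number satisfying their definition; [xget 0] makes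
   them total, with the value 0 when there is no such number. *)

(* The gcd of a possibly infinite set of natural numbers is the nonnegative
   generator of the ideal it spans: its divisors are the common divisors. *)
Definition gcd_set (S : set nat) : nat :=
  xget 0%N [set d | forall m, (m %| d)%N <-> (forall s, S s -> (m %| s)%N)].

Section Ideals.
Variable A : comPzRingType.
Implicit Types (I J P Q : set A).

Definition is_ideal I : Prop :=
  [/\ I 0, forall a b, I a -> I b -> I (a + b)
    & forall c a, I a -> I (c * a)].

Definition ideal_gen (S : set A) : set A :=
  [set a | forall I, is_ideal I -> S `<=` I -> I a].

Definition ideal_mul I J : set A :=
  ideal_gen [set c | exists a b, [/\ I a, J b & c = a * b]].

Definition ideal_pow I (n : nat) : set A := iter n (ideal_mul I) setT.

Definition radical I : set A := [set a | exists n : nat, I (a ^+ n)].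

Definition is_prime I : Prop :=
  [/\ is_ideal I, ~ I 1 & forall a b, I (a * b) -> I a \/ I b].

Definition is_primary I : Prop :=
  [/\ is_ideal I, ~ I 1 & forall a b, I (a * b) -> I a \/ radical I b].

Definition is_unit (a : A) : Prop := exists b, a * b = 1.

(* In a local ring this is the maximal ideal. *)
Definition nonunits : set A := [set a | ~ is_unit a].

Definition is_local_ring : Prop := is_ideal nonunits.

(* m-primary ideals of a local ring with maximal ideal m *)
Definition is_m_primary Q : Prop := is_primary Q /\ radical Q = nonunits.

Definition has_chain (F : set (set A)) (n : nat) : Prop :=
  exists J : nat -> set A,
    (forall i, (i <= n)%N -> F (J i)) /\
    (forall i, (i < n)%N -> J i `<` J i.+1).

Definition max_chain (F : set (set A)) (n : nat) : Prop :=
  has_chain F n /\ ~ has_chain F n.+1.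

Definition has_krull_dim (d : nat) : Prop := max_chain is_prime d.

(* The length of the A-module A/I; its submodules are the J/I for J an ideal
   containing I. *)
Definition quo_length I : nat :=
  xget 0%N (max_chain [set J | is_ideal J /\ I `<=` J]).

Definition is_noetherian : Prop :=
  forall I, is_ideal I -> exists n (g : 'I_n -> A), I = ideal_gen (range g).

Definition is_regular_local_ring : Prop :=
  [/\ is_noetherian, is_local_ring
    & exists d (g : 'I_d -> A), has_krull_dim d /\ nonunits = ideal_gen (range g)].

(* The Hilbert-Samuel multiplicity e(Q, A) *)
Definition multiplicity Q : nat :=
  xget 0%N [set e | exists d (p : {poly rat}),
    [/\ has_krull_dim d,
        exists N : nat, forall n : nat, (N <= n)%N ->
          p.[n%:R] = (quo_length (ideal_pow Q n))%:R
      & e%:R = (d`!)%:R * p`_d]].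

Definition gamma : nat :=
  gcd_set [set e | exists2 Q, is_m_primary Q & e = multiplicity Q].

End Ideals.

(* phi : A -> B identifies B with the localization A_f. *)
Definition is_localization_away (A B : comPzRingType) (phi : A -> B) (f : A) :
    Prop :=
  [/\ is_unit (phi f),
      forall b, exists a n, b * phi f ^+ n = phi a
    & forall a, phi a = 0 -> exists n : nat, f ^+ n * a = 0].

(* The k-algebra A, with structure morphism phi, is finitely generated. *)
Definition is_fg_algebra (k A : comPzRingType) (phi : k -> A) : Prop :=
  exists n (g : 'I_n -> A), forall S : set A,
    range phi `<=` S -> range g `<=` S ->
    (forall a b, S a -> S b -> S (a + b)) ->
    (forall a b, S a -> S b -> S (a * b)) -> S = setT.

(* The dimension over the field k of A/m, for A a local k-algebra with
   structure morphism phi and maximal ideal m: the cardinality of a family in A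
   whose classes modulo m form a basis of A/m. *)
Definition residue_degree (k : fieldType) (A : comPzRingType) (phi : k -> A) :
    nat :=
  xget 0%N [set n | exists e : 'I_n -> A, forall a,
    exists! c : {ffun 'I_n -> k}, nonunits (a - \sum_(i < n) phi (c i) * e i)].

(** * Ringed spaces *)

Record opens (T : topologicalType) := Opens {
  pts :> set T;
  pts_open : open pts }.

Definition opensT (T : topologicalType) : opens T := Opens openT.

Definition opensI (T : topologicalType) (U V : opens T) : opens T :=
  Opens (openI (pts_open U) (pts_open V)).

Lemma opensIl (T : topologicalType) (U V : opens T) : opensI U V `<=` U.
Proof. by move=> y []. Qed.

Lemma opensIr (T : topologicalType) (U V : opens T) : opensI U V `<=` V.
Proof. by move=> y []. Qed.

Definition opens_preim (S T : topologicalType) (f : S -> T)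
    (cf : continuous f) (V : opens T) : opens S :=
  Opens (proj1 (continuousP f) cf V (pts_open V)).

Record ringedSpace := RingedSpace {
  space :> topologicalType;
  sect : opens space -> comPzRingType;
  res : forall U V : opens space, V `<=` U -> {rmorphism sect U -> sect V};
  res_id : forall (U : opens space) (h : U `<=` U) s, res h s = s;
  res_comp : forall (U V W : opens space) (hUV : V `<=` U) (hVW : W `<=` V)
      (hUW : W `<=` U) s, res hVW (res hUV s) = res hUW s;
  sheaf : forall (I : Type) (U : opens space) (V : I -> opens space)
      (hV : forall i, V i `<=` U),
    U `<=` \bigcup_i V i ->
    forall s : (forall i, sect (V i)),
    (forall i j (W : opens space) (hi : W `<=` V i) (hj : W `<=` V j),
       res hi (s i) = res hj (s j)) ->
    exists! t : sect U, forall i, res (hV i) t = s i }.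

(** ** Stalks *)

Section Stalk.
Variables (X : ringedSpace) (x : X).

Record pregerm := Pregerm {
  pg_open : opens X;
  pg_mem : pts pg_open x;
  pg_sect : sect pg_open }.

HB.instance Definition _ := gen_eqMixin pregerm.
HB.instance Definition _ := gen_choiceMixin pregerm.

Definition same_germ (a b : pregerm) : Prop :=
  exists (W : opens X) (hx : pts W x)
    (ha : W `<=` pg_open a) (hb : W `<=` pg_open b),
    res ha (pg_sect a) = res hb (pg_sect b).

Definition same_germb : rel pregerm := fun a b => `[< same_germ a b >].

Lemma same_germ_refl : reflexive same_germb.
Proof.
move=> a; apply/asboolP.
by exists (pg_open a), (pg_mem a), (@subset_refl _ _), (@subset_refl _ _).
Qed.

Lemma same_germ_sym : symmetric same_germb.
Proof.
by move=> a b; apply/asboolP/asboolP => -[W [hx [ha [hb e]]]]; exists W, hx, hb, ha.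
Qed.

Lemma same_germ_trans : transitive same_germb.
Proof.
move=> b a c /asboolP[W [hx [ha [hb e]]]] /asboolP[W' [hx' [hb' [hc e']]]].
apply/asboolP; exists (opensI W W'), (conj hx hx').
have i1 : opensI W W' `<=` W by move=> y [].
have i2 : opensI W W' `<=` W' by move=> y [].
exists (subset_trans i1 ha), (subset_trans i2 hc).
rewrite -(res_comp ha i1) e (res_comp hb i1 (subset_trans i1 hb)).
by rewrite -(res_comp hc i2) -e' (res_comp hb' i2 (subset_trans i1 hb)).
Qed.

Canonical same_germ_equiv :=
  EquivRel same_germb same_germ_refl same_germ_sym same_germ_trans.

Definition stalk : Type := {eq_quot same_germ_equiv}.
HB.instance Definition _ := EqQuotient.on stalk.
HB.instance Definition _ := Choice.on stalk.

Definition germ (U : opens X) (hx : pts U x) (s : sect U) : stalk :=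
  \pi_stalk (Pregerm hx s).

Lemma germP (U V : opens X) (hU : pts U x) (hV : pts V x) (s : sect U) (t : sect V) :
  germ hU s = germ hV t <->
  exists (W : opens X) (hx : pts W x) (i : W `<=` U) (j : W `<=` V),
    res i s = res j t.
Proof.
split=> [/eqmodP/asboolP//|H]; by apply/eqmodP/asboolP.
Qed.

Lemma germ_res (U V : opens X) (hU : pts U x) (hV : pts V x) (i : V `<=` U) s :
  germ hV (res i s) = germ hU s.
Proof.
by apply/germP; exists V, hV, (@subset_refl _ _), i; rewrite res_id.
Qed.

Lemma germ_surj (a : stalk) :
  exists (U : opens X) (hx : pts U x) (s : sect U), a = germ hx s.
Proof.
rewrite -[a]reprK; case: (repr a) => U hx s; by exists U, hx, s.
Qed.

Lemma germ_surj2 (a b : stalk) :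
  exists (U : opens X) (hx : pts U x) (s t : sect U), a = germ hx s /\ b = germ hx t.
Proof.
have [U [hU [s ->]]] := germ_surj a; have [V [hV [t ->]]] := germ_surj b.
have i : opensI U V `<=` U by move=> y [].
have j : opensI U V `<=` V by move=> y [].
exists (opensI U V), (conj hU hV), (res i s), (res j t).
by rewrite !germ_res.
Qed.

Lemma germ_surj3 (a b c : stalk) :
  exists (U : opens X) (hx : pts U x) (s t u : sect U),
    [/\ a = germ hx s, b = germ hx t & c = germ hx u].
Proof.
have [U [hU [s [t [-> ->]]]]] := germ_surj2 a b.
have [V [hV [u ->]]] := germ_surj c.
have i : opensI U V `<=` U by move=> y [].
have j : opensI U V `<=` V by move=> y [].
exists (opensI U V), (conj hU hV), (res i s), (res i t), (res j u).
by rewrite !germ_res.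
Qed.

Definition stalk_op2 (op : forall U : opens X, sect U -> sect U -> sect U)
    (a b : stalk) : stalk :=
  let p := repr a in let q := repr b in
  germ (U := opensI (pg_open p) (pg_open q)) (conj (pg_mem p) (pg_mem q))
    (op _ (res (@opensIl _ (pg_open p) (pg_open q)) (pg_sect p))
          (res (@opensIr _ (pg_open p) (pg_open q)) (pg_sect q))).

Lemma stalk_op2E (op : forall U : opens X, sect U -> sect U -> sect U) :
  (forall (U V : opens X) (h : V `<=` U) s t,
     res h (op _ s t) = op _ (res h s) (res h t)) ->
  forall (U : opens X) (hx : pts U x) s t,
  stalk_op2 op (germ hx s) (germ hx t) = germ hx (op _ s t).
Proof.
move=> opE U hx s t; rewrite /stalk_op2.
have: germ (pg_mem (repr (germ hx s))) (pg_sect (repr (germ hx s))) = germ hx s.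
  by rewrite -[RHS]reprK; case: (repr (germ hx s)).
have: germ (pg_mem (repr (germ hx t))) (pg_sect (repr (germ hx t))) = germ hx t.
  by rewrite -[RHS]reprK; case: (repr (germ hx t)).
case: (repr (germ hx s)) (repr (germ hx t)) => [V hV s'] [W hW t'] /=.
move=> /germP[W' [hW' [i' [j' e']]]] /germP[V' [hV' [i [j e]]]].
apply/germP; exists (opensI V' W'), (conj hV' hW').
have k : opensI V' W' `<=` opensI V W by move=> y [/i ? /i' ?].
have l : opensI V' W' `<=` U by move=> y [/j].
exists k, l; rewrite !opE; congr (op _ _ _).
  have kV : opensI V' W' `<=` V' by move=> y [].
  have kVV : opensI V' W' `<=` V by move=> y [/i].
  by rewrite (res_comp _ _ kVV) -(res_comp i kV) e (res_comp _ _ l).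
have kV : opensI V' W' `<=` W' by move=> y [].
have kVV : opensI V' W' `<=` W by move=> y [_ /i'].
by rewrite (res_comp _ _ kVV) -(res_comp i' kV) e' (res_comp _ _ l).
Qed.

Definition stalk_zero : stalk := germ (U := opensT X) I 0.
Definition stalk_one : stalk := germ (U := opensT X) I 1.
Definition stalk_add := stalk_op2 (fun U s t => s + t).
Definition stalk_mul := stalk_op2 (fun U s t => s * t).
Definition stalk_opp (a : stalk) : stalk :=
  germ (pg_mem (repr a)) (- pg_sect (repr a)).

Lemma stalk_addE (U : opens X) (hx : pts U x) s t :
  stalk_add (germ hx s) (germ hx t) = germ hx (s + t).
Proof. by apply: stalk_op2E => *; rewrite rmorphD. Qed.

Lemma stalk_mulE (U : opens X) (hx : pts U x) s t :
  stalk_mul (germ hx s) (germ hx t) = germ hx (s * t).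
Proof. by apply: stalk_op2E => *; rewrite rmorphM. Qed.

Lemma stalk_oppE (U : opens X) (hx : pts U x) s :
  stalk_opp (germ hx s) = germ hx (- s).
Proof.
rewrite /stalk_opp.
have: germ (pg_mem (repr (germ hx s))) (pg_sect (repr (germ hx s))) = germ hx s.
  by rewrite -[RHS]reprK; case: (repr (germ hx s)).
case: (repr (germ hx s)) => [V hV s'] /= /germP[W [hW [i [j e]]]].
by apply/germP; exists W, hW, i, j; rewrite !rmorphN e.
Qed.

Lemma stalk_zeroE (U : opens X) (hx : pts U x) : stalk_zero = germ hx 0.
Proof.
have h : U `<=` opensT X by [].
by rewrite /stalk_zero -(germ_res (U := opensT X) I hx h) rmorph0.
Qed.

Lemma stalk_oneE (U : opens X) (hx : pts U x) : stalk_one = germ hx 1.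
Proof.
have h : U `<=` opensT X by [].
by rewrite /stalk_one -(germ_res (U := opensT X) I hx h) rmorph1.
Qed.

Fact stalk_addA : associative stalk_add.
Proof.
move=> a b c; have [U [hx [s [t [u [-> -> ->]]]]]] := germ_surj3 a b c.
by rewrite !stalk_addE addrA.
Qed.

Fact stalk_addC : commutative stalk_add.
Proof.
move=> a b; have [U [hx [s [t [-> ->]]]]] := germ_surj2 a b.
by rewrite !stalk_addE addrC.
Qed.

Fact stalk_add0 : left_id stalk_zero stalk_add.
Proof.
move=> a; have [U [hx [s ->]]] := germ_surj a.
by rewrite (stalk_zeroE hx) stalk_addE add0r.
Qed.

Fact stalk_addN : left_inverse stalk_zero stalk_opp stalk_add.
Proof.
move=> a; have [U [hx [s ->]]] := germ_surj a.
by rewrite stalk_oppE stalk_addE addNr -stalk_zeroE.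
Qed.

HB.instance Definition _ :=
  GRing.isZmodule.Build stalk stalk_addA stalk_addC stalk_add0 stalk_addN.

Fact stalk_mulA : associative stalk_mul.
Proof.
move=> a b c; have [U [hx [s [t [u [-> -> ->]]]]]] := germ_surj3 a b c.
by rewrite !stalk_mulE mulrA.
Qed.

Fact stalk_mulC : commutative stalk_mul.
Proof.
move=> a b; have [U [hx [s [t [-> ->]]]]] := germ_surj2 a b.
by rewrite !stalk_mulE mulrC.
Qed.

Fact stalk_mul1 : left_id stalk_one stalk_mul.
Proof.
move=> a; have [U [hx [s ->]]] := germ_surj a.
by rewrite (stalk_oneE hx) stalk_mulE mul1r.
Qed.

Fact stalk_mulDl : left_distributive stalk_mul +%R.
Proof.
move=> a b c; have [U [hx [s [t [u [-> -> ->]]]]]] := germ_surj3 a b c.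
have addE (s' t' : sect U) : germ hx s' + germ hx t' = germ hx (s' + t').
  exact: stalk_addE.
by rewrite addE !stalk_mulE addE mulrDl.
Qed.

HB.instance Definition _ :=
  GRing.Zmodule_isComPzRing.Build stalk stalk_mulA stalk_mulC stalk_mul1 stalk_mulDl.

Fact germ_is_zmod_morphism (U : opens X) (hx : pts U x) : zmod_morphism (germ hx).
Proof. by move=> s t; rewrite -stalk_addE -stalk_oppE. Qed.

Fact germ_is_monoid_morphism (U : opens X) (hx : pts U x) : monoid_morphism (germ hx).
Proof.
split=> [|s t]; first exact: esym (stalk_oneE hx).
exact: esym (stalk_mulE hx s t).
Qed.

HB.instance Definition _ (U : opens X) (hx : pts U x) :=
  GRing.isZmodMorphism.Build (sect U) stalk (germ hx) (germ_is_zmod_morphism hx).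
HB.instance Definition _ (U : opens X) (hx : pts U x) :=
  GRing.isMonoidMorphism.Build (sect U) stalk (germ hx) (germ_is_monoid_morphism hx).

End Stalk.

(** * Schemes *)

(* (U, O_X|U) is isomorphic to Spec A; then necessarily A = O_X(U), up to
   isomorphism. The map h is the underlying homeomorphism onto the set of prime
   ideals of A, with its basis of open sets D(f) = {p | f \notin p}, and the
   sections over D(f) are A_f. *)
Definition is_affine (X : ringedSpace) (U : opens X) : Prop :=
  exists h : X -> set (sect U),
    let D f := [set x | pts U x /\ ~ h x f] in
    [/\ set_bij U (@is_prime (sect U)) h,
        forall f, open (D f),
        forall (V : set X) x, open V -> V x -> pts U x ->
          exists f, D f x /\ D f `<=` V
      & forall f (W : opens X) (hW : W `<=` U), pts W = D f ->
          is_localization_away (res hW) f].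

Record scheme := Scheme {
  scheme_space :> ringedSpace;
  scheme_affine : forall x : scheme_space,
    exists U : opens scheme_space, pts U x /\ is_affine U }.


(** ** Morphisms *)

Record scheme_mor (X Y : scheme) := SchemeMor {
  mor_fun :> X -> Y;
  mor_cont : continuous mor_fun;
  mor_sect : forall V : opens Y,
    {rmorphism sect V -> sect (opens_preim mor_cont V)};
  mor_res : forall (V W : opens Y) (h : W `<=` V)
      (h' : opens_preim mor_cont W `<=` opens_preim mor_cont V) s,
    mor_sect W (res h s) = res h' (mor_sect V s);
  (* the induced maps O_(Y, f x) -> O_(X, x) are local homomorphisms *)
  mor_local : forall (x : X) (V : opens Y) (hx : pts V (mor_fun x)) (s : sect V),
    is_unit (germ (x := x) (U := opens_preim mor_cont V) hx (mor_sect V s)) ->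
    is_unit (germ hx s) }.

Arguments mor_cont {X Y} s : rename.
Arguments mor_sect {X Y} s V : rename.

Definition mor_id_sect (X : scheme) (V : opens X)
    (h : opens_preim (f := idfun) (fun x => cvg_id) V `<=` V) :
    {rmorphism sect V -> sect (opens_preim (f := idfun) (fun x => cvg_id) V)} :=
  res h.

Lemma mor_id_res (X : scheme) (V W : opens X) (h : W `<=` V)
    (h' : opens_preim (f := idfun) (fun x => cvg_id) W `<=`
          opens_preim (f := idfun) (fun x => cvg_id) V) s :
  mor_id_sect (V := W) (@subset_refl _ W) (res h s) =
  res h' (mor_id_sect (@subset_refl _ V) s).
Proof.
have k : opens_preim (f := idfun) (fun x => cvg_id) W `<=` V := h.
by rewrite /mor_id_sect (res_comp _ _ k) (res_comp _ _ k).
Qed.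

Lemma mor_id_local (X : scheme) (x : X) (V : opens X) (hx : pts V x) (s : sect V) :
  is_unit (germ (x := x) (U := opens_preim (f := idfun) (fun x => cvg_id) V) hx
             (mor_id_sect (@subset_refl _ V) s)) ->
  is_unit (germ hx s).
Proof. by rewrite germ_res. Qed.

Definition mor_id (X : scheme) : scheme_mor X X :=
  SchemeMor (@mor_id_res X) (@mor_id_local X).

Section Composition.
Variables (X Y Z : scheme) (g : scheme_mor Y Z) (f : scheme_mor X Y).

Fact mor_comp_cont : continuous (g \o f).
Proof. by move=> x; apply: continuous_comp; apply: mor_cont. Qed.

(* The two open sets (g o f)^-1 V and f^-1 (g^-1 V) have the same points, but
   are only propositionally equal as elements of [opens X]. *)
Definition mor_comp_sect (V : opens Z) :
    {rmorphism sect V -> sect (opens_preim mor_comp_cont V)} :=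
  let U := opens_preim (mor_cont f) (opens_preim (mor_cont g) V) in
  let r : {rmorphism sect U -> sect (opens_preim mor_comp_cont V)} :=
    res (U := U) (V := opens_preim mor_comp_cont V) (@subset_refl _ U) in
  r \o mor_sect f (opens_preim (mor_cont g) V) \o mor_sect g V.


Lemma mor_comp_sectE (V : opens Z)
    (h : opens_preim mor_comp_cont V `<=`
         opens_preim (mor_cont f) (opens_preim (mor_cont g) V)) s :
  mor_comp_sect V s =
  res h (mor_sect f (opens_preim (mor_cont g) V) (mor_sect g V s)).
Proof.
rewrite /mor_comp_sect /=.
by congr (res _ _); apply: Prop_irrelevance.
Qed.

Lemma mor_comp_res (V W : opens Z) (h : W `<=` V)
    (h' : opens_preim mor_comp_cont W `<=` opens_preim mor_comp_cont V) s :
  mor_comp_sect W (res h s) = res h' (mor_comp_sect V s).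
Proof.
have hg : opens_preim (mor_cont g) W `<=` opens_preim (mor_cont g) V.
  by move=> y; apply: h.
have hf : opens_preim (mor_cont f) (opens_preim (mor_cont g) W) `<=`
          opens_preim (mor_cont f) (opens_preim (mor_cont g) V).
  by move=> y; apply: h.
have k U : opens_preim mor_comp_cont U `<=`
           opens_preim (mor_cont f) (opens_preim (mor_cont g) U) by [].
have kWV : opens_preim mor_comp_cont W `<=`
           opens_preim (mor_cont f) (opens_preim (mor_cont g) V).
  by move=> y; apply: h.
rewrite (mor_comp_sectE (k W)) (mor_comp_sectE (k V)).
by rewrite (mor_res h hg) (mor_res hg hf) (res_comp _ _ kWV) (res_comp _ _ kWV).
Qed.

Lemma mor_comp_local (x : X) (V : opens Z) (hx : pts V (g (f x))) (s : sect V) :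
  is_unit (germ (x := x) (U := opens_preim mor_comp_cont V) hx
             (mor_comp_sect V s)) ->
  is_unit (germ hx s).
Proof.
have k : opens_preim mor_comp_cont V `<=`
         opens_preim (mor_cont f) (opens_preim (mor_cont g) V) by [].
rewrite (mor_comp_sectE k) germ_res => u.
by have := mor_local (s0 := g) (mor_local (s0 := f) u).
Qed.

Definition mor_comp : scheme_mor X Z :=
  SchemeMor mor_comp_res mor_comp_local.

End Composition.

Definition is_closed_immersion (X Y : scheme) (f : scheme_mor X Y) : Prop :=
  [/\ injective f, forall F : set X, closed F -> closed (f @` F)
    & (* O_Y -> f_* O_X is surjective, on the stalks at the points of f(X) *)
      forall (x : X) (a : stalk x),
      exists (V : opens Y) (hx : pts V (f x)) (s : sect V),
        a = germ (U := opens_preim (mor_cont f) V) hx (mor_sect f V s)].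

(** ** Schemes over a field *)

(* A morphism X -> Spec k is the same as a ring morphism k -> O_X(X). *)
Record kScheme (k : fieldType) := KScheme {
  kscheme_scheme :> scheme;
  kstruct : {rmorphism k -> sect (opensT kscheme_scheme)} }.

Section OverField.
Variable k : fieldType.
Implicit Types X Y P T : kScheme k.

Definition is_kmor X Y (f : scheme_mor X Y) : Prop :=
  forall c (h : opens_preim (mor_cont f) (opensT Y) `<=` opensT X),
    mor_sect f (opensT Y) (kstruct Y c) = res h (kstruct X c).

(* (P, p, q) is the fibre product of X and Y over Spec k *)
Definition is_product X Y P (p : scheme_mor P X) (q : scheme_mor P Y) : Prop :=
  [/\ is_kmor p, is_kmor q
    & forall T (f : scheme_mor T X) (g : scheme_mor T Y),
      is_kmor f -> is_kmor g ->
      exists! h : scheme_mor T P,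
        [/\ is_kmor h, mor_comp p h = f & mor_comp q h = g]].

(* the diagonal morphism X -> X x_k X is a closed immersion *)
Definition is_separated X : Prop :=
  exists P (p q : scheme_mor P X) (d : scheme_mor X P),
    [/\ is_product p q, mor_comp p d = mor_id X, mor_comp q d = mor_id X
      & is_closed_immersion d].

Definition is_finite_type X : Prop :=
  exists n (U : 'I_n -> opens X),
    setT `<=` \bigcup_i U i /\
    forall i (h : U i `<=` opensT X),
      is_affine (U i) /\ is_fg_algebra (res h \o kstruct X).

Definition stalk_struct X (x : X) : k -> stalk x :=
  germ (U := opensT X) I \o kstruct X.

(* deg_k(x) = [k(x) : k] *)
Definition pt_degree X (x : X) : nat := residue_degree (@stalk_struct X x).

(* delta(W/k), for W an open subscheme of X; the closed points of W need only be
   closed in W *)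
Definition scheme_index X (W : set X) : nat :=
  gcd_set [set n | exists x, [/\ W x, W `&` closure [set x] `<=` [set x]
                               & n = pt_degree x]].

End OverField.

Definition reg_locus (X : scheme) : set X :=
  [set x | is_regular_local_ring (stalk x)].

Definition is_reduced (X : scheme) : Prop :=
  forall (U : opens X) (s : sect U) (n : nat), s ^+ n = 0 -> s = 0.

Definition is_integral (X : scheme) : Prop :=
  (exists x : X, True) /\
  forall U : opens X, pts U !=set0 ->
    1 <> 0 :> sect U /\ forall s t : sect U, s * t = 0 -> s = 0 \/ t = 0.

(** ** Cycles *)

(* An integral closed subscheme of X is identified with its generic point: the
   cycle sum_x n_x [closure {x}] is the function x |-> n_x. *)
Definition is_cycle (X : scheme) (z : X -> int) : Prop :=
  finite_set [set x | z x != 0].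

Definition is_zero_cycle (X : scheme) (z : X -> int) : Prop :=
  is_cycle z /\ forall x, z x != 0 -> closed [set x].

Definition supported_in (X : scheme) (z : X -> int) (U : set X) : Prop :=
  forall x, z x != 0 -> U x.

Definition point_cycle (X : scheme) (x : X) : X -> int :=
  fun y => if y == x then 1 else 0.

Definition cycle_degree (k : fieldType) (X : kScheme k) (z : X -> int) : int :=
  \sum_(x \in [set: X]) z x * (pt_degree x)%:Z.

(* For Y integral with generic point eta and g in k(Y) = O_(Y, eta): the order
   of g at y is n. One writes g = a/b with a, b in O_(Y, y) the germs of sections
   s, t over a common neighbourhood of y, which automatically contains eta. *)
Definition is_order (Y : scheme) (eta : Y) (g : stalk eta) (y : Y) (n : int) :
    Prop :=
  exists (V : opens Y) (hy : pts V y) (he : pts V eta) (s t : sect V),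
    [/\ germ hy s <> 0, germ hy t <> 0, germ he s = germ he t * g
      & n = (quo_length (ideal_gen [set germ hy s]))%:Z
            - (quo_length (ideal_gen [set germ hy t]))%:Z].

(* z = [div(g)] for some integral closed subscheme Y of X and g in k(Y)^* *)
Definition is_principal_cycle (X : scheme) (z : X -> int) : Prop :=
  exists (Y : scheme) (i : scheme_mor Y X) (eta : Y) (g : stalk eta),
    [/\ is_integral Y, is_closed_immersion i, closure [set eta] = setT, g <> 0
      & (forall y, has_krull_dim (stalk y) 1 -> is_order g y (z (i y))) /\
        (forall x, (forall y, has_krull_dim (stalk y) 1 -> i y <> x) -> z x = 0)].

Definition rationally_equivalent (X : scheme) (z z' : X -> int) : Prop :=
  exists n (w : 'I_n -> X -> int),
    (forall j, is_principal_cycle (w j)) /\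
    forall x, z x - z' x = \sum_(j < n) w j x.

(* Main.v *)
(* An integral curve C on X through x0 meeting U is a scheme over some k[t], with t chosen divisible
   by a function phi cutting out only x0. For m large, the principal divisor of
   (t^m + 1 + r) / (t^m + 1), for a suitable regular function r, moves length(O_{C,x0} / phi) [x0]
   into U and is trivial at infinity, where t has a pole; both terms have the same degree because
   the two functions are norms of equal degree in t. The group generated by the lengths of
   O_{X,x0} / (P + f O), for the primes P of dimension one avoiding the complement of U, contains
   e(Q): cutting with superficial elements of Q^s and Q^(s+1), for s large, multiplies e(Q) by the
   coprime numbers s and s + 1 and lowers the dimension. Finally the regular locus contains a dense
   open set whatever k is, by a Jacobian criterion in which the derivations of k are allowed. *)

From HB Require Import structures.
Require Import Defs.
From mathcomp Require Import all_boot all_order all_algebra.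
From mathcomp Require Import ring_quotient zify ring.
From mathcomp Require Import mathcomp_extra boolp classical_sets functions.
From mathcomp Require Import cardinality fsbigop filter topology_structure initial_topology.

Set Implicit Arguments.
Unset Strict Implicit.
Unset Printing Implicit Defensive.

Import GRing.Theory.
Local Open Scope classical_set_scope.
Local Open Scope ring_scope.

(** * Ideals *)

(** Three obstacles shape the argument. The field k may be finite, so generic linear choices are
    excluded; Nagata substitutions, homogeneous prime avoidance and two consecutive degrees take
    their place. The curve C may be singular and is never normalized: orders are lengths, and the
    coordinate ring R of an affine patch of C is only used as a free module over k[t]. For every u
    in R the quotient R/(t^m + u) has k-dimension m times the rank once m is large, which gives the
    equality of degrees with no assumption on X. Finally X need not be proper, and C may have
    further points outside the patch. Separatedness enters only there, for rational equivalence: a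
    local ring dominating both R and the local ring of C at such a point would have two centres on
    X; in the absence of such a ring large negative powers of t are nonunits at the point. All local
    rings of C are handled as subsets of its function field K, and C becomes a scheme whose sections
    are constants of K. *)

Lemma zorn_sets (T : Type) (P : set (set T)) (E0 : set T) : P E0 ->
  (forall F : set (set T), F !=set0 -> F `<=` P -> total_on F subset -> P (\bigcup_(E in F) E)) ->
  exists E, [/\ P E, E0 `<=` E & forall E', P E' -> E `<=` E' -> E' = E].
Proof.
(* With the predicate A -> P (A ∪ E0) the empty chain is covered by P E0, and every candidate
   contains E0 automatically. *)
move=> P0 Pc; have [F FQ tF|A [PA mA]] := @Zorn_bigcup T (fun A => P (A `|` E0)).
  have [[A0 FA0]|no] := pselect (F !=set0); last first.
    by rewrite (_ : \bigcup_(_ in _) _ = set0) ?set0U //; apply/seteqP; split=> // x [A FA]; case: no; exists A.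
  rewrite (_ : _ _ = \bigcup_(E in [set A `|` E0| A in F]) E).
    apply: Pc; [by exists (A0 `|` E0), A0|by move=> _ [A FA <-]; apply: FQ|].
    by move=> _ _ [A FA <-] [B FB <-]; have [s|s] := tF A B FA FB; [left|right]; apply: setSU.
  apply/seteqP; split=> x.
    by move=> [[A Ax]|Ex]; [exists (A `|` E0); [exists A|left]|exists (A0 `|` E0); [exists A0|right]].
  by move=> [_ [A FA <-] [Ax|]]; [left; exists A|right].
exists (A `|` E0); split=> // E' PE' s; apply: contrapT => ne; apply: (mA E').
  split; first by move=> x Ax; apply: s; left.
  move=> s'; apply: ne; apply/seteqP; split=> // x /s'; by left.
by rewrite (_ : E' `|` E0 = E') //; apply/seteqP; split=> x; [case=> // e; apply: s; right|left].
Qed.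

Definition iadd (A : comPzRingType) (I J : set A) : set A :=
  [set x | exists a b, [/\ I a, J b & x = a + b]].

Definition imul1 (A : comPzRingType) (a : A) (J : set A) : set A :=
  [set x | exists2 b, J b & x = a * b].

Definition colon (A : comPzRingType) (I : set A) (a : A) : set A :=
  [set x | I (a * x)].

Definition adjoin (A : comPzRingType) (I : set A) (a : A) : set A :=
  iadd I (imul1 a setT).

Section IdealTheory.
Variable A : comPzRingType.
Implicit Types (I J P Q : set A).

Lemma idl0 I : is_ideal I -> I 0. Proof. by case. Qed.
Lemma idlD I a b : is_ideal I -> I a -> I b -> I (a + b).
Proof. case=> _ h _; apply: h. Qed.
Lemma idlM I c a : is_ideal I -> I a -> I (c * a).
Proof. case=> _ _ h; apply: h. Qed.
Lemma idlMr I c a : is_ideal I -> I a -> I (a * c).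
Proof. rewrite mulrC; apply: idlM. Qed.
Lemma idlN I a : is_ideal I -> I a -> I (- a).
Proof. rewrite -mulN1r; apply: idlM. Qed.
Lemma idlB I a b : is_ideal I -> I a -> I b -> I (a - b).
Proof. by move=> h ? ?; apply: idlD => //; apply: idlN. Qed.
Lemma idl_sum I (T : Type) (r : seq T) (p : pred T) (F : T -> A) :
  is_ideal I -> (forall i, p i -> I (F i)) -> I (\sum_(i <- r | p i) F i).
Proof. by move=> h hF; elim/big_rec: _ => [|i x /hF ?]; [apply: idl0|apply: idlD]. Qed.
Lemma idl_congr I a b : is_ideal I -> I (a - b) -> I b -> I a.
Proof. by move=> ? ?; rewrite -(subrK b a); apply: idlD. Qed.
Lemma idl1 I : is_ideal I -> I 1 -> I = setT.
Proof. by move=> h ?; apply/seteqP; split=> x _; rewrite -[x]mulr1; apply: idlM. Qed.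
Lemma idl_addr I a b : is_ideal I -> I b -> I (a + b) -> I a.
Proof. by move=> h ? ?; rewrite -(addrK b a); apply: idlB. Qed.

Lemma is_idealT : is_ideal ([set: A]). Proof. by []. Qed.
Lemma is_ideal0 : is_ideal ([set 0] : set A).
Proof. by split=> //[a b -> ->|c a ->]; rewrite ?addr0 ?mulr0. Qed.
Lemma is_idealI I J : is_ideal I -> is_ideal J -> is_ideal (I `&` J).
Proof.
split; first by split; apply: idl0.
- by move=> a b [? ?] [? ?]; split; apply: idlD.
- by move=> c a [? ?]; split; apply: idlM.
Qed.
Lemma idl_iadd I J : is_ideal I -> is_ideal J -> is_ideal (iadd I J).
Proof.
split.
- by exists 0, 0; split; rewrite ?addr0 //; apply: idl0.
- move=> _ _ [a [b [ha hb ->]]] [c [d [hc hd ->]]].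
  by exists (a + c), (b + d); split; [apply: idlD|apply: idlD|rewrite addrACA].
- move=> c _ [a [b [ha hb ->]]].
  by exists (c * a), (c * b); split; [apply: idlM|apply: idlM|rewrite mulrDr].
Qed.
Lemma idl_imul1 (a : A) J : is_ideal J -> is_ideal (imul1 a J).
Proof.
split.
- by exists 0; rewrite ?mulr0 //; apply: idl0.
- by move=> _ _ [b hb ->] [c hc ->]; exists (b + c); rewrite ?mulrDr //; apply: idlD.
- by move=> c _ [b hb ->]; exists (c * b); [apply: idlM|rewrite mulrCA].
Qed.
Lemma idl_colon I a : is_ideal I -> is_ideal (colon I a).
Proof.
split; rewrite /colon /=.
- by rewrite mulr0; apply: idl0.
- by move=> ? ?; rewrite mulrDr; apply: idlD.
- by move=> x ?; rewrite mulrCA; apply: idlM.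
Qed.
Lemma idl_adjoin I a : is_ideal I -> is_ideal (adjoin I a).
Proof. by move=> h; apply: idl_iadd => //; apply: idl_imul1. Qed.

Lemma sub_iaddl I J : is_ideal J -> I `<=` iadd I J.
Proof. by move=> h x ?; exists x, 0; rewrite addr0; split => //; apply: idl0. Qed.
Lemma sub_iaddr I J : is_ideal I -> J `<=` iadd I J.
Proof. by move=> h x ?; exists 0, x; rewrite add0r; split => //; apply: idl0. Qed.
Lemma iadd_sub I J L : is_ideal L -> I `<=` L -> J `<=` L -> iadd I J `<=` L.
Proof. move=> hL h1 h2 _ [a [b [ha hb ->]]]; apply: idlD; auto. Qed.
Lemma sub_adjoin I a : I `<=` adjoin I a.
Proof. by apply: sub_iaddl; apply: idl_imul1. Qed.
Lemma mem_adjoin I a : is_ideal I -> adjoin I a a.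
Proof. by move=> hI; apply: sub_iaddr => //; exists 1; rewrite ?mulr1. Qed.
Lemma adjoin_sub I a J : is_ideal J -> I `<=` J -> J a -> adjoin I a `<=` J.
Proof. by move=> hJ h ?; apply: iadd_sub => // _ [b _ ->]; apply: idlMr. Qed.
Lemma adjoinP I a x : adjoin I a x <-> exists c, I (x - a * c).
Proof.
split=> [[i [_ [hi [c _ ->] ->]]]|[c h]]; first by exists c; rewrite addrK.
by exists (x - a * c), (a * c); split; rewrite ?subrK //; exists c.
Qed.
Lemma iadd_mono I J I' J' : I `<=` I' -> J `<=` J' -> iadd I J `<=` iadd I' J'.
Proof. move=> h1 h2 _ [a [b [ha hb ->]]]; exists a, b; split; auto. Qed.
Lemma colon_mono I J a : I `<=` J -> colon I a `<=` colon J a.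
Proof. move=> h x; apply: h. Qed.
Lemma sub_colon I a : is_ideal I -> I `<=` colon I a.
Proof. by move=> x ?; apply: idlM. Qed.

Lemma idl_gen (S : set A) : is_ideal (ideal_gen S).
Proof.
split; first by move=> I hI _; apply: idl0.
- by move=> a b ha hb I hI hS; apply: idlD (ha _ _ _) (hb _ _ _).
- by move=> c a ha I hI hS; apply: idlM (ha _ _ _).
Qed.
Lemma sub_gen (S : set A) : S `<=` ideal_gen S.
Proof. by move=> x ? I _; apply. Qed.
Lemma gen_sub (S : set A) I : is_ideal I -> S `<=` I -> ideal_gen S `<=` I.
Proof. by move=> hI hS x; apply. Qed.
Lemma gen_mono (S S' : set A) : S `<=` S' -> ideal_gen S `<=` ideal_gen S'.
Proof. move=> h; apply: (gen_sub (idl_gen _)) => x /h; apply: sub_gen. Qed.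
Lemma gen1P (a x : A) : ideal_gen [set a] x <-> exists c, x = a * c.
Proof.
split; last by case=> c ->; apply: idlMr (sub_gen _); [apply: idl_gen|].
have h := idl_imul1 a is_idealT.
move/(gen_sub h) => []; last by move=> c _ ->; exists c.
by move=> _ ->; exists 1; rewrite ?mulr1.
Qed.
Lemma gen_rangeP n (g : 'I_n -> A) x :
  ideal_gen (range g) x <-> exists c : 'I_n -> A, x = \sum_i c i * g i.
Proof.
split; last first.
  case=> c ->; apply: idl_sum (idl_gen _) _ => i _.
  by apply: idlM (idl_gen _) _; apply: sub_gen.
move/(_ [set x | exists c : 'I_n -> A, x = \sum_i c i * g i]); apply.
  split; first by exists (fun=> 0); rewrite big1 // => i _; rewrite mul0r.
  - move=> _ _ [c ->] [d ->]; exists (fun i => c i + d i).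
    by rewrite -big_split; apply: eq_bigr => i _; rewrite mulrDl.
  - move=> b _ [c ->]; exists (fun i => b * c i).
    by rewrite mulr_sumr; apply: eq_bigr => i _; rewrite mulrA.
move=> _ [i _ <-]; exists (fun j => (j == i)%:R).
rewrite (bigD1 i) //= eqxx mul1r big1 ?addr0 // => j /negPf ->.
by rewrite mul0r.
Qed.

Definition fgen I := exists s : seq A, I = ideal_gen [set` s].

Lemma noetherian_fgen : is_noetherian A <-> forall I, is_ideal I -> fgen I.
Proof.
split=> h I /h.
  move=> [n [g ->]]; exists (codom g); congr ideal_gen; apply/seteqP; split=> x.
    case=> i _ <-; apply: codom_f.
  by case/codomP=> i ->; exists i.
move=> [s ->]; exists (size s), (tnth (in_tuple s)); congr ideal_gen.
apply/seteqP; split=> x.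
  by move=> /(tnthP (in_tuple s))[i ->]; exists i.
case=> i _ <-; apply: mem_tnth.
Qed.

Lemma noetherian_seq : is_noetherian A -> forall J : nat -> set A,
  (forall n, is_ideal (J n)) -> (forall n, J n `<=` J n.+1) ->
  exists N, forall n, (N <= n)%N -> J n = J N.
Proof.
move=> /noetherian_fgen hn J hJ hS.
have mono m n : (m <= n)%N -> J m `<=` J n.
  elim: n => [|n IH]; first by rewrite leqn0 => /eqP->.
  rewrite leq_eqVlt => /orP[/eqP->//|/IH h]; apply: subset_trans h (hS _).
have /hn [s Es] : is_ideal (\bigcup_n J n).
  split; first by exists 0%N => //; apply: idl0.
  - move=> a b [m _ ha] [n _ hb]; exists (maxn m n) => //.
    by apply: idlD => //; [apply: mono ha|apply: mono hb]; rewrite ?leq_maxl ?leq_maxr.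
  - by move=> c a [m ha]; exists m => //; apply: idlM.
have [N hN] : exists N, [set` s] `<=` J N.
  have : [set` s] `<=` \bigcup_n J n by rewrite Es; apply: sub_gen.
  elim: s {Es} => [|a s IH] h; first by exists 0%N.
  have [|m hm] := IH; first by move=> x xs; apply: h; rewrite /= in_cons xs orbT.
  have [|n _ hn'] := h a; first by rewrite /= mem_head.
  exists (maxn m n) => rewrite /orP[/eqP->|/hm].
    apply: mono hn'; apply: leq_maxr.
  apply: mono; apply: leq_maxl.
exists N => n hNn; apply/seteqP; split; last exact: mono.
apply: subset_trans (gen_sub (hJ N) hN); rewrite -Es.
by move=> hx; exists n.
Qed.

Lemma noetherian_ind : is_noetherian A -> forall R : set A -> Prop,
  (forall I, is_ideal I -> (forall J, is_ideal J -> I `<` J -> R J) -> R I) ->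
  forall I, is_ideal I -> R I.
Proof.
move=> hn R step I hI; apply: contrapT => nR.
pose T := {I : set A | is_ideal I /\ ~ R I}.
have nxt (t : T) : exists u : T, sval t `<` sval u.
  apply: contrapT => no; case: (svalP t) => hid; apply; apply: step => // J hJ lt.
  by apply: contrapT => nRJ; apply: no; exists (exist _ J (conj hJ nRJ)).
have [f hf] := choice nxt.
pose t0 : T := exist _ I (conj hI nR).
pose J n := sval (iter n f t0).
have [||N hN] := noetherian_seq hn (J := J).
- by move=> n; case: (svalP (iter n f t0)).
- by move=> n; have [] := hf (iter n f t0).
have := hf (iter N f t0); rewrite -/(J N) -[sval _]/(J N.+1) (hN N.+1) //.
by case=> _ h; apply: h.
Qed.

Lemma exists_maximal I : is_ideal I -> ~ I 1 ->
  exists M, [/\ is_prime M, I `<=` M & forall J, is_ideal J -> M `<=` J -> ~ J 1 -> J = M].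
Proof.
move=> hI nI1; have [||M [[hM nM1] IM mM]] := @zorn_sets A [set J | is_ideal J /\ ~ J 1] I => //.
  move=> F [J0 F0] FP tF; split; last by move=> [J FJ J1]; case: (FP J FJ).
  split; first by exists J0 => //; case: (FP J0 F0) => h _; apply: idl0.
    move=> a b [J1 F1 a1] [J2 F2 b2]; have [s|s] := tF _ _ F1 F2.
      by exists J2 => //; have [h _] := FP _ F2; apply: idlD => //; apply: s.
    by exists J1 => //; have [h _] := FP _ F1; apply: idlD => //; apply: s.
  by move=> c a [J FJ a1]; exists J => //; have [h _] := FP _ FJ; apply: idlM.
have max J : is_ideal J -> M `<=` J -> ~ J 1 -> J = M by move=> hJ s nJ; apply: mM.
exists M; split=> //; split=> // a.
have [Ma|nMa] := pselect (M a); [by left|right].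
have : adjoin M a 1.
  apply: contrapT => h; apply: nMa.
  rewrite -(max _ (idl_adjoin a hM) (@sub_adjoin M a) h).
  exact: mem_adjoin.
move/adjoinP => [c h]; rewrite -[b]mul1r -(subrK (a * c) 1) mulrDl.
by apply: idlD => //; [apply: idlMr|rewrite mulrAC; apply: idlMr].
Qed.

Lemma prime_ideal P : is_prime P -> is_ideal P. Proof. by case. Qed.
Lemma primeM P a b : is_prime P -> P (a * b) -> P a \/ P b. Proof. case=> _ _; apply. Qed.
Lemma primeNM P a b : is_prime P -> ~ P a -> ~ P b -> ~ P (a * b).
Proof. by move=> hP na nb /(primeM hP)[]. Qed.
Lemma primeX P a n : is_prime P -> P (a ^+ n) -> P a.
Proof.
move=> hP; elim: n => [|n IH]; first by case: hP.
by rewrite exprS => /(primeM hP)[|/IH].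
Qed.

(** Existence of associated primes: a maximal annihilator of a nonzero element of A/I is prime. The
    Noetherian induction runs over the annihilators themselves, so [R] only speaks of ideals that
    happen to be of the form [colon I a]; if xy kills a but neither x nor y does, the annihilator of
    ax is strictly larger. *)
Lemma colon_prime I : is_noetherian A -> is_ideal I -> ~ I 1 ->
  exists a, ~ I a /\ is_prime (colon I a).
Proof.
move=> hn hI nI1.
pose R (J : set A) := forall a, J = colon I a -> ~ I a -> exists a, ~ I a /\ is_prime (colon I a).
suff : R (colon I 1) by move/(_ 1 erefl nI1).
apply: (noetherian_ind hn); last exact: idl_colon.
move=> J hJ IH a EJ nIa.
have [pr|] := pselect (is_prime (colon I a)); first by exists a.
move=> npr.
have [x [y [hxy nx ny]]] : exists x y, [/\ colon I a (x * y), ~ colon I a x & ~ colon I a y].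
  apply: contrapT => h; apply: npr; split; first exact: idl_colon.
    by rewrite /colon /= mulr1.
  move=> x y hxy; apply: contrapT => /not_orP[nx ny].
  by apply: h; exists x, y.
have hsub : J `<=` colon I (a * x).
  by rewrite EJ => z; rewrite /colon /= -mulrA [x * z]mulrC mulrA => ?; apply: idlMr.
apply: (IH (colon I (a * x)) (idl_colon _ hI) _) => //.
split=> // /(_ y) h; apply: ny; rewrite -EJ; apply: h.
by rewrite /colon /= -mulrA.
Qed.

(* Devissage along a prime filtration of [A/I], phrased with ideals only. *)
Lemma prime_filtration_ind (R : set A -> Prop) : is_noetherian A -> R setT ->
  (forall I a, is_ideal I -> ~ I a -> is_prime (colon I a) -> R (adjoin I a) -> R I) ->
  forall I, is_ideal I -> R I.
Proof.
move=> hn RT step; apply: noetherian_ind => // I hI IH.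
have [I1|nI1] := pselect (I 1); first by rewrite (idl1 hI I1).
have [a [nIa pr]] := colon_prime hn hI nI1.
apply: (step I a) => //; apply: IH; first exact: idl_adjoin.
by split; [apply: sub_adjoin|move=> /(_ a (mem_adjoin a hI))].
Qed.

Lemma idl_mul I J : is_ideal (ideal_mul I J). Proof. exact: idl_gen. Qed.
Lemma mem_mul I J a b : I a -> J b -> ideal_mul I J (a * b).
Proof. by move=> ha hb; apply: sub_gen; exists a, b. Qed.
Lemma mul_sub I J L : is_ideal L -> (forall a b, I a -> J b -> L (a * b)) ->
  ideal_mul I J `<=` L.
Proof. by move=> hL h; apply: gen_sub => // _ [a [b [ha hb ->]]]; apply: h. Qed.

Lemma idl_pow Q n : is_ideal (ideal_pow Q n).
Proof. case: n => [|n]; [apply: is_idealT|apply: idl_mul]. Qed.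
Lemma powSmul Q n a b : Q a -> ideal_pow Q n b -> ideal_pow Q n.+1 (a * b).
Proof. exact: mem_mul. Qed.
Lemma pow_mul Q m n a b : ideal_pow Q m a -> ideal_pow Q n b -> ideal_pow Q (m + n) (a * b).
Proof.
elim: m a => [|m IH] a ha hb; first by apply: idlM => //; apply: idl_pow.
suff: ideal_pow Q m.+1 `<=` [set a | ideal_pow Q (m.+1 + n) (a * b)] by apply.
apply: mul_sub => [|c d hc hd /=]; last by rewrite -mulrA; apply: powSmul => //; apply: IH.
have hp := idl_mul Q (ideal_pow Q (m + n)).
split=> /= [|x hy|c hx]; rewrite ?mul0r; first exact: idl0.
  by rewrite mulrDl; apply: (idlD hp).
by rewrite -mulrA; apply: (idlM _ hp).
Qed.
Lemma pow_leq Q m n : (m <= n)%N -> ideal_pow Q n `<=` ideal_pow Q m.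
Proof.
elim: n m => [|n IH] [|m] //; rewrite ltnS => /IH h.
by apply: mul_sub; [apply: idl_pow|move=> a b ha /h hb; apply: powSmul].
Qed.
Lemma pow1 Q : is_ideal Q -> ideal_pow Q 1 = Q.
Proof.
move=> hQ; apply/seteqP; split.
  by apply: mul_sub => // a b ? _; apply: idlMr.
by move=> x hx; rewrite -[x]mulr1; apply: powSmul.
Qed.
Lemma mem_powX Q a n : Q a -> ideal_pow Q n (a ^+ n).
Proof. by move=> ha; elim: n => // IH; rewrite exprS; apply: powSmul. Qed.
Lemma pow_add_sub Q m n L : is_ideal L ->
  (forall a b, ideal_pow Q m a -> ideal_pow Q n b -> L (a * b)) -> ideal_pow Q (m + n) `<=` L.
Proof.
elim: m L => [|m IH] L hL h; first by move=> x hx; rewrite -[x]mul1r; apply: h.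
apply: mul_sub => // a b ha.
suff: ideal_pow Q (m + n) `<=` colon L a by apply.
apply: IH; first exact: idl_colon.
by move=> c d hd; rewrite /colon /= mulrA; apply: h; apply: powSmul.
Qed.

Lemma pow_sub_radical I (s : seq A) : is_ideal I ->
  (forall x, x \in s -> exists n : nat, I (x ^+ n)) ->
  exists n, ideal_pow (ideal_gen [set` s]) n `<=` I.
Proof.
move=> hI; elim: s => [|a s IH] h.
  exists 1%N; apply: mul_sub => // x y h0 _; apply: idlMr => //.
  by apply: h0.
have [|m hm] := IH; first by move=> x xs; apply: h; rewrite in_cons xs orbT.
have [|l hl] := h a; first by rewrite mem_head.
set Q := ideal_gen _ in hm; set Q' := ideal_gen _.
have sQ x : Q' x -> adjoin Q a x.
  apply: gen_sub; first by apply: idl_adjoin; apply: idl_gen.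
  move=> rewrite /orP[/eqP->|ys]; first exact: mem_adjoin (idl_gen _).
  by apply: sub_adjoin; apply: sub_gen.
exists (m + l)%N.
(* The u factors from Q' are split off one at a time: i counts those replaced by an element of Q, j
   those replaced by a, and m + l replacements force membership in I. *)
suff key u : ideal_pow Q' u `<=`
    [set x | forall i j y, ideal_pow Q i y -> (m + l <= u + i + j)%N -> I (x * y * a ^+ j)].
  move=> x /key/(_ 0%N 0%N 1).
  by rewrite !mulr1; apply; rewrite ?addn0.
elim: u => [|u IHu].
  move=> x _ i j y hy; rewrite add0n => le.
  have [mi|im] := leqP m i.
    by apply: idlMr => //; apply: idlM => //; apply: hm; apply: pow_leq hy.
  have lj : (l <= j)%N by lia.
  by rewrite -(subnK lj) exprD; apply: idlM => //; apply: idlM.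
apply: mul_sub.
  split=> [i j y _ _|x z hx hz i j y hy le|c x hx i j y hy le].
  - by rewrite !mul0r; apply: idl0.
  - by rewrite !mulrDl; apply: idlD => //; [apply: hx le|apply: hz le].
  - by rewrite -!mulrA; apply: idlM => //; rewrite mulrA; apply: hx le.
move=> c x /sQ /adjoinP[d hc] /IHu hx i j y hy le.
rewrite -(subrK (a * d) c) mulrDl mulrDl mulrDl; apply: idlD => //.
  rewrite [(c - _) * x]mulrC -[x * _ * y]mulrA; apply: (hx i.+1 j); last lia.
  exact: powSmul.
have -> : a * d * x * y * a ^+ j = d * (x * y * a ^+ j.+1) by rewrite exprS; ring.
apply: idlM => //; apply: (hx i j.+1) => //; lia.
Qed.

End IdealTheory.

#[local] Hint Extern 0 (is_ideal _) => solve [eauto 4 using is_idealT, is_ideal0, idl_iadd,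
  idl_imul1, idl_colon, idl_adjoin, idl_gen, idl_mul, idl_pow,
  prime_ideal with nocore] : core.

(** * Length *)

Section Chains.
Variables A B : comPzRingType.
Implicit Types (F : set (set A)) (G : set (set B)).

Lemma has_chain_leq F m n : (m <= n)%N -> has_chain F n -> has_chain F m.
Proof.
move=> le [J [h1 h2]]; exists J; split=> i hi; first by apply: h1; apply: leq_trans le.
by apply: h2; apply: leq_trans le.
Qed.

Lemma has_chain_sub F F' n : F `<=` F' -> has_chain F n -> has_chain F' n.
Proof. move=> s [J [h1 h2]]; exists J; split=> // i /h1; apply: s. Qed.

Lemma max_chain_uniq F m n : max_chain F m -> max_chain F n -> m = n.
Proof.
move=> [h1 n1] [h2 n2]; case: (ltngtP m n) => // lt; exfalso.
  by apply: n1; apply: has_chain_leq h2.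
by apply: n2; apply: has_chain_leq h1.
Qed.

Lemma max_chain_ex F n : has_chain F 0 -> ~ has_chain F n -> exists2 m, (m < n)%N & max_chain F m.
Proof.
move=> h0; elim: n => [//|n IH].
have [h|h] := pselect (has_chain F n); first by exists n.
by have [m hm] := IH h; exists m => //; apply: ltnW.
Qed.

Lemma has_chain_map F G n (f : set A -> set B) : (forall K, F K -> G (f K)) ->
  (forall K L, F K -> F L -> K `<` L -> f K `<` f L) -> has_chain F n -> has_chain G n.
Proof.
move=> h1 h2 [J [hJ1 hJ2]]; exists (fun i => f (J i)); split=> i hi; first exact/h1/hJ1.
by apply: h2; [apply: hJ1; apply: ltnW|apply: hJ1|apply: hJ2].
Qed.

End Chains.

(* An order isomorphism only up to antisymmetry: monotone maps with [g (f K) = K]. *)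
Lemma has_chain_retract (A B : comPzRingType) (f : set A -> set B) (g : set B -> set A)
    (F : set (set A)) (G : set (set B)) n : (forall K, F K -> G (f K)) ->
  (forall K L, K `<=` L -> f K `<=` f L) -> (forall K L, K `<=` L -> g K `<=` g L) ->
  (forall K, F K -> g (f K) = K) -> has_chain F n -> has_chain G n.
Proof.
move=> h1 h2 h3 h4; apply: has_chain_map h1 _ => K L FK FL [s ns]; split; first exact: h2.
by move=> /h3; rewrite !h4.
Qed.

Lemma max_chain_iso (A B : comPzRingType) (f : set A -> set B) (g : set B -> set A)
    (F : set (set A)) (G : set (set B)) n : (forall K, F K -> G (f K)) ->
  (forall K, G K -> F (g K)) ->
  (forall K L, K `<=` L -> f K `<=` f L) -> (forall K L, K `<=` L -> g K `<=` g L) ->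
  (forall K, F K -> g (f K) = K) -> (forall K, G K -> f (g K) = K) ->
  max_chain F n <-> max_chain G n.
Proof.
split=> -[c nc]; split=> [|c'].
- exact: (@has_chain_retract _ _ f g) c.
- apply: nc; exact: (@has_chain_retract _ _ g f) c'.
- exact: (@has_chain_retract _ _ g f) c.
- apply: nc; exact: (@has_chain_retract _ _ f g) c'.
Qed.

Section Length.
Variable A : comPzRingType.
Implicit Types I J K L : set A.

Definition between I J : set (set A) := [set K | [/\ is_ideal K, I `<=` K & K `<=` J]].
(** The module J/I has length n; [finl I] says that A/I has finite length. *)
Definition ilen I J n := max_chain (between I J) n.
Definition finl I := exists n, ilen I setT n.

Lemma quo_lengthE I n : ilen I setT n -> quo_length I = n.
Proof.
have E : between I setT = [set J | is_ideal J /\ I `<=` J].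
  by apply/seteqP; split=> J => [[]|[]].
rewrite /ilen E => h; rewrite /quo_length; case: xgetP => [m _ h'|/(_ n)//].
exact: max_chain_uniq h.
Qed.

Lemma quo_lengthP I : finl I -> ilen I setT (quo_length I).
Proof. by case=> n h; rewrite (quo_lengthE h). Qed.

Lemma has_chain0 I J : is_ideal I -> I `<=` J -> has_chain (between I J) 0.
Proof. by move=> IJ; exists (fun=> I); split=> // i _; split. Qed.

Lemma has_chain_top I K K' n : is_ideal K' -> K `<` K' -> has_chain (between I K) n ->
  has_chain (between I K') n.+1.
Proof.
move=> hK' lt [X [h1 h2]].
exists (fun i => if (i <= n)%N then X i else K'); split=> i.
  rewrite leq_eqVlt ltnS => /orP[/eqP->|le]; last first.
    rewrite le; case: (h1 i le) => ? ? s; split=> //; apply: subset_trans s lt.1.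
  rewrite ltnn; split=> //; have [_ s1 s2] := h1 n (leqnn n).
  exact: subset_trans (subset_trans s2 lt.1).
rewrite ltnS leq_eqVlt => /orP[/eqP->|lti].
  rewrite ?eqxx ltnn /=; have [_ s1 s2] := h1 n (leqnn n).
  by split; [apply: subset_trans lt.1|move=> h; apply: lt.2; apply: subset_trans s2].
by rewrite ?(ltnW lti) lti ?orbT; apply: h2.
Qed.

Lemma has_chain_cat I J K a b : is_ideal J -> I `<=` J -> J `<=` K ->
  has_chain (between I J) a -> has_chain (between J K) b -> has_chain (between I K) (a + b).
Proof.
move=> hJ IJ JK [X [x1 x2]] [Y [y1 y2]].
exists (fun i => if (i <= a)%N then X i else Y (i - a)%N); split=> i hi.
  case: leqP => h; first by have [? s] := x1 i h; split=> //; apply: subset_trans JK.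
  have [|? s ?] := y1 (i - a)%N; first lia.
  by split=> //; apply: subset_trans s.
case: (ltngtP i a) => h.
- exact: x2.
- rewrite subSn; last lia.
  apply: y2; lia.
- rewrite h subSn // subnn.
  have [_ _ s1] := x1 a (leqnn a); have [|s3 n3] := y2 0%N; first lia.
  have [_ s2 _] := y1 0%N isT.
  split; first exact: subset_trans (subset_trans s2 s3).
  move=> c; apply: n3; apply: subset_trans c (subset_trans s1 s2).
Qed.

(* Modular law: in a chain from I to K, each strict step is strict after
   intersecting with J or after adding J. *)
Lemma has_chain_split I J K n : is_ideal I -> is_ideal J -> I `<=` J -> J `<=` K -> is_ideal K ->
  has_chain (between I K) n -> exists a b, [/\ (n <= a + b)%N,
    has_chain (between I J) a & has_chain (between J K) b].
Proof.
move=> hI hJ IJ JK hK [L [h1 h2]].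
suff [a [b [le ca cb]]] : exists a b, [/\ (n <= a + b)%N,
    has_chain (between I (L n `&` J)) a & has_chain (between J (iadd (L n) J)) b].
  exists a, b; split=> //.
    apply: has_chain_sub ca => M [? ? s]; split=> //; apply: subset_trans s _.
    exact: subIsetr.
  apply: has_chain_sub cb => M [? ? s]; split=> //; apply: subset_trans s _.
  by apply: iadd_sub; case: (h1 n).
elim: n h1 h2 => [|n IH] h1 h2.
  exists 0%N, 0%N; split=> //; apply: has_chain0 => //.
    by have [_ s _] := h1 0%N isT; rewrite subsetI.
  by have [? s _] := h1 0%N isT; apply: sub_iaddr.
have [|i hi|a [b [le ca cb]]] := IH; first by move=> i hi; apply: h1; apply: leqW.
  by apply: h2; apply: leqW.
have [hn sn] := h1 n (leqnSn n); have [hn' sn'] := h1 n.+1 (leqnn _).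
have [ss ns] := h2 n (ltnSn n).
have s1 : L n `&` J `<=` L n.+1 `&` J by move=> x [/ss ?].
have s2 : iadd (L n) J `<=` iadd (L n.+1) J by apply: iadd_mono.
have [e1|e1] := pselect (L n.+1 `&` J `<=` L n `&` J); last first.
  exists a.+1, b; split; first by rewrite ltnS.
    by apply: has_chain_top ca; [apply: is_idealI|split].
  by apply: has_chain_sub cb => M [? s]; split=> //; apply: subset_trans s2.
exists a, b.+1; split; first by rewrite addnS.
  by apply: has_chain_sub ca => M [? s]; split=> //; apply: subset_trans s1.
apply: has_chain_top cb; first exact: idl_iadd.
split=> // e2; apply: ns => x hx.
have [y [z [hy hz e]]] := e2 x (sub_iaddl hJ hx).
have [] : (L n `&` J) z; last by move=> hz' _; rewrite e; apply: idlD.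
by apply: e1; split=> //; rewrite (_ : z = x - y); [apply: idlB => //; apply: ss|rewrite e addrC addKr].
Qed.

Lemma ilen_add I J K a b : is_ideal I -> is_ideal J -> is_ideal K -> I `<=` J -> J `<=` K ->
  ilen I J a -> ilen J K b -> ilen I K (a + b).
Proof.
move=> hI hJ hK IJ JK [ca na] [cb nb]; split; first exact: has_chain_cat cb.
move=> /(has_chain_split hI hJ IJ JK hK)[a' [b' [le ca' cb']]].
case: (leqP a' a) => ha; last by apply: na; apply: has_chain_leq ca'.
case: (leqP b' b) => hb; last by apply: nb; apply: has_chain_leq cb'.
lia.
Qed.

Lemma ilen_split I J K n : is_ideal I -> is_ideal J -> is_ideal K -> I `<=` J -> J `<=` K ->
  ilen I K n -> exists a b, [/\ n = (a + b)%N, ilen I J a & ilen J K b].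
Proof.
move=> hI hJ hK IJ JK h; have [c nc] := h.
have nca : ~ has_chain (between I J) n.+1.
  by move=> x; apply: nc; apply: has_chain_sub x => M [? s]; split=> //; apply: subset_trans JK.
have ncb : ~ has_chain (between J K) n.+1.
  by move=> x; apply: nc; apply: has_chain_sub x => M [? s ?]; split=> //; apply: subset_trans s.
have [a _ ha] := max_chain_ex (has_chain0 hI IJ) nca.
have [b _ hb] := max_chain_ex (has_chain0 hJ JK) ncb.
exists a, b; split=> //.
exact: max_chain_uniq (ilen_add hI hJ hK IJ JK ha hb).
Qed.

Lemma ilen_refl I : is_ideal I -> ilen I I 0.
Proof.
split; first exact: has_chain0.
move=> [X [h1 h2]]; have [_ n0] := h2 0%N isT.
have [_ s0 _] := h1 0%N isT; have [_ _ s1] := h1 1%N isT.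
by apply: n0; apply: subset_trans s0.
Qed.

Lemma ilen0 I J : is_ideal J -> is_ideal I -> I `<=` J -> ilen I J 0 -> I = J.
Proof.
move=> hJ hI IJ [_ n1]; apply: contrapT => ne; apply: n1.
apply: has_chain_top (has_chain0 hI (@subset_refl _ I)) => //; split=> // h.
by apply: ne; apply/seteqP.
Qed.

Lemma finl_sub I J : is_ideal I -> is_ideal J -> I `<=` J -> finl I -> finl J.
Proof.
move=> hI hJ IJ [n h].
by have [a [b [_ hb]]] := ilen_split hI hJ (@is_idealT A) IJ (@subsetT _ _) h; exists b.
Qed.

Lemma ilen_quo I J : is_ideal I -> is_ideal J -> I `<=` J -> finl I ->
  ilen I J (quo_length I - quo_length J) /\ (quo_length J <= quo_length I)%N.
Proof.
move=> hI hJ IJ /quo_lengthP h.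
have [a [b [E ha hb]]] := ilen_split hI hJ (@is_idealT A) IJ (@subsetT _ _) h.
by rewrite E (quo_lengthE hb) addnK leq_addl.
Qed.

Lemma quo_length_sub I J : is_ideal I -> is_ideal J -> I `<=` J -> finl I ->
  (quo_length J <= quo_length I)%N.
Proof. by move=> hI hJ IJ h; case: (ilen_quo hI hJ IJ h). Qed.

Lemma quo_length_eq I J : is_ideal I -> is_ideal J -> I `<=` J -> finl I ->
  quo_length J = quo_length I -> I = J.
Proof. move=> hI hJ IJ h E; have [] := ilen_quo hI hJ IJ h; rewrite E subnn => /ilen0; auto. Qed.

Lemma quo_length_add I J n : is_ideal I -> is_ideal J -> I `<=` J -> ilen I J n -> finl J ->
  finl I /\ quo_length I = (n + quo_length J)%N.
Proof.
move=> hI hJ IJ h /quo_lengthP hJT.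
have := ilen_add hI hJ (@is_idealT A) IJ (@subsetT _ _) h hJT.
by split; [exists (n + quo_length J)%N|apply: quo_lengthE].
Qed.

Lemma quo_lengthT : finl (@setT A) /\ quo_length (@setT A) = 0%N.
Proof. by have := ilen_refl (@is_idealT A); split; [exists 0%N|apply: quo_lengthE]. Qed.

(* Multiplication by q identifies J / {z in J | qz in N} with (N + qJ) / N. *)
Lemma ilen_mul N J (q : A) n : is_ideal N -> is_ideal J ->
  ilen (J `&` colon N q) J n <-> ilen N (iadd N (imul1 q J)) n.
Proof.
move=> hN hJ.
apply: (@max_chain_iso A A (fun K => iadd N (imul1 q K)) (fun K => J `&` colon K q)).
- move=> K [hK s1 s2]; split.
  + by apply: idl_iadd.
  + by apply: sub_iaddl.
  + by apply: iadd_mono => // _ [b /s2 hb ->]; exists b.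
- move=> K [hK s1 s2]; split.
  + by apply: is_idealI.
  + by move=> x [? ?]; split=> //; apply: s1.
  + exact: subIsetl.
- by move=> K L s; apply: iadd_mono => // _ [b /s hb ->]; exists b.
- by move=> K L s x [? ?]; split=> //; apply: s.
- move=> K [hK s1 s2]; apply/seteqP; split=> x.
    move=> [Jx [a [_ [Na [b Kb ->] E]]]].
    rewrite -(subrK b x); apply: idlD => //; apply: s1; split.
      by apply: idlB => //; apply: s2.
    by rewrite /colon /= mulrBr E addrK.
  split; first exact: s2.
  by exists 0, (q * x); split; rewrite ?add0r //; [apply: idl0|exists x].
- move=> K [hK s1 s2]; apply/seteqP; split=> x.
    by move=> [a [_ [/s1 Ka [b [_ Kb] ->] ->]]]; apply: idlD.
  move=> hx; have [a [_ [Na [b Jb ->] E]]] := s2 _ hx.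
  exists a, (q * b); split=> //; exists b; split=> //; rewrite /colon /=.
  by rewrite (_ : q * b = x - a); [apply: idlB => //; apply: s1|rewrite E addrC addKr].
Qed.

Lemma quo_length_mul N J (q : A) : is_ideal N -> is_ideal J -> finl N -> finl (J `&` colon N q) ->
  (quo_length N + quo_length J =
   quo_length (J `&` colon N q) + quo_length (iadd N (imul1 q J)))%N.
Proof.
move=> hN hJ fN fL; set L := J `&` _.
have hL : is_ideal L by apply: is_idealI.
have hq : is_ideal (imul1 q J) by apply: idl_imul1.
have hA : is_ideal (iadd N (imul1 q J)) by apply: idl_iadd.
have [l1 le1] := ilen_quo hL hJ (@subIsetl _ _ _) fL.
have [l2 le2] := ilen_quo hN hA (sub_iaddl hq) fN.
have := max_chain_uniq ((ilen_mul q _ hN hJ).1 l1) l2.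
lia.
Qed.

(** Additivity along 0 -> A/(I : a) -> A/I -> A/(I + aA) -> 0, where the first map is multiplication
    by a. *)
Lemma quo_length_colon I (a : A) : is_ideal I -> finl (adjoin I a) -> finl (colon I a) ->
  finl I /\ (quo_length I = quo_length (colon I a) + quo_length (adjoin I a))%N.
Proof.
move=> hI f1 /quo_lengthP f2.
have := (ilen_mul a (quo_length (colon I a)) hI (@is_idealT A)).1.
rewrite setTI => /(_ f2) h.
by have := quo_length_add hI (idl_adjoin a hI) (@sub_adjoin _ I a) h f1.
Qed.

Lemma finl_colon I (a : A) : is_ideal I -> finl I -> finl (colon I a).
Proof. by move=> f; apply: finl_sub => //; apply: sub_colon. Qed.
Lemma finl_adjoin I (a : A) : is_ideal I -> finl I -> finl (adjoin I a).
Proof. move=> f; apply: finl_sub => //; apply: sub_adjoin. Qed.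

(** Maximality is expressed by inverses modulo M, the form from which residue fields are built. *)
Definition maximal_ideal (M : set A) := [/\ is_ideal M, ~ M 1 &
  forall a, ~ M a -> exists b, M (1 - a * b)].

Lemma maximal_sub M J : maximal_ideal M -> is_ideal J -> M `<=` J -> ~ J 1 -> J = M.
Proof.
move=> [hM M1 mx] hJ s nJ; apply/seteqP; split=> // x Jx; apply: contrapT => /mx[b hb].
by apply: nJ; rewrite -(subrK (x * b) 1); apply: idlD => //; [apply: s|apply: idlMr].
Qed.

Lemma maximal_prime M : maximal_ideal M -> is_prime M.
Proof.
move=> [hM M1 mx]; split=> // a b hab; apply: contrapT => /not_orP[/mx[c hc] nb]; apply: nb.
rewrite -[b]mul1r -(subrK (a * c) 1) mulrDl; apply: idlD; rewrite ?[_ b]mulrC //.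
  exact: idlM.
by rewrite mulrCA mulrA mulrC; apply: idlM.
Qed.

Lemma quo_length_max M : maximal_ideal M -> finl M /\ quo_length M = 1%N.
Proof.
move=> mM; have [hM mx] := mM.
suff : ilen M setT 1 by split; [exists 1%N|apply: quo_lengthE].
split.
  apply: has_chain_top (has_chain0 hM (@subset_refl _ M)) => //.
  by split=> // /(_ 1 I).
move=> [X [h1 h2]].
have [hX0 sX0 _] := h1 0%N isT; have [hX1 sX1 _] := h1 1%N isT.
have [_ n0] := h2 0%N isT; have [_ n1] := h2 1%N isT.
have [E|nE] := pselect (X 1%N 1); first by apply: n1; rewrite (idl1 hX1 E).
by apply: n0; rewrite (maximal_sub mM hX1 sX1 nE).
Qed.

(** Multiplication by a nonzero element of the domain A/P is injective; a length count makes it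
    surjective. *)
Lemma prime_finl_maximal (P : set A) : is_prime P -> finl P -> maximal_ideal P.
Proof.
move=> pP fP; have [hP P1 _] := pP; split=> // a nPa.
have E : colon P a = P.
  apply/seteqP; split=> x; last by apply: sub_colon.
  by move/(primeM pP) => [].
have [_] := quo_length_colon hP (finl_adjoin a hP fP) (finl_colon a hP fP).
rewrite E => /eqP; rewrite -{1}[quo_length P]addn0 eqn_add2l => /eqP E0.
have h : adjoin P a = setT.
  have [_ qT] := quo_lengthT.
  by apply: (quo_length_eq); rewrite ?qT //; apply: finl_adjoin.
by have /adjoinP[b hb] : adjoin P a 1 by [rewrite h]; exists b.
Qed.

Lemma finl_primes I : is_noetherian A -> is_ideal I ->
  (forall P, is_prime P -> I `<=` P -> finl P) -> finl I.
Proof.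
move=> hn; move: I.
apply: (prime_filtration_ind hn).
  by case: quo_lengthT.
move=> I a hI nIa pr IH h.
apply: (quo_length_colon hI _ _).1.
  apply: IH => P pP s; apply: h => //; apply: subset_trans s; apply: sub_adjoin.
by apply: h => //; apply: sub_colon.
Qed.

Lemma finl_radical I J : is_noetherian A -> is_ideal I -> is_ideal J -> finl J ->
  (forall P, is_prime P -> I `<=` P -> J `<=` P) -> finl I.
Proof.
move=> hn hI hJ fJ h; apply: finl_primes => // P pP s.
by apply: finl_sub => //; apply: h.
Qed.

Lemma pow_sub_prime (P Q : set A) n : is_prime P -> ideal_pow Q n `<=` P -> Q `<=` P.
Proof.
move=> pP s x hx; apply: (primeX pP); apply: s; exact: mem_powX.
Qed.

Lemma finl_pow (Q I : set A) n : is_noetherian A -> is_ideal Q -> finl Q -> is_ideal I ->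
  ideal_pow Q n `<=` I -> finl I.
Proof.
move=> hn hQ fQ hI s; apply: (finl_radical hn hI hQ fQ) => P pP sP.
by apply: (pow_sub_prime (n := n) pP); apply: subset_trans sP.
Qed.

End Length.

(** * Noetherian rings *)

(** An ideal of A is generated by the image of its contraction to M. The fraction hypothesis covers
    both quotients, with u = 1, and localizations such as stalks. *)
Lemma localization_noetherian (M A : comPzRingType) (f : {rmorphism M -> A}) : is_noetherian M ->
  (forall a, exists F u, is_unit u /\ a * u = f F) -> is_noetherian A.
Proof.
move=> nM frac I hI.
have hJ : is_ideal (f @^-1` I).
  split=> [|a b|c a] /=; rewrite ?rmorph0 ?rmorphD ?rmorphM; [exact: idl0|exact: idlD|exact: idlM].
have [n [g Eg]] := nM _ hJ; exists n, (f \o g); apply/seteqP; split=> a; last first.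
  apply: gen_sub => // _ [i _ <-]; suff : (f @^-1` I) (g i) by [].
  by rewrite Eg; apply: sub_gen.
move=> Ia; have [F [u [[v uv] E]]] := frac a.
have : (f @^-1` I) F by rewrite /= -E; apply: idlMr.
rewrite Eg => /gen_rangeP[c Ec]; apply/gen_rangeP; exists (fun i => v * f (c i)).
rewrite -[a]mulr1 -uv mulrA E Ec rmorph_sum mulr_suml; apply: eq_bigr => i _.
ring.
Qed.

Lemma noetherian_surj (R S : comPzRingType) (f : {rmorphism R -> S}) :
  (forall y, exists x, f x = y) -> is_noetherian R -> is_noetherian S.
Proof.
move=> fs hR; apply: (localization_noetherian (f := f) hR) => a; have [F E] := fs a.
by exists F, 1; rewrite mulr1; split=> //; exists 1; rewrite mulr1.
Qed.

Lemma field_noetherian (k : fieldType) : is_noetherian k.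
Proof.
apply/noetherian_fgen => I hI.
have [[x [Ix nx]]|h] := pselect (exists x, I x /\ x != 0).
  have IT : I = setT by apply: idl1 => //; rewrite -(mulVf nx); apply: idlM.
  exists [:: 1]; rewrite IT; symmetry; apply: idl1; first exact: idl_gen.
  by apply: sub_gen; rewrite /= mem_head.
exists [::]; apply/seteqP; split=> [x Ix|]; last by apply: gen_sub.
have [->|nx] := eqVneq x 0; first exact: idl0.
by case: h; exists x.
Qed.

Lemma hilbert_basis (R : comNzRingType) : is_noetherian R -> is_noetherian {poly R}.
Proof.
move=> hn; have hfg := (noetherian_fgen R).1 hn; apply/noetherian_fgen => I hI.
pose L n := [set a | exists p : {poly R}, [/\ I p, (size p <= n.+1)%N & p`_n = a]].
have hL n : is_ideal (L n).
  split; first by exists 0; rewrite size_poly0 coef0; split=> //; apply: idl0.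
  - move=> _ _ [p [Ip sp <-]] [q [Iq sq <-]]; exists (p + q); rewrite coefD; split=> //.
      exact: idlD.
    by rewrite (leq_trans (size_polyD _ _)) // geq_max sp.
  - move=> c _ [p [Ip sp <-]]; exists (c%:P * p); rewrite coefCM; split=> //.
      exact: idlM.
    by rewrite mul_polyC (leq_trans (size_scale_leq _ _)).
have LS n : L n `<=` L n.+1.
  move=> _ [p [Ip sp <-]]; exists (p * 'X); rewrite coefMX; split=> //; first exact: idlMr.
  by rewrite (leq_trans (size_polyMleq _ _)) // size_polyX addn2.
have [N hN] := noetherian_seq hn hL LS.
pose good n (t : seq {poly R}) := (forall p, p \in t -> I p) /\
    forall a, L n a -> exists q, [/\ ideal_gen [set` t] q, (size q <= n.+1)%N & q`_n = a].
have gen n : exists t, good n t.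
  rewrite /good; have [s Es] := hfg _ (hL n).
  have hs : forall a, a \in s -> L n a by move=> a as_; rewrite Es; apply: sub_gen.
  rewrite Es {Es}.
  elim: s hs => [|a s IH] hs.
    exists [::]; split=> // a /(_ [set 0]) h; exists 0; rewrite size_poly0 coef0; split=> //.
      exact: idl0.
    by symmetry; apply: h.
  have [|t [t1 t2]] := IH; first by move=> b bs; apply: hs; rewrite in_cons bs orbT.
  have [|p [Ip sp Ea]] := hs a; first by rewrite mem_head.
  exists (p :: t); split=> [q|b hb]; first by rewrite in_cons => /orP[/eqP->//|/t1].
  have : adjoin (ideal_gen [set` s]) a b.
    move: hb; apply: gen_sub; first by apply: idl_adjoin.
    move=> rewrite /orP[/eqP->|bs]; first exact: mem_adjoin.
    by apply: sub_adjoin; apply: sub_gen.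
  move=> /adjoinP[c /t2[q [gq sq Eq]]]; exists (q + c%:P * p); split.
  - apply: (idlD (idl_gen _)).
      by apply: gen_mono gq => z /= zt; rewrite in_cons zt orbT.
    by apply: (idlM _ (idl_gen _)); apply: sub_gen; rewrite /= mem_head.
  - rewrite (leq_trans (size_polyD _ _)) // geq_max sq mul_polyC.
    by rewrite (leq_trans (size_scale_leq _ _)).
  - by rewrite coefD coefCM Eq Ea mulrC subrK.
have [t ht] := choice gen.
exists (flatten [seq t n | n <- iota 0 N.+1]); apply/seteqP; split; last first.
  apply: gen_sub => // p /flatten_mapP[n _]; exact: (ht n).1.
set G := ideal_gen _; have hG : is_ideal G by apply: idl_gen.
have tG n : (n <= N)%N -> ideal_gen [set` t n] `<=` G.
  move=> le; apply: gen_mono => p pt; apply/flatten_mapP; exists n => //.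
  by rewrite mem_iota.
have lead n : forall a, L n a -> exists q, [/\ G q, (size q <= n.+1)%N & q`_n = a].
  move=> a; have [le|lt] := leqP n N.
    by move=> /(ht n).2[q [/(tG _ le) ?]]; exists q.
  rewrite (hN n) ?(ltnW lt) // => /(ht N).2[q [/(tG _ (leqnn N)) Gq sq E]].
  exists (q * 'X^(n - N)); rewrite coefMXn; split.
  - exact: (idlMr _ hG).
  - rewrite (leq_trans (size_polyMleq _ _)) // size_polyXn; lia.
  - rewrite -E; case: ltnP => h; [lia|congr (q`_ _); lia].
move=> p; have [n] := ubnP (size p); elim: n p => // n IH p sp Ip.
have [->|np] := eqVneq p 0; first exact: idl0.
have Esz : size p = (size p).-1.+1 by rewrite prednK // size_poly_gt0.
have [|q [Gq sq Eq]] := lead (size p).-1 p`_(size p).-1.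
  by exists p; rewrite -Esz.
rewrite -(subrK q p); apply: (idlD hG) => //.
have Iq : I q by move: Gq; apply: gen_sub => // z /flatten_mapP[m _]; exact: (ht m).1.
apply: IH; last exact: (idlB hI).
rewrite ltnS in sp; apply: leq_trans sp; rewrite Esz.
apply/leq_sizeP => j; rewrite coefB leq_eqVlt => /orP[/eqP<-|lt]; first by rewrite Eq subrr.
have hq : (size q <= j)%N by apply: leq_trans lt.
by rewrite !nth_default ?subrr // Esz.
Qed.

(* Polynomials in n variables, the last variable being the outermost one. *)
Fixpoint mp (R : comNzRingType) (n : nat) : comNzRingType :=
  if n is m.+1 then {poly mp R m} else R.

Lemma mp_noetherian (R : comNzRingType) n : is_noetherian R -> is_noetherian (mp R n).
Proof. by move=> h; elim: n => //n IH; apply: hilbert_basis. Qed.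

Fixpoint mpev (R : comNzRingType) (S : comNzRingType) (f : {rmorphism R -> S}) (x : nat -> S)
    (n : nat) : {rmorphism mp R n -> S} :=
  if n is m.+1 then
    [the {rmorphism {poly mp R m} -> S} of horner_eval (x m) \o map_poly (mpev f x m)]
  else f.

Section Mpev.
Variables (R S : comNzRingType) (f : {rmorphism R -> S}) (x : nat -> S).

Lemma mpevS n (p : {poly mp R n}) : mpev f x n.+1 p = (map_poly (mpev f x n) p).[x n].
Proof. by []. Qed.

Lemma mpev_X n : mpev f x n.+1 ('X : {poly mp R n}) = x n.
Proof. by rewrite mpevS map_polyX hornerX. Qed.

Lemma mpev_C n (c : mp R n) : mpev f x n.+1 (c%:P : {poly mp R n}) = mpev f x n c.
Proof. by rewrite mpevS map_polyC hornerC. Qed.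

Lemma mpev_range_var n i : (i < n)%N -> range (mpev f x n) (x i).
Proof.
elim: n => // n IH; rewrite ltnS leq_eqVlt => /orP[/eqP->|/IH[p _ <-]].
  exists ('X : {poly mp R n}) => //; apply: mpev_X.
exists (p%:P : {poly mp R n}) => //; apply: mpev_C.
Qed.

Lemma mpev_range_const n c : range (mpev f x n) (f c).
Proof. by elim: n => [|n [p _ <-]]; [exists c|exists (p%:P : {poly mp R n}) => //; apply: mpev_C]. Qed.

Lemma mpev_ind n (T : set S) : (forall c, T (f c)) -> (forall i, (i < n)%N -> T (x i)) ->
  (forall a b, T a -> T b -> T (a + b)) -> (forall a b, T a -> T b -> T (a * b)) ->
  forall p, T (mpev f x n p).
Proof.
move=> h1 + h3 h4; elim: n => [|n IH] h2 p; first exact: h1.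
have T0 : T 0 by rewrite -(rmorph0 f).
rewrite mpevS; elim/poly_ind: p => [|p c IHp]; first by rewrite map_poly0 horner0.
rewrite rmorphD rmorphM /= map_polyX map_polyC hornerMXaddC; apply: h3; first apply: h4 => //.
  exact: h2.
by apply: IH => i hi; apply: h2; apply: leqW.
Qed.

End Mpev.

(** * Graded ideals of the Rees algebra *)

(* A homogeneous ideal of the Rees algebra of Q is a sequence of ideals
   N n contained in Q^n with Q N n contained in N n.+1. *)
Section Rees.
Variables (A : comNzRingType) (Q : set A).
Hypothesis noethA : is_noetherian A.
Hypothesis idQ : is_ideal Q.
Local Notation "Q ^^ n" := (ideal_pow Q n) (at level 30).
Implicit Types (N P : nat -> set A).

Definition gideal N := [/\ forall n, is_ideal (N n), forall n, N n `<=` Q ^^ n &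
  forall n a b, Q a -> N n b -> N n.+1 (a * b)].

Definition gsub N N' := forall n, N n `<=` N' n.

Lemma gideal_mul N m n a b : gideal N -> (Q ^^ m) a -> N n b -> N (m + n)%N (a * b).
Proof.
move=> [h1 h2 h3] ha hb; elim: m a ha => [|m IH] a ha; first exact: idlM.
have hc : is_ideal (colon (N (m.+1 + n)%N) b) by apply: idl_colon.
suff: (Q ^^ m.+1) `<=` colon (N (m.+1 + n)%N) b by move=> /(_ a ha); rewrite mulrC.
apply: (mul_sub hc) => c d hc' /IH hd; rewrite /colon /=.
by rewrite (_ : b * (c * d) = c * (d * b)); [apply: h3|ring].
Qed.

(** The pullback, along X_i -> x_i T, of the homogeneous ideal ⊕ N_n T^n of the Rees algebra.
    Through it homogeneous ideals inherit the ascending chain condition from [mp A r]. *)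
Definition rees_ideal r (x : nat -> A) N : set (mp A r) :=
  [set F | forall n, N n (mpev polyC (fun i => (x i)%:P * 'X) r F)`_n].

Section Presentation.
Variables (r : nat) (x : nat -> A).
Hypothesis Qx : forall i, (i < r)%N -> Q (x i).
Hypothesis Qgen : forall I, is_ideal I -> (forall i, (i < r)%N -> I (x i)) -> Q `<=` I.
Let ev := mpev (R := A) polyC (fun i => (x i)%:P * 'X) r.

Lemma rees_ev_pow F n : (Q ^^ n) (ev F)`_n.
Proof.
move: n; apply: (mpev_ind (T := [set p : {poly A} | forall n, (Q ^^ n) p`_n])) => /=.
- move=> c n; rewrite coefC; case: n => //n; exact: (idl0).
- move=> i hi [|n] //; rewrite coefMX coefC; case: n => [|n].
    by move/Qx: hi; rewrite -[X in X _](pow1 idQ).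
  exact: (idl0).
- by move=> p q hp hq n; rewrite coefD; apply: (idlD).
- move=> p q hp hq n; rewrite coefM; apply: (idl_sum _ (idl_pow Q n)) => i _.
  by rewrite -{1}(subnKC (leq_ord i)); apply: pow_mul.
Qed.

Lemma rees_ev_surj n a : (Q ^^ n) a -> exists F, ev F = a%:P * 'X^n.
Proof.
elim: n a => [|n IH] a.
  have [F E] := mpev_range_const polyC (fun i => (x i)%:P * 'X) r a.
  by exists F; rewrite mulr1.
have hI : is_ideal ([set a : A | exists F, ev F = a%:P * 'X^(n.+1)] : set A).
  split; first by exists 0; rewrite rmorph0 mul0r.
  - by move=> b c [F EF] [G EG]; exists (F + G); rewrite rmorphD polyCD mulrDl EF EG.
  - move=> c b [F EF]; have [G _ EG] := mpev_range_const polyC (fun i => (x i)%:P * 'X) r c.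
    by exists (G * F); rewrite rmorphM polyCM -mulrA -EF EG.
apply: (mul_sub hI) => b c Qb /IH[F EF].
suff : Q `<=` colon [set a : A | exists F, ev F = a%:P * 'X^(n.+1)] c.
  by move=> h; rewrite mulrC; apply: h.
apply: Qgen => // i hi.
have [G _ EG] := mpev_range_var polyC (fun i => (x i)%:P * 'X) hi.
exists (G * F); rewrite rmorphM EF EG exprS; ring.
Qed.

Lemma idl_rees N : gideal N -> is_ideal (rees_ideal x N : set (mp A r)).
Proof.
move=> gN; have [h1 h3] := gN; split.
- by move=> n; rewrite rmorph0 coef0; apply: (idl0).
- by move=> F G hF hG n; rewrite rmorphD coefD; apply: (idlD).
- move=> C F hF n; rewrite rmorphM coefM; apply: (idl_sum _ (h1 n)) => i _.
  rewrite -{1}(subnKC (leq_ord i)); apply: gideal_mul => //; apply: rees_ev_pow.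
Qed.

Lemma rees_ideal_sub N N' : gideal N -> gideal N' ->
  (rees_ideal x N : set (mp A r)) `<=` rees_ideal x N' <-> gsub N N'.
Proof.
move=> [h1 h2 h3]; split=> [s n a Na|s F hF n]; last exact: s.
have [F EF] := rees_ev_surj (h2 _ _ Na).
have : rees_ideal x N F.
  move=> m; rewrite EF coefCM coefXn; case: eqP => [->|_]; rewrite ?mulr1 // mulr0.
  exact: (idl0).
by move=> /s/(_ n); rewrite EF coefCM coefXn eqxx mulr1.
Qed.

End Presentation.

Lemma rees_presentation : exists r (x : nat -> A), (forall i, (i < r)%N -> Q (x i)) /\
  forall I, is_ideal I -> (forall i, (i < r)%N -> I (x i)) -> Q `<=` I.
Proof.
have [s Es] := (noetherian_fgen A).1 noethA Q idQ.
exists (size s), (nth 0 s); split=> [i hi|I hI h].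
  by rewrite Es; apply: sub_gen; apply: mem_nth.
by rewrite Es; apply: gen_sub => // y /(nthP 0)[i hi <-]; apply: h.
Qed.

Lemma gideal_ind (R : (nat -> set A) -> Prop) :
  (forall N, gideal N -> (forall N', gideal N' -> gsub N N' -> ~ gsub N' N -> R N') -> R N) ->
  forall N, gideal N -> R N.
Proof.
move=> step; have [r [x [hx hg]]] := rees_presentation.
pose R' (H : set (mp A r)) := forall N, gideal N -> rees_ideal x N = H -> R N.
suff h H : is_ideal H -> R' H by move=> N gN; apply: h erefl; rewrite //; apply: idl_rees.
move: H; refine (@noetherian_ind _ (@mp_noetherian A r noethA) R' _) => H hH IH N gN EH.
apply: step => // N' gN' s ns; apply: (IH (rees_ideal x N')) => //.
  exact: idl_rees.
rewrite -EH; split; first exact: (rees_ideal_sub hg gN gN').2.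
by move=> /(rees_ideal_sub hg gN' gN).1.
Qed.

(** [T c] is the homogeneous ideal generated by the part of N in degrees at most c; the chain of
    these ideals is stationary. *)
Lemma artin_rees N : gideal N -> exists c, forall n, (c <= n)%N ->
  N n `<=` ideal_mul (Q ^^ (n - c)) (N c).
Proof.
move=> gN; have [h1 h2 h3] := gN.
pose T c n := if (n <= c)%N then N n else ideal_mul (Q ^^ (n - c)) (N c).
have Tsub c n : T c n `<=` N n.
  rewrite /T; case: leqP => [_|lt]; first exact: subset_refl.
  apply: (mul_sub (h1 n)) => a b ha.
  by rewrite -(subnK (ltnW lt)); apply: gideal_mul.
have gT c : gideal (T c).
  split=> [n|n|n a b Qa].
  - rewrite /T; case: leqP => //.
  - by apply: subset_trans.
  rewrite /T; case: (ltngtP n c) => hnc.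
  - exact: h3.
  - move: b.
    apply: mul_sub; first exact: idl_colon.
    move=> y z hz; rewrite /colon /= mulrA; apply: mem_mul.
    by rewrite subSn; [apply: powSmul|lia].
  - move=> hb; rewrite hnc subSn // subnn; apply: mem_mul; rewrite ?pow1 //.
    by rewrite -hnc.
have [r [x [hx hg]]] := rees_presentation.
have TS c : gsub (T c) (T c.+1).
  move=> n; rewrite /T; case: (ltngtP n c.+1) => hnc.
  - by rewrite -ltnS hnc.
  - rewrite ifF; last lia.
    apply: mul_sub; first exact: idl_mul.
    move=> a b ha hb; move: a ha; have -> : (n - c = (n - c.+1) + 1)%N by lia.
    suff: Q ^^ (n - c.+1 + 1) `<=` colon (ideal_mul (Q ^^ (n - c.+1)) (N c.+1)) b.
      by move=> h a /h; rewrite mulrC.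
    apply: pow_add_sub => // y z hy; rewrite pow1 // => hz.
    by rewrite /colon /= mulrC -mulrA; apply: mem_mul => //; apply: h3.
  - rewrite hnc ifF; last lia.
    by move=> a /(_ (N c.+1)); apply=> // _ [y [z [hy hz ->]]];
      have := gideal_mul gN hy hz; rewrite subnK.
have [||c hc] := noetherian_seq (@mp_noetherian A r noethA) (J := fun c => rees_ideal x (T c)).
- by move=> c; apply: idl_rees.
- move=> c; exact: (rees_ideal_sub hg (gT c) (gT c.+1)).2.
exists c => n; rewrite leq_eqVlt => /orP[/eqP<-|lt].
  by move=> a ha; rewrite -[a]mul1r; apply: mem_mul => //; rewrite subnn.
have : gsub (T n) (T c).
  by apply: (rees_ideal_sub hg (gT n) (gT c)).1; rewrite (hc n (ltnW lt)).
by move=> /(_ n); rewrite /T leqnn leqNgt lt.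
Qed.

(** Artin-Rees for the filtration Q^n ∩ (I + aA): if ax = i + z with i in I and z in Q^n, then z is
    congruent modulo I to aw with w in Q^(n-c), so x - w lies in (I : a). *)
Lemma artin_rees_colon I (a : A) : is_ideal I -> exists c, forall n, (c <= n)%N ->
  colon (iadd I (Q ^^ n)) a `<=` iadd (colon I a) (Q ^^ (n - c)).
Proof.
move=> hI; have hJ := idl_adjoin a hI.
have gN : gideal (fun n => Q ^^ n `&` adjoin I a).
  split=> [n|n|n b c Qb [h1 h2]].
  - by apply: is_idealI.
  - exact: subIsetl.
  - by split; [apply: powSmul|apply: (idlM _ hJ)].
have [c hc] := artin_rees gN; exists c => n le x [i [z [Ii Qz E]]].
have : (Q ^^ n `&` adjoin I a) z.
  by split=> //; apply/adjoinP; exists x; rewrite E -opprB addrK; apply: (idlN hI).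
move=> /(hc n le).
have hK : is_ideal (iadd I (imul1 a (Q ^^ (n - c)))).
  by apply: idl_iadd.
move=> /(mul_sub hK) [].
  move=> u v hu [_ [j [_ [Ij [w _ ->] ->]]]].
  exists (u * j), (a * (u * w)); split; rewrite ?mulrDr 1?[u * (a * w)]mulrCA //.
    exact: (idlM _ hI).
  by exists (u * w) => //; apply: (idlMr _).
move=> j [_ [Ij [w hw ->] Ez]].
exists (x - w), w; split; rewrite ?subrK //.
by rewrite /colon /= mulrBr E Ez addrA addrK; apply: (idlD hI).
Qed.

(** ** Homogeneous primes *)

(** Graded versions of [colon] and [adjoin] for a placed in degree d, that is, for the element a T^d
    of the Rees algebra. *)
Definition gcolon N d (a : A) : nat -> set A := fun n => Q ^^ n `&` colon (N (d + n)%N) a.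
Definition gadjoin N d (a : A) : nat -> set A :=
  fun n => if (d <= n)%N then iadd (N n) (imul1 a (Q ^^ (n - d))) else N n.
Definition gprime P := [/\ gideal P, ~ P 0%N 1 &
  forall m n a b, (Q ^^ m) a -> (Q ^^ n) b -> P (m + n)%N (a * b) -> P m a \/ P n b].

Lemma gideal_colon N d a : gideal N -> (Q ^^ d) a -> gideal (gcolon N d a).
Proof.
move=> gN ha; have [h1 h2 h3] := gN; split=> [n|n|n b c Qb [hc1 hc2]].
- by apply: is_idealI.
- exact: subIsetl.
- split; first exact: powSmul.
  by rewrite /colon /= addnS mulrCA; apply: h3.
Qed.

Lemma gsub_colon N d a : gideal N -> (Q ^^ d) a -> gsub N (gcolon N d a).
Proof.
move=> gN hb; split; first by have [_ h _] := gN; apply: h.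
exact: gideal_mul.
Qed.

Lemma gideal_adjoin N d a : gideal N -> (Q ^^ d) a -> gideal (gadjoin N d a).
Proof.
move=> gN ha; have [h1 h2 h3] := gN.
split=> [n|n|n b c Qb]; rewrite /gadjoin.
- by case: leqP => _.
- case: leqP => // le; apply: (iadd_sub) => // _ [b hb ->].
  by rewrite -{1}(subnKC le); apply: pow_mul.
case: (leqP d n) => le; last first.
  case: leqP => le' hc; last exact: h3.
  by apply: sub_iaddl => //; apply: h3.
rewrite (leqW le) => -[u [_ [hu [v hv ->] ->]]].
exists (b * u), (a * (b * v)); split; first exact: h3.
  by exists (b * v) => //; rewrite subSn //; apply: powSmul.
by rewrite mulrDr mulrCA.
Qed.

Lemma gsub_adjoin N d a : gsub N (gadjoin N d a).
Proof.
move=> n; rewrite /gadjoin; case: leqP => [_|_]; last exact: subset_refl.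
apply: sub_iaddl.
by apply: idl_imul1.
Qed.

Lemma mem_gadjoin N d a : gideal N -> gadjoin N d a d a.
Proof.
move=> [h1 _ _]; rewrite /gadjoin leqnn; apply: sub_iaddr => //.
by exists 1; rewrite ?mulr1 // subnn.
Qed.

Lemma gcolon_prime N : gideal N -> ~ N 0%N 1 ->
  exists d a, [/\ (Q ^^ d) a, ~ N d a & gprime (gcolon N d a)].
Proof.
move=> gN nN1.
pose R (J : nat -> set A) := forall d a, J = gcolon N d a -> (Q ^^ d) a -> ~ N d a ->
  exists d a, [/\ (Q ^^ d) a, ~ N d a & gprime (gcolon N d a)].
suff : R (gcolon N 0 1) by move/(_ 0%N 1 erefl I nN1).
apply: gideal_ind; last exact: gideal_colon.
move=> J gJ IH d a EJ Qa nNa.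
have [pr|npr] := pselect (gprime (gcolon N d a)); first by exists d, a.
have [m [n [x [y [Qx Qy hxy nx ny]]]]] : exists m n x y, [/\ (Q ^^ m) x, (Q ^^ n) y,
    gcolon N d a (m + n)%N (x * y), ~ gcolon N d a m x & ~ gcolon N d a n y].
  apply: contrapT => h; apply: npr; split; first exact: gideal_colon.
    by move=> [_]; rewrite /colon /= mulr1 addn0.
  move=> m n x y Qx Qy hxy; apply: contrapT => /not_orP[nx ny].
  by apply: h; exists m, n, x, y.
have Qax : (Q ^^ (d + m)) (a * x) by apply: pow_mul.
apply: (IH (gcolon N (d + m) (a * x)) %N) => //.
- exact: gideal_colon.
- rewrite EJ => i z [Qz hz]; split=> //; rewrite /colon /=.
  rewrite -mulrA mulrCA [(d + m)%N]addnC -addnA.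
  exact: gideal_mul.
- move=> /(_ n y) h; apply: ny; rewrite -EJ; apply: h; split=> //.
  by rewrite /colon /= -mulrA -addnA; case: hxy.
- by move=> h; apply: nx.
Qed.

Lemma gprime_filtration_ind (R : (nat -> set A) -> Prop) : R (fun n => Q ^^ n) ->
  (forall N d a, gideal N -> (Q ^^ d) a -> gprime (gcolon N d a) -> R (gadjoin N d a) -> R N) ->
  forall N, gideal N -> R N.
Proof.
move=> RT step; apply: gideal_ind => N gN IH; have [h1 h2 h3] := gN.
have [N1|nN1] := pselect (N 0%N 1).
  suff -> : N = (fun n => Q ^^ n) by [].
  apply/funext => n; apply/seteqP; split=> // b hb; rewrite -[b]mulr1 -[n]addn0.
  exact: gideal_mul.
have [d [a [Qa nNa pr]]] := gcolon_prime gN nN1.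
apply: (step N d a) => //; apply: IH; [exact: gideal_adjoin|exact: gsub_adjoin|].
by move=> /(_ d a (mem_gadjoin d a gN)).
Qed.

Lemma gprimeNM P m n a b : gprime P -> (Q ^^ m) a -> (Q ^^ n) b -> ~ P m a -> ~ P n b ->
  ~ P (m + n)%N (a * b).
Proof. by move=> [_ _ h] Qa Qb na nb /(h _ _ _ _ Qa Qb)[]. Qed.

Lemma gprimeX P a n : gprime P -> Q a -> ~ P 1%N a -> ~ P n (a ^+ n).
Proof.
move=> pP Qa na; elim: n => [|n IH]; first by case: pP.
rewrite exprS -add1n; apply: gprimeNM => //; first by rewrite pow1.
exact: mem_powX.
Qed.

(* Graded prime avoidance. Pairwise incomparable primes are avoided by a single
   sum of products, so that no hypothesis on the residue field is needed. *)
Lemma gprime_avoid (s : seq (nat -> set A)) :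
  (forall P, List.In P s -> gprime P /\ ~ Q `<=` P 1%N) ->
  exists s0, forall n, (s0 <= n)%N -> exists2 f, (Q ^^ n) f & forall P, List.In P s -> ~ P n f.
Proof.
have [l] := ubnP (size s); elim: l s => // l IH s ltl hs.
have gs P : List.In P s -> gideal P by move=> /hs[[]].
have [[s1 [P [s2 [P' [Es P'in sP]]]]]|inc] := pselect (exists s1 P s2 P',
    [/\ s = s1 ++ P :: s2, List.In P' (s1 ++ s2) & gsub P P']).
  have [||s0 hs0] := IH (s1 ++ s2).
  - by move: ltl; rewrite Es !size_cat addnS.
  - move=> P1 h1; apply: hs; rewrite Es; apply/List.in_app_iff => /=.
    case: (proj1 (List.in_app_iff _ _ _) h1); tauto.
  exists s0 => n /hs0[f Qf hf]; exists f => // P1; rewrite Es => /List.in_app_iff[h|/= [<-|h]].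
  - by apply: hf; apply/List.in_app_iff; left.
  - by move=> /sP; apply: hf.
  - by apply: hf; apply/List.in_app_iff; right.
have inc' s1 P s2 P' : s = s1 ++ P :: s2 -> List.In P' (s1 ++ s2) -> ~ gsub P' P.
  move=> Es h sP; apply: inc; case: (List.in_app_or _ _ _ h) => /(@List.in_split _ _)[u [v E]].
    exists u, P', (v ++ P :: s2), P; rewrite Es E -catA; split=> //.
    by apply/List.in_app_iff; right; apply/List.in_app_iff; right; left.
  exists (s1 ++ P :: u), P', v, P; rewrite Es E -catA; split=> //.
  by apply/List.in_app_iff; left; apply/List.in_app_iff; right; left.
(* Incomparability gives an element outside P and inside all the other primes. A power of u, an
   element of Q outside P in degree one, brings it to any large degree n; this is why primes
   containing Q in degree one are excluded. *)
have sep s1 P s2 : s = s1 ++ P :: s2 -> exists d, forall n, (d <= n)%N ->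
    exists2 f, (Q ^^ n) f & ~ P n f /\ forall P', List.In P' (s1 ++ s2) -> P' n f.
  move=> Es; have [|pP nP] := hs P; first by rewrite Es; apply/List.in_app_iff; right; left.
  have [u nu] : exists2 u, Q u & ~ P 1%N u.
    by apply: contrapT => h; apply: nP => u Qu; apply: contrapT => nu; apply: h; exists u.
  have gs' P' : List.In P' (s1 ++ s2) -> gideal P'.
    by move=> /List.in_app_iff[h|h]; apply: gs; rewrite Es; apply/List.in_app_iff;
      [left|right; right].
  have [d [a [Qa na ha]]] : exists d a, [/\ (Q ^^ d) a, ~ P d a &
      forall P', List.In P' (s1 ++ s2) -> P' d a].
    have : forall P', List.In P' (s1 ++ s2) -> gideal P' /\ ~ gsub P' P.
      by move=> P' h; split; [apply: gs'|apply: inc' h].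
    elim: (s1 ++ s2) => [|P' t IHt] ht.
      by exists 0%N, 1; case: pP.
    have [|d [a [Qa na ha]]] := IHt; first by move=> P1 h1; apply: ht; right.
    have [gP' nP'] := ht P' (or_introl erefl).
    have [m [b [hb nb]]] : exists m b, P' m b /\ ~ P m b.
      apply: contrapT => h; apply: nP' => m b hb; apply: contrapT => nb.
      by apply: h; exists m, b.
    have Qb : (Q ^^ m) b by have [_ h2 _] := gP'; apply: h2.
    exists (m + d)%N, (b * a); split; [exact: pow_mul|exact: gprimeNM|].
    move=> P1 [<-|h1]; first by rewrite mulrC addnC; apply: gideal_mul.
    by apply: gideal_mul; [case: (ht P1); first right|exact: Qb|exact: ha].
  exists d => n le; exists (u ^+ (n - d) * a).
    by rewrite -{1}(subnK le); apply: pow_mul => //; apply: mem_powX.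
  split=> [|P' hP']; rewrite -{1}(subnK le).
    by apply: gprimeNM => //; [apply: mem_powX|apply: gprimeX].
  by apply: gideal_mul; [apply: gs'|apply: mem_powX|apply: ha].
have key : forall t t0, s = t0 ++ t -> exists s0, forall n, (s0 <= n)%N -> exists2 f, (Q ^^ n) f &
    (forall P, List.In P t -> ~ P n f) /\ (forall P, List.In P t0 -> P n f).
  elim=> [|P t IHt] t0 Es.
    exists 0%N => n _; exists 0; first exact: (idl0).
    split=> // P hP; have [|h1 _ _] := gs P; last exact: (idl0).
    by rewrite Es; apply/List.in_app_iff; left.
  have [|n1 hn1] := IHt (rcons t0 P); first by rewrite cat_rcons.
  have [n2 hn2] := sep _ _ _ Es.
  exists (maxn n1 n2) => n; rewrite geq_max => /andP[/hn1[g Qg [g1 g2]] /hn2[f Qf [f1 f2]]].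
  have hi P' : List.In P' s -> is_ideal (P' n) by move=> /gs[].
  have hPs : List.In P s by rewrite Es; apply/List.in_app_iff; right; left.
  have hts P' : List.In P' t -> List.In P' s.
    by move=> h; rewrite Es; apply/List.in_app_iff; right; right.
  have ht0s P' : List.In P' t0 -> List.In P' s.
    by move=> h; rewrite Es; apply/List.in_app_iff; left.
  have rc P' : List.In P' t0 \/ P' = P -> List.In P' (rcons t0 P).
    by rewrite -cats1 => h; apply/List.in_app_iff; case: h => [|->]; [left|right; left].
  exists (g + f); first exact: (idlD).
  split=> [P' [<-|h]|P' h].
  - rewrite addrC => hgf; apply: f1; apply: (idl_addr (hi _ hPs) _ hgf).
    by apply: g2; apply: rc; right.
  - move=> hgf; apply: (g1 P' h); apply: (idl_addr (hi _ (hts _ h)) _ hgf).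
    by apply: f2; apply/List.in_app_iff; right.
  - apply: (idlD (hi _ (ht0s _ h))); first by apply: g2; apply: rc; left.
    by apply: f2; apply/List.in_app_iff; left.
have [s0 hs0] := key s [::] erefl.
by exists s0 => n /hs0[f Qf [hf _]]; exists f.
Qed.

End Rees.

Import Num.Theory Order.TTheory.

(** * Polynomials at large integers *)

Definition evn (P : nat -> Prop) := exists N, forall n, (N <= n)%N -> P n.

Lemma evn_and P Q : evn P -> evn Q -> evn (fun n => P n /\ Q n).
Proof.
move=> [N hN] [M hM]; exists (maxn N M) => n; rewrite geq_max => /andP[? ?].
by split; [apply: hN|apply: hM].
Qed.
Lemma evn_imp (P Q : nat -> Prop) : (forall n, P n -> Q n) -> evn P -> evn Q.
Proof. by move=> h [N hN]; exists N => n /hN/h. Qed.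
Lemma evn_all (P : nat -> Prop) : (forall n, P n) -> evn P.
Proof. by move=> h; exists 0%N => n. Qed.
Lemma evn_ge N : evn (fun n => (N <= n)%N).
Proof. by exists N. Qed.

Section PolyLarge.
Implicit Types p q : {poly rat}.

(** A uniform lower bound e > 0, rather than mere positivity, carries the induction: e n exceeds the
    constant term as soon as n is at least (1 - c)/e. *)
Lemma poly_pos_large p : 0 < lead_coef p -> exists2 e : rat, 0 < e & evn (fun n => e <= p.[n%:R]).
Proof.
elim/poly_ind: p => [|p c IH]; first by rewrite lead_coef0.
have [->|np] := eqVneq p 0.
  rewrite mul0r add0r lead_coefC => c0; exists c => //; apply: evn_all => n.
  by rewrite hornerC.
rewrite lead_coefDl ?lead_coefMX; last first.
  rewrite size_polyC size_mulX // ltnS; apply: leq_trans (leq_b1 _) _.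
  by rewrite size_poly_gt0.
move=> /IH[e e0 [N hN]]; exists 1 => //.
have [M hM] : exists M : nat, (1 - c) / e <= M%:R.
  exists (Num.bound `|(1 - c) / e|).
  exact: ltW (le_lt_trans (ler_norm _) (archi_boundP (normr_ge0 _))).
exists (maxn N M) => n; rewrite geq_max => /andP[/hN h1 Mn].
rewrite hornerMXaddC -lerBlDr; apply: le_trans (_ : e * n%:R <= _); last first.
  by apply: ler_wpM2r.
rewrite -ler_pdivrMl // mulrC; apply: le_trans hM _.
by rewrite ler_nat.
Qed.

Lemma lead_coef_ge0_large p : evn (fun n => 0 <= p.[n%:R]) -> 0 <= lead_coef p.
Proof.
move=> h; rewrite leNgt; apply/negP => lt.
have [|e e0 h'] := @poly_pos_large (- p); first by rewrite lead_coefN oppr_gt0.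
have [N hN] := evn_and h h'; have [h1 h2] := hN N (leqnn N).
by move: (lt_le_trans e0 h2); rewrite hornerN oppr_gt0 ltNge h1.
Qed.

Lemma size_le_large p q : evn (fun n => 0 <= p.[n%:R] <= q.[n%:R]) -> (size p <= size q)%N.
Proof.
move=> h; rewrite leqNgt; apply/negP => lt.
have h1 : 0 <= lead_coef p.
  by apply: lead_coef_ge0_large; apply: evn_imp h => n /andP[].
have h2 : 0 <= lead_coef (q - p).
  by apply: lead_coef_ge0_large; apply: evn_imp h => n /andP[_]; rewrite hornerD hornerN subr_ge0.
move: h2; rewrite lead_coefDr ?size_polyN // lead_coefN oppr_ge0 => h2.
have /eqP : lead_coef p = 0 by apply/le_anti; rewrite h2.
by rewrite lead_coef_eq0 => /eqP E; rewrite E size_poly0 in lt.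
Qed.

Lemma poly_eq_large p q : evn (fun n => p.[n%:R] = q.[n%:R]) -> p = q.
Proof.
move=> h; apply/eqP; rewrite -subr_eq0 -size_poly_leq0 -(size_poly0 rat).
by apply: size_le_large; apply: evn_imp h => n E; rewrite hornerD hornerN E subrr horner0.
Qed.

Definition shift (c : rat) p := p \Po ('X - c%:P).

Lemma shiftE c p x : (shift c p).[x] = p.[x - c].
Proof. by rewrite horner_comp hornerXsubC. Qed.

Lemma size_shift c p : size (shift c p) = size p.
Proof. by apply: size_comp_poly2; rewrite size_XsubC. Qed.

(** Differencing lowers the degree by one and multiplies the top coefficient by g c. For g = 0 the
    difference vanishes while [g.-1] is still 0, whence the case distinction. *)
Lemma shift_diff (c : rat) g p : (size p <= g.+1)%N ->
  (size (p - shift c p)%R <= g)%N /\ (p - shift c p)`_g.-1 = if g is 0 then 0 else p`_g * g%:R * c.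
Proof.
elim: g p => [|g IH] p sp.
  by rewrite /shift (size1_polyC sp) comp_polyC subrr size_poly0 coef0.
elim/poly_ind: p sp => [_|p a _ sp].
  by rewrite /shift comp_poly0 subrr size_poly0 !coef0 !mul0r.
have sp' : (size p <= g.+1)%N.
  have [->|np] := eqVneq p 0; first by rewrite size_poly0.
  by move: sp; rewrite size_MXaddC (negPf np).
have -> : p * 'X + a%:P - shift c (p * 'X + a%:P) = (p - shift c p) * 'X + c *: shift c p.
  rewrite /shift comp_polyD comp_polyM comp_polyX comp_polyC -mul_polyC; ring.
have [h1 h2] := IH p sp'; split.
  apply: leq_trans (size_polyD _ _) _; rewrite geq_max; apply/andP; split.
    by apply: leq_trans (size_polyMleq _ _) _; rewrite size_polyX addn2.
  by apply: leq_trans (size_scale_leq _ _) _; rewrite size_shift.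
have -> : (p * 'X + a%:P)`_g.+1 = p`_g by rewrite coefD coefMX coefC addr0.
have E : (shift c p)`_g = p`_g.
  by apply/eqP; rewrite eq_sym -subr_eq0 -coefB nth_default.
rewrite coefD coefMX coefZ E; case: g {IH sp sp' h1 E} h2 => [|g] h2 /=.
  by rewrite add0r mulr1 mulrC.
rewrite h2 -[g.+2%:R]natr1; ring.
Qed.

Lemma size_shift_diff (c : rat) g p : (size p <= g.+1)%N -> (size (p - shift c p)%R <= g)%N.
Proof. by case/(shift_diff c). Qed.

Lemma coef_shift_diff (c : rat) g p : (size p <= g.+2)%N -> (p - shift c p)`_g = p`_g.+1 * g.+1%:R * c.
Proof. by case/(shift_diff c). Qed.

Lemma antidifference q : exists p, p - shift 1 p = q.
Proof.
have [n] := ubnP (size q); elim: n q => // n IH q; rewrite ltnS => sq.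
have [->|nq] := eqVneq q 0; first by exists 0; rewrite /shift comp_poly0 subrr.
have Es : size q = (size q).-1.+1 by rewrite prednK // size_poly_gt0.
set d := (size q).-1 in Es.
pose p0 := (lead_coef q / d.+1%:R) *: 'X^(d.+1) : {poly rat}.
have sp0 : (size p0 <= d.+2)%N by apply: leq_trans (size_scale_leq _ _) _; rewrite size_polyXn.
have [|p Ep] := IH (q - (p0 - shift 1 p0)).
  apply: leq_trans sq; rewrite Es ltnS; apply/leq_sizeP => j.
  rewrite leq_eqVlt => /orP[/eqP<-|lt].
    rewrite coefB coef_shift_diff // coefZ coefXn eqxx mulr1 mulr1 mulfVK ?pnatr_eq0 //.
    by rewrite subrr.
  rewrite coefB !nth_default ?Es //.
  apply: leq_trans (size_shift_diff 1 sp0) lt.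
exists (p0 + p); rewrite -(subrK (p0 - shift 1 p0) q) -Ep /shift; ring.
Qed.

Definition epoly (h : nat -> rat) := exists p, evn (fun n => p.[n%:R] = h n).

Lemma epoly_eq (h h' : nat -> rat) : evn (fun n => h n = h' n) -> epoly h -> epoly h'.
Proof. by move=> e [p hp]; exists p; apply: evn_imp (evn_and e hp) => n [<- ->]. Qed.
Lemma epolyD h h' : epoly h -> epoly h' -> epoly (fun n => h n + h' n).
Proof.
by move=> [p hp] [q hq]; exists (p + q); apply: evn_imp (evn_and hp hq) => n [<- <-]; rewrite hornerD.
Qed.
Lemma epoly_pred (h : nat -> rat) : epoly h -> epoly (fun n => h n.-1).
Proof.
move=> [p [N hN]]; exists (shift 1 p); exists N.+1 => -[//|n] le.
by rewrite shiftE -natr1 addrK hN.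
Qed.
Lemma epoly_diff (h g : nat -> rat) : evn (fun n => h n.+1 = h n + g n.+1) -> epoly g -> epoly h.
Proof.
move=> [N hN] [q [M hM]]; have [p Ep] := antidifference q.
pose L := maxn N M; exists (p + (h L - p.[L%:R])%:P); exists L => n.
elim: n => [|n IH] le.
  have E : L = 0%N by apply/eqP; rewrite -leqn0.
  by rewrite hornerD hornerC E addrC subrK.
move: le; rewrite leq_eqVlt => /orP[/eqP->|]; first by rewrite hornerD hornerC addrC subrK.
rewrite ltnS => le; rewrite hN; last by apply: leq_trans le; apply: leq_maxl.
rewrite -IH // -hM; last by apply: leq_trans (leqW le); apply: leq_maxr.
rewrite -Ep !hornerD hornerN shiftE !hornerC -natr1 addrK; ring.
Qed.

End PolyLarge.

(** * Hilbert-Samuel functions *)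

Lemma In_mapP (S T : Type) (f : S -> T) (l : seq S) y :
  List.In y (map f l) <-> exists2 x, List.In x l & y = f x.
Proof.
elim: l => [|a l IH] /=; first by split=> -[].
split=> [[<-|/IH[x xl ->]]|[x [->|xl] Ey]]; [by exists a; [left|]|by exists x; [right|]|by left|].
by right; apply: IH.2; exists x.
Qed.

Section HilbertSamuel.
Variables (A : comNzRingType) (Q : set A).
Hypothesis noethA : is_noetherian A.
Hypothesis idQ : is_ideal Q.
Hypothesis finQ : finl Q.
Local Notation "Q ^^ n" := (ideal_pow Q n) (at level 30).
Implicit Types (I J P : set A) (N : nat -> set A).
Let qr I : rat := (quo_length I)%:R.

Lemma idQn n : is_ideal (Q ^^ n). Proof. exact: idl_pow. Qed.
Lemma finQn J n : is_ideal J -> Q ^^ n `<=` J -> finl J.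
Proof. exact: finl_pow. Qed.
Lemma idIQ I n : is_ideal I -> is_ideal (iadd I (Q ^^ n)).
Proof. by move=> h. Qed.
Lemma finIQ I n : is_ideal I -> finl (iadd I (Q ^^ n)).
Proof. by move=> h; apply: (finQn); [apply: idIQ|apply: sub_iaddr]. Qed.

(** The function is the length of Q^n/N_n, a Hilbert function. In the graded Noetherian induction,
    multiplication by an element q of Q outside N_1 gives an exact sequence relating the quotients
    by [gcolon], by N and by [gadjoin]. If [gcolon] is no larger than N, the relation is a
    difference equation and is solved by summation. *)
Lemma hilbert_epoly N : gideal Q N -> (forall n, Q ^^ n.+1 `<=` N n) ->
  epoly (fun n => qr (N n) - qr (Q ^^ n)).
Proof.
move: N; apply: (gideal_ind noethA idQ) => N gN IH full; have [h1 h2 h3] := gN.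
have [QN|nQN] := pselect (Q `<=` N 1%N).
  exists 0, 1%N => -[//|n] _; rewrite horner0.
  suff -> : N n.+1 = Q ^^ n.+1 by rewrite subrr.
  apply/seteqP; split; first exact: h2.
  apply: (mul_sub (h1 n.+1)) => a b /QN ha hb; rewrite mulrC.
  by have := gideal_mul gN hb ha; rewrite addn1.
have [q [Qq nq]] : exists q, Q q /\ ~ N 1%N q.
  by apply: contrapT => h; apply: nQN => q Qq; apply: contrapT => nq; apply: h; exists q.
have Qq1 : (Q ^^ 1) q by rewrite pow1.
have gA := gideal_adjoin gN Qq1; have sA : gsub N (gadjoin Q N 1 q) := @gsub_adjoin A Q N 1 q.
have gC := gideal_colon gN Qq1; have sC := gsub_colon gN Qq1.
have pA : epoly (fun n => qr (gadjoin Q N 1 q n) - qr (Q ^^ n)).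
  apply: IH => //; first by move=> /(_ 1%N q (mem_gadjoin 1 q gN)).
  by move=> n; apply: subset_trans.
have rec n : qr (N n.+1) - qr (Q ^^ n.+1) =
    (qr (gcolon Q N 1 q n) - qr (Q ^^ n)) + (qr (gadjoin Q N 1 q n.+1) - qr (Q ^^ n.+1)).
  have fN : finl (N n.+1) by apply: finQn.
  have fC : finl (Q ^^ n `&` colon (N n.+1) q).
    have [hC _ _] := gC; apply: (finQn (hC n)).
    by apply: subset_trans.
  have /eqP := quo_length_mul (h1 n.+1) (idQn n) fN fC.
  rewrite -(eqr_nat rat) !natrD => /eqP E.
  rewrite /gadjoin subSS subn0 /qr.
  apply/eqP; apply/eqP; move: E; set a := (quo_length (N _))%:R => E;
    rewrite -[a](addrK (quo_length (Q ^^ n))%:R) E; ring.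
have [CN|nCN] := pselect (gsub (gcolon Q N 1 q) N).
  have EC n : gcolon Q N 1 q n = N n by apply/seteqP.
  by apply: epoly_diff pA; apply: evn_all => n; rewrite rec EC.
have pC : epoly (fun n => qr (gcolon Q N 1 q n) - qr (Q ^^ n)).
  by apply: IH => // n; apply: subset_trans.
apply: epoly_eq (epolyD (epoly_pred pC) pA).
by exists 1%N => -[//|n].
Qed.

(** The Hilbert-Samuel function of the module A/I. *)
Definition chi I n := quo_length (iadd I (Q ^^ n)).

Lemma iadd_colonE I J a : iadd (iadd I J) (imul1 a setT) = iadd (adjoin I a) J.
Proof.
apply/seteqP; split=> z.
  move=> [_ [_ [[i [j [hi hj ->]]] [c _ ->] ->]]].
  exists (i + a * c), j; split; rewrite 1?addrAC //.
  by exists i, (a * c); split=> //; exists c.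
move=> [_ [j [[i [_ [hi [c _ ->] ->]]] hj ->]]].
exists (i + j), (a * c); split; rewrite 1?addrAC //; last by exists c.
by exists i, j.
Qed.

Lemma chi_adjoin I a n : is_ideal I ->
  chi I n = (chi (adjoin I a) n + quo_length (colon (iadd I (Q ^^ n)) a))%N.
Proof.
move=> hI; have h := idIQ n hI.
have [_] := quo_length_colon h (finl_adjoin a h (finIQ n hI)) (finl_colon a h (finIQ n hI)).
by rewrite addnC /chi -iadd_colonE.
Qed.

Lemma chi_epoly I : is_ideal I -> epoly (fun n => (chi I n)%:R).
Proof.
move=> hI; pose N n := Q ^^ n `&` iadd I (Q ^^ n.+1).
have gN : gideal Q N.
  split=> [n|n|n a b Qa [hb [i [c [Ii Qc E]]]]].
  - by apply: is_idealI.
  - exact: subIsetl.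
  - split; first exact: powSmul.
    rewrite E mulrDr; exists (a * i), (a * c); split=> //; first exact: idlM.
    exact: powSmul.
have full n : Q ^^ n.+1 `<=` N n.
  by move=> x hx; split; [apply: pow_leq hx|apply: sub_iaddr].
apply: (epoly_diff _ (epoly_pred (hilbert_epoly gN full))).
apply: evn_all => n.
have h := idIQ n.+1 hI; have [h1 _ _] := gN.
have E1 : colon (iadd I (Q ^^ n.+1)) 1 = iadd I (Q ^^ n.+1).
  by apply/seteqP; split=> x; rewrite /colon /= mul1r.
have E2 : iadd (iadd I (Q ^^ n.+1)) (imul1 1 (Q ^^ n)) = iadd I (Q ^^ n).
  apply/seteqP; split.
    apply: (iadd_sub (idIQ n hI)); first by apply: iadd_mono => //; apply: pow_leq.
    by move=> _ [b hb ->]; rewrite mul1r; apply: sub_iaddr.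
  apply: (iadd_sub); first by apply: idl_iadd.
    apply: subset_trans (sub_iaddl (idl_imul1 _ (idQn n))).
    by apply: sub_iaddl.
  by move=> x hx; apply: sub_iaddr => //; exists x; rewrite ?mul1r.
have := quo_length_mul (q := 1) h (idQn n) (finIQ n.+1 hI).
rewrite E1 E2 => /(_ (finQn (h1 n) (full n)))/eqP.
rewrite -(eqr_nat rat) !natrD => /eqP E.
rewrite addrA [X in X - _]addrC.
by apply/eqP; rewrite eq_sym subr_eq eq_sym; apply/eqP.
Qed.

(** The Hilbert-Samuel polynomial of A/I. Its [size] plays the role of 1 + dim A/I in all the
    dimension arguments below; the zero polynomial belongs to the zero module. *)
Definition hs I : {poly rat} := xget 0 [set p | evn (fun n => p.[n%:R] = (chi I n)%:R)].

Lemma hsP I : is_ideal I -> evn (fun n => (hs I).[n%:R] = (chi I n)%:R).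
Proof.
by move=> /chi_epoly[p hp]; rewrite /hs; case: xgetP => [q //|/(_ p)].
Qed.

Lemma hs_uniq I p : is_ideal I -> evn (fun n => p.[n%:R] = (chi I n)%:R) -> hs I = p.
Proof.
move=> hI hp; apply: poly_eq_large.
by apply: evn_imp (evn_and (hsP hI) hp) => n [-> ->].
Qed.

Lemma hsT : hs setT = 0.
Proof.
apply: hs_uniq => //; apply: evn_all => n; rewrite horner0 /chi.
have -> : iadd setT (Q ^^ n) = [set: A].
  by apply/seteqP; split=> // x _; apply: sub_iaddl.
by have [_ ->] := quo_lengthT A.
Qed.

Lemma chi_mono I J n : is_ideal I -> is_ideal J -> I `<=` J -> (chi J n <= chi I n)%N.
Proof.
move=> hI hJ s; apply: quo_length_sub; [exact: idIQ|exact: idIQ|exact: iadd_mono|exact: finIQ].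
Qed.

Lemma hs_mono I J : is_ideal I -> is_ideal J -> I `<=` J -> (size (hs J) <= size (hs I))%N.
Proof.
move=> hI hJ s; apply: size_le_large.
apply: evn_imp (evn_and (hsP hI) (hsP hJ)) => n [-> ->].
by rewrite ler0n ler_nat chi_mono.
Qed.

Lemma chi_colon_ge I J a n m : is_ideal I -> is_ideal J -> 
  colon (iadd I (Q ^^ n)) a `<=` iadd J (Q ^^ m) ->
  (chi J m <= quo_length (colon (iadd I (Q ^^ n)) a))%N.
Proof.
move=> hI hJ s; apply: quo_length_sub s _; [exact/idl_colon/idIQ|exact: idIQ|].
by apply: finl_colon; [apply: idIQ|apply: finIQ].
Qed.

Lemma chi_colon_le I J a n m : is_ideal I -> is_ideal J -> 
  iadd J (Q ^^ m) `<=` colon (iadd I (Q ^^ n)) a ->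
  (quo_length (colon (iadd I (Q ^^ n)) a) <= chi J m)%N.
Proof.
move=> hI hJ s; apply: quo_length_sub s _; [exact: idIQ|exact/idl_colon/idIQ|exact: finIQ].
Qed.

Lemma iadd_colon_sub I a n : is_ideal I ->
  iadd (colon I a) (Q ^^ n) `<=` colon (iadd I (Q ^^ n)) a.
Proof.
move=> hI; apply: iadd_sub; first exact/idl_colon/idIQ.
  by apply: colon_mono; apply: sub_iaddl.
by move=> x hx; apply: sub_iaddr => //; apply: (idlM _).
Qed.

Lemma evn_shift (P : nat -> Prop) c : evn P -> evn (fun n => P (n - c)%N).
Proof. move=> [N hN]; exists (N + c)%N => n le; apply: hN; lia. Qed.

Lemma hs_shift I c : is_ideal I -> evn (fun n => (shift c%:R (hs I)).[n%:R] = (chi I (n - c))%:R).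
Proof.
move=> hI; apply: evn_imp (evn_and (evn_ge c) (evn_shift c (hsP hI))) => n [le <-].
by rewrite shiftE natrB.
Qed.

(** By Artin-Rees the difference between the polynomials of A/I and A/(I + aA) lies, at large
    integers, between the polynomial of A/(I : a) shifted by a constant and that polynomial itself;
    shifting does not change the coefficient in degree g. *)
Lemma hs_filt g I a : is_ideal I -> (size (hs I) <= g.+1)%N ->
  [/\ (size (hs (adjoin I a)) <= g.+1)%N, (size (hs (colon I a)) <= g.+1)%N &
      (hs I)`_g = (hs (adjoin I a))`_g + (hs (colon I a))`_g].
Proof.
move=> hI sI; have hA := idl_adjoin a hI; have hC := idl_colon a hI.
have sA : (size (hs (adjoin I a)) <= g.+1)%N.
  apply: leq_trans sI; apply: hs_mono => //; apply: sub_adjoin.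
have [c hc] := artin_rees_colon noethA idQ a hI.
set q := hs I - hs (adjoin I a); set p := hs (colon I a).
have bnd : evn (fun n => 0 <= (shift c%:R p).[n%:R] <= q.[n%:R] /\ q.[n%:R] <= p.[n%:R]).
  apply: evn_imp (evn_and (evn_and (hsP hI) (hsP hA)) (evn_and (evn_and (hs_shift c hC) (hsP hC))
    (evn_ge c))) => n [[E1 E2] [[E3 E4] le]].
  rewrite hornerD hornerN E1 E2 E3 E4 (chi_adjoin a n hI) natrD addrC addKr ler0n !ler_nat.
  split; first by apply: chi_colon_ge => //; apply: hc.
  by apply: chi_colon_le => //; apply: iadd_colon_sub.
have sq : (size q <= g.+1)%N.
  by apply: leq_trans (size_polyD _ _) _; rewrite geq_max size_polyN sI.
have sp : (size p <= g.+1)%N.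
  by rewrite -(size_shift c%:R); apply: leq_trans sq; apply: size_le_large; apply: evn_imp bnd => n [].
have spq : (size (p - q)%R <= g)%N.
  apply: leq_trans (size_shift_diff c%:R sp); apply: size_le_large.
  apply: evn_imp bnd => n [/andP[h0 h1] h2].
  by rewrite !(hornerD p) !hornerN subr_ge0 h2 lerD2l lerN2.
have /eqP : (p - q)`_g = 0 by rewrite nth_default.
by rewrite coefB subr_eq0 => /eqP ->; rewrite coefB addrC subrK.
Qed.

Lemma colon_primeE P f : is_prime P -> ~ P f -> colon P f = P.
Proof.
move=> pP nf; apply/seteqP; split=> x; first by move/(primeM pP) => [].
by apply: sub_colon.
Qed.

(** Since (P : f) = P, Artin-Rees bounds the function of A/(P + fA) by the difference of the
    function of A/P at n and at n - c, whose degree is smaller. *)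
Lemma hs_drop P f : is_prime P -> ~ P f ->
  (size (hs (adjoin P f)) <= (size (hs P)).-1)%N.
Proof.
move=> pP nf; have [hP _ _] := pP; have hA := idl_adjoin f hP.
have [E|nz] := eqVneq (hs P) 0.
  by have := hs_mono hP hA (@sub_adjoin _ P f); rewrite E size_poly0.
have [c hc] := artin_rees_colon noethA idQ f hP; rewrite (colon_primeE pP nf) in hc.
apply: (@leq_trans (size (hs P - shift c%:R (hs P))%R)); last first.
  by apply: size_shift_diff; rewrite prednK // size_poly_gt0.
apply: size_le_large.
apply: evn_imp (evn_and (evn_and (hsP hP) (hsP hA)) (evn_and (hs_shift c hP) (evn_ge c))) => n [[E1 E2] [E3 le]].
rewrite hornerD hornerN E1 E2 E3 (chi_adjoin f n hP) natrD ler0n -addrA lerDl subr_ge0 ler_nat.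
by apply: chi_colon_ge => //; apply: hc.
Qed.

(** For f in Q the colon ideal of I + Q^n contains I + Q^(n-1), so the new function is at least the
    first difference of the old one: one element lowers the dimension by at most one. *)
Lemma hs_lower I f : is_ideal I -> Q f -> ((size (hs I)).-1 <= size (hs (adjoin I f)))%N.
Proof.
move=> hI Qf; have hA := idl_adjoin f hI.
case Es : (size) => [//|[//|g]].
apply: (@leq_trans (size (hs I - shift 1%:R (hs I))%R)).
  rewrite ltnNge; apply/negP => le.
  have : (hs I - shift 1%:R (hs I))`_g = 0 by rewrite nth_default.
  rewrite coef_shift_diff ?Es // mulr1 => /eqP; rewrite mulf_eq0 pnatr_eq0.
  have -> : (hs I)`_g.+1 = lead_coef (hs I) by rewrite /lead_coef Es.
  by rewrite lead_coef_eq0 -size_poly_eq0 Es.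
apply: size_le_large.
apply: evn_imp (evn_and (evn_and (hsP hI) (hsP hA)) (evn_and (hs_shift 1 hI) (evn_ge 1))) => n [[E1 E2] [E3 le]].
rewrite hornerD hornerN E1 E2 E3 subr_ge0 ler_nat; apply/andP; split.
  apply: quo_length_sub; [exact: idIQ|exact: idIQ| |exact: finIQ].
  apply: iadd_mono => //; apply: pow_leq; lia.
rewrite (chi_adjoin f n hI) natrD lerBlDr lerD2l ler_nat.
apply: chi_colon_le => //; apply: iadd_sub; first exact/idl_colon/idIQ.
  by apply: subset_trans (sub_colon f (idIQ n hI)); apply: sub_iaddl.
move=> x hx; apply: sub_iaddr => //.
by have := powSmul Qf hx; rewrite subn1 prednK.
Qed.

(* Multiplication by f in Q^s is injective on gr_Q(A/P) in large degrees. *)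
Lemma filter_regular_colon P s f : is_prime P -> (Q ^^ s) f -> ~ P f ->
  evn (fun n => forall z, (Q ^^ n) z -> iadd P (Q ^^ (s + n).+1) (f * z) -> iadd P (Q ^^ n.+1) z) ->
  evn (fun n => chi (adjoin P f) (n + s) + chi P n = chi P (n + s))%N.
Proof.
move=> pP Qf nf [n0 hn0]; have [hP _] := pP.
have [c hc] := artin_rees_colon noethA idQ f hP; rewrite (colon_primeE pP nf) in hc.
exists (n0 + c)%N => n le; rewrite (chi_adjoin f (n + s) hP); congr (_ _)%N.
congr quo_length; apply/seteqP; split.
  apply: iadd_sub; first exact/idl_colon/idIQ.
    by apply: subset_trans (sub_colon f (idIQ (n + s) hP)); apply: sub_iaddl.
  by move=> x hx; apply: sub_iaddr => //; rewrite addnC; apply: pow_mul.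
move=> z hz.
(* Artin-Rees places z in P + Q^(n+s-c); injectivity on the graded pieces then raises the exponent
   one step at a time up to n. *)
have key i : (i <= n)%N -> (n0 <= i)%N -> iadd P (Q ^^ i) z -> iadd P (Q ^^ n) z.
  move=> lei; elim: {i}(n - i)%N {-2}i (erefl (n - i)%N) lei => [|d IH] i Ed lei n0i hi.
    by have -> : n = i by lia.
  case: hi => u [w [Pu Qw E]].
  apply: (IH i.+1); try lia.
  have hw : iadd P (Q ^^ (s + i).+1) (f * w).
    have -> : f * w = f * z - f * u by rewrite E; ring.
    apply: (idlB (idIQ _ hP)).
      apply: (iadd_mono (@subset_refl _ P) _ hz); apply: pow_leq; lia.
    by apply: sub_iaddl; [apply: idQn|apply: (idlM _ hP)].
  rewrite E; apply: (idlD (idIQ _ hP)); last exact: hn0.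
  by apply: sub_iaddl.
have [le1|lt1] := leqP (n + s - c) n.
  apply: key (hc (n + s)%N _ z hz); lia.
apply: (iadd_mono (@subset_refl _ P) _ (hc (n + s)%N _ z hz)); last lia.
apply: pow_leq; lia.
Qed.

Lemma gprime_of_prime P : is_prime P -> gprime Q (fun n => Q ^^ n `&` P).
Proof.
move=> pP; have [hP P1 _] := pP; split; last 2 first.
- by case.
- by move=> m n a b Qa Qb [_ /(primeM pP)[h|h]]; [left|right].
split=> [n|n|n a b Qa [Qb Pb]].
- by apply: is_idealI.
- exact: subIsetl.
- by split; [apply: powSmul|apply: idlM].
Qed.

(** Here Q^n/N_n is the degree n part of gr_Q(A/P). A filtration by homogeneous primes yields
    finitely many of them to avoid; P and the primes of l are added through their traces Q^n ∩ P'.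
    Avoidance is possible in every large degree s, in particular in two consecutive ones. *)
Lemma filter_regular_ex P (l : seq (set A)) : is_prime P -> ~ Q `<=` P ->
  (forall P', List.In P' l -> is_prime P' /\ ~ Q `<=` P') ->
  exists s0, forall s, (s0 <= s)%N -> exists f, [/\ (Q ^^ s) f, ~ P f,
    forall P', List.In P' l -> ~ P' f &
    evn (fun n => chi (adjoin P f) (n + s) + chi P n = chi P (n + s))%N].
Proof.
move=> pP nQP hl.
pose N n := Q ^^ n `&` iadd P (Q ^^ n.+1).
have gN : gideal Q N.
  split=> [n|n|n a b Qa [hb [i [c [Ii Qc E]]]]].
  - by apply: is_idealI.
  - exact: subIsetl.
  - split; first exact: powSmul.
    rewrite E mulrDr; exists (a * i), (a * c); split=> //; first exact: idlM.
    exact: powSmul.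
have [L [L1 L2]] : exists L : seq (nat -> set A), (forall R : nat -> set A, List.In R L -> gprime Q R /\ ~ Q `<=` R 1%N) /\
    forall s f, (Q ^^ s) f -> (forall R : nat -> set A, List.In R L -> ~ R s f) ->
      evn (fun n => forall z, (Q ^^ n) z -> N (s + n)%N (f * z) -> N n z).
  move: N gN; apply: (gprime_filtration_ind noethA idQ).
    by exists [::]; split=> // s f Qf _; apply: evn_all.
  move=> N d a gN Qa pr [L [L1 L2]]; have [h1 h3] := gN.
  (* A quotient by a prime containing Q in degree one vanishes in positive degrees, so it imposes no
     condition on f for large n. *)
  have [rel|nrel] := pselect (Q `<=` gcolon Q N d a 1%N).
    exists L; split=> // s f Qf hf; have [n0 hn0] := L2 s f Qf hf.
    exists (maxn n0 d.+1) => n; rewrite geq_max => /andP[n0n dn] z Qz hz.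
    have : gadjoin Q N d a n z by apply: hn0 => //; apply: (@gsub_adjoin _ Q).
    rewrite /gadjoin (ltnW dn) => -[w [_ [Nw [b Qb ->] E]]].
    rewrite E; apply: (idlD) => //.
    have [gC _] := pr.
    have : gcolon Q N d a (n - d)%N b.
      have -> : (n - d = (n - d).-1 + 1)%N by lia.
      have sub : Q ^^ ((n - d).-1 + 1) `<=` gcolon Q N d a ((n - d).-1 + 1)%N.
        have [hC _ _] := gC; apply: (pow_add_sub (hC _)) => x y hx.
        rewrite (pow1 idQ) => /rel hy; exact: (gideal_mul gC hx hy).
      by apply: sub; have <- : (n - d = (n - d).-1 + 1)%N by lia.
    by move=> [_]; rewrite subnKC // ltnW.
  exists (gcolon Q N d a :: L); split=> [P' [<-//|/L1//]|s f Qf hf].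
  have [n0 hn0] := L2 s f Qf (fun R h => hf R (or_intror h)).
  exists (maxn n0 d) => n; rewrite geq_max => /andP[n0n dn] z Qz hz.
  have : gadjoin Q N d a n z by apply: hn0 => //; apply: (@gsub_adjoin _ Q).
  rewrite /gadjoin dn => -[w [_ [Nw [b Qb ->] E]]].
  rewrite E; apply: (idlD) => //.
  have [_ _ pp] := pr.
  have : gcolon Q N d a (s + (n - d))%N (f * b).
    split; first exact: pow_mul.
    rewrite /colon /= (_ : (d + (s + (n - d)) = s + n)%N); last lia.
    have -> : a * (f * b) = f * z - f * w by rewrite E; ring.
    by apply: (idlB) => //; apply: gideal_mul.
  move=> hfb; have [h|] := pp _ _ _ _ Qf Qb hfb; first case: (hf _ (or_introl erefl) h).
  by move=> [_]; rewrite subnKC.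
have [|s0 hs0] := gprime_avoid idQ (s := L ++ map (fun (p : set A) n => Q ^^ n `&` p) (P :: l)).
  have rel P' : is_prime P' -> ~ Q `<=` P' -> gprime Q (fun n => Q ^^ n `&` P') /\ ~ Q `<=` (Q ^^ 1 `&` P').
    by move=> pP' nQ; split; [apply: gprime_of_prime|move=> h; apply: nQ => x /h[]].
  move=> R hR; case: (List.in_app_or _ _ _ hR) => [/L1//|hR'].
  have [P1 h ->] := (In_mapP _ _ _).1 hR'.
  by case: h => [<-|/hl[h1 h2]]; apply: rel.
exists s0 => s /hs0[f Qf hf]; exists f.
have av P' : List.In P' (P :: l) -> ~ P' f.
  move=> h Pf; apply: (hf (fun n => Q ^^ n `&` P')); last by [].
  by apply/List.in_app_iff; right; apply/In_mapP; exists P'.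
have : ~ P f by apply: av; left.
split=> //; first by move=> P' h; apply: av; right.
apply: filter_regular_colon => //.
have [n0 hn0] := L2 s f Qf (fun R h => hf R ((List.in_app_iff _ _ _).2 (or_introl h))).
exists n0 => n le z Qz hz; have [] // := hn0 n le z.
by split=> //; apply: pow_mul.
Qed.

End HilbertSamuel.

(** * Multiplicities and curves through a point *)

Section CurveReduction.
Variables (A : comNzRingType) (Q : set A).
Hypothesis noethA : is_noetherian A.
Hypothesis idQ : is_ideal Q.
Hypothesis finQ : finl Q.
(* Q is contained in the Jacobson radical. *)
Hypothesis jacQ : forall I, is_ideal I -> ~ I 1 -> ~ iadd I Q 1.
Local Notation "Q ^^ n" := (ideal_pow Q n) (at level 30).
Local Notation hs := (hs Q).
Local Notation chi := (chi Q).
Implicit Types (I J P : set A).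

Lemma chi_gt0 I n : is_ideal I -> ~ I 1 -> (0 < n)%N -> (0 < chi I n)%N.
Proof.
move=> hI nI n0; rewrite lt0n; apply/eqP => E; have hIQ := idIQ Q n hI.
have ET : iadd I (Q ^^ n) = setT.
  apply: (quo_length_eq hIQ) => //; first exact: finIQ.
  by case: (quo_lengthT A) => _ ->.
apply: (jacQ hI nI); have : iadd I (Q ^^ n) 1 by rewrite ET.
by apply: iadd_mono => // x; rewrite -{2}(pow1 idQ); apply: pow_leq.
Qed.

Lemma hs_neq0 I : is_ideal I -> ~ I 1 -> hs I != 0.
Proof.
move=> hI nI; apply/eqP => E.
have [N hN] := evn_and (hsP noethA idQ finQ hI) (evn_ge 1).
have [] := hN N (leqnn N); rewrite E horner0 => /esym/eqP; rewrite pnatr_eq0 => /eqP E0 N0.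
by have := chi_gt0 hI nI N0; rewrite E0.
Qed.

Lemma hs_drop_lt P f : is_prime P -> ~ P f -> (size (hs (adjoin P f)) < size (hs P))%N.
Proof.
move=> pP nf; have [hP P1 _] := pP.
have := hs_drop noethA idQ finQ pP nf.
by rewrite -(@prednK (size (hs P))) // size_poly_gt0; apply: hs_neq0.
Qed.

Lemma prime_sub_drop P P' : is_prime P -> is_prime P' -> P `<` P' -> (size (hs P') < size (hs P))%N.
Proof.
move=> pP pP' [s ns]; have [f Pf nf] : exists2 f, P' f & ~ P f.
  by apply: contrapT => h; apply: ns => f Pf; apply: contrapT => nf; apply: h; exists f.
apply: leq_ltn_trans (hs_drop_lt pP nf).
by apply: hs_mono => //; apply: adjoin_sub.
Qed.

Lemma sub_prime_of_size1 P : is_prime P -> (size (hs P) <= 1)%N -> Q `<=` P.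
Proof.
move=> pP s1 q Qq; apply: contrapT => nq; have [hP P1 _] := pP.
have : (0 < size (hs (adjoin P q)))%N.
  rewrite size_poly_gt0; apply: hs_neq0; first exact: idl_adjoin.
  move=> /adjoinP[c hc]; apply: (jacQ hP P1); exists (1 - q * c), (q * c).
  by split; rewrite ?subrK //; apply: idlMr.
have := hs_drop_lt pP nq; lia.
Qed.

Lemma finl_of_size1 I : is_ideal I -> (size (hs I) <= 1)%N -> finl I.
Proof.
move=> hI s1; apply: (finl_radical noethA hI idQ finQ) => P pP s.
apply: sub_prime_of_size1 => //; by apply: leq_trans s1; apply: hs_mono.
Qed.

Lemma size1_of_sub P : is_ideal P -> Q `<=` P -> (size (hs P) <= 1)%N.
Proof.
move=> hP s; rewrite (@hs_uniq A Q noethA idQ finQ P (quo_length P)%:R%:P) ?size_polyC ?leq_b1 //.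
exists 1%N => n n0; rewrite hornerC /chi; congr (quo_length _)%:R.
apply/seteqP; split; first by apply: sub_iaddl.
apply: iadd_sub => // x hx; apply: s; move: hx; rewrite -{2}(pow1 idQ); exact: pow_leq.
Qed.

(** For a generator x of Q the ideals I + x^n A stabilize, so x^n (1 - xc) lies in I for some c. By
    [jacQ] the ideal (I : x^n), which contains 1 - xc, is the whole ring. *)
Lemma pow_sub_finl I : is_ideal I -> finl I -> exists n, Q ^^ n `<=` I.
Proof.
move=> hI fI; have [s Es] := (noetherian_fgen A).1 noethA Q idQ.
rewrite Es; apply: pow_sub_radical => // x xs.
have : Q x by rewrite Es; apply: sub_gen.
pose J n := adjoin I (x ^+ n).
have hJ n : is_ideal (J n) by apply: idl_adjoin.
have fJ n : finl (J n) by apply: finl_adjoin.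
have JS n : J n.+1 `<=` J n.
  apply: adjoin_sub => //; first exact: sub_adjoin.
  by rewrite exprS; apply: (idlM _ (hJ n)); apply: mem_adjoin.
have [n En] : exists n, quo_length (J n.+1) = quo_length (J n).
  apply: contrapT => h.
  have lt n : (n <= quo_length (J n))%N.
    elim: n => // n IH; have := quo_length_sub (hJ n.+1) (hJ n) (JS n) (fJ _).
    rewrite leq_eqVlt => /orP[/eqP E|]; first by case: h; exists n.
    exact: leq_ltn_trans.
  have := leq_trans (lt (quo_length I).+1) (quo_length_sub hI (hJ _) (@sub_adjoin _ I _) fI).
  by rewrite ltnn.
have : J n.+1 (x ^+ n).
  rewrite (quo_length_eq (hJ n.+1) (hJ n)) //; exact: mem_adjoin.
move=> /adjoinP[c hc]; exists n.
have hC := idl_colon (x ^+ n) hI.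
suff : colon I (x ^+ n) 1 by rewrite /colon /= mulr1.
apply: contrapT => nC; apply: (jacQ hC nC).
exists (1 - x * c), (x * c); split; rewrite ?subrK //; last exact: idlMr.
by rewrite /colon /= mulrBr mulr1 mulrA -exprSr.
Qed.

Lemma hs_const I : is_ideal I -> finl I -> hs I = (quo_length I)%:R%:P.
Proof.
move=> hI fI; have [n hn] := pow_sub_finl hI fI.
apply: hs_uniq => //; exists n => m le; rewrite hornerC; congr (quo_length _)%:R.
apply/seteqP; split; first by apply: sub_iaddl.
by apply: iadd_sub => // x hx; apply: hn; apply: pow_leq hx.
Qed.

(** The list consists of the primes of a filtration of A/K that do not contain Q. The remaining
    factors have constant polynomials, which f cannot be expected to lower; this accounts for
    [maxn 1]. *)
Lemma hs_drop_list K : is_ideal K -> exists l : seq (set A),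
  (forall P, List.In P l -> is_prime P /\ ~ Q `<=` P) /\
  forall f, (forall P, List.In P l -> ~ P f) ->
    (size (hs (adjoin K f)) <= maxn 1 (size (hs K)).-1)%N.
Proof.
move: K; apply: (prime_filtration_ind noethA).
  exists [::]; split=> // f.
  have -> : adjoin setT f = [set: A] by apply/seteqP; split=> // x _; apply: sub_adjoin.
  by rewrite hsT // size_poly0.
move=> I a hI nIa pP [l [l1 l2]]; set P := colon I a in pP.
have [hP _] := pP; have hA := idl_adjoin a hI.
have : (size (hs P) <= maxn 1 (size (hs I)))%N /\ (size (hs (adjoin I a)) <= size (hs I))%N.
  split; last by apply: hs_mono => //; apply: sub_adjoin.
  have [|_ h _] := @hs_filt A Q noethA idQ finQ (size (hs I)).-1 I a hI.
    case: (size _) => //.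
  by apply: leq_trans h _; case: (size) => [|n] //; rewrite leq_max leqnn orbT.
have main f : (size (hs (adjoin I f)) <=
    maxn (size (hs (adjoin (adjoin I a) f))) (size (hs (adjoin P f))))%N.
  have hIf := idl_adjoin f hI; have hAf := idl_adjoin f hA.
  have hPf := idl_adjoin f hP.
  apply: leq_trans (size_polyD _ _); apply: size_le_large.
  apply: evn_imp (evn_and (hsP noethA idQ finQ hIf) (evn_and (hsP noethA idQ finQ hAf)
    (hsP noethA idQ finQ hPf))) => n [E1 [E2 E3]].
  rewrite hornerD E1 E2 E3 -natrD ler0n ler_nat.
  rewrite (chi_adjoin noethA idQ finQ a n hIf).
  have -> : adjoin (adjoin I f) a = adjoin (adjoin I a) f.
    exact: iadd_colonE.
  rewrite leq_add2l; apply: chi_colon_le => //.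
  apply: iadd_sub; first exact/idl_colon/idIQ.
    apply: adjoin_sub; first exact/idl_colon/idIQ.
      move=> x hx; apply: sub_iaddl; first exact: idQn.
      exact: sub_adjoin.
    apply: sub_iaddl; first exact: idQn.
    by apply: (idlM _ hIf); apply: mem_adjoin.
  move=> x hx; apply: sub_iaddr => //.
  by apply: (idlM _).
have [QP|nQP] := pselect (Q `<=` P).
  exists l; split=> // f hf; apply: leq_trans (main f) _; rewrite geq_max; apply/andP; split.
    apply: leq_trans (l2 f hf) _; lia.
  rewrite leq_max; apply/orP; left; apply: size1_of_sub; first exact: idl_adjoin.
  apply: subset_trans QP _; apply: sub_adjoin.
exists (P :: l); split=> [P' [<-|/l1]|f hf] //.
apply: leq_trans (main f) _; rewrite geq_max; apply/andP; split.
  apply: leq_trans (l2 f (fun P' h => hf P' (or_intror h))) _; lia.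
apply: leq_trans (hs_drop noethA idQ finQ pP (hf P (or_introl erefl))) _; lia.
Qed.

(** If A/(I : a) and A/(I + aA) both had smaller dimension, additivity would make the leading
    coefficient of [hs I] vanish; so one of the two keeps the dimension, and the filtration can be
    followed to a prime. *)
Lemma hs_prime_ge I : is_ideal I -> (0 < size (hs I))%N ->
  exists P, [/\ is_prime P, I `<=` P & (size (hs I) <= size (hs P))%N].
Proof.
move: I; apply: (prime_filtration_ind noethA); first by rewrite hsT // size_poly0.
move=> I a hI nIa pP IH s0.
have [le|lt] := leqP (size (hs I)) (size (hs (colon I a))).
  by exists (colon I a); split=> //; apply: sub_colon.
have [le|lt'] := leqP (size (hs I)) (size (hs (adjoin I a))).
  have [|P [p1 p2 p3]] := IH; first exact: leq_trans le.
  exists P; split=> //; last exact: leq_trans p3.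
  apply: subset_trans p2; apply: sub_adjoin.
case Es : (size) s0 lt lt' => [//|g] _; rewrite !ltnS => lt lt'.
have [|_ _] := @hs_filt A Q noethA idQ finQ g I a hI; first by rewrite Es.
rewrite [X in _ = X + _]nth_default // [X in _ = _ X]nth_default // => /eqP.
have -> : (hs I)`_g = lead_coef (hs I) by rewrite /lead_coef Es.
by rewrite lead_coef_eq0 -size_poly_eq0 Es.
Qed.

Lemma prime_chain_of_hs g I : is_ideal I -> (g < size (hs I))%N ->
  exists X : nat -> set A, [/\ I `<=` X 0%N, forall i, (i <= g)%N -> is_prime (X i) &
    forall i, (i < g)%N -> X i `<` X i.+1].
Proof.
elim: g I => [|g IH] I hI lt.
  have [P [p1 p3]] := hs_prime_ge hI lt.
  by exists (fun=> P).
have [P [p1 p2 p3]] := hs_prime_ge hI (ltn_trans (ltn0Sn _) lt).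
have [hP _] := p1; have lt' := leq_trans lt p3.
have [f [Qf nf]] : exists f, Q f /\ ~ P f.
  apply: contrapT => h; have := size1_of_sub hP _; rewrite leqNgt (leq_trans _ lt') //.
  suff QP : Q `<=` P by move=> /(_ QP).
  by move=> q Qq; apply: contrapT => nq; apply: h; exists q.
have hPf := idl_adjoin f hP.
have [|X [x1 x2 x3]] := IH (adjoin P f) hPf.
  by apply: leq_trans (hs_lower noethA idQ finQ hP Qf); case: (size _) lt'.
exists (fun i => if i is j.+1 then X j else P); split=> // -[|i] //.
- apply: x2.
- split; first by apply: subset_trans x1; apply: sub_adjoin.
  by move=> h; apply: nf; apply: h; apply: x1; apply: mem_adjoin.
- apply: x3.
Qed.

Lemma hs_of_prime_chain g (X : nat -> set A) : (forall i, (i <= g)%N -> is_prime (X i)) ->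
  (forall i, (i < g)%N -> X i `<` X i.+1) -> (g < size (hs (X 0%N)))%N.
Proof.
elim: g X => [|g IH] X h1 h2.
  by have [h n _] := h1 0%N isT; rewrite size_poly_gt0 hs_neq0.
apply: leq_ltn_trans (prime_sub_drop (h1 0%N isT) (h1 1%N isT) (h2 0%N isT)).
by apply: (IH (fun i => X i.+1)) => i hi; [apply: h1|apply: h2].
Qed.

(** Both inequalities come from chains of primes: each strict inclusion lowers the degree, and
    conversely a top-dimensional prime can be cut by an element of Q that lowers the degree by at
    most one. *)
Lemma krull_dim_hs d : has_krull_dim A d <-> size (hs [set 0]) = d.+1.
Proof.
have h0 := is_ideal0 A; split=> [[[X [h1 h2]] nd]|E].
  apply/eqP; rewrite eqn_leq; apply/andP; split.
    rewrite leqNgt; apply/negP => /(prime_chain_of_hs h0)[Y [_ y1 y2]].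
    by apply: nd; exists Y.
  apply: leq_trans (hs_of_prime_chain h1 h2) _; have [hX _ _] := h1 0%N isT.
  by apply: hs_mono => // _ ->; apply: idl0.
split.
  have [|X [_ x2]] := @prime_chain_of_hs d _ h0; first by rewrite E.
  by exists X.
move=> [X [h1 h2]]; have := hs_of_prime_chain h1 h2; have [hX _ _] := h1 0%N isT.
rewrite ltnNge => /negP; apply; rewrite -E.
by apply: hs_mono => // _ ->; apply: idl0.
Qed.

Section Subgroup.
Variables (J : set A) (G : int -> Prop).
Hypothesis idJ : is_ideal J.
Hypothesis G0 : G 0.
Hypothesis GD : forall a b, G a -> G b -> G (a + b).
Hypothesis GB : forall a b, G a -> G b -> G (a - b).
Hypothesis GL : forall P f, is_prime P -> ~ J `<=` P -> Q f -> ~ P f ->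
  finl (adjoin P f) -> G (quo_length (adjoin P f))%:Z.

(* One step of the reduction: cutting with superficial elements f in Q^s and
   f' in Q^(s+1) multiplies the multiplicity by s and s+1. *)
Lemma prime_case g P (l : seq (set A)) : is_prime P -> size (hs P) = g.+2 ->
  (forall P', List.In P' l -> is_prime P' /\ ~ Q `<=` P') ->
  (forall f, Q f -> ~ P f -> (forall P', List.In P' l -> ~ P' f) ->
    (size (hs (adjoin P f)) <= g.+1)%N ->
    exists2 z, G z & (hs (adjoin P f))`_g * g`!%:R = z%:~R) ->
  exists2 z, G z & (hs P)`_g.+1 * (g.+1)`!%:R = z%:~R.
Proof.
move=> pP EP hl step; have [hP _] := pP.
have nQP : ~ Q `<=` P by move/(size1_of_sub hP); rewrite EP.
have [s0 hs0] := filter_regular_ex noethA idQ finQ pP nQP hl.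
have key s : (s0 <= s)%N -> (0 < s)%N ->
    exists2 z, G z & (hs P)`_g.+1 * (g.+1)`!%:R * s%:R = z%:~R.
  move=> le s1; have [f [Qf nf hf hev]] := hs0 s le.
  have Qf1 : Q f by rewrite -(pow1 idQ); apply: pow_leq Qf.
  have E : hs (adjoin P f) = hs P - shift s%:R (hs P).
    apply: hs_uniq => //.
    have hev' : evn (fun n => (chi (adjoin P f) n + chi P (n - s) = chi P n)%N).
      apply: evn_imp (evn_and (evn_shift s hev) (evn_ge s)) => n [+ sn].
      by rewrite subnK.
    apply: evn_imp (evn_and hev' (evn_and (hsP noethA idQ finQ hP) (hs_shift noethA idQ finQ s hP))) => n [E1 [E2 E3]].
    by rewrite hornerD hornerN E2 E3 -E1 natrD addrK.
  have [|z Gz Ez] := step f Qf1 nf hf; first by rewrite E; apply: size_shift_diff; rewrite EP.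
  exists z => //; rewrite -Ez E coef_shift_diff ?EP // natrM; ring.
have [||z1 G1 E1] := key s0.+1 => //.
have [||z2 G2 E2] := key s0.+2 => //; first exact: leqW.
exists (z2 - z1); first exact: GB.
rewrite rmorphB /= -E1 -E2 -[s0.+2%:R]natr1; ring.
Qed.

(** The top coefficient is additive along a prime filtration, so only the primes of full dimension
    contribute. *)
Lemma filt_case g : (forall P, is_prime P -> ~ J `<=` P -> size (hs P) = g.+2 ->
    exists2 z, G z & (hs P)`_g.+1 * (g.+1)`!%:R = z%:~R) ->
  forall I, is_ideal I -> (size (hs I) <= g.+2)%N ->
  (forall P, is_prime P -> I `<=` P -> size (hs P) = g.+2 -> ~ J `<=` P) ->
  exists2 z, G z & (hs I)`_g.+1 * (g.+1)`!%:R = z%:~R.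
Proof.
move=> pcase; apply: (prime_filtration_ind noethA).
  by move=> _; exists 0 => //; rewrite hsT // coef0 mul0r.
move=> I a hI nIa pP IH sI hU.
have [sA sC ->] := hs_filt noethA idQ finQ a hI sI.
have [|z1 G1 E1] := IH sA.
  move=> P pP' s; apply: hU => //; apply: subset_trans s; apply: sub_adjoin.
have [z2 G2 E2] : exists2 z, G z & (hs (colon I a))`_g.+1 * (g.+1)`!%:R = z%:~R.
  move: sC; rewrite leq_eqVlt => /orP[/eqP E|lt]; last first.
    by exists 0 => //; rewrite nth_default // mul0r.
  by apply: pcase => //; apply: hU => //; apply: sub_colon.
by exists (z1 + z2); [apply: GD|rewrite mulrDl E1 E2 rmorphD].
Qed.

(** J stands for the ideal of the complement of U, and [G] for the group of the n such that n[x0]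
    can be moved. The condition that no top-dimensional prime contains J must survive the cut by f.
    Therefore f also avoids the primes of [hs_drop_list] for P + J: then P + J + fA has too small a
    dimension to lie in a top-dimensional prime over P + fA. *)
Lemma multiplicity_subgroup g I : is_ideal I -> (size (hs I) <= g.+2)%N ->
  (forall P, is_prime P -> I `<=` P -> size (hs P) = g.+2 -> ~ J `<=` P) ->
  exists2 z, G z & (hs I)`_g.+1 * (g.+1)`!%:R = z%:~R.
Proof.
elim: g I => [|g IH] hI.
  apply: (filt_case) hI => P pP nJP EP.
  apply: (prime_case (l := [::])) => // f Qf nf _ sf.
  have hPf : is_ideal (adjoin P f) by apply: idl_adjoin.
  have := finl_of_size1 hPf sf.
  exists (quo_length (adjoin P f))%:Z; first exact: GL.
  by rewrite hs_const // coefC mulr1.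
apply: (filt_case) hI => P pP nJP EP.
have [hP _ _] := pP; have hK := idl_iadd hP idJ.
have [l [l1 l2]] := hs_drop_list hK.
apply: (prime_case (l := l)) => // f Qf nf hf sf.
apply: IH => //.
move=> P' pP' s EP' sJ.
have [j Jj nj] : exists2 j, J j & ~ P j.
  by apply: contrapT => h; apply: nJP => j Jj; apply: contrapT => nj; apply: h; exists j.
have : (size (hs (iadd P J)) < g.+3)%N.
  rewrite -EP; apply: leq_ltn_trans (hs_drop_lt pP nj).
  apply: hs_mono => //.
  by apply: adjoin_sub => //; [apply: sub_iaddl|apply: sub_iaddr].
have h2 : (size (hs P') <= size (hs (adjoin (iadd P J) f)))%N.
  apply: hs_mono => //.
  apply: adjoin_sub => //; last by apply: s; apply: mem_adjoin.
  by apply: iadd_sub => // x hx; apply: s; apply: sub_adjoin.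
have := leq_trans h2 (l2 f hf); lia.
Qed.

End Subgroup.

End CurveReduction.

(** * Noether normalization *)

Section FieldExt.
Variables (k K : fieldType) (kap : {rmorphism k -> K}).
Implicit Types (x y t : nat -> K) (n m r : nat).

Definition salg x n : set K := range (mpev kap x n).

Lemma salgP x n z : salg x n z <-> exists F, mpev kap x n F = z.
Proof. by split=> [[F _ <-]|[F <-]]; exists F. Qed.
Lemma salgD x n a b : salg x n a -> salg x n b -> salg x n (a + b).
Proof. by move=> [F _ <-] [G _ <-]; exists (F + G); rewrite ?rmorphD. Qed.
Lemma salgN x n a : salg x n a -> salg x n (- a).
Proof. by move=> [F _ <-]; exists (- F); rewrite ?rmorphN. Qed.
Lemma salgB x n a b : salg x n a -> salg x n b -> salg x n (a - b).
Proof. by move=> ha hb; apply: salgD => //; apply: salgN. Qed.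
Lemma salgM x n a b : salg x n a -> salg x n b -> salg x n (a * b).
Proof. by move=> [F _ <-] [G _ <-]; exists (F * G); rewrite ?rmorphM. Qed.
Lemma salgX x n a i : salg x n a -> salg x n (a ^+ i).
Proof. by move=> [F _ <-]; exists (F ^+ i); rewrite ?rmorphXn. Qed.
Lemma salgC x n c : salg x n (kap c). Proof. exact: mpev_range_const. Qed.
Lemma salg1 x n : salg x n 1. Proof. rewrite -(rmorph1 kap); apply: salgC. Qed.
Lemma salg0 x n : salg x n 0. Proof. rewrite -(rmorph0 kap); apply: salgC. Qed.
Lemma salg_var x n i : (i < n)%N -> salg x n (x i). Proof. exact: mpev_range_var. Qed.
Lemma salg_sum x n (T : Type) (s : seq T) (P : pred T) (F : T -> K) :
  (forall i, P i -> salg x n (F i)) -> salg x n (\sum_(i <- s | P i) F i).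
Proof. by move=> h; elim/big_rec: _ => [|i z /h ?]; [apply: salg0|apply: salgD]. Qed.
Lemma salg_sub x n (T : set K) : (forall c, T (kap c)) -> (forall i, (i < n)%N -> T (x i)) ->
  (forall a b, T a -> T b -> T (a + b)) -> (forall a b, T a -> T b -> T (a * b)) ->
  salg x n `<=` T.
Proof. by move=> h1 h2 h3 h4 _ [F _ <-]; apply: mpev_ind. Qed.
Lemma salg_mono x y n m : (forall i, (i < n)%N -> salg y m (x i)) -> salg x n `<=` salg y m.
Proof. move=> h; apply: salg_sub => //; [apply: salgC|apply: salgD|apply: salgM]. Qed.

Lemma mpev_ext x y n : (forall i, (i < n)%N -> x i = y i) -> mpev kap x n =1 mpev kap y n.
Proof.
elim: n => [//|n IH] h F; rewrite !mpevS h //; congr (_.[_]).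
by apply: eq_map_poly; apply: IH => i hi; apply: h; apply: leqW.
Qed.

Fixpoint mpC n : {rmorphism k -> mp k n} :=
  if n is m.+1 then [the {rmorphism k -> {poly mp k m}} of polyC \o mpC m] else idfun.

Lemma mpev_mpC x n c : mpev kap x n (mpC n c) = kap c.
Proof. by elim: n => //n IH; rewrite -[LHS]/(mpev kap x n.+1 _) mpev_C. Qed.

Lemma map_mpC_neq0 n (P : {poly k}) : P != 0 -> map_poly (mpC n) P != 0.
Proof.
move=> nP; have : lead_coef P != 0 by rewrite lead_coef_eq0.
apply: contraNneq => E; apply/eqP.
have : mpC n (lead_coef P) = 0 by rewrite -coef_map E coef0.
elim: n {E} => [//|n IH] /eqP; rewrite polyC_eq0 => /eqP; exact: IH.
Qed.

Lemma mpev_map_mpC x n (P : {poly k}) :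
  mpev kap x n.+1 (map_poly (mpC n) P : {poly mp k n}) = (map_poly kap P).[x n].
Proof.
rewrite mpevS -map_poly_comp; congr (_.[_]); apply: eq_map_poly => c.
exact: mpev_mpC.
Qed.

(** The substitution x_(i+1) = x'_i + x_0^(e_i), which works over finite fields as well: G is F
    rewritten as a polynomial in x_0 over k[x'], with a nonzero constant of k as leading
    coefficient. *)
Lemma nagata m (F : mp k m.+1) x : F != 0 -> exists (e : nat -> nat) (G : {poly K}),
  [/\ forall i, salg (fun i => x i.+1 - x 0%N ^+ e i) m G`_i,
      G.[x 0%N] = mpev kap x m.+1 F & exists2 c, c != 0 & lead_coef G = kap c].
Proof.
elim: m F => [|m IH] F nF.
  exists (fun=> 0%N), (map_poly kap (F : {poly k})); split.
  - move=> i; rewrite coef_map; apply: salgC.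
  - by rewrite mpevS.
  - by exists (lead_coef (F : {poly k})); rewrite ?lead_coef_eq0 // lead_coef_map.
pose P : {poly mp k m.+1} := F.
pose J := (size P).-1.
have [|e [GJ [GJ1 GJ2 [c nc GJ3]]]] := IH (lead_coef P); first by rewrite lead_coef_eq0.
set x' := (fun i => x i.+1 - x 0%N ^+ e i).
pose good j (G : {poly K}) := (forall i, salg x' m G`_i) /\ G.[x 0%N] = mpev kap x m.+1 P`_j.
have gen j : exists G, good j G.
  apply: (mpev_ind (T := [set z | exists G : {poly K}, (forall i, salg x' m G`_i) /\ G.[x 0%N] = z])) => /=.
  - move=> d; exists (kap d)%:P; split; last by rewrite hornerC.
    move=> i; rewrite coefC; case: eqP => _; [apply: salgC|apply: salg0].
  - move=> [|i].
      exists 'X; split; last by rewrite hornerX.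
      move=> i; rewrite coefX; case: eqP => _; [apply: salg1|apply: salg0].
    exists ((x' i)%:P + 'X^(e i)); split; last by rewrite hornerD hornerC hornerXn subrK.
    move=> l; rewrite coefD coefC coefXn; apply: salgD.
      by case: eqP => _; [apply: salg_var|apply: salg0].
    case: eqP => _; [apply: salg1|apply: salg0].
  - move=> a b [G1 [h1 <-]] [G2 [h2 <-]]; exists (G1 + G2); split; last by rewrite hornerD.
    by move=> i; rewrite coefD; apply: salgD.
  - move=> a b [G1 [h1 <-]] [G2 [h2 <-]]; exists (G1 * G2); split; last by rewrite hornerM.
    by move=> i; rewrite coefM; apply: salg_sum => l _; apply: salgM.
have [G' hG'] := choice gen.
pose G j := if j == J then GJ else G' j.
have hG j : (forall i, salg x' m (G j)`_i) /\ (G j).[x 0%N] = mpev kap x m.+1 P`_j.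
  by rewrite /G; case: eqP => [->|_]; [split|exact: hG'].
(* E exceeds the degrees in x_0 of all coefficients G j, so in the sum of the G j L^j, with L monic
   of degree E, the term j = J alone reaches the top degree. *)
pose E := (\max_(j < J.+1) size (G j)).+1.
have hE j : (j <= J)%N -> (size (G j) < E)%N.
  move=> le; exact: (@leq_bigmax _ (fun j : 'I_J.+1 => size (G j)) (Ordinal (n := J.+1) le)).
pose e' i := if (i < m)%N then e i else E.
pose x'' := fun i => x i.+1 - x 0%N ^+ e' i.
have x''E i : (i < m)%N -> x'' i = x' i by move=> hi; rewrite /x'' /e' hi.
have sx : salg x' m `<=` salg x'' m.+1.
  by apply: salg_mono => i hi; rewrite -x''E //; apply: salg_var; apply: ltnW.
pose L : {poly K} := (x'' m)%:P + 'X^E.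
have sL : size L = E.+1.
  rewrite /L addrC size_polyDl size_polyXn // size_polyC.
  by apply: leq_trans (leq_b1 _) _.
have mL : L \is monic.
  rewrite monicE /L addrC lead_coefDl ?lead_coefXn // size_polyXn size_polyC.
  by apply: leq_trans (leq_b1 _) _.
have mLj j : L ^+ j \is monic by apply: monic_exp.
have sLj j : size (L ^+ j) = (E * j).+1 by rewrite -[size _]prednK ?size_poly_gt0 ?monic_neq0 // size_exp sL.
have sG j : (size (G j * L ^+ j)%R <= size (G j) + E * j)%N.
  by apply: leq_trans (size_polyMleq _ _) _; rewrite sLj addnS.
have EGJ : G J = GJ by rewrite /G eqxx.
have nGJ : GJ != 0 by rewrite -lead_coef_eq0 GJ3 fmorph_eq0.
have sGJ : size (GJ * L ^+ J)%R = (size GJ + E * J)%N.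
  by rewrite size_Mmonic // sLj addnS.
exists e', (\sum_(j < J.+1) G j * L ^+ j); split.
- move=> i; rewrite coef_sum; apply: salg_sum => j _; rewrite coefM.
  apply: salg_sum => l _; apply: salgM; first by apply: sx; apply: (hG j).1.
  move: (i - l)%N => i'; elim: (j : nat) i' => [|j' IHj] i'.
    rewrite coef1; case: eqP => _; [apply: salg1|apply: salg0].
  rewrite exprS coefM; apply: salg_sum => l' _; apply: salgM; last exact: IHj.
  rewrite coefD coefC coefXn; apply: salgD.
    by case: eqP => _; [apply: salg_var|apply: salg0].
  case: eqP => _; [apply: salg1|apply: salg0].
- rewrite horner_sum mpevS.
  have -> : (map_poly (mpev kap x m.+1) P).[x m.+1] = \sum_(j < J.+1) mpev kap x m.+1 P`_j * x m.+1 ^+ j.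
    rewrite (@horner_coef_wide _ J.+1); first by apply: eq_bigr => j _; rewrite coef_map.
    by apply: leq_trans (size_poly _ _) _; rewrite prednK // size_poly_gt0.
  apply: eq_bigr => j _; rewrite hornerM (hG j).2 horner_exp hornerD hornerC hornerXn.
  by rewrite /x'' /e' ltnn subrK.
- exists c => //; rewrite big_ord_recr /= EGJ addrC lead_coefDl ?lead_coef_Mmonic //.
  rewrite sGJ; apply: (@leq_ltn_trans (E * J)); last first.
    by rewrite -[X in (X < _)%N]add0n ltn_add2r size_poly_gt0.
  apply: leq_trans (size_sum _ _ _) _; apply/bigmax_leqP => j _.
  apply: leq_trans (sG j) _; apply: (@leq_trans (E + E * j)).
    by rewrite leq_add2r ltnW // hE // ltnW.
  by rewrite -mulnS leq_mul2l ltn_ord.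
Qed.

Lemma integral_salg t r x n z : (forall i, (i < n)%N -> integralOver (mpev kap t r) (x i)) ->
  salg x n z -> integralOver (mpev kap t r) z.
Proof.
move=> h; apply: (salg_sub) => //.
- move=> c; rewrite -(mpev_mpC t r c); apply: integral_id.
- exact: integral_add.
- exact: integral_mul.
Qed.

Lemma noether_normalization n x : exists r t, [/\ (forall i, (i < r)%N -> salg x n (t i)),
  injective (mpev kap t r) & forall z, salg x n z -> integralOver (mpev kap t r) z].
Proof.
suff [r [t [h1 h3]]] : exists r t, [/\ (forall i, (i < r)%N -> salg x n (t i)),
  injective (mpev kap t r) & forall i, (i < n)%N -> integralOver (mpev kap t r) (x i)].
  by exists r, t; split=> // z; apply: integral_salg.
elim: n x => [|n IH] x.
  exists 0%N, x; split=> //; apply: fmorph_inj.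
have [inj|ninj] := pselect (injective (mpev kap x n.+1)).
  exists n.+1, x; split=> // i hi; first exact: salg_var.
  have [F <-] := (salgP _ _ _).1 (salg_var x hi); exact: integral_id.
have [F [nF F0]] : exists F, F != 0 /\ mpev kap x n.+1 F = 0.
  apply: contrapT => h; apply: ninj => F G E; apply: contrapT => /eqP nFG; apply: h.
  by exists (F - G); rewrite subr_eq0 rmorphB E subrr.
have [e [G [G1 G2 [c nc G3]]]] := nagata x nF.
set x' := (fun i => x i.+1 - x 0%N ^+ e i).
have [r [t [t1 t2 t3]]] := IH x'; exists r, t; split=> // [i hi|i hi].
  have : salg x' n `<=` salg x n.+1; last by apply; apply: t1.
  apply: salg_mono => j hj; apply: salgB; first exact: salg_var.
  by apply: salgX; apply: salg_var.
have int0 : integralOver (mpev kap t r) (x 0%N).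
  apply: (@integral_root_monic _ _ _ _ ((kap c)^-1 *: G)).
  - by rewrite monicE lead_coefZ G3 mulVf // fmorph_eq0.
  - by rewrite rootE hornerZ G2 F0 mulr0.
  - apply/integral_poly => j; rewrite coefZ -fmorphV; apply: integral_mul.
      rewrite -(mpev_mpC t r); apply: integral_id.
    exact: integral_salg (G1 j).
case: i hi => [//|i] hi; rewrite -(subrK (x 0%N ^+ e i) (x i.+1)); apply: integral_add.
  by apply: t3.
by elim: (e i) => [|j IHj]; [apply: integral1|rewrite exprS; apply: integral_mul].
Qed.

(** ** Lattices *)

Section Lattice.
Variables (D : comNzRingType) (tau : {rmorphism D -> K}).
Hypothesis tau_inj : injective tau.

Definition dspan (e : seq K) : set K :=
  [set z | exists c : nat -> D, z = \sum_(i < size e) tau (c i) * e`_i].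
Definition dindep (e : seq K) := forall c : nat -> D,
  \sum_(i < size e) tau (c i) * e`_i = 0 -> forall i, (i < size e)%N -> c i = 0.

Lemma dspanD e a b : dspan e a -> dspan e b -> dspan e (a + b).
Proof.
move=> [c ->] [d ->]; exists (fun i => c i + d i); rewrite -big_split.
by apply: eq_bigr => i _; rewrite rmorphD mulrDl.
Qed.
Lemma dspanZ e d a : dspan e a -> dspan e (tau d * a).
Proof.
move=> [c ->]; exists (fun i => d * c i); rewrite mulr_sumr.
by apply: eq_bigr => i _; rewrite rmorphM mulrA.
Qed.
Lemma dspan0 e : dspan e 0.
Proof. by exists (fun=> 0); rewrite big1 // => i _; rewrite rmorph0 mul0r. Qed.
Lemma dspan_sum e (T : Type) (s : seq T) (P : pred T) (F : T -> K) :
  (forall i, P i -> dspan e (F i)) -> dspan e (\sum_(i <- s | P i) F i).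
Proof. by move=> h; elim/big_rec: _ => [|i z /h ?]; [apply: dspan0|apply: dspanD]. Qed.
Lemma dspan_mem e u : u \in e -> dspan e u.
Proof.
move=> /(nthP 0)[j hj <-]; exists (fun i => (i == j)%:R).
rewrite (bigD1 (Ordinal hj)) //= eqxx rmorph1 mul1r big1 ?addr0 // => i ni.
by rewrite [_ == _](negPf ni) rmorph0 mul0r.
Qed.
Lemma dspan_sub e (T : set K) : T 0 -> (forall a b, T a -> T b -> T (a + b)) ->
  (forall d a, T a -> T (tau d * a)) -> (forall u, u \in e -> T u) -> dspan e `<=` T.
Proof.
move=> T0 TD TZ Te _ [c ->]; elim/big_rec: _ => // i z Tz; apply: TD; apply: TZ.
by apply: Te; apply: mem_nth.
Qed.
Lemma dspan_cons u e z : dspan (u :: e) z <-> exists d a, dspan e a /\ z = tau d * u + a.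
Proof.
split=> [[c ->]|[d [_ [[c ->] ->]]]].
  rewrite big_ord_recl /=; exists (c 0%N), (\sum_(i < size e) tau (c i.+1) * e`_i); split=> //.
  by exists (fun i => c i.+1).
by exists (fun i => if i is j.+1 then c j else d); rewrite big_ord_recl.
Qed.

Lemma max_indep (w : seq K) : exists e, [/\ {subset e <= w}, dindep e &
  forall u, u \in w -> exists2 d, d != 0 & dspan e (tau d * u)].
Proof.
elim: w => [|u w [e [e1 e2 e3]]]; first by exists [::].
have [[d [nd hd]]|h] := pselect (exists d, d != 0 /\ dspan e (tau d * u)).
  exists e; split=> // v; first by move=> /e1; rewrite in_cons orbC => ->.
  by rewrite in_cons => /orP[/eqP->|/e3//]; exists d.
exists (u :: e); split.
- by move=> v; rewrite !in_cons => /orP[->//|/e1->]; rewrite orbT.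
- move=> c; rewrite big_ord_recl => E.
  have c0 : c 0%N = 0.
    apply: contrapT => /eqP n0; apply: h; exists (c 0%N); split=> //.
    exists (fun i => - c i.+1); move/eqP: E; rewrite addr_eq0 => /eqP ->.
    by rewrite -sumrN; apply: eq_bigr => i _; rewrite rmorphN mulNr.
  move: E; rewrite c0 rmorph0 mul0r add0r => /(e2 (fun i => c i.+1)) E [|i] //hi; exact: E.
- move=> v; rewrite in_cons => /orP[/eqP->|/e3[d hd]].
    by exists 1; [apply: oner_neq0|rewrite rmorph1 mul1r; apply: dspan_mem; rewrite mem_head].
  by exists d => //; apply/dspan_cons; exists 0, (tau d * v); rewrite rmorph0 mul0r add0r.
Qed.

(** A maximal independent subfamily of w spans the same lattice up to torsion; multiplying the
    individual denominators gives one d for all of w. *)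
Lemma common_denominator (w : seq K) : exists e, [/\ {subset e <= w}, dindep e &
  exists2 d, tau d != 0 & forall z, dspan w z -> dspan e (tau d * z)].
Proof.
have [e [e1 e2 e3]] := max_indep w; exists e; split=> //.
have [d nd hd] : exists2 d, tau d != 0 & forall u, u \in w -> dspan e (tau d * u).
  elim: w e3 {e1} => [|u w IH] h; first by exists 1; rewrite ?rmorph1 ?oner_neq0.
  have [|d nd hd] := IH; first by move=> v vw; apply: h; rewrite in_cons vw orbT.
  have [|d' nd' hd'] := h u; first by rewrite mem_head.
  exists (d * d').
    rewrite rmorphM mulf_neq0 //; apply: contraNneq nd' => E.
    by apply/eqP/tau_inj; rewrite rmorph0.
  move=> v; rewrite rmorphM => /orP[/eqP->|/hd h'].
    by rewrite -mulrA; apply: dspanZ.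
  by rewrite mulrAC mulrC; apply: dspanZ.
exists d => // z [c ->]; rewrite mulr_sumr; apply: dspan_sum => i _.
by rewrite mulrCA; apply: dspanZ; apply: hd; apply: mem_nth.
Qed.

Lemma dspan_uniq e (c d : nat -> D) : dindep e ->
  \sum_(i < size e) tau (c i) * e`_i = \sum_(i < size e) tau (d i) * e`_i ->
  forall i, (i < size e)%N -> c i = d i.
Proof.
move=> he E i hi; apply/eqP; rewrite -subr_eq0; apply/eqP.
apply: (he (fun i => c i - d i)) => //.
have : \sum_(i < size e) tau (c i - d i) * e`_i =
    \sum_(i < size e) tau (c i) * e`_i - \sum_(i < size e) tau (d i) * e`_i.
  by rewrite -sumrB; apply: eq_bigr => j _; rewrite rmorphB mulrBl.
by rewrite E subrr.
Qed.

Lemma dspan_mul e f a b : dspan e a -> dspan f b ->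
  dspan [seq u * v | u <- e, v <- f] (a * b).
Proof.
move=> ha hb; pose T := dspan [seq u * v | u <- e, v <- f].
suff : dspan e `<=` [set z | T (z * b)] by move/(_ a ha).
apply: dspan_sub => /= [|x hy|d hx|u ue].
- rewrite mul0r; apply: dspan0.
- by rewrite mulrDl; apply: dspanD.
- by rewrite -mulrA; apply: dspanZ.
suff : dspan f `<=` [set z | T (u * z)] by move/(_ b hb).
apply: dspan_sub => /= [|x hy|d hx|v vf].
- rewrite mulr0; apply: dspan0.
- by rewrite mulrDr; apply: dspanD.
- by rewrite mulrCA; apply: dspanZ.
- by apply: dspan_mem; apply/allpairsP; exists (u, v).
Qed.

Lemma integral_powers z : integralOver tau z -> exists N, forall i,
  dspan [seq z ^+ j | j <- iota 0 N] (z ^+ i).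
Proof.
move=> [q mq /rootP qz]; exists (size q).-1 => i.
have E : z ^+ i = (map_poly tau (Pdiv.Ring.rmodp 'X^i q)).[z].
  rewrite -hornerXn -(map_polyXn tau) {1}(Pdiv.RingMonic.rdivp_eq mq 'X^i).
  by rewrite rmorphD rmorphM hornerD hornerM qz mulr0 add0r.
rewrite E (@horner_coef_wide _ (size q).-1); last first.
  apply: leq_trans (size_poly _ _) _; rewrite -ltnS prednK ?size_poly_gt0 ?monic_neq0 //.
  by apply: Pdiv.Ring.ltn_rmodpN0; apply: monic_neq0.
apply: dspan_sum => j _; rewrite coef_map; apply: dspanZ; apply: dspan_mem.
by apply/mapP; exists (j : nat) => //; rewrite mem_iota /=.
Qed.

Lemma integral_finite x n : (forall c, exists d, tau d = kap c) ->
  (forall i, (i < n)%N -> integralOver tau (x i)) ->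
  exists w, (forall u, u \in w -> salg x n u) /\ salg x n `<=` dspan w.
Proof.
move=> hk; suff : forall m, (m <= n)%N -> (forall i, (i < m)%N -> integralOver tau (x i)) ->
    exists w, (forall u, u \in w -> salg x n u) /\ salg x m `<=` dspan w by apply.
elim=> [|m IH] lem hx.
  exists [:: 1]; split=> [u|_ [c _ <-]]; first by rewrite inE => /eqP->; apply: salg1.
  have [d <-] := hk c; rewrite -[X in _ X]mulr1; apply: dspanZ; apply: dspan_mem.
  by rewrite mem_head.
have [|i hi|w [w1 w2]] := IH; first exact: ltnW.
  by apply: hx; apply: leqW.
have [N hN] := integral_powers (hx m (ltnSn m)).
exists [seq u * v | u <- w, v <- [seq x m ^+ j | j <- iota 0 N]]; split.
  move=> _ /allpairsP[[u v] [/w1 hu /mapP[j _ ->] ->]]; apply: salgM => //.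
  by apply: salgX; apply: salg_var.
move=> _ [F _ <-]; rewrite mpevS horner_coef; apply: dspan_sum => i _; rewrite coef_map.
by apply: dspan_mul (hN i); apply: w2; exists (F : {poly mp k m})`_i.
Qed.

End Lattice.

(** ** One-dimensional algebras *)

(** The leading coefficient of ay is that of y; it is a multiple of c, and the corresponding term
    can be subtracted. *)
Lemma monic_dvd (E : comNzRingType) (a y : {poly E}) (c : E) : a \is monic ->
  (forall j, exists u, (a * y)`_j = c * u) -> exists q, y = c%:P * q.
Proof.
move=> ma; have [N] := ubnP (size y); elim: N y => // N IH y; rewrite ltnS => sy h.
have [->|ny] := eqVneq y 0; first by exists 0; rewrite mulr0.
have [u Eu] : exists u, lead_coef y = c * u.
  rewrite -(lead_coef_Mmonic y ma) mulrC; apply: h.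
have Esz : size y = (size y).-1.+1 by rewrite prednK // size_poly_gt0.
have [||q Eq] := IH (y - c%:P * (u *: 'X^((size y).-1))).
- apply: leq_trans sy; rewrite Esz ltnS; apply/leq_sizeP => j.
  rewrite leq_eqVlt => /orP[/eqP<-|lt].
    by rewrite coefB coefCM coefZ coefXn eqxx mulr1 -Eu subrr.
  rewrite coefB coefCM coefZ coefXn gtn_eqF // !mulr0 subr0 nth_default //.
  by rewrite Esz.
- move=> j; have [v Ev] := h j; exists (v - (a * (u *: 'X^((size y).-1)))`_j).
  by rewrite mulrBr coefB Ev [c%:P * _]mulrC mulrA coefMC [_ * c]mulrC mulrBr.
exists (u *: 'X^((size y).-1) + q); rewrite mulrDr -Eq addrC subrK //.
Qed.

(* If a(t)/f and b/f lie in R, where R is finite over E[t], a is monic in t and b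
   is a nonzero element of E, then f is invertible in R: with L a free E[t]-lattice
   such that d R is contained in L, the elements z = d / f^n satisfy a^n z, b^n z in L,
   hence z in L, so that d is divisible in R by all powers of f. *)
Lemma codim2_unit x n (E : comNzRingType) (tau : {rmorphism {poly E} -> K})
    (a : {poly E}) (b : E) (f : K) : injective tau ->
  (forall d, salg x n (tau d)) -> (forall c, exists d, tau d = kap c) ->
  (forall i, (i < n)%N -> integralOver tau (x i)) ->
  a \is monic -> b != 0 -> salg x n f -> f != 0 ->
  salg x n (tau a / f) -> salg x n (tau b%:P / f) -> salg x n f^-1.
Proof.
move=> ti hD hk hx ma nb Rf nf Raf Rbf.
have [w [w1 w2]] := integral_finite hk hx.
have [e [e1 e2 [d nd hd]]] := common_denominator ti w.
have Re u : dspan tau e u -> salg x n u.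
  apply: dspan_sub => [|u1 u2|d1 hu1|u1 /e1/w1//]; [exact: salg0|exact: salgD|].
  by apply: salgM.
have tau_neq0 z : z != 0 -> tau z != 0.
  by apply: contraNneq => E0; apply/eqP/ti; rewrite rmorph0.
have key m : salg x n (tau d * f ^- m).
  apply: Re.
  have h1 : dspan tau e (tau d * (tau a / f) ^+ m) by apply: hd; apply: w2; apply: salgX.
  have h2 : dspan tau e (tau d * (tau b%:P / f) ^+ m) by apply: hd; apply: w2; apply: salgX.
  have [y Ey] := h1; have [y' Ey'] := h2.
  have rel i : (i < size e)%N -> (b ^+ m)%:P * y i = a ^+ m * y' i.
    apply: (dspan_uniq (c := fun i => (b ^+ m)%:P * y i) (d := fun i => a ^+ m * y' i) e2).
    transitivity (tau (b ^+ m)%:P * (tau d * (tau a / f) ^+ m)).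
      by rewrite Ey mulr_sumr; apply: eq_bigr => j _; rewrite rmorphM mulrA.
    transitivity (tau (a ^+ m) * (tau d * (tau b%:P / f) ^+ m)); last first.
      by rewrite Ey' mulr_sumr; apply: eq_bigr => j _; rewrite rmorphM mulrA.
    rewrite !rmorphXn !exprMn; ring.
  have hq i : exists q, (i < size e)%N -> y' i = (b ^+ m)%:P * q.
    case: (ltnP i) => [hi|_]; last by exists 0.
    have [|q ->] := @monic_dvd E (a ^+ m) (y' i) (b ^+ m) (monic_exp m ma); last by exists q.
    by move=> j; exists (y i)`_j; rewrite -rel // coefCM.
  have [q Eq] := choice hq.
  have nbm : tau (b ^+ m)%:P != 0.
    by rewrite polyC_exp rmorphXn expf_neq0 // tau_neq0 // polyC_eq0.
  exists q; apply: (mulfI nbm).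
  have -> : tau (b ^+ m)%:P * (tau d * f ^- m) = tau d * (tau b%:P / f) ^+ m.
    rewrite polyC_exp rmorphXn exprMn exprVn; ring.
  rewrite Ey' mulr_sumr; apply: eq_bigr => i _; rewrite (Eq i (ltn_ord i)) rmorphM mulrA //.
pose J m := [set F : mp k n | exists2 g, salg x n g & mpev kap x n F = tau d * f ^- m * g].
have hJ m : is_ideal (J m).
  split; first by exists 0; [apply: salg0|rewrite rmorph0 mulr0].
  - move=> F G [g hg E1] [g' hg' E2]; exists (g + g'); first exact: salgD.
    by rewrite rmorphD E1 E2 mulrDr.
  - move=> C F [g hg E1]; exists (mpev kap x n C * g); first by apply: salgM => //; exists C.
    by rewrite rmorphM E1 mulrCA.
have JS m : J m `<=` J m.+1.
  move=> F [g hg E1]; exists (f * g); first exact: salgM.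
  rewrite E1 exprS invfM; field; rewrite expf_neq0 //.
have [N hN] := noetherian_seq (@mp_noetherian k n (@field_noetherian k)) hJ JS.
have [F _ EF] := key N.+1.
have : J N F.
  by rewrite -(hN N.+1) //; exists 1; [apply: salg1|rewrite mulr1].
move=> [g hg]; rewrite EF exprSr invfM mulrA => Eg.
have -> : f^-1 = g; last by [].
by apply: (mulfI (_ : tau d * f ^- N != 0)) => //; rewrite mulf_neq0 // invr_eq0 expf_neq0.
Qed.

(** The last hypothesis says that R/fR is algebraic over k, which forces a single variable in the
    normalization. With no variable f is algebraic over k, hence invertible in R. With at least two,
    f divides monic polynomials in each of the last two variables, and [codim2_unit] makes it
    invertible. *)
Lemma curve_normalization x n (f : K) : salg x n f -> f != 0 -> ~ salg x n f^-1 ->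
  (forall z, salg x n z -> exists P : {poly k}, P != 0 /\ salg x n ((map_poly kap P).[z] / f)) ->
  exists s : K, [/\ salg x n s, injective (mpev kap (fun=> s) 1) &
    forall z, salg x n z -> integralOver (mpev kap (fun=> s) 1) z].
Proof.
move=> Rf nf nRf alg; have [r [t [t1 t2 t3]]] := noether_normalization n x.
have mon z : salg x n z -> exists P : {poly k}, P \is monic /\ salg x n ((map_poly kap P).[z] / f).
  move=> /alg[P [nP hP]]; have : lead_coef P != 0 by rewrite lead_coef_eq0.
  exists ((lead_coef P)^-1 *: P); split; first by rewrite monicE lead_coefZ mulVf.
  rewrite map_polyZ hornerZ -mulrA; apply: salgM => //; apply: salgC.
case: r t1 t2 t3 => [|[|r]] t1 t2 t3.
- exfalso; apply: nRf; have [q mq qf] := t3 f Rf.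
  have [c [p [nc pf]]] : exists c (p : {poly k}), c != 0 /\ (map_poly kap (p * 'X + c%:P)).[f] = 0.
    have nq := monic_neq0 mq; move: (rootP qf) => /=.
    have [N] := ubnP (size (q : {poly k})); elim: N (q : {poly k}) nq => // N IH.
    elim/poly_ind => [|p c _]; first by rewrite eqxx.
    move=> nq; have [c0|nc] := eqVneq c 0; last by move=> E; exists c, p.
    rewrite c0 addr0 in nq *; have np : p != 0 by apply: contraNneq nq => ->; rewrite mul0r.
    rewrite size_mulX // => lt; rewrite rmorphM /= map_polyX hornerMX => /eqP.
    rewrite mulf_eq0 (negPf nf) orbF => /eqP; exact: IH.
  have -> : f^-1 = - (map_poly kap p).[f] * kap c^-1.
    move: pf; rewrite rmorphD rmorphM /= map_polyX map_polyC hornerMXaddC => /eqP.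
    rewrite addr_eq0 => /eqP E; rewrite fmorphV.
    by apply: (mulIf nf); rewrite mulVf // mulrAC mulNr E opprK mulfV // fmorph_eq0.
  apply: salgM; last exact: salgC.
  apply: salgN; rewrite horner_coef; apply: salg_sum => i _; rewrite coef_map.
  by apply: salgM; [apply: salgC|apply: salgX].
  exists (t 0%N); split; first exact: t1.
    apply: t2.
  by move=> z /t3[q qz]; exists q.
exfalso; apply: nRf.
have [P1 [mP1 R1]] := mon (t r.+1) (t1 _ (ltnSn _)).
have [P2 [mP2 R2]] := mon (t r) (t1 _ (leqnSn _)).
apply: (@codim2_unit x n (mp k r.+1) (mpev kap t r.+2) (map_poly (mpC r.+1) P1)
  (map_poly (mpC r) P2 : {poly mp k r})) => //.
- move=> d; have : salg t r.+2 `<=` salg x n by apply: salg_mono.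
  by apply; exists d.
- move=> c; exists (mpC r.+2 c); exact: (mpev_mpC t r.+2 c).
- by move=> i hi; apply: t3; apply: salg_var.
- exact: monic_map.
- by apply: map_mpC_neq0; apply: monic_neq0.
- by rewrite mpev_map_mpC.
- by rewrite mpev_C mpev_map_mpC.
Qed.

End FieldExt.

(** * Maps out of stalks *)

Section StalkLift.
Variables (X : ringedSpace) (x : X) (R : comPzRingType).
Variable phi : forall U : opens X, pts U x -> {rmorphism sect U -> R}.
Hypothesis compat : forall (U V : opens X) (hU : pts U x) (hV : pts V x) (i : V `<=` U) s,
  phi hV (res i s) = phi hU s.

Definition stalk_lift_fun (a : stalk x) : R :=
  phi (pg_mem (repr a)) (pg_sect (repr a)).

Lemma stalk_lift_funE (U : opens X) (hU : pts U x) (s : sect U) :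
  stalk_lift_fun (germ hU s) = phi hU s.
Proof.
rewrite /stalk_lift_fun.
have: germ (pg_mem (repr (germ hU s))) (pg_sect (repr (germ hU s))) = germ hU s.
  by rewrite -[RHS]reprK; case: (repr).
case: (repr) => [V hV s'] /germP[W [hW [i [j e]]]].
by rewrite -(compat hV hW i) e.
Qed.

Lemma stalk_lift : exists psi : {rmorphism stalk x -> R},
  forall (U : opens X) (hU : pts U x) s, psi (germ hU s) = phi hU s.
Proof.
have fB : zmod_morphism stalk_lift_fun.
  move=> a b; have [U [hU [s [t [-> ->]]]]] := germ_surj2 a b.
  by rewrite -rmorphB !stalk_lift_funE rmorphB.
have fM : monoid_morphism stalk_lift_fun.
  split=> [|a b].
    by rewrite -(rmorph1 (germ (U := opensT X) I)) stalk_lift_funE rmorph1.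
  have [U [hU [s [t [-> ->]]]]] := germ_surj2 a b.
  by rewrite -rmorphM !stalk_lift_funE rmorphM.
pose m1 := GRing.isZmodMorphism.Build _ _ stalk_lift_fun fB.
pose m2 := GRing.isMonoidMorphism.Build _ _ stalk_lift_fun fM.
pose psi : {rmorphism stalk x -> R} := HB.pack stalk_lift_fun m1 m2.
exists psi => s; apply: stalk_lift_funE.
Qed.

End StalkLift.

(** * Subrings of a field *)

(** Local rings of integral schemes are treated as subsets of the function field; c is a unit of the
    subring O. *)
Definition kunit (K : fieldType) (O : set K) (c : K) := [/\ c != 0, O c & O c^-1].

Section Subrings.
Variable K : fieldType.
Implicit Types (O J N : set K).

Definition subring O := [/\ O 1, forall a b, O a -> O b -> O (a - b)
  & forall a b, O a -> O b -> O (a * b)].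

Definition kideal O J := [/\ J `<=` O, J 0, forall a b, J a -> J b -> J (a + b)
  & forall c a, O c -> J a -> J (c * a)].

(** The length of O/N, computed inside K; [olenE] compares it with [quo_length] over any ring
    mapping onto O. *)
Definition olen O N : nat := xget 0%N (max_chain [set J | kideal O J /\ N `<=` J]).

(* Stands for Krull dimension at most one. *)
Definition dim1 O := forall v f, O v -> v != 0 -> O f -> ~ kunit O f ->
  exists n : nat, O (f ^+ n / v).

Definition klocal O := forall a b, O a -> O b -> ~ kunit O a -> ~ kunit O b -> ~ kunit O (a + b).

Lemma subring0 O : subring O -> O 0.
Proof. by case=> h1 hB _; rewrite -(subrr 1); apply: hB. Qed.
Lemma subringN O a : subring O -> O a -> O (- a).
Proof. move=> hO; have := subring0 hO; case: hO => _ hB ha; rewrite -sub0r; apply: hB. Qed.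
Lemma subringD O a b : subring O -> O a -> O b -> O (a + b).
Proof. by move=> hO ha hb; rewrite -[b]opprK; case: (hO) => _ hB _; apply: hB => //; apply: subringN. Qed.
Lemma subringX O a n : subring O -> O a -> O (a ^+ n).
Proof. by move=> [h1 _ hM] ha; elim: n => [|n IH]; rewrite // exprS; apply: hM. Qed.

Lemma kunitM O a b : subring O -> kunit O a -> kunit O b -> kunit O (a * b).
Proof.
by move=> [_ _ hM] [a1 a2 a3] [b1 b3]; split; rewrite ?mulf_neq0 ?invfM //; apply: hM.
Qed.

Lemma kunitMl O a b : subring O -> O a -> O b -> kunit O (a * b) -> kunit O a.
Proof.
move=> [_ _ hM] ha hb [/[!mulf_eq0]/norP[n1 n2] h2]; split=> //.
by rewrite (_ : a^-1 = b * (a * b)^-1); [apply: hM|rewrite invfM mulrCA mulfV ?mulr1].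
Qed.

Lemma kunit1 O : subring O -> kunit O 1.
Proof. by case=> h1 _; split; rewrite ?oner_neq0 ?invr1. Qed.

Lemma klocalB O a b : subring O -> klocal O -> O a -> O b -> ~ kunit O a -> ~ kunit O b ->
  ~ kunit O (a - b).
Proof.
move=> hO lO Oa Ob na nb; apply: lO => //; first exact: subringN.
move=> [h0 _ h1]; apply: nb; split=> //; first by rewrite -oppr_eq0.
by rewrite -[_^-1]opprK -invrN; apply: subringN.
Qed.

Lemma range_subring (B : comPzRingType) (be : {rmorphism B -> K}) : subring (range be).
Proof.
split; first by exists 1; rewrite ?rmorph1.
  by move=> _ _ [a _ <-] [b _ <-]; exists (a - b); rewrite ?rmorphB.
by move=> _ _ [a _ <-] [b _ <-]; exists (a * b); rewrite ?rmorphM.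
Qed.

Section Preimage.
Variables (B : comPzRingType) (be : {rmorphism B -> K}).

Lemma kideal_preimage J : kideal (range be) J -> is_ideal (be @^-1` J).
Proof.
move=> [_ h0 hD hM]; split=> [|a b|c a] /=; rewrite ?rmorph0 ?rmorphD ?rmorphM //.
  exact: hD.
by apply: hM.
Qed.

Lemma image_kideal (J : set B) : is_ideal J -> kideal (range be) (be @` J).
Proof.
move=> hJ; split.
- by move=> _ [a _ <-].
- exists 0; rewrite ?rmorph0 //; apply: (idl0 hJ).
- by move=> _ _ [a ha <-] [b hb <-]; exists (a + b); rewrite ?rmorphD //; apply: (idlD hJ).
- by move=> _ _ [a _ <-] [b hb <-]; exists (a * b); rewrite ?rmorphM //; apply: (idlM _ hJ).
Qed.

Lemma image_preimageK J : kideal (range be) J -> be @` (be @^-1` J) = J.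
Proof.
move=> [hJ _ _ _]; apply/seteqP; split=> [_ [a ha <-] //|c hc].
by have [a _ E] := hJ c hc; exists a; rewrite //= E.
Qed.

Lemma preimage_imageK (J : set B) : is_ideal J -> be @^-1` [set 0] `<=` J ->
  be @^-1` (be @` J) = J.
Proof.
move=> hJ hk; apply/seteqP; split=> [a [b hb E]|a /=]; last by exists a.
by apply: (idl_congr hJ _ hb); apply: hk; rewrite /= rmorphB E subrr.
Qed.

Lemma olen_chain N n : kideal (range be) N ->
  ilen (be @^-1` N) setT n <-> max_chain [set J | kideal (range be) J /\ N `<=` J] n.
Proof.
move=> hN; have ker0 (J : set B) : be @^-1` N `<=` J -> be @^-1` [set 0] `<=` J.
  by move=> s a a0; apply: s; rewrite /= a0; case: hN.
apply: (@max_chain_iso B K (fun J : set B => be @` J) (fun J : set K => be @^-1` J)).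
- move=> J [hJ s _]; split; first exact: image_kideal.
  by rewrite -(image_preimageK hN) => _ [a ha <-]; exists a => //; apply: s.
- by move=> J [hJ s]; split=> //; [apply: kideal_preimage|move=> a; apply: s].
- by move=> J L s _ [a ha <-]; exists a => //; apply: s.
- move=> J L s a; apply: s.
- by move=> J [hJ s _]; apply: preimage_imageK => //; apply: ker0.
- by move=> J [hJ s]; apply: image_preimageK.
Qed.

Lemma olenE N : kideal (range be) N -> quo_length (be @^-1` N) = olen (range be) N.
Proof.
move=> hN; congr xget; apply/funext => n; apply/propext.
rewrite -(olen_chain n hN) /ilen (_ : between _ _ = [set J | is_ideal J /\ be @^-1` N `<=` J]) //.
by apply/seteqP; split=> J; [case|case=> split].
Qed.

End Preimage.

Definition kmulr O (a : K) : set K := [set a * c | c in O].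

Lemma kideal_mulr O a : subring O -> O a -> kideal O (kmulr O a).
Proof.
move=> hO ha; have [h1 hB hM] := hO; split.
- by move=> _ [c hc <-]; apply: hM.
- by exists 0; rewrite ?mulr0 //; apply: subring0.
- by move=> _ _ [c hc <-] [d hd <-]; exists (c + d); rewrite ?mulrDr //; apply: subringD.
- by move=> c _ hc [d hd <-]; exists (c * d); rewrite 1?mulrCA //; apply: hM.
Qed.

End Subrings.

(** By [dim1] a nonzero prime contains a power of every nonunit, so the only primes are 0 and the
    maximal ideal; the nonzero nonunit keeps these two distinct. *)
Lemma krull_dim1 (B : comPzRingType) (K : fieldType) (v : {rmorphism B -> K}) :
  injective v -> dim1 (range v) -> (exists2 f, f != 0 & range v f /\ ~ kunit (range v) f) ->
  klocal (range v) -> has_krull_dim B 1.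
Proof.
move=> vinj d1 [f0 nf0 [[f _ Ef] uf]] loc; rewrite -{f0}Ef in nf0 uf.
have hv := range_subring v; have R a : range v (v a) by exists a.
have : is_prime ([set 0] : set B).
  split; first exact: is_ideal0.
    by move=> /(congr1 v); rewrite rmorph0 rmorph1 => /eqP; rewrite oner_eq0.
  move=> a b /(congr1 v)/eqP; rewrite rmorph0 rmorphM mulf_eq0 => /orP[] /eqP E; [left|right];
  by apply: vinj; rewrite rmorph0.
pose m : set B := [set a | ~ kunit (range v) (v a)].
have : is_prime m.
  split; first split.
  - by rewrite /m /= rmorph0 => -[/eqP].
  - by move=> b hb; rewrite /m /= rmorphD; apply: loc.
  - by move=> c a ha; rewrite /m /= rmorphM mulrC => /(kunitMl hv (R a) (R c)).
  - by apply; rewrite rmorph1; apply: kunit1.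
  move=> a b; rewrite /m /= rmorphM => nab; apply: contrapT => /not_orP[/contrapT na /contrapT nb].
  by apply: nab; apply: kunitM.
have max (P : set B) : is_prime P -> P `<=` m.
  move=> [hP P1 _] a ha [n0 _ [b _ E]]; apply: P1.
  rewrite (_ : 1 = b * a); first exact: (idlM _ hP).
  by apply: vinj; rewrite rmorphM rmorph1 E mulVf.
have big (P : set B) a : is_prime P -> P a -> a <> 0 -> P = m.
  move=> pP Pa na; apply/seteqP; split; first exact: max.
  move=> b hb; have nva : v a != 0 by apply/eqP => E; apply: na; apply: vinj; rewrite rmorph0.
  have [n [c _ E]] := d1 _ _ (R a) nva (R b) hb.
  apply: (primeX pP (n := n)); rewrite (_ : b ^+ n = c * a); first exact: (idlM _).
  by apply: vinj; rewrite rmorphM E divfK // rmorphXn.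
split.
  exists (fun i => if i == 0%N then [set 0] else m); split=> [[|i] //|[|i] //].
  split=> [a ->|sub]; first by rewrite /m /= rmorph0 => -[/eqP].
  by have E := sub f uf; move: nf0; rewrite E rmorph0 eqxx.
move=> [J [h1 h2]]; have [s01 n01] := h2 0%N isT; have [s12 n12] := h2 1%N isT.
have [a [ha na]] : exists a, J 1%N a /\ a <> 0.
  apply: contrapT => no; apply: n01 => a ha; have [->|na] := pselect (a = 0).
    apply: (idl0 (prime_ideal (h1 0%N isT))).
  by case: no; exists a.
apply: n12; rewrite (big _ a (h1 1%N isT) ha na); exact/max/h1.
Qed.

(** * Irreducible spaces with a sheaf of subrings of a field *)

(* The sections over V are the constants of K that lie in O t for all t in V;
   they are functions on V, so that there is a single section over the empty set. *)
Record cspace := CSpace {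
  cs_top :> topologicalType;
  cs_K : fieldType;
  cs_O : cs_top -> set cs_K;
  cs_eta : cs_top;
  cs_O1 : forall t, cs_O t 1;
  cs_OE : forall c, cs_O cs_eta c;
  cs_OB : forall t a b, cs_O t a -> cs_O t b -> cs_O t (a - b);
  cs_OM : forall t a b, cs_O t a -> cs_O t b -> cs_O t (a * b);
  cs_gen : forall V : set cs_top, open V -> forall t, V t -> V cs_eta }.
Arguments cs_O : clear implicits.
Arguments cs_eta : clear implicits.

Section CSpace.
Variable X : cspace.
Local Notation K := (cs_K X).
Implicit Types (U V W : opens X).

Definition cfun V := {t : X | pts V t} -> K.
HB.instance Definition _ V := GRing.ComPzRing.on (cfun V).

Definition cpred V : {pred (cfun V)} :=
  fun f => `[< (forall s t, f s = f t) /\ forall t, cs_O X (sval t) (f t) >].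

Arguments cpred : clear implicits.

Lemma cpredP V (f : cfun V) :
  reflect ((forall s t, f s = f t) /\ forall t, cs_O X (sval t) (f t)) (f \in cpred V).
Proof. exact: asboolP. Qed.

Lemma cpred_subring V : subring_closed (cpred V).
Proof.
split.
- apply/cpredP; split=> // t; apply: cs_O1.
- move=> f g /cpredP[f1 f2] /cpredP[g1 g2]; apply/cpredP; split=> [s t|t].
    by rewrite -[LHS]/(f s - g s) (f1 s t) (g1 s t).
  by apply: cs_OB.
- move=> f g /cpredP[f1 f2] /cpredP[g1 g2]; apply/cpredP; split=> [s t|t].
    by rewrite -[LHS]/(f s * g s) (f1 s t) (g1 s t).
  by apply: cs_OM.
Qed.
HB.instance Definition _ V := GRing.isSubringClosed.Build _ (cpred V) (@cpred_subring V).

Record csect V := CSect { cval : cfun V; cvalP : cval \in cpred V }.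
HB.instance Definition _ V := [isSub for @cval V].
HB.instance Definition _ V := gen_eqMixin (csect V).
HB.instance Definition _ V := gen_choiceMixin (csect V).
HB.instance Definition _ V :=
  GRing.SubChoice_isSubComPzRing.Build (cfun V) (cpred V) (csect V) (@cpred_subring V).

Lemma cvalE V (s : csect V) t u : cval s t = cval s u.
Proof. by have /cpredP[h _] := cvalP s. Qed.
Lemma cvalO V (s : csect V) t : cs_O X (sval t) (cval s t).
Proof. by have /cpredP[_ h] := cvalP s. Qed.

Lemma csect_eq V (s t : csect V) : (forall u, cval s u = cval t u) -> s = t.
Proof. by move=> h; apply: val_inj; apply/funext. Qed.
Lemma cvalB V (s t : csect V) u : cval (s - t) u = cval s u - cval t u.
Proof. by rewrite -[cval (s - t)]/(val (s - t)). Qed.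

Lemma cconst_subproof V (c : K) (hc : forall t, pts V t -> cs_O X t c) :
  (fun=> c) \in cpred V.
Proof. by apply/cpredP; split=> // -[t ht]; apply: hc. Qed.
Definition cconst V c hc : csect V := CSect (@cconst_subproof V c hc).

Lemma cfun_res_subproof U V (h : V `<=` U) (s : csect U) :
  ((fun t => cval s (exist _ (sval t) (h _ (svalP t)))) : cfun V) \in cpred V.
Proof.
apply/cpredP; split=> [t u|t]; [apply: cvalE|apply: (cvalO s (exist _ _ _))].
Qed.
Definition cres_fun U V (h : V `<=` U) (s : csect U) : csect V := CSect (cfun_res_subproof h s).

Fact cres_zmod U V (h : V `<=` U) : zmod_morphism (cres_fun h).
Proof. move=> s t; apply: csect_eq => u. apply: (cvalB s t). Qed.
Fact cres_monoid U V (h : V `<=` U) : monoid_morphism (cres_fun h).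
Proof. by split=> [|s t]; apply: csect_eq => u. Qed.
HB.instance Definition _ U V h :=
  GRing.isZmodMorphism.Build (csect U) (csect V) (cres_fun h) (cres_zmod h).
HB.instance Definition _ U V h :=
  GRing.isMonoidMorphism.Build (csect U) (csect V) (cres_fun h) (cres_monoid h).

Definition cres U V (h : V `<=` U) : {rmorphism csect U -> csect V} := cres_fun h.

Lemma cresE U V (h : V `<=` U) s t u : cval (cres h s) t = cval s u.
Proof. exact: (cvalE s). Qed.

Lemma cres_id U (h : U `<=` U) s : cres h s = s.
Proof. apply: csect_eq => t; apply: cresE. Qed.

Lemma cres_comp U V W (hUV : V `<=` U) (hVW : W `<=` V) (hUW : W `<=` U) s :
  cres hVW (cres hUV s) = cres hUW s.
Proof. apply: csect_eq => t; apply: (cvalE s). Qed.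

Lemma csheaf (I : Type) U (V : I -> opens X) (hV : forall i, V i `<=` U) :
  U `<=` \bigcup_i V i -> forall s : (forall i, csect (V i)),
  (forall i j W (hi : W `<=` V i) (hj : W `<=` V j), cres hi (s i) = cres hj (s j)) ->
  exists! t : csect U, forall i, cres (hV i) t = s i.
Proof.
move=> cov s hs.
(* Any two nonempty members of the covering share the generic point, so the given constants are all
   equal. *)
have agree i j t u : cval (s i) t = cval (s j) u.
  have hi : pts (V i) (cs_eta X) := cs_gen (pts_open (V i)) (svalP t).
  have hj : pts (V j) (cs_eta X) := cs_gen (pts_open (V j)) (svalP u).
  have := hs i j (opensI (V i) (V j)) (@opensIl _ _ _) (@opensIr _ _ _).
  move/(congr1 (fun f => @cval (opensI (V i) (V j)) f (exist _ (cs_eta X) (conj hi hj)))).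
  by rewrite (cresE _ _ _ t) (cresE _ _ _ u).
have pick (t : {t : X | pts U t}) : exists c, exists i (u : {u | pts (V i) u}), sval u = sval t /\ c = cval (s i) u.
  case: t => t Ut; have [i _ hi] := cov t Ut.
  by exists (cval (s i) (exist _ t hi)), i, (exist _ t hi).
have [f hf] := choice pick.
have fP : f \in cpred U.
  apply/cpredP; split=> [t u|t].
    by have [i [t' [_ ->]]] := hf t; have [j [u' [_ ->]]] := hf u.
  have [i [t' [<- ->]]] := hf t; apply: cvalO.
exists (CSect fP); split.
  move=> i; apply: csect_eq => t /=.
  by have [j [u [_ E]]] := hf (exist _ (sval t) (hV i (sval t) (svalP t))); rewrite E.
move=> g hg; apply: csect_eq => t /=; have [i [u [E ->]]] := hf t.
rewrite -(hg i); apply: cresE.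
Qed.

Definition cringed : ringedSpace := RingedSpace cres_id cres_comp csheaf.

Definition cvalue_fun V t (ht : pts V t) (s : csect V) : K := cval s (exist _ t ht).
Fact cvalue_zmod V t (ht : pts V t) : zmod_morphism (cvalue_fun ht).
Proof. by move=> a. Qed.
Fact cvalue_monoid V t (ht : pts V t) : monoid_morphism (cvalue_fun ht).
Proof. by split=> [|a b]. Qed.
HB.instance Definition _ V t (ht : pts V t) :=
  GRing.isZmodMorphism.Build (csect V) K (cvalue_fun ht) (cvalue_zmod ht).
HB.instance Definition _ V t (ht : pts V t) :=
  GRing.isMonoidMorphism.Build (csect V) K (cvalue_fun ht) (cvalue_monoid ht).
Definition cvalue V t (ht : pts V t) : {rmorphism csect V -> K} := cvalue_fun ht.

Lemma cvalueE V t (ht : pts V t) (s : csect V) u : cvalue ht s = cval s u.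
Proof. exact: cvalE. Qed.

Lemma cstalk (t : X) : exists psi : {rmorphism @stalk cringed t -> K},
  [/\ forall V (ht : pts V t) s, psi (@germ cringed t V ht s) = cvalue ht s,
      injective psi & forall a, cs_O X t (psi a)].
Proof.
have [|psi hpsi] := @stalk_lift cringed t K (fun V ht => cvalue ht).
  move=> U V hU hV i s; apply: (cvalE s).
exists psi; split=> //.
  move=> a b; have [U [hU [s [s' [-> ->]]]]] := germ_surj2 a b; rewrite !hpsi => E.
  congr germ; apply: csect_eq => u.
  by rewrite -(cvalueE hU) -[RHS](cvalueE hU).
move=> a; have [U [hU [s ->]]] := germ_surj a; rewrite hpsi; apply: (cvalO s (exist _ _ _)).
Qed.

Definition cunit (t : X) (c : K) := kunit (cs_O X t) c.

(** A criterion for [is_affine] that mentions only subsets of K, with B the ring of functions on V.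
    It serves for integral closed subschemes and for the spectra with one and two points. *)
Lemma caffine V : pts V (cs_eta X) ->
  (forall t a b, pts V t -> cs_O X t a -> cs_O X t b -> ~ cunit t a -> ~ cunit t b -> ~ cunit t (a + b)) ->
  let B : set K := [set c | forall t, pts V t -> cs_O X t c] in
  (forall f, B f -> open [set t | pts V t /\ cunit t f]) ->
  (forall (W : set X) t, open W -> W t -> pts V t -> exists f, [/\ B f, cunit t f &
     forall u, pts V u -> cunit u f -> W u]) ->
  (forall f c, B f -> f != 0 -> (forall t, pts V t -> cunit t f -> cs_O X t c) ->
     exists n : nat, B (c * f ^+ n)) ->
  (forall t u, pts V t -> pts V u -> (forall f, B f -> cunit t f <-> cunit u f) -> t = u) ->
  (forall P : set K, P `<=` B -> P 0 -> (forall a b, P a -> P b -> P (a + b)) ->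
     (forall a b, B a -> P b -> P (a * b)) -> ~ P 1 ->
     (forall a b, B a -> B b -> P (a * b) -> P a \/ P b) ->
     exists2 t, pts V t & forall f, B f -> P f <-> ~ cunit t f) ->
  is_affine (X := cringed) V.
Proof.
move=> Veta loc B Dopen basis locz inj sur.
have sO t : subring (cs_O X t) by split; [apply: cs_O1|apply: cs_OB|apply: cs_OM].
pose v : csect V -> K := cvalue Veta.
have vB s : B (v s).
  move=> t ht; rewrite /v (cvalueE Veta s (exist _ t ht)); apply: (cvalO s (exist _ _ _)).
have vinj : injective v.
  by move=> s s' E; apply: csect_eq => t; rewrite -(cvalueE Veta) -[RHS](cvalueE Veta).
have vsur c : B c -> exists s, v s = c by move=> hc; exists (cconst hc).
exists (fun t => [set s | ~ cunit t (v s)]) => /=.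
split.
- split=> [t ht|t u|P pP].
  + split; first split=> /=.
    * by rewrite /v => -[]; rewrite eqxx.
    * by move=> b nb; apply: loc => //; apply: vB.
    * by move=> c a na hca; apply: na; move: hca; rewrite /v rmorphM mulrC; apply: (kunitMl (sO t)); apply: vB.
    * by apply; apply: kunit1.
    * move=> a b; rewrite /= /v rmorphM => nab; apply: contrapT => /not_orP[/contrapT na /contrapT nb].
      by apply: nab; apply: (kunitM).
  + rewrite !inE => ht hu E; apply: inj => // f /vsur[s <-].
    have Es : (~ cunit t (v s)) = (~ cunit u (v s)) := congr1 (fun S : set (csect V) => S s) E.
    by split=> h; apply: contrapT; [rewrite -Es|rewrite Es].
  + have [hP P1 Pp] := pP.
    have [||||||t ht hPt] := sur (v @` P).
    * by move=> _ [s _ <-].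
    * by exists 0; [apply: (idl0 hP)|rewrite /v rmorph0].
    * by move=> _ _ [a ha <-] [b hb <-]; exists (a + b); [apply: (idlD hP)|rewrite /v rmorphD].
    * by move=> _ _ /vsur[a <-] [b hb <-]; exists (a * b); [apply: (idlM _ hP)|rewrite /v rmorphM].
    * by move=> [s hs] E; apply: P1; rewrite (_ : 1 = s) //; apply: vinj.
    * move=> _ _ /vsur[a <-] /vsur[b <-] [s hs E].
      have : P (a * b) by rewrite (_ : a * b = s) //; apply: vinj.
      by move/Pp => [h|h]; [left; exists a|right; exists b].
    * exists t => //; apply/seteqP; split=> s.
        by move/(hPt (v s) (vB s)).2 => [s' hs' /vinj <-].
      by move=> hs; apply: (hPt (v s) (vB s)).1.
- move=> f; have := Dopen (v f) (vB f); congr open; apply/seteqP; split=> t [h1 h2]; split=> //.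
  exact: contrapT.
- move=> W t oW Wt Vt; have [_ [/vsur[s <-] h1 h2]] := basis W t oW Wt Vt.
  exists s; split; first split=> //.
  by move=> u [Vu /contrapT hu]; apply: h2.
- move=> f W hW EW.
  have DW t : pts W t <-> pts V t /\ cunit t (v f).
    rewrite EW /=; split=> -[h1 h2]; split=> //; exact: contrapT.
  (* D(0) is empty and carries the zero ring, which is the localization at 0. *)
  have [f0|nf] := eqVneq (v f) 0.
    have nW t : ~ pts W t by move/DW => [_ [/negP]]; rewrite f0.
    have (a b : csect W) : a = b by apply: csect_eq => -[t ht]; case: (nW t ht).
    split; first by exists 0.
      by move=> b; exists 0, 0%N.
    by move=> a _; exists 1%N; rewrite (_ : f = 0) ?mul0r //; apply: vinj.
  have Weta : pts W (cs_eta X) by apply/DW; split=> //; split=> //; apply: cs_OE.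
  pose w : csect W -> K := cvalue Weta.
  have winj : injective w.
    by move=> s s' E; apply: csect_eq => t; rewrite -(cvalueE Weta) -[RHS](cvalueE Weta).
  have wres a : w (cres hW a) = v a by apply: (cvalE a).
  have wM a b : w (a * b) = w a * w b by rewrite /w.
  have wX a n : w (a ^+ n) = w a ^+ n by rewrite /w rmorphXn.
  split.
  + have hc t : pts W t -> cs_O X t (v f)^-1 by move=> /DW[_ []].
    exists (cconst hc); apply: winj; rewrite wM wres.
    by rewrite mulfV.
  + move=> b; have [|n] := locz (v f) (w b) (vB f) nf.
      move=> t ht u; have Wt : pts W t by apply/DW.
      rewrite /w (cvalueE Weta b (exist _ t Wt)); apply: (cvalO b (exist _ _ _)).
    move/vsur => [a Ea]; exists a, n; apply: winj.
    by rewrite wM wX !wres.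
  + exists 0%N; rewrite mul1r; apply: vinj.
    by rewrite -wres (_ : cres hW a = 0).
Qed.

End CSpace.
Arguments cpred : clear implicits.

(** * Affine charts and local rings *)

Lemma is_unitM (A : comPzRingType) (a b : A) : is_unit (a * b) <-> is_unit a /\ is_unit b.
Proof.
split=> [[c hc]|[[c hc] [d hd]]].
  by split; [exists (b * c); rewrite mulrA|exists (a * c); rewrite mulrA (mulrC b)].
by exists (c * d); rewrite mulrACA hd mulr1.
Qed.

Lemma is_unitX (A : comPzRingType) (a : A) n : is_unit a -> is_unit (a ^+ n).
Proof.
move=> ua; elim: n => [|n IH]; first by exists 1; rewrite mulr1.
by rewrite exprS; apply/is_unitM.
Qed.

Lemma rmorph_is_unit (A B : comPzRingType) (f : {rmorphism A -> B}) a :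
  is_unit a -> is_unit (f a).
Proof. by move=> [b hb]; exists (f b); rewrite -rmorphM hb rmorph1. Qed.

Section Chart.
Variables (X : ringedSpace) (V : opens X) (h : X -> set (sect V)).

(** The condition of [is_affine] for a fixed h, so that the prime [h t] of a point t can be
    named. *)
Definition chart : Prop :=
  let D f := [set x | pts V x /\ ~ h x f] in
    [/\ set_bij V (@is_prime (sect V)) h,
        forall f, open (D f),
        forall (W : set X) x, open W -> W x -> pts V x ->
          exists f, D f x /\ D f `<=` W
      & forall f (W : opens X) (hW : W `<=` V), pts W = D f ->
          is_localization_away (res hW) f].
Hypothesis ch : chart.

Lemma chart_prime t : pts V t -> is_prime (h t).
Proof. have [[hf _ _] _ _ _] := ch; apply: hf. Qed.

Lemma chart_inj t u : pts V t -> pts V u -> h t = h u -> t = u.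
Proof. by have [[_ hi _] _ _ _] := ch; move=> ht hu; apply: hi; rewrite inE. Qed.

Lemma chart_surj P : is_prime P -> exists2 t, pts V t & h t = P.
Proof. by have [[_ _ hs] _ _ _] := ch; move=> /hs[t]; exists t. Qed.

Lemma chart_open f : open [set x | pts V x /\ ~ h x f].
Proof. by have [_ hD _] := ch. Qed.

Definition chartD f : opens X := Opens (chart_open f).

Lemma chartD_sub f : chartD f `<=` V. Proof. by move=> t []. Qed.

Lemma chartD_loc f : is_localization_away (res (@chartD_sub f)) f.
Proof. by have [_ _ _ loc] := ch; apply: loc. Qed.

Lemma chart_basis (W : opens X) t : pts W t -> pts V t ->
  exists2 f, pts (chartD f) t & chartD f `<=` W.
Proof.
have [_ _ bas _] := ch => Wt Vt.
by have [f [hf sub]] := bas _ t (pts_open W) Wt Vt; exists f.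
Qed.

Lemma chart_unit t (Vt : pts V t) s : is_unit (germ Vt s) <-> ~ h t s.
Proof.
have [hI h1 hM] := chart_prime Vt; split.
  move=> [b hb] hs; have [W [Wt [s' E]]] := germ_surj b.
  move: hb; rewrite E -(rmorph1 (germ Wt)).
  have Wt' : pts (opensI V W) t by [].
  rewrite -(germ_res Vt Wt' (@opensIl _ V W)) -(germ_res Wt Wt' (@opensIr _ V W)).
  rewrite rmorph1 -rmorphM -(rmorph1 (germ Wt')) => /germP[W' [W't [i [j]]]].
  rewrite rmorphM rmorph1 => E'.
  have [f ft fW] := chart_basis W't Vt.
  have [[u hu] hfr hker] := chartD_loc f.
  have [a [n ha]] := hfr (res (subset_trans fW i) (res (@opensIr _ V W) s')).
  have Es : res (@chartD_sub f) s = res fW (res i (res (@opensIl _ V W) s)).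
    have kk : chartD f `<=` opensI V W := subset_trans fW i.
    by rewrite (res_comp i fW kk) (res_comp _ _ (@chartD_sub f)).
  have E2 : res (@chartD_sub f) s * res (subset_trans fW i) (res (@opensIr _ V W) s') = 1.
    by rewrite Es -(res_comp i fW) -rmorphM E' !rmorph1.
  have : res (@chartD_sub f) (s * a - f ^+ n) = 0.
    by rewrite rmorphB rmorphM rmorphXn -ha mulrA E2 mul1r subrr.
  move=> /hker[m]; rewrite mulrBr => /eqP; rewrite subr_eq0 => /eqP Ef.
  have hmn : h t (f ^+ (m + n)) by rewrite exprD -Ef; apply: (idlM _ hI); exact: (idlMr _ hI).
  case: ft => _; apply; apply: (primeX (chart_prime Vt) hmn).
move=> hs; have Dt : pts (chartD s) t by [].
have [us _ _] := chartD_loc s.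
by rewrite -(germ_res Vt Dt (@chartD_sub s)); apply: rmorph_is_unit.
Qed.

Lemma chart_frac t (Vt : pts V t) (a : stalk t) :
  exists s f, ~ h t f /\ a * germ Vt f = germ Vt s.
Proof.
have [W [Wt [s' ->]]] := germ_surj a.
have [f ft fW] := chart_basis Wt Vt.
have [_ hfr _] := chartD_loc f; have [b [n hb]] := hfr (res fW s').
exists b, (f ^+ n); split; first by case: ft => _ nf /(primeX (chart_prime Vt)).
rewrite -(germ_res Wt ft fW) -!(germ_res Vt ft (@chartD_sub f)) -rmorphM.
by rewrite rmorphXn hb.
Qed.

Lemma chart_ker t (Vt : pts V t) s : germ Vt s = 0 -> exists2 f, ~ h t f & f * s = 0.
Proof.
rewrite -(rmorph0 (germ Vt)) => /germP[W [Wt [i [j]]]]; rewrite rmorph0 => E.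
have [f ft fW] := chart_basis Wt Vt.
have [_ _ hker] := chartD_loc f; have [|n hn] := hker s.
  by rewrite -(res_comp i fW) E rmorph0.
by exists (f ^+ n) => //; case: ft => _ nf /(primeX (chart_prime Vt)).
Qed.

Lemma chart_special y t : pts V y -> pts V t ->
  (forall W : set X, open W -> W t -> W y) <-> h y `<=` h t.
Proof.
move=> Vy Vt; split=> [sp s hs|hyt W oW Wt].
  by apply: contrapT => nh; have [] := sp _ (chart_open s).
have [_ _ bas _] := ch; have [f [[_ hf] sub]] := bas W t oW Wt Vt.
by apply: sub; split=> // /hyt.
Qed.

End Chart.

Lemma scheme_chart (X : scheme) (x : X) : exists (V : opens X) h, pts V x /\ @chart X V h.
Proof. by have [V [Vx [h hh]]] := scheme_affine x; exists V, h. Qed.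

Lemma stalk_local (X : scheme) (x : X) : is_local_ring (stalk x) /\ ~ nonunits (1 : stalk x).
Proof.
have [V [h [Vx ch]]] := scheme_chart x; have [hI hM] := chart_prime ch Vx.
have : is_unit (1 : stalk x) by exists 1; rewrite mulr1.
split; last by [].
have : ~ is_unit (0 : stalk x).
  rewrite -(rmorph0 (germ Vx)) => /(chart_unit ch Vx); apply; exact: (idl0 hI).
split=> //.
- move=> a b na nb.
  have [s [f [hf E]]] := chart_frac ch Vx a; have [s' [f' [hf' E']]] := chart_frac ch Vx b.
  have ns : h x s by apply: contrapT => /(chart_unit ch Vx); rewrite -E => /is_unitM[].
  have ns' : h x s' by apply: contrapT => /(chart_unit ch Vx); rewrite -E' => /is_unitM[].
  move=> uab; have : is_unit ((a + b) * (germ Vx f * germ Vx f')).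
    by apply/is_unitM; split=> //; apply/is_unitM; split; apply/(chart_unit ch Vx).
  rewrite mulrDl mulrA E (mulrC (germ Vx f)) mulrA E' -!rmorphM -rmorphD.
  by move/(chart_unit ch Vx); apply; apply: (idlD hI); apply: (idlMr _ hI).
- by move=> c a na /is_unitM[].
Qed.

(** * Morphisms of schemes *)

Lemma rmorph_ext (A B : comPzRingType) (f g : {rmorphism A -> B}) : (forall a, f a = g a) -> f = g.
Proof.
move=> E; have {}E : (f : A -> B) = g by apply/funext.
case: f g E => f [[f1] [f2]] [g [[g1] [g2]]] /= E; subst.
by rewrite (Prop_irrelevance f1 g1) (Prop_irrelevance f2 g2).
Qed.

Lemma mor_ext (X Y : scheme) (f g : scheme_mor X Y) : (forall x, f x = g x) ->
  (forall V s (i : opens_preim (mor_cont g) V `<=` opens_preim (mor_cont f) V),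
    res i (mor_sect f V s) = mor_sect g V s) -> f = g.
Proof.
move=> E; have {}E : (f : X -> Y) = g by apply/funext.
case: f g E => f fc fs fr fl [g gc gs gr gl] /= E; subst.
have E := Prop_irrelevance fc gc; subst => Es.
have E : fs = gs.
  apply: functional_extensionality_dep => V; apply: rmorph_ext => s.
  by rewrite -(Es V s (@subset_refl _ _)) res_id.
subst gs; congr SchemeMor; exact: Prop_irrelevance.
Qed.

(* [pi] is typically the residue map of the point [eta]. *)
Definition gval (X : ringedSpace) (eta : X) (K : comPzRingType) (pi : {rmorphism stalk eta -> K})
  (V : opens X) (Ve : pts V eta) : {rmorphism sect V -> K} := pi \o germ Ve.

Section Mor.
Variables (T : cspace) (X : scheme) (psi : T -> X).
Variable pi : {rmorphism stalk (psi (cs_eta T)) -> cs_K T}.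
Hypothesis psi_cont : continuous psi.
Hypothesis aff : forall x : cringed T, exists U : opens (cringed T), pts U x /\ is_affine U.
Hypothesis piO : forall t (V : opens X) (Vt : pts V (psi t)) (Ve : pts V (psi (cs_eta T))) s,
  cs_O T t (gval pi Ve s).
Hypothesis pi_local : forall t (V : opens X) (Vt : pts V (psi t)) (Ve : pts V (psi (cs_eta T))) s,
  cunit t (gval pi Ve s) -> is_unit (germ Vt s).

Let Vgen (V : opens X) t : pts V (psi t) -> pts V (psi (cs_eta T)).
Proof. by move=> Vt; apply: (cs_gen (pts_open (opens_preim psi_cont V)) Vt). Qed.

Fact cmor_subproof (V : opens X) (s : sect V) :
  (fun t => gval pi (Vgen (svalP t)) s) \in cpred T (opens_preim psi_cont V).
Proof.
apply/cpredP; split=> [t u|t]; last exact: piO (svalP t) _ _.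
by rewrite (Prop_irrelevance (Vgen (svalP t)) (Vgen (svalP u))).
Qed.

Definition cmor_fun V s : csect (opens_preim psi_cont V) := CSect (cmor_subproof s).

Fact cmor_zmod V : zmod_morphism (@cmor_fun V).
Proof. by move=> a b; apply: csect_eq => u; rewrite /= !rmorphB. Qed.
Fact cmor_monoid V : monoid_morphism (@cmor_fun V).
Proof. by split=> [|a b]; apply: csect_eq => u; rewrite /= ?rmorph1 ?rmorphM. Qed.
HB.instance Definition _ V :=
  GRing.isZmodMorphism.Build (sect V) (csect (opens_preim psi_cont V)) (@cmor_fun V) (@cmor_zmod V).
HB.instance Definition _ V :=
  GRing.isMonoidMorphism.Build (sect V) (csect (opens_preim psi_cont V)) (@cmor_fun V) (@cmor_monoid V).

Definition cscheme : scheme := Scheme aff.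

Definition cmor_sect (V : opens X) : {rmorphism sect V -> @sect cscheme (opens_preim psi_cont V)} :=
  @cmor_fun V.

Lemma cmor_res (V W : opens X) (h : W `<=` V)
  (h' : opens_preim psi_cont W `<=` opens_preim psi_cont V) s :
  cmor_sect W (res h s) = @res cscheme _ _ h' (cmor_sect V s).
Proof.
apply: (@csect_eq T) => u.
congr (pi _); apply: germ_res.
Qed.

Lemma cmor_local (t : cscheme) (V : opens X) (Vt : pts V (psi t)) (s : sect V) :
  is_unit (@germ cscheme t (opens_preim psi_cont V) Vt (cmor_sect V s)) -> is_unit (germ Vt s).
Proof.
have [v [vE vinj vO]] := cstalk t.
move=> [b /(congr1 v)]; rewrite rmorphM rmorph1 vE => E.
have Ve := Vgen Vt.
have Ev : cvalue (V := opens_preim psi_cont V) Vt (cmor_sect V s) = gval pi Ve s.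
  by rewrite /= (Prop_irrelevance (Vgen _) Ve).
apply: (@pi_local t V Vt Ve); rewrite Ev in E; split; last 2 first.
- exact: piO.
- suff <- : v b = (gval pi Ve s)^-1 by [].
  have nz : gval pi Ve s != 0 by apply/eqP => E0; move: E; rewrite E0 mul0r => /esym/eqP; rewrite oner_eq0.
  by rewrite -[RHS]mulr1 -E mulKf.
- by apply/eqP => E0; move: E; rewrite E0 mul0r => /esym/eqP; rewrite oner_eq0.
Qed.

(** A morphism out of such a space amounts to a map of points together with the values of sections
    at the generic point. *)
Lemma cmorP : exists f : scheme_mor cscheme X,
  [/\ mor_fun f = psi
    & forall (V : opens X) s u (Ve : pts V (psi (cs_eta T))),
      @cval T (opens_preim (mor_cont f) V) (mor_sect f V s) u = gval pi Ve s].
Proof.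
exists (@SchemeMor cscheme X psi psi_cont cmor_sect cmor_res cmor_local); split=> // V s u Ve /=.
by rewrite (Prop_irrelevance (Vgen _) Ve).
Qed.

End Mor.

(** * Integral closed subschemes *)

Section ClosedSub.
Variables (X : scheme) (eta : X) (K : fieldType) (pi : {rmorphism stalk eta -> K}).
Hypothesis pi_surj : forall c, exists a, pi a = c.
Hypothesis pi_ker : forall a, pi a = 0 <-> nonunits a.

(** The point t is a specialization of eta. *)
Definition spec (t : X) := forall W : opens X, pts W t -> pts W eta.

(** For t a specialization of eta, the local ring at t of the reduced closure of eta, inside the
    residue field K of eta. *)
Definition Oring (t : X) : set K :=
  [set c | exists (V : opens X) (Vt : pts V t) (Ve : pts V eta) s, gval pi Ve s = c].

Lemma spec_closure t : closure [set eta] t <-> spec t.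
Proof.
split=> [ht W Wt|ht W].
  have [_ [<- //]] := ht W (open_nbhs_nbhs (conj (pts_open W) Wt)).
rewrite nbhsE => -[U [oU Ut] UW]; exists eta; split=> //; apply: UW.
exact: (ht (Opens oU)).
Qed.

Lemma gval_res (V W : opens X) (Ve : pts V eta) (We : pts W eta) (i : W `<=` V) s :
  gval pi We (res i s) = gval pi Ve s.
Proof. by rewrite /= germ_res. Qed.

(** The stalk of X maps onto the local ring of the closure of eta. Units are reflected: if be(b)
    be(a) = 1 and a is a nonunit, then 1 - ba is a unit of the stalk with image 0. *)
Lemma stalk_value t : spec t -> exists be : {rmorphism stalk t -> K},
  [/\ forall (V : opens X) (Vt : pts V t) (Ve : pts V eta) s, be (germ Vt s) = gval pi Ve s,
      range be = Oring t & forall a, kunit (Oring t) (be a) -> is_unit a].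
Proof.
move=> ht; have [|be hbe] := @stalk_lift X t K (fun V Vt => gval pi (ht V Vt)).
  move=> U V i s; apply: gval_res.
have beE (V : opens X) (Vt : pts V t) (Ve : pts V eta) s : be (germ Vt s) = gval pi Ve s.
  by rewrite hbe (Prop_irrelevance (ht V Vt) Ve).
have rbe : range be = Oring t.
  apply/seteqP; split=> [_ [a _ <-]|_ [V [Vt [Ve [s <-]]]]].
    have [V [Vt [s ->]]] := germ_surj a; have Ve := ht V Vt.
    by exists V, Vt, Ve, s.
  by exists (germ Vt s).
exists be; split=> // a [na _]; rewrite -rbe => -[b _ Eb]; apply: contrapT => nua.
have [l1 n1] := stalk_local t.
have [c hc] : is_unit (1 - b * a).
  by apply: contrapT => nu; apply: n1; rewrite -(subrK (b * a) 1); apply: (idlD l1) => //; apply: (idlM _ l1).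
move/(congr1 be): hc; rewrite rmorphM rmorphB rmorph1 rmorphM Eb mulVf // subrr mul0r.
by move=> /esym/eqP; rewrite oner_eq0.
Qed.

Lemma Oring_subring t : spec t -> subring (Oring t).
Proof. move=> /stalk_value[be [_ <- _]]; apply: range_subring. Qed.

Lemma Oring_local t : spec t -> klocal (Oring t).
Proof.
move=> ht; have [be [_ rbe bu]] := stalk_value ht; have [hI _] := stalk_local t.
have ub a : is_unit a -> kunit (Oring t) (be a).
  move=> [b hb]; have E : be a * be b = 1 by rewrite -rmorphM hb rmorph1.
  have : be a != 0 by apply/eqP => E0; move: E; rewrite E0 mul0r => /esym/eqP; rewrite oner_eq0.
  split=> //; rewrite -rbe; first by exists a.
  by exists b => //; rewrite -[RHS]mulr1 -E mulKf.
move=> a b; rewrite -{1 2}rbe => -[a' _ <-] [b' _ <-] na nb; rewrite -rmorphD => /bu.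
by apply: (idlD hI); move=> /ub.
Qed.

Lemma spec_eta : spec eta. Proof. by []. Qed.

Lemma Oring_eta c : Oring eta c.
Proof.
have [a <-] := pi_surj c; have [V [Ve [s ->]]] := germ_surj a.
by exists V, Ve, Ve, s.
Qed.

Lemma Oring_frac c t : spec t -> exists a b, [/\ Oring t a, Oring t b, b != 0 & c * b = a].
Proof.
move=> ht; have [V [h [Vt ch]]] := scheme_chart t; have Ve := ht V Vt.
have [a Ea] := pi_surj c; have [s [f [hf E]]] := chart_frac ch Ve a.
exists (gval pi Ve s), (gval pi Ve f); split; [by exists V, Vt, Ve, s|by exists V, Vt, Ve, f| |].
  by apply/eqP /pi_ker; apply; apply/(chart_unit ch Ve).
by rewrite -Ea -rmorphM E.
Qed.

Section ChartAt.
Variables (V : opens X) (h : X -> set (sect V)).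
Hypothesis ch : chart h.
Variable Ve : pts V eta.
Local Notation val := (gval pi Ve).

Lemma chart_val0 s : val s = 0 <-> h eta s.
Proof.
rewrite pi_ker; split=> [n|hs /(chart_unit ch Ve)//].
by apply: contrapT => ns; apply: n; apply/(chart_unit ch Ve).
Qed.

Lemma chart_spec t : pts V t -> spec t <-> h eta `<=` h t.
Proof.
move=> Vt; rewrite -(chart_special ch Ve Vt); split=> sp W.
  by move=> oW Wt; apply: (sp (Opens oW)).
apply: sp; apply: pts_open.
Qed.

Lemma chart_Oring t s : pts V t -> Oring t (val s).
Proof. by move=> Vt; exists V, Vt, Ve, s. Qed.

Lemma chart_kunit t s : pts V t -> spec t -> kunit (Oring t) (val s) <-> ~ h t s.
Proof.
move=> Vt ht; have [be [beE rbe bu]] := stalk_value ht.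
rewrite -(chart_unit ch Vt) -(beE V Vt Ve); split=> [/bu//|[b hb]].
have E : be (germ Vt s) * be b = 1 by rewrite -rmorphM hb rmorph1.
have : be (germ Vt s) != 0 by apply/eqP => E0; move: E; rewrite E0 mul0r => /esym/eqP; rewrite oner_eq0.
split=> //; rewrite -rbe; first by exists (germ Vt s).
by exists b => //; rewrite -[RHS]mulr1 -E mulKf.
Qed.

Lemma chart_Ofrac t c : pts V t -> spec t -> Oring t c ->
  exists s f, ~ h t f /\ c * val f = val s.
Proof.
move=> Vt ht; have [be [beE rbe bu]] := stalk_value ht.
rewrite -rbe => -[a _ <-]; have [s [f [hf E]]] := chart_frac ch Vt a.
by exists s, f; rewrite -!(beE V Vt Ve) -rmorphM E.
Qed.

Lemma chart_point (P : set (sect V)) : is_prime P -> h eta `<=` P ->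
  exists t, [/\ pts V t, spec t & h t = P].
Proof.
move=> /(chart_surj ch)[t Vt <-] s; exists t; split=> //; exact/(chart_spec Vt).
Qed.

(* If [c] is not a quotient by a power of [f], a maximal ideal of the sections over D(f)
   containing all denominators of [c] is a point where [c] is not defined. *)
Lemma chart_global f c : ~ h eta f ->
  (forall t, pts V t -> spec t -> ~ h t f -> Oring t c) -> exists n s, c * val f ^+ n = val s.
Proof.
move=> nf hc; pose W := chartD ch f; have We : pts W eta by [].
pose sWV : W `<=` V := @chartD_sub _ V h ch f; have [[u hu] hfr hker] := chartD_loc ch f.
have valr s : gval pi We (res sWV s) = val s by apply: gval_res.
pose I : set (sect W) := [set b | exists a, gval pi We b * c = gval pi We a].
have hI : is_ideal I.
  split; first by exists 0; rewrite !rmorph0 mul0r.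
    by move=> a b [a' ha] [b' hb]; exists (a' + b'); rewrite !rmorphD mulrDl ha hb.
  by move=> d a [a' ha]; exists (d * a'); rewrite !rmorphM -mulrA ha.
have [[a]|nI1] := pselect (I 1).
  rewrite rmorph1 mul1r => Ea; have [s [n E]] := hfr a; exists n, s.
  by rewrite Ea -!valr -E rmorphM rmorphXn.
have [M [pM sM _]] := exists_maximal hI nI1; have [iM M1 mM] := pM.
have [||t [Vt ht Et]] := @chart_point (res sWV @^-1` M).
- split; first split=> [|a b|d a] /=; rewrite ?rmorph0 ?rmorphD ?rmorphM.
  + exact: (idl0 iM).
  + exact: (idlD iM).
  + exact: (idlM _ iM).
  + by rewrite /= rmorph1.
  + move=> a b /=; rewrite rmorphM; apply: mM.
- move=> s /chart_val0 Es /=; apply: sM; exists 0; rewrite valr Es mul0r rmorph0 //.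
have hft : ~ h t f.
  rewrite Et => Mf; apply: M1; rewrite -hu; exact: (idlMr _ iM).
have [s [g [hg E]]] := chart_Ofrac Vt ht (hc t Vt ht hft).
by case: hg; rewrite Et /=; apply: sM; exists (res sWV s); rewrite !valr mulrC.
Qed.

End ChartAt.

Record ypt := Ypt { yval : X; yspec : spec yval }.
Arguments yspec : clear implicits.
HB.instance Definition _ := gen_eqMixin ypt.
HB.instance Definition _ := gen_choiceMixin ypt.

Lemma yval_inj : injective yval.
Proof. by move=> [a ha] [b hb] /= E; subst b; rewrite (Prop_irrelevance ha hb). Qed.

Definition ytop : topologicalType := initial_topology yval.
Definition yeta : ytop := Ypt spec_eta.

Lemma yopen (W : set ytop) : open W <-> exists2 U : set X, open U & yval @^-1` U = W.
Proof. by []. Qed.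

Fact ygen (V : set ytop) : open V -> forall t, V t -> V yeta.
Proof. by move=> [U oU <-] [t ht] Ut; apply: (ht (Opens oU)). Qed.

(** The reduced closed subscheme with generic point eta, its sections being constants of K. *)
Definition yspace : cspace := @CSpace ytop K (fun y => Oring (yval y)) yeta
  (fun y => let: And3 h _ _ := Oring_subring (yspec y) in h) Oring_eta
  (fun y => let: And3 _ h _ := Oring_subring (yspec y) in h)
  (fun y => let: And3 _ _ h := Oring_subring (yspec y) in h) ygen.

Lemma yaffine (x : cringed yspace) : exists U : opens (cringed yspace), pts U x /\ is_affine U.
Proof.
have [V [h [Vx ch]]] := scheme_chart (yval x); have Ve := yspec x V Vx.
have cont : continuous (yval : ytop -> X) by apply: initial_continuous.
exists (opens_preim cont V); split=> //.
have nf1 : ~ h eta 1 by case: (chart_prime ch Ve).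
have BP c : (forall t : ytop, pts V (yval t) -> Oring (yval t) c) -> exists s, gval pi Ve s = c.
  move=> hc; have [|n [s]] := @chart_global V h ch Ve 1 c nf1.
    by move=> t Vt ht _; apply: (hc (Ypt ht)).
  by rewrite rmorph1 expr1n mulr1 => ->; exists s.
have valO s (t : ytop) : pts V (yval t) -> Oring (yval t) (gval pi Ve s).
  apply: chart_Oring.
have unitP s (t : ytop) : pts V (yval t) -> kunit (Oring (yval t)) (gval pi Ve s) <-> ~ h (yval t) s.
  move=> Vt; apply: (chart_kunit ch) => //; apply: yspec.
apply: (@caffine yspace) => //.
- move=> t a b Vt; apply: Oring_local; apply: yspec.
- move=> f /BP[s <-]; exists (chartD ch s); first exact: pts_open.
  apply/seteqP; split=> t [Vt hs]; split=> //; first exact/(unitP s t Vt).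
  by have /(unitP s t Vt) := hs.
- move=> W t /yopen[U oU <-] Ut Vt; have [f [_ hf] sub] := chart_basis ch (W := Opens oU) Ut Vt.
  exists (gval pi Ve f); split; [by move=> Vu; apply: valO|exact/(unitP f t Vt)|].
  by move=> u Vu /(unitP f u Vu) hu; apply: (sub).
- move=> f c /BP[s <-] ns hc; have [||n [a E]] := @chart_global V h ch Ve s c.
  + by move/(chart_val0 ch Ve) => E; rewrite E eqxx in ns.
  + by move=> t Vt ht hs; apply: (hc (Ypt ht)) => //; apply/unitP.
  exists n => Vt; rewrite E; apply: valO.
- move=> t u Vt Vu E; apply: yval_inj; apply: (chart_inj ch Vt Vu).
  have key s : ~ h (yval t) s <-> ~ h (yval u) s.
    rewrite -(unitP s t Vt) -(unitP s u Vu); apply: E => Vw; exact: valO.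
  by apply/seteqP; split=> s hs; apply: contrapT => /key.
- move=> P PB P0 PD PM P1 Pp.
  have Bv s : forall t : ytop, pts V (yval t) -> Oring (yval t) (gval pi Ve s) by move=> t; apply: valO.
  have [||t [Vt ht Et]] := @chart_point V h ch Ve (gval pi Ve @^-1` P).
  + split; first split=> [|a b|d a] /=; rewrite ?rmorph0 ?rmorphD ?rmorphM //.
    * exact: PD.
    * apply: PM; apply: (Bv d).
    * by rewrite /= !rmorph1.
    * move=> a b /=; rewrite !rmorphM; apply: Pp; [apply: (Bv a)|apply: (Bv b)].
  + by move=> s /(chart_val0 ch Ve) /= ->.
  exists (Ypt ht) => // f /BP[s <-].
  split=> [hP|]; first by move/(unitP s (Ypt ht) Vt); rewrite Et.
  move=> nu; have : h t s by apply: contrapT => hs; apply: nu; apply/(unitP s (Ypt ht) Vt).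
  by rewrite Et.
Qed.

Definition yscheme : scheme := cscheme yaffine.

Lemma yembed : exists i : scheme_mor yscheme X, is_closed_immersion i /\ mor_fun i = yval.
Proof.
have cont : continuous (yval : ytop -> X) by apply: initial_continuous.
have [||i [Ei Es]] := @cmorP yspace X yval pi cont yaffine.
- by move=> t V Vt Ve s; apply: chart_Oring.
- move=> t V Vt Ve s; have [be [beE _ bu]] := stalk_value (yspec t).
  by rewrite -(beE _ Vt) => /bu.
exists i; split=> //; split.
- rewrite Ei; apply: yval_inj.
- move=> F cF; have /yopen[U oU EU] : open (~` (F : set ytop)) by apply: closed_openC.
  rewrite (_ : _ @` F = closure [set eta] `&` ~` U).
    by apply: closedI; [apply: closed_closure|apply: open_closedC].
  rewrite Ei; apply/seteqP; split=> [_ [t Ft <-]|t [/spec_closure ht nU]].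
    split; first apply/spec_closure/yspec.
    by move=> Ut; have : (~` F) t by rewrite -EU.
  exists (Ypt ht) => //; apply: contrapT => nF.
  have : (~` F) (Ypt ht) by [].
  by rewrite -EU.
- move=> y a; have [v [vE vinj vO]] := cstalk y.
  have [V [Vy [Ve [s E]]]] := vO a.
  have Vy' : pts V (i y) by rewrite Ei.
  exists V, Vy', s; apply: vinj.
  by rewrite vE -E (cvalueE _ _ (exist (fun t : yspace => pts (opens_preim (mor_cont i) V) t) y Vy')).
Qed.

Lemma yintegral : is_integral yscheme.
Proof.
split; first by exists yeta.
move=> U [y Uy]; have Ue : pts U yeta := ygen (pts_open U) Uy.
pose w : csect U -> K := cvalue Ue.
have winj : injective w.
  by move=> s s' E; apply: csect_eq => t; rewrite -(cvalueE Ue) -[RHS](cvalueE Ue).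
split=> [/(congr1 w)|s t /(congr1 w)].
  by rewrite /w => /eqP; rewrite oner_eq0.
rewrite /w rmorphM => /eqP; rewrite mulf_eq0 => /orP[] /eqP E; [left|right];
by apply: winj.
Qed.

Lemma yclosure : closure [set (yeta : yscheme)] = setT.
Proof.
apply/seteqP; split=> // y _ W; rewrite nbhsE => -[U [oU Uy] UW]; exists yeta; split=> //.
apply: UW; apply: (ygen oU Uy).
Qed.

(** Orders are read off inside K: only the function c is global, the numerator a and the denominator
    b may change from point to point. The last hypothesis, through [krull_dim1], makes every point
    of the support of z a point of codimension one. *)
Lemma principal_cycle (c : K) (z : X -> int) : c != 0 ->
  (forall y, spec y -> exists a b, [/\ a != 0, b != 0, Oring y a, Oring y b & a = b * c /\
     z y = (olen (Oring y) (kmulr (Oring y) a))%:Z - (olen (Oring y) (kmulr (Oring y) b))%:Z]) ->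
  (forall x, z x != 0 -> [/\ spec x, dim1 (Oring x) & exists2 f, f != 0 & Oring x f /\ ~ kunit (Oring x) f]) ->
  is_principal_cycle z.
Proof.
move=> c0 h1 h2; have [i [ci Ei]] := yembed.
have sv (y : yscheme) : exists v : {rmorphism stalk y -> K},
  [/\ forall (V : opens yscheme) (Vy : pts V y) s, v (germ Vy s) = cvalue Vy s,
   injective v & range v = Oring (yval y)].
  have [v [vE vinj vO]] := cstalk y; exists v; split=> //.
  apply/seteqP; split=> [_ [a _ <-]|_ [V [Vy [Ve [s <-]]]]]; first exact: vO.
  have cont : continuous (yval : ytop -> X) by apply: initial_continuous.
  pose s' : csect (X := yspace) (opens_preim cont V) :=
    @cconst yspace (opens_preim cont V) (gval pi Ve s) (fun t Vt => chart_Oring Ve s Vt).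
  by exists (@germ yscheme y (opens_preim cont V) Vy s').
have [ve [veE veinj rve]] := sv yeta.
have [g _ Eg] : range ve c by rewrite rve; apply: Oring_eta.
exists yscheme, i, yeta, g; split=> //; first exact: yintegral; first exact: yclosure.
  by move=> g0; move: c0; rewrite -Eg g0 rmorph0 eqxx.
split=> [y _|x nx]; last first.
  apply/eqP; apply: contrapT => /negP /h2[hx d1 nu]; apply: (nx (Ypt hx)); last by rewrite Ei.
  have [v [_ vinj rv]] := sv (Ypt hx); apply: (krull_dim1 vinj); rewrite rv //.
  exact: Oring_local.
have [v [vE vinj rv]] := sv y; have [a [b [a0 b0 Oa Ob [E Ez]]]] := h1 _ (yspec y).
have [sa _ Ea] : range v a by rewrite rv.
have [sb _ Eb] : range v b by rewrite rv.
have [U [Uy [s [t [Es Et]]]]] := germ_surj2 sa sb.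
have Ue : pts U yeta := ygen (pts_open U) Uy.
have gen (s1 : stalk y) : quo_length (ideal_gen [set s1]) = olen (Oring (yval y)) (kmulr (Oring (yval y)) (v s1)).
  rewrite -rv -olenE; last by apply: kideal_mulr; [apply: range_subring|exists s1].
  congr quo_length; apply/seteqP; split=> [x /gen1P[d ->] /=|x [_ [d _ <-]]].
    by exists (v d); [exists d|rewrite rmorphM].
  by rewrite -rmorphM => /vinj <-; apply/gen1P; exists d.
exists U, Uy, Ue, s, t; rewrite -Es -Et; split.
- by move=> s0; move: a0; rewrite -Ea s0 rmorph0 eqxx.
- by move=> s0; move: b0; rewrite -Eb s0 rmorph0 eqxx.
- apply: veinj; rewrite rmorphM Eg !veE.
  have E2 (q : csect U) : cvalue Ue q = cvalue Uy q by apply: (cvalE q).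
  by rewrite !E2 -!vE -Es -Et Ea Eb.
- by rewrite Ei !gen Ea Eb.
Qed.

End ClosedSub.

(** * Spectra of a field and of a one-dimensional local subring *)

Section CStruct.
Variables (T : cspace) (k : fieldType) (kap : {rmorphism k -> cs_K T}).
Hypothesis aff : forall x : cringed T, exists U : opens (cringed T), pts U x /\ is_affine U.
Hypothesis kapO : forall t c, cs_O T t (kap c).

Definition ckstruct_fun (c : k) : csect (opensT T) := cconst (fun t (_ : pts (opensT T) t) => kapO t c).
Fact ckstruct_zmod : zmod_morphism ckstruct_fun.
Proof. by move=> a b; apply: csect_eq => u; rewrite /= rmorphB. Qed.
Fact ckstruct_monoid : monoid_morphism ckstruct_fun.
Proof. by split=> [|a b]; apply: csect_eq => u; rewrite /= ?rmorph1 ?rmorphM. Qed.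
HB.instance Definition _ := GRing.isZmodMorphism.Build k (csect (opensT T)) ckstruct_fun ckstruct_zmod.
HB.instance Definition _ := GRing.isMonoidMorphism.Build k (csect (opensT T)) ckstruct_fun ckstruct_monoid.
Definition ckstruct : {rmorphism k -> @sect (cscheme aff) (opensT (cscheme aff))} := ckstruct_fun.
Definition ckscheme : kScheme k := KScheme ckstruct.
End CStruct.

(** The Sierpinski space, with [true] as generic and [false] as closed point. *)
Definition sier : Type := bool.
HB.instance Definition _ := Choice.on sier.
Definition sopen : set_system sier := [set U | U false -> U true].
Fact sopenT : sopen setT. Proof. by []. Qed.
Fact sopenI : setI_closed sopen.
Proof. by move=> U V hU hV [/hU ? /hV ?]. Qed.
Fact sopen_bigU (I : Type) (f : I -> set sier) : (forall i, sopen (f i)) -> sopen (\bigcup_i f i).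
Proof. by move=> h [i hi]; exists i => //; apply: h. Qed.
HB.instance Definition _ := isOpenTopological.Build sier sopenT sopenI sopen_bigU.

Lemma sier_open (U : set sier) : (U false -> U true) -> open U. Proof. by []. Qed.

Definition pt1 : Type := unit.
HB.instance Definition _ := Choice.on pt1.
Definition popen : set_system pt1 := setT.
Fact popenT : popen setT. Proof. by []. Qed.
Fact popenI : setI_closed popen. Proof. by []. Qed.
Fact popen_bigU (I : Type) (f : I -> set pt1) : (forall i, popen (f i)) -> popen (\bigcup_i f i).
Proof. by []. Qed.
HB.instance Definition _ := isOpenTopological.Build pt1 popenT popenI popen_bigU.

Section OnePoint.
Variable K : fieldType.

Definition fspace : cspace := @CSpace pt1 K (fun=> setT) tt (fun=> I) (fun=> I)
  (fun _ _ _ _ _ => I) (fun _ _ _ _ _ => I) (fun _ _ t => let: tt := t in id).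

Lemma faffine (x : cringed fspace) : exists U : opens (cringed fspace), pts U x /\ is_affine U.
Proof.
have fu (f : K) : f != 0 -> kunit setT f by [].
exists (opensT fspace); split=> //; apply: (@caffine fspace) => //.
- move=> t a b _ _ _ na nb; have z c : ~ cunit t c -> c = 0.
    by move=> nc; apply/eqP; apply: contrapT => /negP /fu.
  by rewrite (z _ na) (z _ nb) addr0 => -[/eqP].
- by move=> W [] _ Wt _; exists 1; split=> //; [apply: fu; apply: oner_neq0|case].
- by move=> f c _; exists 0%N.
- by move=> [] [].
- move=> P _ P0 _ PM P1 _; exists tt => // f _; split=> [Pf [n0 _ _]|nf].
    by apply: P1; rewrite -(mulVf n0); apply: PM.
  rewrite (_ : f = 0) //; apply/eqP; apply: contrapT => /negP n0; apply: nf; exact: fu.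
Qed.
End OnePoint.

Section TwoPoints.
Variables (K : fieldType) (E : set K).
Hypotheses (subE : subring E) (locE : klocal E) (dimE : dim1 E).
Hypothesis fracE : forall c, exists w v, [/\ E w, E v, v != 0 & c * v = w].
Hypothesis nfE : exists2 p, p != 0 & E p /\ ~ kunit E p.

Definition sO (b : sier) : set K := if b then setT else E.

Fact sO_subring b : subring (sO b). Proof. by case: b. Qed.
Fact sgen (V : set sier) : open V -> forall t, V t -> V true. Proof. move=> oV [] //. Qed.

Definition sspace : cspace := @CSpace sier K sO true
  (fun b => let: And3 h _ _ := sO_subring b in h) (fun=> I)
  (fun b => let: And3 _ h _ := sO_subring b in h)
  (fun b => let: And3 _ _ h := sO_subring b in h) sgen.

(** The nonunit p of [nfE] cuts out the open point. By [dimE] a nonzero prime contains a power of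
    every nonunit, so it is the prime of the closed point. *)
Lemma saffine (x : cringed sspace) : exists U : opens (cringed sspace), pts U x /\ is_affine U.
Proof.
have [E1 EB EM] := subE; have [p p0 [Ep np]] := nfE.
have fu (f : K) : f != 0 -> cunit (X := sspace) true f by [].
exists (opensT sspace); split=> //; apply: (@caffine sspace) => //.
- case=> a b _ /=; last exact: locE.
  move=> _ _ na nb; have z c : ~ cunit (X := sspace) true c -> c = 0.
    by move=> nc; apply/eqP; apply: contrapT => /negP /fu.
  by rewrite (z _ na) (z _ nb) addr0 => -[/eqP].
- by move=> f _ /=; move=> [_ [n0 _]].
- have u1 b : cunit (X := sspace) b 1 by apply: kunit1; apply: sO_subring.
  move=> W [] oW Wt _; last by exists 1; split=> // [[] _|[] _ _] //; [exact: _ Wt].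
  by exists p; split=> [[]//||[]//].
- move=> f c hf f0 hc; have Ef : E f by apply: (hf false).
  have [uf|nf] := pselect (kunit E f).
    by exists 0%N => -[] //_; rewrite mulr1; apply: (hc false).
  have [w [v [Ew Ev v0 Ec]]] := fracE c; have [n hn] := dimE Ev v0 Ef nf.
  exists n => -[] //_; rewrite (_ : c * f ^+ n = w * (f ^+ n / v)); first exact: EM.
  by rewrite -Ec -mulrA (mulrC v) divfK.
- have Bp t : pts (opensT sspace) t -> sO t p by case: t.
  move=> [] [] // _ _ /(_ p Bp) [h1 h2]; exfalso; apply: np.
    by apply: h1.
  by apply: h2.
- move=> P PB P0 PD PM P1 Pp; have BE c : E c -> forall t : sier, pts (opensT sspace) t -> sO t c by move=> ? [].
  have [[v Pv v0]|nv] := pselect (exists2 v, P v & v != 0); last first.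
    exists true => // f hf; split=> [Pf [f0 _ _]|nf]; first by apply: nv; exists f.
    by rewrite (_ : f = 0) //; apply/eqP; apply: contrapT => /negP /fu.
  have Ev : E v by apply: (PB v Pv false).
  exists false => // f hf; have Ef : E f by apply: (hf false).
  split=> [Pf [f0 _ hi]|nf].
    by apply: P1; rewrite -(mulVf f0); apply: PM => //; apply: BE.
  have [n hn] := dimE Ev v0 Ef nf.
  have Pn : P (f ^+ n) by rewrite -(divfK v0 (f ^+ n)); apply: PM => //; apply: BE.
  elim: n Pn {hn} => [|n IH]; first by rewrite expr0.
  by rewrite exprS => /Pp[||//|/IH//]; [apply: BE|apply: BE; apply: subringX].
Qed.
End TwoPoints.

(** * Separatedness *)

Local Notation pre f V := (opens_preim (mor_cont f) V).

Lemma mor_eq_sect (X Y : scheme) (f g : scheme_mor X Y) : f = g -> forall (V : opens Y) (s : sect V)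
    (W : opens X) (i : W `<=` pre f V) (j : W `<=` pre g V),
  res i (mor_sect f V s) = res j (mor_sect g V s).
Proof. by move=> -> V s W i j; rewrite (Prop_irrelevance i j). Qed.

Lemma comp_sectE (X Y Z : scheme) (g : scheme_mor Y Z) (f : scheme_mor X Y) (V : opens Z) s
    (h : pre (mor_comp g f) V `<=` pre f (pre g V)) :
  mor_sect (mor_comp g f) V s = res h (mor_sect f _ (mor_sect g V s)).
Proof. exact: mor_comp_sectE. Qed.

Lemma mor_compA (X Y Z T : scheme) (f : scheme_mor Z T) (g : scheme_mor Y Z) (h : scheme_mor X Y) :
  mor_comp f (mor_comp g h) = mor_comp (mor_comp f g) h.
Proof.
apply: mor_ext => // V s i.
pose U := pre h (pre g (pre f V)).
have k1 : pre (mor_comp (mor_comp f g) h) V `<=` U by [].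
have k2 : pre h (pre (mor_comp f g) V) `<=` U by [].
have k3 : pre (mor_comp f (mor_comp g h)) V `<=` U by [].
have k4 : pre (mor_comp f g) V `<=`
  pre g (pre f V) by [].
rewrite (@comp_sectE _ _ _ f (mor_comp g h) V s).
rewrite (@comp_sectE _ _ _ (mor_comp f g) h V s).
rewrite (@comp_sectE _ _ _ f g V s k4) (mor_res k4 k2).
by rewrite (res_comp _ _ k3) (res_comp _ _ k1) (res_comp _ _ k1).
Qed.

Lemma mor_comp1 (X Y : scheme) (f : scheme_mor X Y) : mor_comp (mor_id Y) f = f.
Proof.
apply: mor_ext => // V s i.
have k : pre f (pre (mor_id Y) V) `<=` pre f V by [].
rewrite /=.
have k2 : pre (mor_comp (mor_id Y) f) V `<=` pre f V by [].
rewrite (mor_res _ k) (res_comp _ _ k2).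
by rewrite (res_comp _) res_id.
Qed.

Lemma kmor_comp (k : fieldType) (X Y Z : kScheme k) (g : scheme_mor Y Z) (f : scheme_mor X Y) :
  is_kmor g -> is_kmor f -> is_kmor (X := X) (Y := Z) (mor_comp g f).
Proof.
move=> hg hf c h.
have k1 : pre g (opensT Z) `<=` opensT Y by [].
have k2 : pre f (pre g (opensT Z)) `<=` pre f (opensT Y) by [].
have k3 : pre f (opensT Y) `<=` opensT X by [].
rewrite (@comp_sectE _) (hg c k1) (mor_res k1 k2) (hf c k3).
have k4 : pre f (pre g (opensT Z)) `<=` opensT X by [].
by rewrite (res_comp _ _ k4) (res_comp _ _ h).
Qed.

(* Valuative uniqueness, for the spectrum of [E] instead of a valuation ring. *)
Lemma separated_domination (k : fieldType) (X : kScheme k) (eta : X) (K : fieldType)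
    (pi : {rmorphism stalk eta -> K}) (E : set K) (y1 y2 : X) :
  (forall c, exists a, pi a = c) -> (forall a, pi a = 0 <-> nonunits a) ->
  is_separated X -> subring E -> klocal E -> dim1 E ->
  (exists2 p, p != 0 & E p /\ ~ kunit E p) ->
  spec eta y1 -> spec eta y2 ->
  Oring pi y1 `<=` E -> Oring pi y2 `<=` E ->
  (forall c, Oring pi y1 c -> kunit E c -> kunit (Oring pi y1) c) ->
  (forall c, Oring pi y2 c -> kunit E c -> kunit (Oring pi y2) c) -> y1 = y2.
Proof.
move=> pis pik sepX subE locE dimE nfE s1 s2 O1 O2 u1 u2.
have fracE c : exists w v, [/\ E w, E v, v != 0 & c * v = w].
  by have [a [b [ha hb b0 E']]] := Oring_frac pis pik c s1; exists a, b; split=> //; apply: O1.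
have affE := saffine (subE := subE) locE dimE fracE nfE; have affK := @faffine K.
have [P [p [q [d [prodP pd qd [dinj dcl _]]]]]] := sepX.
pose kapE : {rmorphism k -> K} := pi \o germ (U := opensT X) I \o kstruct X.
have kapO1 c : E (kapE c) by apply: O1; exists (opensT X), I, I, (kstruct X c).
have kapE_O (t : sspace subE) c : cs_O (sspace subE) t (kapE c) by case: t; last exact: kapO1.
have kapK_O (t : fspace K) c : cs_O (fspace K) t (kapE c) by [].
pose SE := ckscheme affE kapE_O; pose SK := ckscheme affK kapK_O.
pose ext_val (f : scheme_mor SE X) := forall (V : opens X) s u (Ve : pts V eta),
  @cval (sspace subE) (pre f V) (mor_sect f V s) u = gval pi Ve s.
have lift y : spec eta y -> Oring pi y `<=` E ->
    (forall c, Oring pi y c -> kunit E c -> kunit (Oring pi y) c) ->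
    exists f : scheme_mor SE X, [/\ mor_fun f = (fun b : sier => if b then eta else y) & ext_val f].
  move=> sy Oy uy; pose psi (b : sspace subE) := if b then eta else y.
  have cpsi : continuous psi.
    by apply/continuousP => U oU; apply: sier_open => Uy; apply: (sy (Opens oU)).
  have [||f [Ef fs]] := @cmorP (sspace subE) X psi pi cpsi affE; last by exists f.
  - by move=> [] V Vt Ve s //=; apply: Oy; exists V, Vt, Ve, s.
  - move=> [] V Vt Ve s /=.
      move=> [n0 _ _]; rewrite (Prop_irrelevance Vt Ve); apply: contrapT => nu.
      by move: n0; rewrite /gval /= (pik (germ Ve s)).2 // eqxx.
    have [be [beE rbe bu]] := stalk_value pi sy.
    move=> hu; apply: bu; rewrite (beE V Vt Ve); apply: uy => //.
    by exists V, Vt, Ve, s.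
have [f1 [f1E f1s]] := lift y1 s1 O1 u1; have [f2 [f2E f2s]] := lift y2 s2 O2 u2.
have kf f : ext_val f -> is_kmor f.
  move=> fs c h; apply: (@csect_eq (sspace subE)) => u.
  by rewrite (fs _ _ u I).
have [_ _ univ] := prodP.
have [h [[hk ph qh] _]] := univ SE f1 f2 (kf _ f1s) (kf _ f2s).
have [v [vE vinj vO]] := cstalk (X := sspace subE) true.
have [|||j [jE js]] := @cmorP (fspace K) SE (fun=> true) v _ affK.
- by apply/continuousP => U oU; rewrite /=.
- by [].
- move=> t V Vt Ve s; rewrite (Prop_irrelevance Vt Ve) => -[n0 _ _].
  have oV1 : open ([set b | b] : set sier) by [].
  pose W1 : opens SE := Opens oV1.
  have W1O b : pts W1 b -> cs_O (sspace subE) b (gval v Ve s)^-1 by case: b.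
  exists (@germ SE true W1 isT (cconst W1O)); apply: vinj.
  rewrite rmorphM rmorph1 (vE W1 isT (cconst W1O)).
  by rewrite -[X in X * _]/(gval v Ve s) mulfV.
have [|||e [eE es]] := @cmorP (fspace K) X (fun=> eta) pi _ affK.
- by apply/continuousP => U oU; rewrite /=.
- by [].
- move=> t V Vt Ve s; rewrite (Prop_irrelevance Vt Ve) => -[n0 _ _].
  apply: contrapT => nu; by move: n0; rewrite /gval /= (pik (germ Ve s)).2 // eqxx.
have kj : is_kmor (X := SK) (Y := SE) j.
  move=> c h0; apply: (@csect_eq (fspace K)) => u.
  by rewrite (js _ _ u I) /gval /= vE.
have ke : is_kmor (X := SK) e by move=> c h0; apply: (@csect_eq (fspace K)) => u; rewrite (es _ _ u I).
have kd : is_kmor (Y := P) d.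
  have [kp _ _] := prodP => c h0.
  have kP : pre p (opensT X) `<=` opensT P by [].
  have := kp c kP => E1.
  have sub0 : opensT P `<=` pre p (opensT X) by [].
  have E2 : kstruct P c = res sub0 (mor_sect p (opensT X) (kstruct X c)) by rewrite E1 (res_comp _ _ (@subset_refl _ _)) res_id.
  have sub1 : pre d (opensT P) `<=` pre d (pre p (opensT X)) by [].
  rewrite E2 (mor_res sub0 sub1).
  have sub2 : pre d (opensT P) `<=` pre (mor_comp p d) (opensT X) by [].
  have sub3 : pre d (opensT P) `<=` pre (mor_id X) (opensT X) by [].
  have := mor_eq_sect pd (kstruct X c) sub2 sub3.
  rewrite (@comp_sectE _ _ _ p d _ _ (fun _ => id)) /= /mor_id_sect (res_comp _ _ sub1) (res_comp _ _ h0) => ->.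
  by [].
have comp (f : scheme_mor SE X) (y : X) : mor_fun f = (fun b : sier => if b then eta else y) -> ext_val f -> mor_comp f j = e.
  move=> fE fs; apply: mor_ext => [x|V s i]; first by rewrite /= jE fE eE.
  apply: (@csect_eq (fspace K)) => u.
  have Ve : pts V eta by case: (u) => t; rewrite /= eE.
  rewrite (es V s u Ve) (@comp_sectE _ _ _ f j V s (fun _ => id)).
  have Ve' : pts (pre f V) true by rewrite /= fE.
  have u' : {t : fspace K | pts (pre j (pre f V)) t}.
    by exists tt; rewrite /= jE.
  apply: (etrans (@cvalE (fspace K) (pre j (pre f V)) (mor_sect j _ (mor_sect f V s)) _ u')).
  rewrite (js _ _ _ Ve') /gval /= vE.
  exact: (fs V s (exist _ true Ve') Ve).
have e1 := comp f1 y1 f1E f1s; have e2 := comp f2 y2 f2E f2s.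
have [h' [_ uniq]] := univ SK e e ke ke.
have E1 : h' = mor_comp h j.
  by apply: uniq; split; [exact: kmor_comp|rewrite mor_compA ph|rewrite mor_compA qh].
have E2 : h' = mor_comp d e.
  by apply: uniq; split; [exact: kmor_comp|rewrite mor_compA pd mor_comp1|rewrite mor_compA qd mor_comp1].
(* At the generic point h agrees with the diagonal. Since the image of the diagonal is closed it
   also contains the image of the closed point, whose two projections are y1 and y2. *)
have hd : h true = d eta.
  have := congr1 (fun f : scheme_mor SK P => f tt) (etrans (esym E1) E2).
  by rewrite /= jE eE.
have cl : closed (d @` setT) by apply: dcl; apply: closedT.
have [x _ dx] : (d @` setT) (h false).
  apply: contrapT => nd; have oU : open (~` (d @` [set: X])) by apply: closed_openC.
  have := proj1 (continuousP h) (mor_cont h) _ oU => /(_ nd) /=; apply.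
  by rewrite hd; exists eta.
have p1 : p (h false) = y1 by rewrite -[p _]/(mor_comp p h false) ph f1E.
have p2 : q (h false) = y2 by rewrite -[q _]/(mor_comp q h false) qh f2E.
by rewrite -p1 -p2 -dx -[p _]/(mor_comp p d x) -[q _]/(mor_comp q d x) pd qd.
Qed.

(** * Dimension over a field *)

Section KDim.
Variables (k : fieldType) (A : comPzRingType) (phi : {rmorphism k -> A}).
Implicit Types (I J P : set A).

Definition kspan (T : finType) (e : T -> A) I :=
  forall a, exists c : T -> k, I (a - \sum_i phi (c i) * e i).
Definition kfree (T : finType) (e : T -> A) I :=
  forall c : T -> k, I (\sum_i phi (c i) * e i) -> forall i, c i = 0.

(* [A/I] has dimension [n] over [k] *)
Definition kd I n := exists (T : finType) (e : T -> A), [/\ #|T| = n, kspan e I & kfree e I].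

Lemma kfree_leq (T S : finType) (e : T -> A) (f : S -> A) I : is_ideal I -> kfree e I ->
  (forall i, exists c : S -> k, I (e i - \sum_j phi (c j) * f j)) -> (#|T| <= #|S|)%N.
Proof.
move=> hI free /choice[C hC]; rewrite leqNgt; apply/negP => lt.
pose M := \matrix_(i < #|T|, j < #|S|) C (enum_val i) (enum_val j).
have : kermx M != 0.
  rewrite kermx_eq0 /row_free; apply/negP => /eqP E.
  by have := rank_leq_col M; rewrite E leqNgt lt.
move=> /rowV0Pn[u /sub_kermxP uM nu]; move/negP: nu; apply; apply/eqP/rowP => i; rewrite mxE.
rewrite -(enum_valK i); apply: (free (fun t => u 0 (enum_rank t))) => {i}.
apply: (idl_congr hI); last exact: (idl0 hI).
suff -> : \sum_i phi (u 0 (enum_rank i)) * e i - 0 =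
    \sum_i phi (u 0 (enum_rank i)) * (e i - \sum_j phi (C i j) * f j).
  by apply: idl_sum => // i _; apply: (idlM _ hI).
under [RHS]eq_bigr => i do rewrite mulrBr.
rewrite sumrB; congr (_ _).
under eq_bigr => i do rewrite mulr_sumr.
rewrite exchange_big big1 // => j.
under eq_bigr => i do rewrite mulrA -rmorphM.
rewrite -mulr_suml -rmorph_sum (_ : \sum_i _ = (u *m M) 0 (enum_rank j)); last first.
  rewrite mxE (reindex (@enum_val T T)) /=; last first.
    exists enum_rank => x _; [apply: enum_valK|apply: enum_rankK].
  by apply: eq_bigr => i _; rewrite enum_valK !mxE enum_rankK.
by rewrite uM mxE rmorph0 mul0r.
Qed.

Lemma kd_uniq I m n : is_ideal I -> kd I m -> kd I n -> m = n.
Proof.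
move=> hI [T [e [<- s f]]] [T' [e' [<- s' f']]]; apply/eqP; rewrite eqn_leq.
apply/andP; split; [apply: (kfree_leq hI f) => i; apply: s'|apply: (kfree_leq hI f') => i; apply: s].
Qed.

Lemma kspan_sub (T : finType) (e : T -> A) I J : I `<=` J -> kspan e I -> kspan e J.
Proof. by move=> s h a; have [c hc] := h a; exists c; apply: s. Qed.

Lemma kspan_ord (T : finType) (e : T -> A) I : kspan e I -> kspan (fun i : 'I_#|T| => e (enum_val i)) I.
Proof.
move=> h a; have [c hc] := h a; exists (fun i => c (enum_val i)).
rewrite (reindex (@enum_val T T)) // in hc.
exists enum_rank => x _; [apply: enum_valK|apply: enum_rankK].
Qed.

Lemma kfree_ord (T : finType) (e : T -> A) I : kfree e I -> kfree (fun i : 'I_#|T| => e (enum_val i)) I.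
Proof.
move=> h c hc i; rewrite -(enum_valK i); apply: (h (fun t => c (enum_rank t))).
rewrite (reindex (@enum_val T T)) /=; last first.
  exists enum_rank => x _; [apply: enum_valK|apply: enum_rankK].
by under eq_bigr => j do rewrite enum_valK.
Qed.

Lemma kd_ord I n : kd I n -> exists e : 'I_n -> A, kspan e I /\ kfree e I.
Proof.
move=> [T [e [<- f]]]; exists (fun i => e (enum_val i)).
by split; [apply: kspan_ord|apply: kfree_ord].
Qed.

Lemma kd_of_span n (e : 'I_n -> A) I : is_ideal I -> kspan e I -> exists2 m, (m <= n)%N & kd I m.
Proof.
move=> hI; elim: n e => [|n IH] e s.
  by exists 0%N => //; exists 'I_0, e; split; rewrite ?card_ord // => c _ [].
have [fr|nf] := pselect (kfree e I).
  by exists n.+1 => //; exists 'I_n.+1, e; rewrite ?card_ord.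
have [c [hc [i0 ci0]]] : exists c : 'I_n.+1 -> k, I (\sum_i phi (c i) * e i) /\ exists i, c i <> 0.
  apply: contrapT => no; apply: nf => c hc i; apply: contrapT => nc; apply: no.
  by exists c; split=> //; exists i.
have [|m hm] := IH (fun i => e (lift i0 i)); last by exists m => //; apply: leqW.
move=> a; have [d hd] := s a; pose q := d i0 / c i0.
exists (fun i => d (lift i0 i) - q * c (lift i0 i)).
have := idlD hI hd (idlM (phi q) hI hc); congr I.
rewrite !(bigD1_ord i0) //mulrDr mulrA -rmorphM divfK; last exact/eqP.
rewrite opprD -addrA; congr (_ _); rewrite addrACA (addrC _ (phi (d i0) * _)) subrr add0r.
rewrite mulr_sumr -sumrN -big_split -sumrN /=; apply: eq_bigr => i _.
ring.
Qed.

Lemma kd_fin (T : finType) (e : T -> A) I : is_ideal I -> kspan e I -> exists n, kd I n.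
Proof. by move=> hI /kspan_ord/(kd_of_span hI)[m _]; exists m. Qed.

Lemma kd_sub I J n : is_ideal J -> I `<=` J -> kd I n -> exists2 m, (m <= n)%N & kd J m.
Proof.
move=> hJ s /kd_ord[e [sp _]]; apply: (kd_of_span hJ); exact: kspan_sub sp.
Qed.

Lemma kdT : kd setT 0.
Proof.
by exists 'I_0, (fun=> 0); split; [rewrite card_ord|move=> a; exists (fun=> 0)|move=> c _ []].
Qed.

Lemma kd_step I x a b : is_ideal I -> kd (adjoin I x) a -> kd (colon I x) b -> kd I (a + b).
Proof.
move=> hI [T [e [<- s f]]] [S [e' [<- s' f']]].
exists (T + S)%type, (fun i => match i with inl i => e i | inr j => e' j * x end).
split; first by rewrite card_sum.
  move=> u; have [c /adjoinP[w hw]] := s u; have [d hd] := s' w.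
  exists (fun i => match i with inl i => c i | inr j => d j end).
  rewrite big_sumType /=; have := idlD hI hw hd; congr I.
  rewrite (_ : \sum_j phi (d j) * (e' j * x) = (\sum_j phi (d j) * e' j) * x); first ring.
  by rewrite mulr_suml; apply: eq_bigr => j _; rewrite mulrA.
move=> c; rewrite big_sumType /= => hc.
have c1 : forall i, c (inl i) = 0.
  apply: f; apply/adjoinP; exists (- \sum_j phi (c (inr j)) * e' j).
  rewrite mulrN opprK; move: hc; congr (I (_ _)).
  by rewrite mulr_sumr; apply: eq_bigr => j _; rewrite mulrA mulrC.
have c2 : forall j, c (inr j) = 0.
  apply: f'; move: hc; rewrite big1 ?add0r; last first.
    by move=> i _; rewrite c1 rmorph0 mul0r.
  by congr I; rewrite mulr_sumr; apply: eq_bigr => j _; rewrite mulrA mulrC.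
by case.
Qed.

Lemma kd_filtration I : is_noetherian A -> is_ideal I ->
  (forall P, is_prime P -> I `<=` P -> exists n, kd P n) -> exists n, kd I n.
Proof.
move=> hn hI hP.
suff : forall J, is_ideal J -> I `<=` J -> exists n, kd J n by move/(_ I hI); apply.
apply: (prime_filtration_ind hn) => [_|J a hJ _ pr IH IJ].
  exists 0%N; apply: kdT.
have [|n hn'] := IH; first by move=> z /IJ; apply: sub_adjoin.
have [|m hm] := hP _ pr; first by move=> z /IJ; apply: sub_colon.
by exists (n + m)%N; apply: kd_step hm.
Qed.

Lemma kd_algebraic I n a : is_ideal I -> kd I n ->
  exists c : 'I_n.+1 -> k, (exists i, c i != 0) /\ I (\sum_i phi (c i) * a ^+ i).
Proof.
move=> hI /kd_ord[e [s _]]; apply: contrapT => no.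
suff fr : kfree (fun i : 'I_n.+1 => a ^+ i) I.
  by have := kfree_leq hI fr (fun => s _); rewrite !card_ord ltnn.
move=> c hc i; apply/eqP; apply: contrapT => /negP nc; apply: no; exists c; split=> //; by exists i.
Qed.

(** If no inverse existed, 1 together with the products of a with a basis of A/P would be n + 1
    independent elements. *)
Lemma kd_inverse P n a : is_prime P -> kd P n -> ~ P a -> exists b, P (1 - a * b).
Proof.
move=> pP hd na; have hP := prime_ideal pP; have [e [s f]] := kd_ord hd.
apply: contrapT => no.
pose e' (i : 'I_n.+1) := if unlift ord0 i is Some j then a * e j else 1.
suff fr : kfree e' P.
  by have := kfree_leq hP fr (fun => s _); rewrite !card_ord ltnn.
move=> c; rewrite big_ord_recl /e' unlift_none mulr1.
under eq_bigr => i do rewrite liftK.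
move=> hc.
have E : \sum_(i < n) phi (c (lift ord0 i)) * (a * e i) = a * \sum_(i < n) phi (c (lift ord0 i)) * e i.
  by rewrite mulr_sumr; apply: eq_bigr => i _; rewrite mulrCA.
rewrite E in hc.
have c0 : c ord0 = 0.
  apply/eqP; apply: contrapT => /negP nc; apply: no.
  exists (- (phi (c ord0)^-1 * \sum_(i < n) phi (c (lift ord0 i)) * e i)).
  have := idlM (phi (c ord0)^-1) hP hc.
  by rewrite mulrDr -rmorphM mulVf // rmorph1 mulrN opprK mulrCA.
move=> i; case: (unliftP ord0 i) => [j ->|->//]; apply: (f (fun i => c (lift ord0 i))).
by move: hc; rewrite c0 rmorph0 add0r => /(primeM pP)[].
Qed.

Lemma kd_maximal P n : is_prime P -> kd P n -> maximal_ideal P.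
Proof.
move=> pP hd; have [hP P1 _] := pP; split=> // a na; have [b hb] := kd_inverse pP hd na.
by exists b.
Qed.

Lemma residue_degreeE n : is_ideal (@nonunits A) -> kd (@nonunits A) n -> residue_degree phi = n.
Proof.
move=> hm hd; have [e [s f]] := kd_ord hd.
have P1 (n' : nat) (e' : 'I_n' -> A) : (forall a, exists! c : {ffun 'I_n' -> k},
    nonunits (a - \sum_(i < n') phi (c i) * e' i)) <-> kspan e' (@nonunits A) /\ kfree e' (@nonunits A).
  split=> [h|[s' f'] a]; first split.
  - by move=> a; have [c [hc _]] := h a; exists c.
  - move=> c hc i; have [d [_ uniq]] := h 0.
    have E0 : nonunits (0 - \sum_(i < n') phi ([ffun=> 0] i) * e' i).
      rewrite big1 ?subr0; first exact: (idl0 hm).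
      by move=> j _; rewrite ffunE rmorph0 mul0r.
    have E1 : nonunits (0 - \sum_(i < n') phi ([ffun i => - c i] i) * e' i).
      move: hc; congr nonunits; rewrite sub0r -sumrN.
      by apply: eq_bigr => j _; rewrite ffunE rmorphN mulNr opprK.
    have := congr1 (fun g : {ffun 'I_n' -> k} => g i) (etrans (esym (uniq _ E0)) (uniq _ E1)).
    by rewrite !ffunE => /esym/eqP; rewrite oppr_eq0 => /eqP.
  have [c hc] := s' a; exists (finfun c); split=> [|d hd'].
    by move: hc; congr (nonunits (_ - _)); apply: eq_bigr => i _; rewrite ffunE.
  apply/ffunP => i; rewrite ffunE; apply/eqP; rewrite -subr_eq0; apply/eqP.
  apply: (f' (fun i => c i - d i)).
  have := idlB hm hd' hc; congr nonunits.
  rewrite opprB addrC addrA subrK -sumrB; apply: eq_bigr => j _; by rewrite rmorphB mulrBl.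
rewrite /residue_degree; case: xgetP => [n' _ [e' /P1[s' f']]|no]; last first.
  by exfalso; apply: (no n); exists e; apply/P1.
by apply: (kd_uniq hm _ hd); exists 'I_n', e'; rewrite card_ord.
Qed.

End KDim.

(** * Residue fields *)

(** Carries results on nonzero rings over to rings such as stalks, whose nontriviality is a
    proposition and not part of their structure. *)
Lemma comNz_transport (P : comPzRingType -> Prop) : (forall A : comNzRingType, P A) ->
  forall A : comPzRingType, (1 : A) != 0 -> P A.
Proof.
move=> h [T c] n1.
pose N := HB.pack_for comNzRingType (GRing.ComPzRing.Pack c) (GRing.PzSemiRing_isNonZero.Build _ n1).
exact: h N.
Qed.

Section Residue.
Variables (A : comNzRingType) (m : set A).
Hypotheses (hm : is_ideal m) (m1 : ~ m 1) (minv : forall a, ~ m a -> exists b, m (1 - a * b)).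

Definition mpred : pred A := fun a => `[< m a >].

Fact mpred_idealr : idealr_closed mpred.
Proof.
split=> [||a u v /asboolP hu /asboolP hv]; [exact/asboolP/(idl0 hm)|exact/asboolPn|apply/asboolP].
by apply: (idlD hm) => //; apply: (idlM _ hm).
Qed.
HB.instance Definition _ := isIdealr.Build A mpred mpred_idealr.

Local Open Scope quotient_scope.
Definition midealr : idealr A := mpred.
Definition resfield := {ideal_quot midealr}.
HB.instance Definition _ := GRing.ComNzRing.on resfield.

Lemma rpi_eq0 a : \pi_resfield a = 0 <-> m a.
Proof.
rewrite -[0](rmorph0 (\pi_resfield)); split=> [/eqP|h]; last apply/eqP.
  by rewrite -Quotient.idealrBE subr0 => /asboolP.
by rewrite -Quotient.idealrBE subr0; apply/asboolP.
Qed.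

Definition rinv (x : resfield) : resfield :=
  if pselect (exists y, y * x = 1) is left h then sval (cid h) else 0.

Fact rmulV (x : resfield) : x != 0 -> rinv x * x = 1.
Proof.
move=> x0; rewrite /rinv; case: pselect => [h|[]]; first by case: cid.
have [|b hb] := minv (a := repr x).
  by move=> h; case/eqP: x0; rewrite -[x]reprK; apply/rpi_eq0.
exists (\pi_resfield b); rewrite -{1}[x]reprK -rmorphM; apply/eqP.
rewrite eq_sym -subr_eq0 -(rmorph1 (\pi_resfield)) -rmorphB mulrC; exact/eqP/rpi_eq0.
Qed.
Fact rinv0 : rinv 0 = 0.
Proof.
by rewrite /rinv; case: pselect => // -[y] E; case/eqP: (oner_neq0 resfield); rewrite -E mulr0.
Qed.
HB.instance Definition _ := GRing.ComNzRing_isField.Build resfield rmulV rinv0.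

Lemma residue_field_comNz : exists (K : fieldType) (pi : {rmorphism A -> K}),
  (forall c, exists a, pi a = c) /\ forall a, pi a = 0 <-> m a.
Proof.
exists resfield, \pi_resfield; split=> [c|a]; [by exists (repr c); apply: reprK|exact: rpi_eq0].
Qed.

End Residue.

Lemma residue_field (A : comPzRingType) (m : set A) : is_ideal m -> ~ m 1 ->
  (forall a, ~ m a -> exists b, m (1 - a * b)) ->
  exists (K : fieldType) (pi : {rmorphism A -> K}),
    (forall c, exists a, pi a = c) /\ forall a, pi a = 0 <-> m a.
Proof.
move=> hm m1; have n1 : (1 : A) != 0 by apply/eqP => E; apply: m1; rewrite E; apply: idl0.
move: A n1 m hm m1; apply: comNz_transport => m; apply: residue_field_comNz.
Qed.

(** * Lengths and degrees *)

Section LengthDegree.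
Variables (k : fieldType) (M : comPzRingType) (phi : {rmorphism k -> M}).
Variables (K : fieldType) (be : {rmorphism M -> K}).
Hypothesis noethM : is_noetherian M.

(** O is the localization of the image of M at the prime [locmax O]. The first clause presents O as
    the image of some ring, over which lengths can be taken. [ext O I] is the extension of the ideal
    I to O. *)
Definition is_loc (O : set K) := [/\ exists (B : comPzRingType) (f : {rmorphism B -> K}), range f = O,
  klocal O, forall F, O (be F)
  & forall c, O c -> exists s f, kunit O (be f) /\ c * be f = be s].

Definition locmax (O : set K) : set M := [set F | ~ kunit O (be F)].
Definition ext (O : set K) (I : set M) : set K :=
  [set c | exists b i, [/\ kunit O (be b), I i & c * be b = be i]].

Lemma loc_subring O : is_loc O -> subring O.
Proof. move=> [[B [f <-]] _ _ _]; apply: range_subring. Qed.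

Lemma locmax_prime O : is_loc O -> is_prime (locmax O).
Proof.
move=> hO; have sO := loc_subring hO; have [_ lO RO _] := hO; split; first split.
- by rewrite /locmax /= rmorph0 => -[/eqP].
- by move=> b nb; rewrite /locmax /= rmorphD; apply: lO.
- by move=> c a na; rewrite /locmax /= rmorphM mulrC => /(kunitMl sO (RO a) (RO c)).
- by apply; rewrite rmorph1; apply: kunit1.
- move=> a b; rewrite /locmax /= rmorphM => nab; apply: contrapT => /not_orP[/contrapT na /contrapT nb].
  by apply: nab; apply: kunitM.
Qed.

Lemma ext_kideal O I : is_loc O -> is_ideal I -> kideal O (ext O I).
Proof.
move=> hO hI; have sO := loc_subring hO; have [_ lO RO fO] := hO; have [_ _ OM] := sO; split.
- move=> c [b [i [[b0 _ hb] _ E]]]; rewrite (_ : c = be i / be b); first exact: OM.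
  by rewrite -E mulfK.
- by exists 1, 0; split; rewrite ?rmorph0 ?mul0r ?rmorph1; [apply: kunit1|apply: (idl0 hI)|].
- move=> c d [b [i [ub hi E]]] [b' [i' [ub' hi' E']]]; exists (b * b'), (i * b' + i' * b); split.
  + by rewrite rmorphM; apply: kunitM.
  + by apply: (idlD hI); apply: (idlMr _ hI).
  + by rewrite mulrDl rmorphD !rmorphM -E -E' mulrA (mulrC (be b)) mulrA.
- move=> c a /fO[s [f [uf Ec]]] [b [i [ub hi E]]]; exists (f * b), (s * i); split.
  + by rewrite rmorphM; apply: kunitM.
  + exact: (idlM _ hI).
  + by rewrite !rmorphM -E -Ec mulrACA.
Qed.

Section Local.
Variables (O : set K) (B : comPzRingType) (f : {rmorphism B -> K}).
Hypotheses (hO : is_loc O) (rf : range f = O).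

Let sO := loc_subring hO.

Lemma locmax_nonunit : maximal_ideal (locmax O) ->
  f @^-1` ext O (locmax O) = [set b | ~ kunit O (f b)].
Proof.
move=> mx; have [_ lO RO fO] := hO; apply/seteqP; split=> b.
  move=> [d [i [ud ni E]]] ub; apply: ni; rewrite -E; exact: kunitM.
move=> nb; have [|s [g [ug E]]] := fO (f b); first by rewrite -rf.
exists g, s; split=> //; rewrite /locmax /= -E => u; apply: nb.
by apply: kunitMl u => //; rewrite -rf.
Qed.

Lemma locmax_maximal : maximal_ideal (locmax O) -> maximal_ideal (f @^-1` ext O (locmax O)).
Proof.
move=> mx; have hI := kideal_preimage.
have hi : is_ideal (f @^-1` ext O (locmax O)).
  by apply: hI; rewrite rf; apply: ext_kideal; case: mx.
rewrite locmax_nonunit // in hi *; split=> //=.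
  by apply; rewrite rmorph1; apply: kunit1.
move=> a /contrapT[na _]; rewrite -rf => -[b _ Eb]; exists b.
by rewrite rmorphB rmorph1 rmorphM Eb mulfV // subrr => -[/eqP].
Qed.

Lemma ext_adjoin I x y : is_ideal I -> f y = be x ->
  adjoin (f @^-1` ext O I) y = f @^-1` ext O (adjoin I x).
Proof.
move=> hI E; have [_ lO RO fO] := hO; apply/seteqP; split=> b.
  move=> /adjoinP[c [d [i [ud hi Ed]]]].
  have [|s [g [ug Ec]]] := fO (f c); first by rewrite -rf.
  exists (d * g), (i * g + x * s * d); split.
  - by rewrite rmorphM; apply: kunitM.
  - apply/adjoinP; exists (s * d); rewrite mulrA addrK; exact: (idlMr _ hI).
  - rewrite rmorphD !rmorphM -Ed -Ec rmorphB rmorphM E; ring.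
move=> [d [i [ud /adjoinP[c hc] Ed]]].
have [d0 _ di] := ud; have [e _ Ee] : range f (be c / be d).
  by rewrite rf; case: (sO) => _ _; apply.
apply/adjoinP; exists e; exists d, (i - x * c).
by rewrite !rmorphB !rmorphM E Ee mulrBl Ed; rewrite mulrA divfK.
Qed.

Lemma ext_colon I x y : is_ideal I -> f y = be x -> (forall a, be a = 0 -> I a) ->
  colon (f @^-1` ext O I) y = f @^-1` ext O (colon I x).
Proof.
move=> hI E ker; have [_ lO RO fO] := hO; apply/seteqP; split=> b.
  rewrite /colon /= rmorphM E => -[d [i [ud hi Ed]]].
  have [|s [g [ug Ec]]] := fO (f b); first by rewrite -rf.
  have hsd : I (x * (s * d)).
    apply: (idl_congr hI (b := i * g)); last exact: (idlMr _ hI).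
    apply: ker; rewrite rmorphB !rmorphM -Ed -Ec; ring.
  by exists (g * d), (s * d); split; [rewrite rmorphM; apply: kunitM|exact: hsd|rewrite !rmorphM mulrA Ec].
rewrite /= => -[d [i [ud hi Ed]]]; exists d, (x * i); split=> //.
rewrite !rmorphM E -Ed; ring.
Qed.

Lemma ext_top I b : is_ideal I -> I b -> kunit O (be b) -> f @^-1` ext O I = setT.
Proof.
move=> hI Ib ub; have hE := ext_kideal hO hI; apply: idl1; first by apply: kideal_preimage; rewrite rf.
by rewrite /= rmorph1; exists b, b; rewrite mul1r.
Qed.

(** A factor M/(I : x) of a filtration contributes 1 to the length over O if (I : x) is the maximal
    ideal of O, and 0 otherwise, because then (I : x) contains a unit of O. *)
Lemma ext_step I x : is_ideal I -> (forall a, be a = 0 -> I a) -> maximal_ideal (colon I x) ->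
  maximal_ideal (locmax O) ->
  finl (f @^-1` ext O (adjoin I x)) ->
  finl (f @^-1` ext O I) /\ quo_length (f @^-1` ext O I) =
    ((if pselect (colon I x = locmax O) then 1 else 0) + quo_length (f @^-1` ext O (adjoin I x)))%N.
Proof.
move=> hI ker mc mx fin; have [_ _ RO _] := hO.
have [y _ Ey] : range f (be x) by rewrite rf.
have iE : is_ideal (f @^-1` ext O I) by apply: kideal_preimage; rewrite rf; apply: ext_kideal.
rewrite -(ext_adjoin hI Ey) in fin *.
have [fc qc] : finl (colon (f @^-1` ext O I) y) /\
    quo_length (colon (f @^-1` ext O I) y) = if pselect (colon I x = locmax O) then 1%N else 0%N.
  rewrite (ext_colon hI Ey ker); case: pselect => [/= e|/= ne].
    rewrite e; exact/quo_length_max/locmax_maximal.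
  have [b cb nb] : exists2 b, colon I x b & ~ locmax O b.
    apply: contrapT => no; apply: ne; apply: esym; apply: (maximal_sub mc).
    - exact: (prime_ideal (locmax_prime hO)).
    - by move=> b cb; apply: contrapT => nb; apply: no; exists b.
    - by case: (locmax_prime hO).
  rewrite (ext_top (idl_colon x hI) cb (contrapT nb)); exact: quo_lengthT.
by have [f1 f2] := quo_length_colon iE fin fc; rewrite f2 qc.
Qed.

End Local.

(** In a prime filtration of M/I every factor is the residue field of exactly one y; it adds deg y
    to the dimension over k and 1 to the length at y alone. *)
Theorem length_degree (T : eqType) (O : T -> set K) (ys : seq T) (deg : T -> nat) (I : set M) :
  uniq ys -> (forall y, y \in ys -> is_loc (O y)) ->
  (forall y y', y \in ys -> y' \in ys -> locmax (O y) = locmax (O y') -> y = y') ->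
  (forall y, y \in ys -> kd phi (locmax (O y)) (deg y)) ->
  is_ideal I -> (forall a, be a = 0 -> I a) ->
  (forall P, is_prime P -> I `<=` P -> exists2 y, y \in ys & P = locmax (O y)) ->
  kd phi I (\sum_(y <- ys) olen (O y) (ext (O y) I) * deg y).
Proof.
move=> uys hO inj hd hI ker hP.
have mx y : y \in ys -> maximal_ideal (locmax (O y)).
  by move=> hy; apply: kd_maximal (hd y hy); apply/locmax_prime/hO.
suff : forall J, is_ideal J -> I `<=` J ->
    (forall y (B : comPzRingType) (f : {rmorphism B -> K}), y \in ys -> range f = O y ->
       finl (f @^-1` ext (O y) J)) /\
    kd phi J (\sum_(y <- ys) olen (O y) (ext (O y) J) * deg y).
  by move/(_ I hI) => [].
apply: (prime_filtration_ind noethM) => [_|J x hJ nx pr IH IJ].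
  have top y (B : comPzRingType) (f : {rmorphism B -> K}) : y \in ys -> range f = O y ->
      f @^-1` ext (O y) setT = setT.
    move=> hy rf; apply: (ext_top (hO y hy) rf (b := 1)) => //.
    by rewrite rmorph1; apply: kunit1; apply: loc_subring; apply: hO.
  split=> [y B f hy rf|]; first by rewrite top //; apply: (quo_lengthT B).1.
  rewrite big_seq big1 => [|y hy]; first exact: kdT.
  have [[B [f rf]] _] := hO y hy.
  rewrite -rf -olenE; last by rewrite rf; apply: ext_kideal; [apply: hO|apply: is_idealT].
  by rewrite rf (top y B f hy rf) (quo_lengthT B).2.
have kerJ a : be a = 0 -> J a by move/ker/IJ.
have sJ := @sub_adjoin _ J x; have [|fin hk] := IH; first by move=> a /IJ/sJ.
have [y hy Ey] : exists2 y, y \in ys & colon J x = locmax (O y).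
  by apply: hP => // a /IJ; apply: sub_colon.
have mc : maximal_ideal (colon J x) by rewrite Ey; apply: mx.
split=> [z B f hz rf|].
  by have [] := ext_step (hO z hz) rf hJ kerJ mc (mx z hz) (fin z B f hz rf).
rewrite (_ : \sum_(z <- ys) _ = (\sum_(z <- ys) olen (O z) (ext (O z) (adjoin J x)) * deg z + deg y)%N).
  by apply: kd_step hk _ => //; rewrite Ey; apply: hd.
rewrite (bigD1_seq y) //(bigD1_seq y) //addnAC; congr addn; last first.
  rewrite big_seq_cond [RHS]big_seq_cond; apply: eq_bigr => z /andP[hz nzy].
  have [[B [f rf]] _] := hO z hz; have [_] := ext_step (hO z hz) rf hJ kerJ mc (mx z hz) (fin z B f hz rf).
  case: pselect => [E|ne] /=; first by move/eqP: nzy; case; apply: inj; rewrite -?Ey.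
  rewrite !olenE ?rf //; first by move=> ->.
  - by apply: ext_kideal; [apply: hO|apply: idl_adjoin].
  - by apply: ext_kideal; [apply: hO|].
have [[B [f rf]] _] := hO y hy; have [_] := ext_step (hO y hy) rf hJ kerJ mc (mx y hy) (fin y B f hy rf).
case: pselect => [E|ne] /=; last by case: ne.
rewrite !olenE ?rf.
- by move=> ->; rewrite mulnDl mul1n addnC.
- by apply: ext_kideal; [apply: hO|apply: idl_adjoin].
- by apply: ext_kideal; [apply: hO|].
Qed.

End LengthDegree.

(** * Curves over k[t] *)

Lemma sum_pair (V : nmodType) (I J : finType) (G : I * J -> V) :
  \sum_p G p = \sum_i \sum_j G (i, j).
Proof. by rewrite pair_bigA; apply: eq_bigr => -[]. Qed.

Section Curve.
Variables (k K : fieldType) (kap : {rmorphism k -> K}).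

(** Evaluation k[X] -> K at t, sealed behind an opaque proof so that it never unfolds to the
    iterated [mpev]. *)
Fact pev_subproof (t : K) : {f : {rmorphism {poly k} -> K} | forall p, f p = mpev kap (fun=> t) 1 p}.
Proof. by exists [the {rmorphism {poly k} -> K} of mpev kap (fun=> t) 1]. Qed.
Definition pev t := sval (pev_subproof t).

Lemma pev_mpev t p : pev t p = mpev kap (fun=> t) 1 p. Proof. exact: (svalP (pev_subproof t)). Qed.
Lemma pevE t p : pev t p = (map_poly kap p).[t]. Proof. exact: pev_mpev. Qed.
Lemma pev_C t c : pev t c%:P = kap c. Proof. by rewrite pevE map_polyC hornerC. Qed.
Lemma pev_X t : pev t 'X = t. Proof. by rewrite pevE map_polyX hornerX. Qed.
Lemma pev_Xn t n : pev t 'X^n = t ^+ n. Proof. by rewrite rmorphXn pev_X. Qed.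
Lemma pev_coef t (p : {poly k}) n : (size p <= n)%N -> pev t p = \sum_(i < n) kap p`_i * t ^+ i.
Proof.
move=> h; rewrite pevE (@horner_coef_wide _ n) ?size_map_poly //.
by apply: eq_bigr => i _; rewrite coef_map.
Qed.

(** After powers of the variable are removed from a relation satisfied by a, its constant term is
    nonzero and a multiple of a. *)
Lemma pev_dvd t (p : {poly {poly k}}) a (O : set K) : subring O -> (forall q, O (pev t q)) -> O a ->
  a != 0 -> p != 0 -> (map_poly (pev t) p).[a] = 0 -> exists N, N != 0 /\ O (pev t N / a).
Proof.
move=> hO Op Oa a0; have [_ _ OM] := hO; elim/poly_ind: p => [|p c IH pn]; first by rewrite eqxx.
rewrite rmorphD rmorphM /= map_polyX map_polyC hornerMXaddC.
have [c0|cn] := eqVneq c 0.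
  have E0 : pev t c = 0 by move: c0; rewrite -(rmorph0 (pev t)) => ->.
  move=> h; have /eqP : (map_poly (pev t) p).[a] * a = 0.
    by apply: etrans h; apply: esym; apply: etrans (addr0 _); congr (_ _).
  rewrite mulf_eq0 (negPf a0) orbF => /eqP; apply: IH.
  by apply: contra pn => /eqP ->; rewrite c0 mul0r add0r.
move=> h; exists c; split=> //.
have -> : pev t c / a = - (map_poly (pev t) p).[a].
  by move/eqP: h; rewrite addrC addr_eq0 => /eqP ->; rewrite mulNr mulfK.
apply: subringN => //; rewrite (horner_coef_wide _ (leqnn _)).
apply: (big_ind O); [exact: subring0|by move=> *; apply: subringD|move=> i _].
by apply: OM; [rewrite coef_map; apply: Op|apply: subringX].
Qed.

Section FreeBasis.
Variables (t : K) (R : set K).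
Hypothesis t_inj : injective (pev t).
Hypothesis RZ : forall d z, R z -> R (pev t d * z).
Hypothesis RD : forall a b, R a -> R b -> R (a + b).

Definition pspan n (e : 'I_n -> K) :=
  forall z, R z -> exists c : 'I_n -> {poly k}, z = \sum_i pev t (c i) * e i.

Let pev0 d : pev t d = 0 -> d = 0. Proof. by rewrite -(rmorph0 (pev t)) => /t_inj. Qed.

(* Euclid's algorithm on the coefficients of a relation between minimally many generators. *)
Lemma free_basis n (w : 'I_n -> K) : (forall i, R (w i)) -> pspan w ->
  exists m (e : 'I_m -> K), [/\ forall i, R (e i), pspan e &
    forall c : 'I_m -> {poly k}, \sum_i pev t (c i) * e i = 0 -> forall i, c i = 0].
Proof.
elim: n w => [|n IH] w Rw sw; first by exists 0%N, w; split=> // c _ [].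
apply: contrapT => no.
suff key : forall N (e : 'I_n.+1 -> K) (c : 'I_n.+1 -> {poly k}) i, (forall i, R (e i)) -> pspan e ->
    \sum_i pev t (c i) * e i = 0 -> c i <> 0 -> (size (c i) <= N)%N -> False.
  apply: no; exists n.+1, w; split=> // c hc i; apply: contrapT => nc.
  exact: (key _ w c i Rw sw hc nc).
elim=> [|N IHN] e c i Re se hc nc sz.
  by apply: nc; apply/eqP; rewrite -size_poly_eq0 -leqn0.
have [[j nj]|dv] := pselect (exists j, ~~ (c i %| c j)).
  have nij : j != i by apply: contraNneq nj => ->.
  pose q := c j %/ c i; pose r := c j %% c i.
  pose e' l := if l == i then e i + pev t q * e j else e l.
  pose c' l := if l == j then r else c l.
  apply: (IHN e' c' j).
  - by move=> l; rewrite /e'; case: eqP => // _; apply: RD => //; apply: RZ.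
  - move=> z Rz; have [d Ed] := se z Rz.
    exists (fun l => if l == j then d j - d i * q else d l); rewrite Ed.
    rewrite (bigD1 i) //(bigD1 j) //[RHS](bigD1 i) //[in RHS](bigD1 j) //=.
    rewrite /e' eqxx eq_sym (negPf nij) eqxx.
    have -> : \sum_(l < n.+1 | (l != i) && (l != j)) pev t (if l == j then d j - d i * q else d l) *
       (if l == i then e i + pev t q * e j else e l) = \sum_(l < n.+1 | (l != i) && (l != j)) pev t (d l) * e l.
      by apply: eq_bigr => l /andP[/negPf-> /negPf->].
    ring.
  - rewrite -[RHS]hc.
    rewrite (bigD1 i) //(bigD1 j) //[RHS](bigD1 i) //[in RHS](bigD1 j) //=.
    rewrite /e' /c' eqxx eq_sym (negPf nij) eqxx.
    have -> : \sum_(l < n.+1 | (l != i) && (l != j)) pev t (if l == j then r else c l) *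
       (if l == i then e i + pev t q * e j else e l) = \sum_(l < n.+1 | (l != i) && (l != j)) pev t (c l) * e l.
      by apply: eq_bigr => l /andP[/negPf-> /negPf->].
    rewrite (divp_eq (c j) (c i)) rmorphD rmorphM; ring.
  - by rewrite /c' eqxx => /eqP; move: nj; rewrite /dvdp => /negP.
  - rewrite /c' eqxx -ltnS; apply: leq_trans sz; rewrite ltn_modp; exact/eqP.
have dv' j : c j = c j %/ c i * c i.
  by apply/esym/divpK; apply: contrapT => nd; apply: dv; exists j; apply/negP.
have Ei : e i = - \sum_(l < n) pev t (c (lift i l) %/ c i) * e (lift i l).
  apply/eqP; rewrite -addr_eq0.
  have : pev t (c i) * (e i + \sum_(l < n) pev t (c (lift i l) %/ c i) * e (lift i l)) = 0.
    rewrite -[RHS]hc (bigD1_ord i) //mulrDr mulr_sumr; congr (_ _); apply: eq_bigr => l _.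
    by rewrite mulrA -rmorphM; congr (pev t _ * _); rewrite mulrC.
  by move/eqP; rewrite mulf_eq0 => /orP[/eqP/pev0|/eqP //].
apply: no; apply: (IH (fun l => e (lift i l))) => // z Rz; have [d Ed] := se z Rz.
exists (fun l => d (lift i l) - d i * (c (lift i l) %/ c i)).
rewrite Ed (bigD1_ord i) //= Ei mulrN mulr_sumr addrC -sumrB.
apply: eq_bigr => l _; ring.
Qed.

End FreeBasis.

(* [R] is a finitely generated subalgebra, integral over the polynomial ring k[t]. *)
Definition curve_ring x n t := [/\ salg kap x n t, injective (pev t) &
  forall z, salg kap x n z -> integralOver (pev t) z].

Section CurveRing.
Variables (x : nat -> K) (n : nat) (t : K).
Hypothesis cr : curve_ring x n t.
Local Notation R := (salg kap x n).

Lemma cr_pev p : R (pev t p).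
Proof.
have [Rt _ _] := cr; rewrite (pev_coef t (leqnn _)).
apply: (@salg_sum _ _ kap x n _ _ xpredT) => i _.
by apply: salgM; [apply: salgC|apply: salgX].
Qed.

Lemma salg_subring : subring R.
Proof. by split; [apply: salg1|move=> *; apply: salgB|move=> *; apply: salgM]. Qed.

Lemma cr_t_neq0 : t != 0.
Proof.
have [_ inj _] := cr; apply/eqP => t0.
have : pev t 'X = pev t 0 by rewrite pev_X rmorph0.
by move/inj /eqP; rewrite polyX_eq0.
Qed.

Lemma cr_pev_neq0 p : p != 0 -> pev t p != 0.
Proof. by have [_ inj _] := cr; move=> p0; rewrite -(rmorph0 (pev t)); apply: contra p0 => /eqP/inj->. Qed.

Lemma cr_basis : exists s (e : 'I_s -> K), [/\ forall i, R (e i), pspan t R e &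
  forall c : 'I_s -> {poly k}, \sum_i pev t (c i) * e i = 0 -> forall i, c i = 0].
Proof.
have [Rt inj int] := cr.
have [||w [w1 w2]] := @integral_finite k K kap {poly k} (pev t) x n.
- move=> c; exists c%:P; apply: pev_C.
- by move=> i hi; apply: int; apply: salg_var.
apply: (@free_basis t R inj _ _ (size w) (fun i => w`_i)).
- move=> d Rz; apply: salgM; apply: cr_pev.
- apply: salgD.
- by move=> i; apply: w1; apply: mem_nth.
- by move=> z /w2[c ->]; exists (fun i => c i).
Qed.

Section Basis.
Variables (s : nat) (e : 'I_s -> K).
Hypotheses (Re : forall i, R (e i)) (se : pspan t R e).
Hypothesis fe : forall c : 'I_s -> {poly k}, \sum_i pev t (c i) * e i = 0 -> forall i, c i = 0.

(** The filtration of R by the degrees in t of the coordinates on the basis e. It is stable under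
    products only up to the constant of [Rle_mul]. *)
Definition Rle d : set K :=
  [set z | exists c : 'I_s -> {poly k}, z = \sum_i pev t (c i) * e i /\ forall i, (size (c i) <= d)%N].

Lemma RleD d a b : Rle d a -> Rle d b -> Rle d (a + b).
Proof.
move=> [c [-> hc]] [c' [-> hc']]; exists (fun i => c i + c' i); split=> [|i].
  by rewrite -big_split; apply: eq_bigr => i _; rewrite rmorphD mulrDl.
by apply: leq_trans (size_polyD _ _) _; rewrite geq_max hc hc'.
Qed.

Lemma Rle0 d : Rle d 0.
Proof. by exists (fun=> 0); rewrite ?size_poly0 big1 // => i _; rewrite rmorph0 mul0r. Qed.

Lemma Rle_sum d (T : Type) (r : seq T) (F : T -> K) : (forall i, Rle d (F i)) -> Rle d (\sum_(i <- r) F i).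
Proof. move=> h; apply: (big_ind) => //; [apply: Rle0|apply: RleD]. Qed.

Lemma Rle_mono d d' z : (d <= d')%N -> Rle d z -> Rle d' z.
Proof. by move=> le [c [-> hc]]; exists c; split=> // i; apply: leq_trans. Qed.

Lemma RleZ d m (p : {poly k}) z : (size p <= m.+1)%N -> Rle d z -> Rle (m + d) (pev t p * z).
Proof.
move=> sp [c [-> hc]]; exists (fun i => p * c i); split=> [|i].
  by rewrite mulr_sumr; apply: eq_bigr => i _; rewrite rmorphM mulrA.
apply: leq_trans (size_polyMleq _ _) _; have := hc i; lia.
Qed.

Lemma Rle_R d z : Rle d z -> R z.
Proof.
move=> [c [-> _]]; apply: (@salg_sum _ _ kap x n _ _ xpredT) => i _.
apply: salgM => //; apply: cr_pev.
Qed.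

Lemma Rle_ex z : R z -> exists d, Rle d z.
Proof.
move=> /se[c ->]; exists (\max_i size (c i))%N, c; split=> // i; exact: leq_bigmax.
Qed.

Lemma Rle_mul : exists C, forall d d' a b, Rle d a -> Rle d' b -> Rle (C + d + d') (a * b).
Proof.
have gen (ij : 'I_s * 'I_s) : exists d, Rle d (e ij.1 * e ij.2).
  by apply: Rle_ex; apply: salgM.
have [D hD] := choice gen; exists (\max_ij D ij)%N => d d' a b [c [-> hc]] [c' [-> hc']].
rewrite mulr_suml; apply: Rle_sum => i; rewrite mulr_sumr; apply: Rle_sum => j.
have -> : pev t (c i) * e i * (pev t (c' j) * e j) = pev t (c i * c' j) * (e i * e j).
  ring.
apply: (@Rle_mono (d + d' + D (i, j))%N).
  have : (D (i, j) <= \max_ij D ij)%N by [apply: leq_bigmax]; lia.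
apply: RleZ (hD (i, j)).
apply: leq_trans (size_polyMleq _ _) _; have := hc i; have := hc' j; lia.
Qed.

(** Multiplication by u raises the filtration by at most a constant [c0], so for m > c0 the term t^m
    dominates and t^m + u can be divided by like a monic polynomial of degree m in t; remainders
    have coordinates of degree less than m. *)
Lemma cr_division u : R u -> exists m1, forall m, (m1 <= m)%N ->
  (forall z, R z -> exists q, R q /\ Rle m (z - (t ^+ m + u) * q)) /\
  (forall q, R q -> Rle m ((t ^+ m + u) * q) -> q = 0).
Proof.
move=> Ru; have [C hC] := Rle_mul; have [du hdu] := Rle_ex Ru.
pose c0 := (C + du)%N.
have mulu d z : Rle d z -> Rle (c0 + d) (u * z) by move=> hz; apply: hC.
exists c0.+1 => m lem; split.
  move=> z /Rle_ex[d]; elim: d z => [|d IH] z hz.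
    by exists 0; split; [apply: salg0|rewrite mulr0 subr0; apply: Rle_mono hz].
  have [le|lt] := leqP d.+1 m.
    by exists 0; split; [apply: salg0|rewrite mulr0 subr0; apply: Rle_mono hz].
  have [c [Ez hc]] := hz.
  pose y := \sum_i pev t ((c i)`_d *: 'X^(d - m)) * e i.
  have Ry : Rle (d - m).+1 y.
    exists (fun i => (c i)`_d *: 'X^(d - m)); split=> // i.
    by apply: leq_trans (size_scale_leq _ _) _; rewrite size_polyXn.
  have h1 : Rle d (z - t ^+ m * y).
    exists (fun i => c i - (c i)`_d *: 'X^d); split.
      rewrite Ez mulr_sumr -sumrB; apply: eq_bigr => i _; rewrite mulrA -mulrBl.
      rewrite -(pev_Xn t m) -rmorphM -rmorphB.
      by rewrite -scalerAr -exprD subnKC.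
    move=> i; apply/leq_sizeP => j; rewrite coefB coefZ coefXn leq_eqVlt => /orP[/eqP<-|lt'].
      by rewrite eqxx mulr1 subrr.
    by rewrite gtn_eqF // mulr0 subr0 nth_default //; apply: leq_trans.
  have h2 : Rle d (u * y) by apply: Rle_mono (mulu _ _ Ry); lia.
  have [|q [Rq hq]] := IH (z - (t ^+ m + u) * y).
    rewrite mulrDl opprD addrA; apply: RleD => //.
    by rewrite -mulN1r -(rmorphN1 (pev t)); apply: (@RleZ d 0) => //; rewrite size_polyN size_poly1.
  exists (q + y); split; first by apply: salgD => //; apply: Rle_R Ry.
  move: hq; congr (Rle _); ring.
move=> q Rq; have [c0' Eq] := se Rq; move=> [c [Ec hc]].
apply: contrapT => nq; have [i0 ni0] : exists i, c0' i != 0.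
  apply: contrapT => no; apply: nq; rewrite Eq big1 // => i.
  have -> : c0' i = 0 by apply/eqP; apply: contrapT => /negP ni; apply: no; exists i.
  by rewrite rmorph0 mul0r.
pose i1 := [arg max_(i > i0) size (c0' i)].
have hmax i : (size (c0' i) <= size (c0' i1))%N by rewrite /i1; case: arg_maxnP => // j _; apply.
have [c2 [Ec2 hc2]] : Rle (c0 + size (c0' i1)) (u * q) by apply: mulu; exists c0'.
have E : forall i, c i - 'X^m * c0' i - c2 i = 0.
  apply: fe; rewrite (eq_bigr (fun i => pev t (c i) * e i - t ^+ m * (pev t (c0' i) * e i) - pev t (c2 i) * e i)).
    rewrite !sumrB -Ec -Ec2 -mulr_sumr -Eq; ring.
  move=> i _; rewrite !rmorphB rmorphM pev_Xn; ring.
have pos : (0 < size (c0' i1))%N by apply: leq_trans (hmax i0); rewrite size_poly_gt0.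
have : ('X^m * c0' i1)`_(m + (size (c0' i1)).-1) = 0.
  have -> : 'X^m * c0' i1 = c i1 - c2 i1.
    by have /eqP := E i1; rewrite addrAC subr_eq0 => /eqP.
  rewrite coefB !nth_default ?subrr //.
    apply: leq_trans (hc2 i1) _; lia.
  apply: leq_trans (hc i1) _; lia.
rewrite coefXnM ltnNge leq_addr addKn => E0.
have : lead_coef (c0' i1) = 0 by rewrite lead_coefE.
by move/eqP; rewrite lead_coef_eq0 -size_poly_eq0 => /eqP E1; rewrite E1 in pos.
Qed.

End Basis.

Local Notation M := (mp k n).
Local Notation ev := (mpev kap x n).

(** The principal ideal aR, pulled back to the polynomial ring M: R itself is only a subset of K,
    whereas dimensions and filtrations refer to ideals of a ring. *)
Definition multI (a : K) : set M := [set F | exists2 q, R q & ev F = a * q].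

Lemma multI_ideal a : is_ideal (multI a).
Proof.
split; first by exists 0; rewrite ?rmorph0 ?mulr0 //; apply: salg0.
  move=> F G [q Rq E] [q' Rq' E']; exists (q + q'); first exact: salgD.
  by rewrite rmorphD E E' mulrDr.
move=> c F [q Rq E]; exists (ev c * q); first by apply: salgM => //; exists c.
rewrite rmorphM E; ring.
Qed.

Lemma multI_ker a F : ev F = 0 -> multI a F.
Proof. exists 0; rewrite ?mulr0 //; apply: salg0. Qed.

(** By division with remainder the elements t^j e_i with j < m form a basis of the quotient; s is
    the rank of R over k[t] and does not depend on u. *)
Lemma cr_dim : exists s, forall u, R u -> exists m1, forall m, (m1 <= m)%N ->
  kd (mpC k n) (multI (t ^+ m + u)) (s * m).
Proof.
have [s [e [Re se fe]]] := cr_basis; exists s => u Ru.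
have [m1 hm] := cr_division Re se fe Ru; exists m1 => m /hm[h1 h2].
have [Rt _ _] := cr.
have lift (ij : 'I_s * 'I_m) : exists F, ev F = t ^+ ij.2 * e ij.1.
  by apply/salgP; apply: salgM => //; apply: salgX.
have [E hE] := choice lift.
exists ('I_s * 'I_m)%type, E; split; first by rewrite card_prod !card_ord.
  move=> F; have [q [Rq [c [Ec hc]]]] := h1 (ev F) ((salgP _ _ _ _).2 (ex_intro _ F erefl)).
  exists (fun ij : 'I_s * 'I_m => (c ij.1)`_ij.2), q => //.
  rewrite rmorphB rmorph_sum; apply/eqP; rewrite subr_eq addrC -subr_eq; apply/eqP; rewrite Ec.
  rewrite sum_pair /=; apply: eq_bigr => i _.
  rewrite (pev_coef t (hc i)) mulr_suml; apply: eq_bigr => j _.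
  rewrite rmorphM mpev_mpC hE; ring.
move=> c [q Rq]; rewrite rmorph_sum => Eq.
pose p i := \poly_(j < m) oapp (fun j => c (i, j)) 0 (insub j).
have hp i (j : 'I_m) : (p i)`_j = c (i, j) by rewrite coef_poly ltn_ord valK.
have Ep : \sum_(ij : 'I_s * 'I_m) ev (mpC k n (c ij) * E ij) = \sum_i pev t (p i) * e i.
  rewrite sum_pair.
  apply: eq_bigr => i _; rewrite (pev_coef t (size_poly _ _)) mulr_suml.
  apply: eq_bigr => j _; rewrite rmorphM mpev_mpC hE hp; ring.
have q0 : q = 0.
  apply: h2 => //; rewrite -Eq Ep; exists p; split=> // i; apply: size_poly.
move: Eq; rewrite Ep q0 mulr0 => /fe p0 [i j]; by rewrite -hp p0 coef0.
Qed.

Lemma cr_norm a : R a -> a != 0 -> exists N, N != 0 /\ exists2 q, R q & pev t N = a * q.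
Proof.
move=> Ra a0; have [_ _ int] := cr; have [p mp' /rootP rp] := int a Ra.
have [N [N0 hN]] := pev_dvd salg_subring cr_pev Ra a0 (monic_neq0 mp') rp.
by exists N; split=> //; exists (pev t N / a); rewrite // mulrC divfK.
Qed.

Lemma cr_finite a : R a -> a != 0 -> exists d, kd (mpC k n) (multI a) d.
Proof.
move=> Ra a0; have [N [N0 [q Rq EN]]] := cr_norm Ra a0.
have [s [e [Re se fe]]] := cr_basis; have [Rt _ _] := cr.
have lift (ij : 'I_s * 'I_(size N)) : exists F, ev F = t ^+ ij.2 * e ij.1.
  by apply/salgP; apply: salgM => //; apply: salgX.
have [E hE] := choice lift; apply: (kd_fin (multI_ideal a) (e := E)) => F.
have [c Ec] := se (ev F) ((salgP _ _ _ _).2 (ex_intro _ F erefl)).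
exists (fun ij : 'I_s * 'I_(size N) => (c ij.1 %% N)`_ij.2), (q * \sum_i pev t (c i %/ N) * e i).
  apply: salgM => //; apply: (@salg_sum _ _ kap x n _ _ xpredT) => i _.
  apply: salgM => //; apply: cr_pev.
rewrite rmorphB rmorph_sum mulrA -EN; apply/eqP; rewrite subr_eq; apply/eqP; rewrite Ec mulr_sumr.
rewrite sum_pair -big_split /=.
apply: eq_bigr => i _.
have -> : \sum_(j < size N) ev (mpC k n (c i %% N)`_j * E (i, j)) = pev t (c i %% N) * e i.
  rewrite (@pev_coef t (c i %% N) (size N)); last by rewrite ltnW // ltn_modp.
  rewrite mulr_suml; apply: eq_bigr => j _; rewrite rmorphM mpev_mpC hE; ring.
rewrite mulrA -mulrDl -rmorphM -rmorphD; congr (pev t _ * _).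
by rewrite mulrC -divp_eq.
Qed.

Hypothesis fracR : forall c : K, exists a b, [/\ R a, R b, b != 0 & c * b = a].

Lemma cr_frac c : exists a N, [/\ R a, N != 0 & c * pev t N = a].
Proof.
have [a [b [Ra Rb b0 E]]] := fracR c; have [N [N0 [q Rq EN]]] := cr_norm Rb b0.
by exists (a * q), N; split=> //; [apply: salgM|rewrite EN mulrA E].
Qed.

Lemma cr_alg v (O : set K) : v != 0 -> subring O -> (forall p, O (pev t p)) -> O v ->
  exists N, N != 0 /\ O (pev t N / v).
Proof.
move=> v0 hO Op Ov; have [a [D [Ra D0 E]]] := cr_frac v; have [_ _ OM] := hO.
have a0 : a != 0 by rewrite -E mulf_neq0 // cr_pev_neq0.
have [_ _ int] := cr; have [p mp' /rootP rp] := int a Ra.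
have Oa : O a by rewrite -E; apply: OM.
have [N [N0 hN]] := pev_dvd hO Op Oa a0 (monic_neq0 mp') rp.
exists N; split=> //; rewrite (_ : _ / v = pev t N / a * pev t D); first exact: OM.
by rewrite -E invfM mulrA divfK // cr_pev_neq0.
Qed.

End CurveRing.
End Curve.

(** ** Rings of dimension one over k[t] *)

Section CurveDim.
Variables (k K : fieldType) (kap : {rmorphism k -> K}).
Local Notation pev := (pev kap).

Section OneCurve.
Variables (x : nat -> K) (n : nat) (t : K).
Local Notation R := (salg kap x n).
Hypothesis cr : curve_ring kap x n t.
Hypothesis fracR : forall c : K, exists a b, [/\ R a, R b, b != 0 & c * b = a].

Lemma cr_poly_root z : exists p : {poly {poly k}}, p != 0 /\ (map_poly (pev t) p).[z] = 0.
Proof.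
have [a [N [Ra N0 E]]] := cr_frac cr fracR z; have [_ _ int] := cr.
have [p mp' /rootP rp] := int a Ra.
exists (p \Po (N *: 'X)); split.
  rewrite -size_poly_eq0 size_comp_poly2 ?size_poly_eq0 ?monic_neq0 //.
  by rewrite -mul_polyC size_mulX ?polyC_eq0 // size_polyC N0.
by rewrite map_comp_poly horner_comp linearZ /= map_polyX hornerZ hornerX mulrC E.
Qed.

Section Dim1.
Variable O : set K.
Hypotheses (hO : subring O) (lO : klocal O) (Op : forall p, O (pev t p)).
Hypothesis nuO : exists p, p != 0 /\ ~ kunit O (pev t p).

Lemma cr_uniformizer : exists pi : {poly k}, [/\ pi != 0, ~ kunit O (pev t pi) &
  forall p, ~ kunit O (pev t p) -> pi %| p].
Proof.
have [p0 [np0 hp0]] := nuO.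
have [m [pi [Em pi0 hpi]] mmin] : exists2 m, (exists p : {poly k}, [/\ size p = m, p != 0 & ~ kunit O (pev t p)]) &
    forall p : {poly k}, p != 0 -> ~ kunit O (pev t p) -> (m <= size p)%N.
  have [m] := ubnP (size p0); elim: m p0 np0 hp0 => // m IH p np hp; rewrite ltnS => le.
  have [[q [nq hq lt]]|no] := pselect (exists q : {poly k}, [/\ q != 0, ~ kunit O (pev t q) & (size q < size p)%N]).
    by apply: (IH q) => //; apply: leq_trans le.
  exists (size p); first by exists p.
  by move=> q nq hq; rewrite leqNgt; apply/negP => lt; apply: no; exists q.
exists pi; split=> // p hp; apply: contrapT => /negP npi.
have : (m <= size (p %% pi)%R)%N.
  apply: mmin; first apply: npi => E.
  have -> : p %% pi = p - p %/ pi * pi by rewrite {2}(divp_eq p pi) addrC addKr.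
  rewrite rmorphB; apply: klocalB => //; rewrite rmorphM mulrC => /(kunitMl hO (Op _) (Op _)).
  exact: hpi.
by rewrite -Em leqNgt ltn_modp pi0.
Qed.

(** Let pi be the uniformizer of the trace of O on k[t]. In a relation for f over k[t] not wholly
    divisible by pi, let l be the first index whose coefficient is prime to pi: the terms from l on
    are f^l times a unit, so pi divides f^l in O. On the other hand v divides some nonzero
    polynomial in t, which is pi^e times a unit of O. *)
Lemma cr_dim1 : dim1 O.
Proof.
have [pi [pi0 hpi dvpi]] := cr_uniformizer; have [O1 _ OM] := hO.
move=> v f Ov v0 Of nf.
have spi : (1 < size pi)%N.
  rewrite ltnNge; apply/negP => /size1_polyC E; apply: hpi; rewrite E pev_C.
  have : pi`_0 != 0 by apply: contra pi0 => /eqP E0; rewrite E E0.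
  split; [by rewrite fmorph_eq0|by rewrite -(pev_C kap t)|].
  by rewrite -fmorphV -(pev_C kap t).
have fpi : exists l, O (f ^+ l / pev t pi).
  have [G [G0 rG]] : exists G : {poly {poly k}}, (exists i, ~~ (pi %| G`_i)) /\ (map_poly (pev t) G).[f] = 0.
    have [G [G0 rG]] := cr_poly_root f.
    have [m] := ubnP (size (lead_coef G)); elim: m G G0 rG => // m IH G G0 rG le.
    have [[i hi]|no] := pselect (exists i, ~~ (pi %| G`_i)); first by exists G; split=> //; exists i.
    have dv i : pi %| G`_i by apply: contrapT => /negP ni; apply: no; exists i.
    pose G' : {poly {poly k}} := \poly_(i < size G) (G`_i %/ pi).
    have EG : G = pi%:P * G'.
      apply/polyP => i; rewrite coefCM coef_poly; case: ltnP => [_|le'].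
        by rewrite mulrC divpK.
      by rewrite mulr0 nth_default.
    have G'0 : G' != 0 by apply: contra G0 => /eqP E; rewrite EG E mulr0.
    apply: (IH G') => //.
      move: rG; rewrite EG rmorphM /= map_polyC hornerM hornerC => /eqP.
      rewrite mulf_eq0 => /orP[/eqP E|/eqP //].
      by have := cr_pev_neq0 cr pi0; rewrite E eqxx.
    move: le; rewrite EG lead_coefM lead_coefC size_mul ?lead_coef_eq0 //.
    case: (size pi) spi => [|[|a]] // _; rewrite ltnS; apply: leq_ltn_trans; exact: leq_addl.
  have [l [hl hmin]] : exists l, ~~ (pi %| G`_l) /\ forall i, (i < l)%N -> pi %| G`_i.
    have [l hl hmin] := ex_minnP G0; exists l; split=> // i lt; apply: contraTT lt => /hmin.
    by rewrite -leqNgt.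
  have : (l < size G)%N by rewrite ltnNge; apply: contra hl => le; rewrite nth_default.
  exists l; rewrite (horner_coef_wide _ (leqnn _)) size_map_inj_poly ?rmorph0 // in rG; last by have [_ inj _] := cr.
  pose T := \sum_(l <= i < size G) pev t G`_i * f ^+ (i - l).
  pose S := \sum_(0 <= i < l) pev t (G`_i %/ pi) * f ^+ i.
  have ES : pev t pi * S + f ^+ l * T = 0.
    rewrite -[RHS]rG -(big_mkord xpredT (fun i => (map_poly (pev t) G)`_i * f ^+ i)) (@big_cat_nat _ _ _ l) //; last exact: ltnW.
    congr (_ + _); rewrite big_distrr /= big_nat_cond [RHS]big_nat_cond; apply: eq_bigr => i /andP[/andP[h1 h2] _].
      rewrite coef_map mulrA -rmorphM [pi * _]mulrC divpK ?hmin //.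
    by rewrite coef_map mulrCA -exprD subnKC.
  have OS m1 m2 (F : nat -> {poly k}) (g : nat -> nat) : O (\sum_(m1 <= i < m2) pev t (F i) * f ^+ g i).
    apply: (big_ind O); [exact: subring0|by move=> *; apply: subringD|move=> i _].
    by apply: OM => //; apply: subringX.
  have uT : kunit O T.
    apply: contrapT => nT.
    have : kunit O (pev t G`_l) by apply: contrapT => /dvpi; apply/negP.
    rewrite /T big_ltn // subnn mulr1 in nT.
    pose T' := \sum_(l.+1 <= i < size G) pev t G`_i * f ^+ (i - l.+1).
    have ET : \sum_(l.+1 <= i < size G) pev t G`_i * f ^+ (i - l) = f * T'.
      rewrite big_distrr /= big_nat_cond [RHS]big_nat_cond; apply: eq_bigr => i /andP[/andP[h1 h2] _].
      by rewrite mulrCA -exprS subnSK.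
    rewrite ET in nT; have OT' : O T' := OS _ _ _ _.
    have nfT : ~ kunit O (f * T') by move/(kunitMl hO Of OT').
    have OT : O (pev t G`_l + f * T') by apply: subringD => //; apply: OM.
    by have := klocalB hO lO OT (OM _ _ Of OT') nT nfT; rewrite addrK.
  have [T0 _ Ti] := uT; have p0 := cr_pev_neq0 cr pi0.
  rewrite (_ : f ^+ l / pev t pi = - (S / T)).
    apply: subringN => //; apply: OM => //; apply: OS.
  apply: (mulIf T0); rewrite mulrAC mulNr divfK //.
  by move/eqP: ES; rewrite addrC addr_eq0 => /eqP ->; rewrite mulNr mulrAC mulfV // mul1r.
have [l hl] := fpi; have [N [N0 hN]] := cr_alg cr fracR v0 hO Op Ov.
have [e [N' [EN nN']]] : exists e N', N = pi ^+ e * N' /\ ~~ (pi %| N').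
  have [m] := ubnP (size N); elim: m N N0 {hN} => // m IH N N0; rewrite ltnS => le.
  have [/dvdpP[q Eq]|nd] := boolP (pi %| N); last by exists 0%N, N; rewrite mul1r.
  have q0 : q != 0 by apply: contra N0 => /eqP E; rewrite Eq E mul0r.
  have [|e [N' [EN' nd]]] := IH q q0.
    apply: leq_trans le; rewrite Eq size_mul //; case: (size pi) spi => [|[|a]] // _.
    by rewrite !addnS leq_addr.
  by exists e.+1, N'; rewrite Eq EN' exprSr mulrAC.
have uN' : kunit O (pev t N') by apply: contrapT => /dvpi; apply/negP.
have [n0 _ ni] := uN'; exists (l * e)%N.
rewrite (_ : _ / v = (f ^+ l / pev t pi) ^+ e * (pev t N / v) * (pev t N')^-1).
  exact: (OM _ _ (OM _ _ (subringX _ hO hl) hN) ni).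
have p0 := cr_pev_neq0 cr pi0.
rewrite EN rmorphM rmorphXn expr_div_n exprM -!mulrA; congr (_ _).
by rewrite (mulrCA (pev t N')) mulfV // mulr1 mulrA mulVf ?expf_neq0 // mul1r.
Qed.

End Dim1.

(** A dimension count: with denominators cleared by d, the N^2 monomials of degree less than N in
    each of u_0 and u_1 lie in a step of the filtration of k-dimension sD, where D is linear in
    N. *)
Lemma cr_dependent (u : nat -> K) : ~ injective (mpev kap u 2).
Proof.
move=> uinj; have [s [e [Re se fe]]] := cr_basis cr.
have [C hC] := Rle_mul Re se.
have [p0 [N0 [Rp0 nN0 E0]]] := cr_frac cr fracR (u 0%N).
have [p1 [N1 [Rp1 nN1 E1]]] := cr_frac cr fracR (u 1%N).
pose d := pev t (N0 * N1); have d0 : d != 0 by apply: (cr_pev_neq0 cr); rewrite mulf_neq0.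
pose a0 := u 0%N * d; pose a1 := u 1%N * d.
have Ra0 : R a0 by rewrite /a0 /d rmorphM mulrA E0; apply: salgM => //; apply: (cr_pev cr).
have Ra1 : R a1 by rewrite /a1 /d rmorphM mulrCA E1; apply: salgM => //; apply: (cr_pev cr).
have Rd : R d by apply: (cr_pev cr).
have [b [b1 ba0 ba1 bd]] : exists b, [/\ Rle kap t e b 1, Rle kap t e b a0, Rle kap t e b a1 & Rle kap t e b d].
  have [x1 h1] := Rle_ex se (salg1 kap x n); have [x2 h2] := Rle_ex se Ra0.
  have [x3 h3] := Rle_ex se Ra1; have [x4 h4] := Rle_ex se Rd.
  exists (x1 + x2 + x3 + x4)%N; split; [apply: Rle_mono h1|apply: Rle_mono h2|apply: Rle_mono h3|apply: Rle_mono h4]; lia.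
have pw z i : Rle kap t e b z -> Rle kap t e (b + i * (C + b)) (z ^+ i).
  move=> hz; elim: i => [|i IH]; first by rewrite addn0.
  rewrite exprS; apply: Rle_mono (hC _ _ _ _ hz IH); lia.
(* The dimension sD equals c1 + c2 N, which is less than N^2 for N = c1 + c2 + 1. *)
pose c1 := (s * (2 * C + 3 * b))%N; pose c2 := (s * (2 * (C + b)))%N; pose N := (c1 + c2).+1.
pose D := (2 * C + 3 * b + 2 * N * (C + b))%N.
have lt : (s * D < N * N)%N.
  nia.
pose mon (ij : 'I_N * 'I_N) := a0 ^+ ij.1 * (a1 ^+ ij.2 * d ^+ (2 * N - ij.1 - ij.2)).
have hmon ij : Rle kap t e D (mon ij).
  case: ij => i j.
  apply: Rle_mono (hC _ _ _ _ (pw _ i ba0) (hC _ _ _ _ (pw _ j ba1) (pw _ (2 * N - i - j)%N bd))).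
  have := ltn_ord i; have := ltn_ord j.
  lia.
have mon_u ij : mon ij = d ^+ (2 * N) * (u 0%N ^+ ij.1 * u 1%N ^+ ij.2).
  case: ij => i j; rewrite /mon !exprMn; have hi := ltn_ord i; have hj := ltn_ord j.
  set q := (2 * N - i - j)%N; have -> : (2 * N = i + (j + q))%N by rewrite /q; lia.
  rewrite !exprD; ring.
have nf : ~ kfree kap mon [set 0].
  move=> fr; have := kfree_leq (f := fun la : 'I_s * 'I_D => t ^+ la.2 * e la.1) (is_ideal0 K) fr.
  rewrite !card_prod !card_ord leqNgt => /(_ _)/negP; apply=> // ij.
  have [c [-> hc]] := hmon ij; exists (fun la : 'I_s * 'I_D => (c la.1)`_la.2).
  rewrite sum_pair /=; apply/eqP; rewrite subr_eq0; apply/eqP; apply: eq_bigr => l _.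
  by rewrite (pev_coef kap t (hc l)) mulr_suml; apply: eq_bigr => j _; rewrite mulrA.
apply: nf => c hc [i j].
pose F : {poly {poly k}} := \poly_(j < N) \poly_(i < N) oapp (fun i => oapp (fun j => c (i, j)) 0 (insub j)) 0 (insub i).
have cF (i' j' : 'I_N) : F`_j'`_i' = c (i', j') by rewrite coef_poly ltn_ord coef_poly ltn_ord valK valK.
have F0 : mpev kap u 2 F = mpev kap u 2 (0 : {poly {poly k}}).
  rewrite (rmorph0) mpevS (@horner_coef_wide _ N); last first.
    apply: leq_trans _; apply: size_poly.
  have : d ^+ (2 * N) * \sum_(ij : 'I_N * 'I_N) kap (c ij) * (u 0%N ^+ ij.1 * u 1%N ^+ ij.2) = 0.
    rewrite -[RHS]hc mulr_sumr; apply: eq_bigr => ij _; rewrite mon_u; ring.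
  move/eqP; rewrite mulf_eq0 expf_eq0 (negPf d0) => /eqP S0; rewrite -[RHS]S0.
  rewrite sum_pair exchange_big /=; apply: eq_bigr => l _.
  rewrite coef_map /= /horner_eval (@horner_coef_wide _ N); last first.
    apply: leq_trans (size_poly _ _) _.
    by have [lt'|le'] := ltnP l (size F); [rewrite coef_poly ltn_ord size_poly|rewrite nth_default // size_poly0].
  rewrite mulr_suml; apply: eq_bigr => a _; rewrite coef_map cF; rewrite mulrA; congr (_ * _ * _).
by rewrite -cF (uinj _ _ F0) !coef0.
Qed.

Lemma mpev_inj_S (u : nat -> K) r : injective (mpev kap u r.+1) -> injective (mpev kap u r).
Proof.
move=> h F G E; have : mpev kap u r.+1 (F%:P : {poly mp k r}) = mpev kap u r.+1 (G%:P : {poly mp k r}).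
  by rewrite !mpev_C.
by move/h/polyC_inj.
Qed.

(** The normalization of any other chart has exactly one variable: two would contradict
    [cr_dependent], and none would make t algebraic over k. *)
Lemma cr_other_chart y m : (forall c : K, exists a b, [/\ salg kap y m a, salg kap y m b, b != 0 & c * b = a]) ->
  exists t', curve_ring kap y m t'.
Proof.
move=> fracY; have [r [u [u1 u2 u3]]] := noether_normalization kap m y.
have r2 : (r <= 1)%N.
  rewrite leqNgt; apply/negP => lt; apply: (@cr_dependent u).
  by move: u2; rewrite -(subnK lt); elim: (r - 2)%N => // q IH /mpev_inj_S/IH.
case: r r2 u1 u2 u3 => [_ _ _ u3|[|//] _ u1 u2 u3].
  have [a [b [Ya Yb b0 E]]] := fracY t.
  have alg z : salg kap y m z -> algebraicOver kap z by move=> /u3 h; apply/integral_algebraic.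
  have : algebraicOver kap t.
    rewrite -(mulfK b0 t) E; apply: algebraic_mul; [exact: alg|apply: algebraic_inv; exact: alg].
  move=> [p p0 /rootP rp]; have [_ inj _] := cr.
  by move/eqP: p0; case; apply: inj; rewrite rmorph0 pevE.
have E1 : mpev kap u 1 =1 mpev kap (fun=> u 0%N) 1 by apply: mpev_ext => -[].
exists (u 0%N); split; first exact: u1.
  move=> p q; rewrite !pev_mpev -!E1; apply: u2.
move=> z /u3[p mp' rp]; exists p => //.
move: rp; congr (root _ z); apply: eq_map_poly => q; by rewrite pev_mpev.
Qed.

End OneCurve.
End CurveDim.

(** ** Points at infinity *)

Section Infinity.
Variables (k K : fieldType) (kap : {rmorphism k -> K}).
Variables (x : nat -> K) (n : nat) (t : K).
Local Notation R := (salg kap x n).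
Hypothesis cr : curve_ring kap x n t.
Variables (B : comNzRingType) (be : {rmorphism B -> K}).
Local Notation O := (range be).
Hypothesis noethB : is_noetherian B.
Hypothesis lO : klocal O.
Hypothesis kapO : forall c, O (kap c).

Let hO : subring O := range_subring be.
Let Obe b : O (be b). Proof. by exists b. Qed.

Definition mB : set B := [set b | ~ kunit O (be b)].

Lemma mB_ideal : is_ideal mB.
Proof.
split; first by rewrite /mB /= rmorph0 => -[/eqP].
  by move=> b nb; rewrite /mB /= rmorphD; apply: lO.
by move=> c a na; rewrite /mB /= rmorphM mulrC => /(kunitMl hO (Obe a) (Obe c)).
Qed.

(** E is a local ring containing R and dominating O. If O is the local ring of a point off the
    patch, the centre of E on the patch would be a second centre. *)
Definition dominating (E : set K) := [/\ subring E, klocal E, O `<=` E, R `<=` E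
  & forall c, O c -> kunit E c -> kunit O c].

Local Notation G := (mp B n).
Local Notation ga := (mpev be x n).

(** The preimage, in polynomials over B, of the ideal generated by the maximal ideal of O in the
    compositum O[R]. *)
Definition infI : set G :=
  [set F | exists F', ideal_gen [set H : G | exists b, mB b /\ ga H = be b] F' /\ ga F = ga F'].

Lemma infI_ideal : is_ideal infI.
Proof.
have hg := idl_gen [set H : G | exists b, mB b /\ ga H = be b]; split.
- exists 0; split=> //; apply: (idl0 hg).
- by move=> a b [a' [ha Ea]] [b' [hb Eb]]; exists (a' + b'); rewrite !rmorphD Ea Eb; split=> //; apply: (idlD hg).
- by move=> c a [a' [ha Ea]]; exists (c * a'); rewrite !rmorphM Ea; split=> //; apply: (idlM _ hg).
Qed.

(** The compositum O[R] is localized at a maximal ideal containing the maximal ideal of O. *)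
Lemma dominating_exists : ~ infI 1 -> exists E, dominating E.
Proof.
move=> nI1; have [N [pN IN maxN]] := exists_maximal infI_ideal nI1.
have [iN NM] := pN.
have kerN F : ga F = 0 -> N F.
  by move=> E; apply: IN; exists 0; rewrite rmorph0; split=> //; apply: idl0.
have ga0 H : ~ N H -> ga H != 0 by move=> nH; apply/eqP => /kerN.
pose E : set K := [set z | exists F H, ~ N H /\ z * ga H = ga F].
have Ega F : E (ga F) by exists F, 1; rewrite rmorph1 mulr1.
have unitE F : kunit E (ga F) <-> ~ N F.
  split=> [[g0 _ [F2 [H [nH EH]]]] NF|nF].
    apply: nH; apply: (idl_congr iN (b := F * F2)); last exact: (idlMr _ iN).
    by apply: kerN; rewrite rmorphB rmorphM -EH mulrA mulfV // mul1r subrr.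
  by split; [apply: ga0|apply: Ega|exists 1, F; rewrite rmorph1 mulVf // ga0].
have sE : subring E.
  split; first by exists 1, 1; rewrite rmorph1 mulr1.
    move=> a b [F [H [nH EF]]] [F' [H' [nH' EF']]]; exists (F * H' - F' * H), (H * H'); split.
      exact: (primeNM pN).
    rewrite rmorphB !rmorphM -EF -EF'; ring.
  move=> a b [F [H [nH EF]]] [F' [H' [nH' EF']]]; exists (F * F'), (H * H'); split.
    exact: (primeNM pN).
  rewrite !rmorphM -EF -EF'; ring.
have nonunit z F H : ~ N H -> z * ga H = ga F -> ~ kunit E z -> N F.
  move=> nH EF nz; apply: contrapT => nF; apply: nz.
  have Ez : E z by exists F, H.
  by apply: (kunitMl sE Ez (Ega H)); rewrite EF; apply/unitE.
have const b : exists2 H : G, ga H = be b & True.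
  by have [H EH] := mpev_range_const be x n b; exists H.
have OE : O `<=` E by move=> _ [b _ <-]; have [H <- _] := const b.
exists E; split=> //.
- move=> a b [F [H [nH EF]]] [F' [H' [nH' EF']]] na nb ub.
  have NF := nonunit _ _ _ nH EF na; have NF' := nonunit _ _ _ nH' EF' nb.
  have : kunit E (ga (F * H' + F' * H)).
    have -> : ga (F * H' + F' * H) = (a + b) * ga (H * H').
      rewrite rmorphD !rmorphM -EF -EF'; ring.
    by apply: kunitM => //; apply/unitE; apply: (primeNM pN).
  by move/unitE; apply; apply: (idlD iN); apply: (idlMr _ iN).
- apply: (@salg_sub _ _ kap x n E) => [c|i hi|a b|a b].
  + exact/OE.
  + by have [F _ <-] := mpev_range_var be x hi.
  + exact: subringD.
  + case: sE => _ _; apply.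
- move=> _ [b _ <-]; have [H EH _] := const b; rewrite -{1}EH => /unitE nH.
  apply: contrapT => nb; apply: nH; apply: IN; exists H; split=> //.
  by apply: sub_gen; exists b.
Qed.

Section NoDomination.
Hypothesis I1 : infI 1.

Local Notation evp p := (map_poly be p).[t].
Definition mB_poly (p : {poly B}) := forall j, mB p`_j.

Lemma mB_polyD p q : mB_poly p -> mB_poly q -> mB_poly (p + q).
Proof. by move=> hp hq j; rewrite coefD; apply: (idlD mB_ideal). Qed.
Lemma mB_polyM p q : mB_poly q -> mB_poly (p * q).
Proof. by move=> hq j; rewrite coefM; apply: idl_sum mB_ideal _ => i _; apply: (idlM _ mB_ideal). Qed.
Lemma mB_poly0 : mB_poly 0.
Proof. move=> j; rewrite coef0; apply: (idl0 mB_ideal). Qed.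

Lemma evpD p q : evp (p + q) = evp p + evp q. Proof. by rewrite rmorphD hornerD. Qed.
Lemma evpM p q : evp (p * q) = evp p * evp q. Proof. by rewrite rmorphM hornerM. Qed.

Lemma pev_lift (q : {poly k}) : exists p : {poly B}, evp p = pev kap t q.
Proof.
elim/poly_ind: q => [|q c [p Ep]]; first by exists 0; rewrite !rmorph0 horner0.
have [b Eb] := kapO c; exists (p * 'X + b%:P).
have E2 : evp b%:P = kap c by rewrite map_polyC hornerC.
by rewrite evpD evpM map_polyX hornerX Ep E2 rmorphD rmorphM pev_X pev_C.
Qed.

(* Determinant trick: R is finite over k[t], hence [m_O O[R] = O[R]] forces [1] to lie in [m_O O[t]]. *)
Lemma infinity_relation : exists2 p : {poly B}, mB_poly p & evp p = 1.
Proof.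
have [s [e [Re se fe]]] := cr_basis cr.
pose V : set K := [set z | exists p : 'I_s -> {poly B}, (forall i, mB_poly (p i)) /\ z = \sum_i evp (p i) * e i].
have VD a b : V a -> V b -> V (a + b).
  move=> [p [hp ->]] [q [hq ->]]; exists (fun i => p i + q i); split=> [i|]; first exact: mB_polyD.
  by rewrite -big_split; apply: eq_bigr => i _; rewrite evpD mulrDl.
have V0 : V 0.
  exists (fun=> 0); split=> [i|]; first exact: mB_poly0.
  by rewrite big1 // => i _; rewrite rmorph0 horner0 mul0r.
have VO q a : V a -> V (evp q * a).
  move=> [p [hp ->]]; exists (fun i => q * p i); split=> [i|]; first exact: mB_polyM.
  by rewrite mulr_sumr; apply: eq_bigr => i _; rewrite evpM mulrA.
have Ve q i : mB_poly q -> V (evp q * e i).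
  exists (fun j => if j == i then q else 0); split=> [j|].
    by case: eqP => _; [|apply: mB_poly0].
  rewrite (bigD1 i) //= eqxx big1 ?addr0 // => j /negPf->.
  by rewrite rmorph0 horner0 mul0r.
have VR z a : R z -> V a -> V (z * a).
  move=> Rz [p [hp ->]]; rewrite mulr_sumr; apply: (big_ind V) => // i _.
  have [c Ec] := se (z * e i) (salgM Rz (Re i)).
  rewrite mulrCA Ec mulr_sumr; apply: (big_ind V) => // j _.
  have [q Eq] := pev_lift (c j); rewrite -Eq mulrCA; apply: VO; exact: Ve.
have Vga F a : V a -> V (ga F * a).
  move: a; apply: (@mpev_ind B K be x n (fun z => forall a, V a -> V (z * a))).
  - by move=> b a Va; have := VO b%:P a Va; rewrite map_polyC hornerC.
  - by move=> i hi a; apply: VR; apply: salg_var.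
  - by move=> y z hy hz a Va; rewrite mulrDl; apply: VD; [apply: hy|apply: hz].
  - by move=> y z hy hz a Va; rewrite -mulrA; apply: hy; apply: hz.
have Vi i : V (e i).
  have [F' [gF EF]] := I1; rewrite -[e i]mul1r -(rmorph1 ga) EF.
  apply: (gF [set F | V (ga F * e i)]); first split=> /=.
  - by rewrite rmorph0 mul0r.
  - move=> b hb; rewrite rmorphD mulrDl; apply: VD.
  - move=> a ha; rewrite rmorphM -mulrA; apply: Vga.
  - move=> H [b [hb EH]] /=; rewrite EH; have := Ve b%:P i; rewrite map_polyC hornerC; apply.
    move=> j; rewrite coefC; case: eqP => _ //; apply: (idl0 mB_ideal).
have [A hA] := choice Vi.
have [|b nb|L [phi [_ phiE]]] := residue_field mB_ideal.
  by apply; rewrite rmorph1; apply: kunit1.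
  have [_ _ [b' _ Eb]] := contrapT nb; exists b'; rewrite /mB /= rmorphB rmorph1 rmorphM Eb.
  by rewrite mulfV ?subrr; [move=> [/eqP]|case: (contrapT nb)].
pose ev : {rmorphism {poly B} -> K} := horner_eval t \o map_poly be.
pose Mx : 'M[{poly B}]_s := \matrix_(i, j) ((i == j)%:R - A i j).
have E1 : map_poly phi (\det Mx) = 1.
  rewrite -det_map_mx (_ : _ _ = 1%:M) ?det1 //; apply/matrixP => i j; rewrite !mxE rmorphB /=.
  rewrite rmorph_nat [map_poly _ (A i j)](_ : _ = 0) ?subr0 //; apply/polyP => l.
  rewrite coef_map coef0; apply/phiE; apply: (hA i).1.
have E0 : ev (\det Mx) = 0.
  rewrite -det_map_mx -det_tr; apply/eqP/det0P; exists (\row_i e i).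
    apply/negP => /eqP E; have [c] := se 1 (salg1 kap x n); rewrite big1.
      by move/eqP; rewrite oner_eq0.
    by move=> i _; have /rowP/(_ i) := E; rewrite !mxE => ->; rewrite mulr0.
  apply/rowP => i; rewrite !mxE.
  under eq_bigr => j do rewrite !mxE rmorphB rmorph_nat mulrBr.
  rewrite sumrB (bigD1 i) //= eqxx mulr1 big1 ?addr0; last first.
    by move=> j nji; rewrite eq_sym (negPf nji) mulr0.
  by apply/eqP; rewrite subr_eq0 (hA i).2; apply/eqP/eq_bigr => j _; rewrite mulrC.
exists (1 - \det Mx); last by rewrite -[LHS]/(ev _) rmorphB rmorph1 E0 subr0.
have E2 : map_poly phi (1 - \det Mx) = 0 by rewrite rmorphB [X in - X]E1 rmorph1 subrr.
by move=> j; apply/phiE; have := coef0 L j; rewrite -E2 coef_map.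
Qed.

End NoDomination.

Hypothesis fracO : forall c : K, exists a b, [/\ O a, O b, b != 0 & c * b = a].
Hypothesis dimO : dim1 O.
Hypothesis nfO : exists2 p, p != 0 & O p /\ ~ kunit O p.

Lemma common_multiple (zs : seq K) : exists b, be b != 0 /\ forall z, z \in zs -> O (be b * z).
Proof.
have [_ _ OM] := hO; elim: zs => [|z zs [b [b0 hb]]]; first by exists 1; rewrite rmorph1 oner_neq0.
have [a [_ [Oa [d _ <-] d0 E]]] := fracO z; exists (b * d); rewrite rmorphM mulf_neq0 //; split=> // y.
rewrite inE => /orP[/eqP->|/hb h]; first by rewrite -mulrA (mulrC (be d)) E; apply: OM.
by rewrite mulrAC; apply: OM.
Qed.

(** If nothing dominates, 1 = p(t) with the coefficients of p in the maximal ideal m of O. Read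
    backwards, this is a monic equation for w = 1/t whose lower coefficients lie in m, so high
    powers of w are combinations of finitely many w^j with coefficients in m^N. For N large m^N
    absorbs any denominators, because O has dimension one. *)
Lemma infinity (r : K) : (exists E, dominating E) \/ exists m0, forall m, (m0 <= m)%N ->
  [/\ O (t ^- m), ~ kunit O (t ^- m), O (r * t ^- m) & ~ kunit O (r * t ^- m)].
Proof.
have [I1|nI1] := pselect (infI 1); last by left; apply: dominating_exists.
right; have [p hp Ep] := infinity_relation I1.
have [O1 _ OM] := hO; have t0 := cr_t_neq0 cr; pose w := t^-1.
have mI := mB_ideal.
have sp : (0 < size p)%N.
  by rewrite size_poly_gt0; apply/negP => /eqP p0; move: Ep; rewrite p0 rmorph0 horner0 => /esym/eqP; rewrite oner_eq0.
pose e0 := (size p).-1.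
have u0 : kunit O (1 - be p`_0).
  apply: contrapT => nu; have : ~ kunit O 1 by rewrite -(subrK (be p`_0) 1); apply: lO => //; [rewrite -(rmorph1 be) -rmorphB|apply: hp].
  by apply; apply: kunit1.
have [v _ Ev] : O (1 - be p`_0)^-1 by case: u0.
have wrel : w ^+ e0 = \sum_(j < e0) be (v * p`_(e0 - j)) * w ^+ j.
  have E : w ^+ e0 = \sum_(i < e0.+1) be p`_i * w ^+ (e0 - i).
    rewrite -[LHS]mul1r -Ep (@horner_coef_wide _ e0.+1); last by rewrite prednK // size_poly.
    rewrite mulr_suml; apply: eq_bigr => i _; rewrite coef_map -mulrA; congr (_ _).
    have hi : (i <= e0)%N by rewrite -ltnS.
    have -> : w ^+ e0 = w ^+ (e0 - i) * w ^+ i by rewrite -exprD subnK.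
    by rewrite mulrCA -exprMn mulfV // expr1n mulr1.
  rewrite big_ord_recl subn0 in E.
  have E2 : (1 - be p`_0) * w ^+ e0 = \sum_(i < e0) be p`_(lift ord0 i) * w ^+ (e0 - lift ord0 i).
    by rewrite mulrBl mul1r {1}E addrC addKr.
  have n0 : 1 - be p`_0 != 0 by case: u0.
  apply: (mulfI n0); rewrite E2 mulr_sumr (reindex_inj rev_ord_inj) /=; apply: eq_bigr => j.
  rewrite rmorphM Ev mulrA mulrA mulfV // mul1r /bump add1n subnSK // subKn //; exact: ltnW.
pose VN N : set K := [set z | exists c : 'I_e0 -> B, (forall j, ideal_pow mB N (c j)) /\ z = \sum_j be (c j) * w ^+ j].
have VD N a b : VN N a -> VN N b -> VN N (a + b).
  move=> [c [hc ->]] [d [hd ->]]; exists (fun j => c j + d j); split=> [j|]; first exact: (idlD).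
  by rewrite -big_split; apply: eq_bigr => j _; rewrite rmorphD mulrDl.
have V0 N : VN N 0.
  exists (fun=> 0); split=> [j|]; first exact: (idl0).
  by rewrite big1 // => j _; rewrite rmorph0 mul0r.
have Vm N b a : mB b -> VN N a -> VN N.+1 (be b * a).
  move=> hb [c [hc ->]]; exists (fun j => b * c j); split=> [j|]; first exact: powSmul.
  by rewrite mulr_sumr; apply: eq_bigr => j _; rewrite rmorphM mulrA.
have Vsub N a : VN N.+1 a -> VN N a.
  by move=> [c [hc ->]]; exists c; split=> // j; apply: (pow_leq).
have mrel j : mB (v * p`_(e0 - j)) by apply: (idlM _ mI).
have base i : VN 0%N (w ^+ i).
  have [m] := ubnP i; elim: m i => // m IH i; rewrite ltnS => le.
  have [lt|ge] := ltnP i e0.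
    exists (fun j => if j == Ordinal lt then 1 else 0).
    rewrite (bigD1 (Ordinal lt)) //= eqxx rmorph1 mul1r big1 ?addr0 // => j /negPf->.
    by rewrite rmorph0 mul0r.
  rewrite -(subnK ge) exprD wrel mulr_sumr; apply: (big_ind) => // [*|j _]; first exact: VD.
  rewrite mulrCA; apply: Vsub; apply: Vm => //; rewrite -exprD; apply: IH.
  have := ltn_ord j; lia.
have claim N : forall i, VN N (w ^+ (e0 * N + i)).
  elim: N => [|N IH] i; first by rewrite muln0.
  rewrite mulnS -addnA exprD wrel mulr_suml; apply: (big_ind) => // [*|j _]; first exact: VD.
  by rewrite -mulrA; apply: Vm => //; rewrite -exprD addnCA.
have [p1 p10 [[q1 _ Eq1] np1]] := nfO.
have [b [b0 hb]] := common_multiple ([seq w ^+ j | j <- iota 0 e0] ++ [seq r * w ^+ j | j <- iota 0 e0]).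
pose f := b * q1.
have f0 : be f != 0 by rewrite rmorphM mulf_neq0 // Eq1.
have : mB f by apply: (idlM _ mI); rewrite /mB /= Eq1.
have hf j : (j < e0)%N -> O (be f * w ^+ j) /\ O (be f * (r * w ^+ j)).
  rewrite rmorphM; split; rewrite mulrAC; apply: OM => //; apply: hb; rewrite mem_cat; apply/orP; [left|right];
  by apply/mapP; exists j; rewrite ?mem_iota.
(* One factor f clears the denominators of the w^j and of the r w^j; the second one, being a
   nonunit, makes the result a nonunit. *)
pose I2 : set B := [set y | exists c, be y = be f * be f * be c].
have iI2 : is_ideal I2.
  split; first by exists 0; rewrite !rmorph0 mulr0.
    by move=> y z [c Ec] [d Ed]; exists (c + d); rewrite !rmorphD Ec Ed mulrDr.
  by move=> y z [c Ec]; exists (y * c); rewrite (rmorphM be y z) (rmorphM be y c) Ec mulrCA.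
have [s Es] := (noetherian_fgen B).1 noethB mB mI.
have [y sy|N hN] := pow_sub_radical (s := s) iI2.
  have my : mB y by rewrite Es; apply: sub_gen.
  have [m [c _ Ec]] := dimO (OM _ _ (Obe f) (Obe f)) (mulf_neq0 f0 f0) (Obe y) my.
  by exists m, c; rewrite rmorphXn Ec mulrC divfK // mulf_neq0.
rewrite -Es in hN.
have fin z : VN N z -> exists2 c, O c & exists2 d, O d & z = be f * c /\ r * z = be f * d.
  move=> [c [hc ->]]; have [d hd] := choice (fun j => hN _ (hc j)).
  exists (\sum_j be (d j) * (be f * w ^+ j)).
    apply: (big_ind O) => [|*|j _]; [exact: subring0|exact: subringD|].
    by apply: OM; case: (hf j).
  exists (\sum_j be (d j) * (be f * (r * w ^+ j))).
    apply: (big_ind O) => [|*|j _]; [exact: subring0|exact: subringD|].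
    by apply: OM; case: (hf j).
  split; rewrite !mulr_sumr; apply: eq_bigr => j _; rewrite hd; ring.
exists (e0 * N)%N => m /subnKC E.
have Ew : t ^- m = w ^+ m by rewrite exprVn.
have [c Oc [d Od [E1 E2]]] := fin (t ^- m) ltac:(by rewrite Ew -E; apply: claim).
rewrite E2 E1; split; [exact: OM| |exact: OM|].
  by move/(kunitMl hO (Obe f) Oc).
by move/(kunitMl hO (Obe f) Od).
Qed.

End Infinity.

(** * Affine patches of a curve *)

Section PatchDef.
Variables (k : fieldType) (X : kScheme k).

Definition kstalk (x : X) : {rmorphism k -> stalk x} := germ (U := opensT X) I \o kstruct X.

Definition generates (V : opens X) n (g : nat -> sect V) := forall S : set (sect V),
  (forall c (i : V `<=` opensT X), S (res i (kstruct X c))) -> (forall i, (i < n)%N -> S (g i)) ->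
  (forall a b, S a -> S b -> S (a + b)) -> (forall a b, S a -> S b -> S (a * b)) -> S = setT.

Lemma ft_charts : is_finite_type X -> exists s : seq (opens X),
  (forall x : X, exists V, List.In V s /\ pts V x) /\
  forall V, List.In V s -> exists h n g, @chart X V h /\ @generates V n g.
Proof.
move=> [n [U [cov hU]]]; exists [seq U i | i <- enum 'I_n]; split=> [x|V].
  have [i hi] := cov x I; exists (U i); split=> //.
  by apply/In_mapP; exists i; have := mem_enum 'I_n i; elim: (enum 'I_n) => //a l IH; rewrite inE => /orP[/eqP->|/IH]; [left|right].
move=> /In_mapP[i _ ->]; have hi : U i `<=` opensT X by [].
have [[h ch] [m [g hg]]] := hU i.
exists h, m, (fun j => oapp g 0 (insub j)); split=> // S S1 S2.
apply: hg => //; first by move=> _ [c _ <-]; apply: S1.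
by move=> _ [j _ <-]; have := S2 j (ltn_ord j); rewrite valK.
Qed.

Section Patch.
Variables (eta : X) (K : fieldType) (pi : {rmorphism stalk eta -> K}).
Hypothesis pi_surj : forall c, exists a, pi a = c.
Hypothesis pi_ker : forall a, pi a = 0 <-> nonunits a.

Definition kap : {rmorphism k -> K} := pi \o kstalk eta.

Variables (V : opens X) (h : X -> set (sect V)) (n : nat) (g : nat -> sect V).
Hypotheses (ch : chart h) (gen : generates n g) (Ve : pts V eta).
Variable H : sect V.
Hypothesis nH : ~ h eta H.
Local Notation val := (gval pi Ve).
Local Notation O := (Oring pi).

(** Generators of the coordinate ring of the closure of eta in D(H): the values of the generators of
    O(V), and 1/H in the last place. *)
Definition px (i : nat) : K := if (i < n)%N then val (g i) else (val H)^-1.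
Local Notation M := (mp k n.+1).
Local Notation ev := (mpev kap px n.+1).
Local Notation R := (salg kap px n.+1).

Definition patch (y : X) := [/\ pts V y, spec eta y & ~ h y H].

Lemma valH0 : val H != 0.
Proof. by apply/eqP /(chart_val0 pi_ker ch Ve). Qed.

Lemma kap_val c (i : V `<=` opensT X) : val (res i (kstruct X c)) = kap c.
Proof. exact: (congr1 pi (germ_res _ _ _ _)). Qed.

Lemma patch_val s : R (val s).
Proof.
suff : [set s | R (val s)] = setT by move=> E; have : [set s | R (val s)] s by rewrite E.
apply: gen.
- move=> c i; change (R (val (res i (kstruct X c)))); rewrite kap_val; apply: salgC.
- move=> i hi; change (R (val (g i))); rewrite (_ : val (g i) = px i); last by rewrite /px hi.
  by apply: salg_var; apply: leqW.
- by move=> a b ha hb; change (R (val (a + b))); rewrite rmorphD; apply: salgD.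
- by move=> a b ha hb; change (R (val (a * b))); rewrite rmorphM; apply: salgM.
Qed.

Lemma patch_frac z : R z -> exists s j, z * val H ^+ j = val s.
Proof.
have sub : V `<=` opensT X by [].
have H0 := valH0.
apply: (salg_sub (T := [set z | exists s j, z * val H ^+ j = val s])).
- by move=> c; exists (res sub (kstruct X c)), 0%N; rewrite mulr1 kap_val.
- move=> i; rewrite ltnS leq_eqVlt => /orP[/eqP->|hi].
    by exists 1, 1%N; rewrite /px ltnn mulVf // rmorph1.
  by exists (g i), 0%N; rewrite mulr1 /px hi.
- move=> a b [s [j E]] [s' [j' E']]; exists (s * H ^+ j' + s' * H ^+ j), (j + j')%N.
  rewrite rmorphD !rmorphM !rmorphXn -E -E' exprD; ring.
- move=> a b [s [j E]] [s' [j' E']]; exists (s * s'), (j + j')%N.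
  rewrite rmorphM -E -E' exprD; ring.
Qed.

Lemma patch_unitH y : patch y -> kunit (O y) (val H).
Proof. by move=> [Vy sy hy]; apply/(chart_kunit pi ch Ve). Qed.

Lemma patch_sub y : patch y -> R `<=` O y.
Proof.
move=> py z /patch_frac[s [j E]]; have [Vy sy hy] := py; have [H0 _ Hi] := patch_unitH py.
have sO := Oring_subring pi sy; have [_ _ OM] := sO.
rewrite (_ : z = val s * (val H)^-1 ^+ j); first by apply: OM; [apply: chart_Oring|apply: subringX].
by rewrite -E -mulrA exprVn mulfV ?expf_neq0 // mulr1.
Qed.

Lemma evR F : R (ev F). Proof. by exists F. Qed.

Lemma lift_val s : exists F, ev F = val s.
Proof. by have /salgP[F] := patch_val s; exists F. Qed.

Lemma patch_loc y : patch y -> is_loc ev (O y).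
Proof.
move=> py; have [Vy sy hy] := py; have [be [_ rbe _]] := stalk_value pi sy; split.
- by exists (stalk y), be.
- exact: Oring_local.
- move=> F; apply: (patch_sub py); apply: evR.
- move=> c /(chart_Ofrac ch Ve Vy sy)[s [f [hf E]]].
  have [F EF] := lift_val s; have [F' EF'] := lift_val f; exists F, F'; rewrite EF EF'; split=> //.
  exact/(chart_kunit pi ch Ve).
Qed.

Lemma patch_locmax y F s : patch y -> ev F = val s -> locmax ev (O y) F <-> h y s.
Proof.
move=> [Vy sy hy] E; change (~ kunit (O y) (ev F) <-> h y s).
rewrite E (chart_kunit pi ch Ve _ Vy sy); split=> [|hs /(_ hs)//]; apply: contrapT.
Qed.

Lemma patch_inj y y' : patch y -> patch y' -> locmax ev (O y) = locmax ev (O y') -> y = y'.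
Proof.
move=> py py' E; have [Vy _ _] := py; have [Vy' _ _] := py'; apply: (chart_inj ch Vy Vy').
apply/seteqP; split=> s; have [F EF] := lift_val s.
  by move/(patch_locmax py EF); rewrite E => /(patch_locmax py' EF).
by move/(patch_locmax py' EF); rewrite -E => /(patch_locmax py EF).
Qed.

Lemma patch_point P : is_prime P -> (forall F, ev F = 0 -> P F) -> exists y, patch y /\ P = locmax ev (O y).
Proof.
move=> pP ker; have [iP P1 PM] := pP.
have indep F F' : ev F = ev F' -> P F -> P F'.
  move=> E PF; apply: (idl_congr iP _ PF); apply: ker; by rewrite rmorphB E subrr.
pose P' : set (sect V) := [set s | exists2 F, P F & ev F = val s].
have inP' F s : ev F = val s -> P' s -> P F by move=> E [F' PF' E']; apply: indep PF'; rewrite E.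
have pP' : is_prime P'.
  split; first split.
  - exists 0; rewrite ?rmorph0 //; apply: (idl0 iP).
  - by move=> a b [F PF E] [F' PF' E']; exists (F + F'); rewrite ?rmorphD ?E ?E' //; apply: (idlD iP).
  - move=> c a [F PF E]; have [G EG] := lift_val c.
    by exists (G * F); rewrite ?rmorphM ?E ?EG //; apply: (idlM _ iP).
  - by move=> h1; apply: P1; apply: inP' h1; rewrite !rmorph1.
  - move=> a b hab; have [F EF] := lift_val a; have [G EG] := lift_val b.
    have : P (F * G) by apply: inP' hab; rewrite !rmorphM EF EG.
    by move/PM => [PF|PG]; [left; exists F|right; exists G].
have [|y [Vy sy Ey]] := chart_point ch Ve pP'.
- move=> s /(chart_val0 pi_ker ch Ve) E; exists 0; rewrite ?rmorph0 //; apply: (idl0 iP).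
have hy : ~ h y H.
  rewrite Ey => -[F PF E]; apply: P1; have [G _ EG] := mpev_range_var kap px (ltnSn n).
  apply: indep (idlMr G iP PF); rewrite rmorphM rmorph1 E EG /px ltnn mulfV //; exact: valH0.
have py : patch y by [].
exists y; split=> //.
have [FH EH] := lift_val H.
apply/seteqP; split=> F.
  move=> PF; have [s [j E]] := patch_frac (evR F).
  have E2 : ev (F * FH ^+ j) = val s by rewrite rmorphM rmorphXn EH.
  have : h y s by rewrite Ey; exists (F * FH ^+ j) => //; apply: (idlMr _ iP).
  move/(patch_locmax py E2) => hl; rewrite /= => u; apply: hl; rewrite rmorphM rmorphXn EH.
  have sO := Oring_subring pi sy; apply: kunitM => //.
  by elim: (j) => [|i IH]; [rewrite expr0; apply: kunit1|rewrite exprS; apply: kunitM => //; apply: patch_unitH].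
move=> lF; have [s [j E]] := patch_frac (evR F).
have E2 : ev (F * FH ^+ j) = val s by rewrite rmorphM rmorphXn EH.
have : locmax ev (O y) (F * FH ^+ j).
  by apply: idlMr lF; apply: prime_ideal; apply: locmax_prime; apply: patch_loc.
move/(patch_locmax py E2); rewrite Ey => /(inP' _ _ E2)/PM[//|/(primeX pP) PH].
by exfalso; apply: hy; rewrite Ey; exists FH.
Qed.

Lemma patch_field c : exists a b, [/\ R a, R b, b != 0 & c * b = a].
Proof.
have [s [f [hf E]]] := chart_Ofrac ch Ve Ve (@spec_eta X eta) (Oring_eta pi_surj c).
exists (val s), (val f); split=> //; [exact: patch_val|exact: patch_val|].
by apply/eqP /(chart_val0 pi_ker ch Ve).
Qed.

Lemma patch_degree y d : patch y -> kd (mpC k n.+1) (locmax ev (O y)) d -> kd (kstalk y) (@nonunits (stalk y)) d.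
Proof.
move=> py hd; have ml := kd_maximal (locmax_prime (patch_loc py)) hd.
have [Vy sy hy] := py; have [be [beE rbe bu]] := stalk_value pi sy; have lO := patch_loc py.
have bek c : be (kstalk y c) = kap c by rewrite /= (beE (opensT X) I I).
have sO := Oring_subring pi sy.
have unit_be a : is_unit a <-> kunit (O y) (be a).
  split=> [|/bu //]; move=> [b hb].
  have E : be a * be b = 1 by rewrite -rmorphM hb rmorph1.
  have : be a != 0 by apply/eqP => E0; move: E; rewrite E0 mul0r => /esym/eqP; rewrite oner_eq0.
  by split=> //; rewrite -rbe; [exists a|exists b => //; rewrite -[RHS]mulr1 -E mulKf].
have [T [e [cT s f]]] := hd.
have lift i : exists b, be b = ev (e i).
  have : O y (ev (e i)) by apply: (patch_sub py); apply: evR.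
  by rewrite -rbe => -[b _ <-]; exists b.
have [e' he'] := choice lift.
have sum_be c : be (\sum_i kstalk y (c i) * e' i) = ev (\sum_i mpC k n.+1 (c i) * e i).
  rewrite !rmorph_sum; apply: eq_bigr => i _; by rewrite !rmorphM bek he' mpev_mpC.
exists T, e'; split=> // [b|c hc].
  have [|F [G [uG E]]] := (let: And4 _ _ _ q := lO in q) (be b); first by rewrite -rbe; exists b.
  have [_ _ inv] := ml; have [|G' hG'] := inv G; first by apply.
  have [c hc] := s (F * G'); exists c; rewrite /nonunits /= unit_be rmorphB sum_be => u.
  have nb : ~ kunit (O y) (be b - ev (F * G')).
    have -> : be b - ev (F * G') = be b * ev (1 - G * G').
      rewrite !rmorphM -E; ring.
    rewrite mulrC => /(kunitMl sO); move=> q; apply: hG'; apply: q; first exact: (patch_sub py (evR _)).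
    by rewrite -rbe.
  have Ob : O y (be b) by rewrite -rbe.
  have OF F' : O y (ev F') by apply: (patch_sub py); apply: evR.
  have := Oring_local sy (a := be b - ev (F * G')) (b := ev (F * G' - \sum_i mpC k n.+1 (c i) * e i)).
  rewrite rmorphB addrA subrK => q; apply: q u => //.
  - by have [_ OB _] := sO; apply: OB.
  - by rewrite -rmorphB.
  - by rewrite -rmorphB.
have : ~ kunit (O y) (ev (\sum_i mpC k n.+1 (c i) * e i)) by rewrite -sum_be => /unit_be.
exact: f.
Qed.

End Patch.
End PatchDef.

(** * Closed points *)

Section NoethPrimes.
Variable A : comPzRingType.
Hypothesis noethA : is_noetherian A.

Lemma mem_primes_radical (I : set A) a : is_ideal I -> (forall P, is_prime P -> I `<=` P -> P a) ->
  exists n : nat, I (a ^+ n).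
Proof.
move=> hI; apply: (prime_filtration_ind noethA (R := fun J => (forall P, is_prime P -> J `<=` P -> P a) ->
  exists n : nat, J (a ^+ n))) hI => [_|J x hJ nx pr IH hP]; first by exists 0%N.
have [|n /adjoinP[c hc]] := IH; first by move=> P pP s; apply: hP => // y /sub_adjoin/s.
have : J (x * a) by apply: (hP _ pr) => y; apply: sub_colon.
exists n.+1; rewrite exprSr -(subrK (x * c) (a ^+ n)) mulrDl; apply: (idlD hJ).
  exact: (idlMr _ hJ).
by rewrite mulrAC; apply: (idlMr _ hJ).
Qed.

(** The primes over I are among those of a prime filtration of A/I: a prime over [colon J x] equals
    it by maximality, and a prime containing x lies over [adjoin J x]. *)
Lemma finite_primes (I : set A) : is_ideal I -> (forall P, is_prime P -> I `<=` P -> maximal_ideal P) ->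
  exists s : seq (set A), forall P, is_prime P -> I `<=` P -> List.In P s.
Proof.
move=> hI; apply: (prime_filtration_ind noethA (R := fun J => (forall P, is_prime P -> J `<=` P -> maximal_ideal P) ->
  exists s : seq (set A), forall P, is_prime P -> J `<=` P -> List.In P s)) hI => [_|J x hJ nx pr IH mx].
  by exists [::] => P [_ P1 _] s; case: P1; apply: s.
have [|s hs] := IH; first by move=> P pP sP; apply: mx => // y /sub_adjoin/sP.
exists (colon J x :: s) => P pP JP; have [Px|nPx] := pselect (P x).
  by right; apply: hs => //; apply: adjoin_sub.
left; apply: esym; apply: maximal_sub; first by apply: mx => // y; apply: sub_colon.
- exact: prime_ideal.
- by move=> y /JP /(primeM pP)[].
- by case: pP.
Qed.

End NoethPrimes.

Lemma const_dvd (k K : fieldType) (kap : {rmorphism k -> K}) (O : set K) (v : K) (p : {poly k}) :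
  subring O -> (forall c, O (kap c)) -> O v -> v != 0 -> p != 0 -> (map_poly kap p).[v] = 0 -> O v^-1.
Proof.
move=> hO Ok Ov v0; have [_ _ OM] := hO; elim/poly_ind: p => [|p c IH pn]; first by rewrite eqxx.
rewrite rmorphD rmorphM /= map_polyX map_polyC hornerMXaddC.
have [c0|cn] := eqVneq c 0.
  have E0 : kap c = 0 by move: c0; rewrite -(rmorph0 kap) => ->.
  move=> h; have /eqP : (map_poly kap p).[v] * v = 0.
    by apply: etrans h; apply: esym; apply: etrans (addr0 _); congr (_ _).
  rewrite mulf_eq0 (negPf v0) orbF => /eqP; apply: IH.
  by apply: contra pn => /eqP ->; rewrite c0 mul0r add0r.
move=> h; have kc : kap c != 0 by rewrite fmorph_eq0.
have -> : v^-1 = kap c^-1 * - (map_poly kap p).[v].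
  apply: (mulIf v0); rewrite mulVf // -mulrA mulNr; move/eqP: h; rewrite addrC addr_eq0 => /eqP <-.
  by rewrite fmorphV mulVf.
apply: (OM) => //; apply: subringN => //; rewrite (horner_coef_wide _ (leqnn _)).
apply: (big_ind O); [exact: subring0|by move=> *; apply: subringD|move=> i _].
apply: OM; last exact: subringX.
rewrite (coef_map kap); apply: Ok.
Qed.

Lemma integral_inverse (R : comNzRingType) (K : fieldType) (f : {rmorphism R -> K}) (O : set K) (v : K) :
  subring O -> (forall c, O (f c)) -> O v -> v != 0 -> integralOver f v^-1 -> O v^-1.
Proof.
move=> hO Of Ov v0 [p mp' /rootP]; have [_ _ OM] := hO.
rewrite (@horner_coef_wide _ (size p)); last exact: size_poly.
have sp : (0 < size p)%N by rewrite size_poly_gt0 monic_neq0.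
case E : (size p) sp => [//|m] _; rewrite big_ord_recr /=.
have -> : (map_poly f p)`_m = 1.
  rewrite coef_map; apply: etrans (rmorph1 f); congr (f _).
  by rewrite -[m]/(m.+1.-1) -E -lead_coefE; apply/monicP.
rewrite mul1r => h; case: m E h => [|m] E h.
  by move: h; rewrite big_ord0 add0r => /eqP; rewrite oner_eq0.
have -> : v^-1 = - \sum_(i < m.+1) f p`_i * v ^+ (m - i).
  have vm : v^-1 ^+ m.+1 * v ^+ m = v^-1 by rewrite exprS -mulrA -exprMn mulVf // expr1n mulr1.
  rewrite -{1}vm; move/eqP: h; rewrite addrC addr_eq0 => /eqP ->.
  rewrite mulNr mulr_suml; congr (- _); apply: eq_bigr => i _; rewrite coef_map -mulrA; congr (_ _).
  have hi : (i <= m)%N by rewrite -ltnS.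
  have -> : v ^+ m = v ^+ i * v ^+ (m - i) by rewrite -exprD subnKC.
  by rewrite mulrA -exprMn mulVf // expr1n mul1r.
apply: subringN => //; apply: (big_ind O); [exact: subring0|by move=> *; apply: subringD|move=> i _].
by apply: OM => //; apply: subringX.
Qed.

(* Zariski's lemma: the transcendence basis of the normalization is empty, as its last
   element would be invertible in a polynomial ring. *)
Lemma salg_field_finite (k K : fieldType) (kap : {rmorphism k -> K}) x n :
  (forall z : K, salg kap x n z) -> exists w : seq K, forall z, exists c : nat -> k, z = \sum_(i < size w) kap (c i) * w`_i.
Proof.
move=> full; have [r [t [t1 t2 t3]]] := noether_normalization kap n x.
case: r t1 t2 t3 => [|r] t1 t2 t3.
  have [||w [_ hw]] := @integral_finite k K kap k kap x n.
  - by move=> c; exists c.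
  - by move=> i hi; apply: t3.
  by exists w => z; have [c ->] := hw z (full z); exists c.
have Xn0 : t r != 0.
  apply/eqP => E; have : mpev kap t r.+1 ('X : {poly mp k r}) = mpev kap t r.+1 (0 : {poly mp k r}).
    by rewrite mpev_X (rmorph0).
  by move/t2 /eqP; rewrite polyX_eq0.
have [G _ EG] : range (mpev kap t r.+1) (t r)^-1.
  apply: (integral_inverse) => //.
  - exact: range_subring.
  - exists ('X : {poly mp k r}) => //; apply: mpev_X.
  - exact: t3.
have : mpev kap t r.+1 (('X : {poly mp k r}) * G) = mpev kap t r.+1 (1 : {poly mp k r}).
  by rewrite (rmorphM) (rmorph1) mpev_X EG mulfV.
move/t2 /(congr1 (fun p : {poly mp k r} => p`_0)).
by rewrite coefXM coef1 => /eqP; rewrite eq_sym oner_eq0.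
Qed.

Lemma mp_morphism (k : fieldType) (S : comNzRingType) n (f : {rmorphism mp k n -> S}) :
  exists x, forall F, f F = mpev (f \o mpC k n) x n F.
Proof.
elim: n f => [|n IH] f; first by exists (fun=> 0).
pose f' : {rmorphism mp k n -> S} := [the {rmorphism mp k n -> S} of f \o polyC].
have [x hx] := IH f'; exists (fun i => if (i < n)%N then x i else f 'X) => F.
pose f1 : {rmorphism {poly mp k n} -> S} := f.
have fE (p : {poly mp k n}) : f1 p = (map_poly f' p).[f1 'X].
  elim/poly_ind: p => [|p c IHp]; first by rewrite !rmorph0 horner0.
  apply: etrans; first by rewrite rmorphD rmorphM.
  by rewrite IHp rmorphD rmorphM /= map_polyX map_polyC hornerMXaddC.
rewrite fE mpevS ltnn; congr (_.[_]); apply: eq_map_poly => c; rewrite hx.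
suff E m (y z : nat -> S) (q q' : {rmorphism k -> S}) : q =1 q' -> (forall i, (i < m)%N -> y i = z i) ->
    mpev q y m =1 mpev q' z m.
  by apply: E => // i ->.
move=> eq; elim: m => [|m IHm] e F' //; rewrite !mpevS e //; congr (_.[_]); apply: eq_map_poly => c'.
by apply: IHm => i hi; apply: e; apply: leqW.
Qed.

Lemma mp_maximal_finite (k : fieldType) n (P : set (mp k n)) : maximal_ideal P -> exists d, kd (mpC k n) P d.
Proof.
move=> [hP P1 Pi]; have [K [rho [rs rk]]] := residue_field hP P1 Pi.
have [x hx] := mp_morphism rho.
have [|w hw] := @salg_field_finite k K (rho \o mpC k n) x n.
  by move=> z; have [F <-] := rs z; exists F.
have [e he] := choice (fun i : 'I_(size w) => rs w`_i).
apply: (kd_fin (e := e) hP) => F; have [c Ec] := hw (rho F).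
exists (fun i : 'I_(size w) => c (nat_of_ord i)); apply/rk.
rewrite rmorphB rmorph_sum Ec; apply/eqP; rewrite subr_eq0; apply/eqP; apply: eq_bigr => i.
by rewrite rmorphM he.
Qed.

Section ClosedPoints.
Variables (k : fieldType) (X : kScheme k).
Hypothesis X_ft : is_finite_type X.

Lemma closed_spec (x y : X) : closed [set x] -> spec x y -> y = x.
Proof. by move=> /closure_id E /spec_closure; rewrite -E. Qed.

Lemma point_chart (x : X) : exists V h n g, [/\ pts V x, @chart X V h & @generates k X V n g].
Proof.
have [s [cov hs]] := ft_charts X_ft; have [V [sV Vx]] := cov x.
by have [h [n [g [ch gen]]]] := hs V sV; exists V, h, n, g.
Qed.

Lemma residue (x : X) : exists (K : fieldType) (pi : {rmorphism stalk x -> K}),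
  (forall c, exists a, pi a = c) /\ forall a, pi a = 0 <-> nonunits a.
Proof.
have [l1 n1] := stalk_local x; apply: residue_field => // a na.
have [b hb] : is_unit a by apply: contrapT.
exists b; rewrite hb subrr; apply: (idl0 l1).
Qed.

(** At a specialization y, a function not vanishing at x has a value algebraic over k, hence a unit
    of the local ring at y. So x and y have the same prime in a chart around y. *)
Lemma finite_point_closed (x : X) d : kd (kstalk x) (@nonunits (stalk x)) d -> closed [set x].
Proof.
move=> hd; suff : closure [set x] = [set x] by move=> <-; apply: closed_closure.
apply/seteqP; split; last exact: subset_closure.
move=> y /spec_closure sy; have [V [h [n [g [Vy ch gen]]]]] := point_chart y.
have Vx := sy V Vy; have [K [pi [pis pik]]] := residue x.
apply: (chart_inj ch Vy Vx); apply/seteqP; split; last by apply/(chart_spec ch Vx Vy).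
move=> s hs; apply: contrapT => ns.
have v0 : gval pi Vx s != 0 by apply/eqP /(chart_val0 pik ch Vx).
have [c [[i ci] hc]] := kd_algebraic (germ Vx s) (let: conj l _ := stalk_local x in l) hd.
have sO := Oring_subring pi sy.
have Ok b : Oring pi y (kap pi b) by exists (opensT X), I, I, (kstruct X b).
have Os : Oring pi y (gval pi Vx s) by apply: chart_Oring.
suff Oi : Oring pi y (gval pi Vx s)^-1.
  by have /(chart_kunit pi ch Vx s Vy sy) : kunit (Oring pi y) (gval pi Vx s) by [].
pose p := \poly_(j < d.+1) oapp c 0 (insub j).
have cp (j : 'I_d.+1) : p`_j = c j by rewrite coef_poly ltn_ord valK.
apply: (const_dvd (p := p)) => //.
  by apply/eqP => E; move: ci; rewrite -cp E coef0 eqxx.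
rewrite (@horner_coef_wide _ d.+1); last apply: leq_trans (size_poly _ _) (size_poly _ _).
have /pik := hc; rewrite rmorph_sum => E; rewrite -[RHS]E; apply: eq_bigr => j.
by rewrite coef_map cp rmorphM rmorphXn.
Qed.

Section ClosedPatch.
Variables (eta : X) (K : fieldType) (pi : {rmorphism stalk eta -> K}).
Hypothesis pis : forall c, exists a, pi a = c.
Hypothesis pik : forall a, pi a = 0 <-> nonunits a.
Variables (V : opens X) (h : X -> set (sect V)) (n : nat) (g : nat -> sect V).
Hypotheses (ch : chart h) (gen : generates n g) (Ve : pts V eta).
Variable H : sect V.
Hypothesis nH : ~ h eta H.
Local Notation ev := (mpev (kap pi) (px pi n g Ve H) n.+1).
Local Notation R := (salg (kap pi) (px pi n g Ve H) n.+1).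
Local Notation O := (Oring pi).
Local Notation patch := (patch eta h H).

Lemma locmax_ker y F : ev F = 0 -> locmax ev (O y) F.
Proof. by move=> E; case=> /eqP. Qed.

Lemma locmax_sub y y' : patch y -> patch y' -> locmax ev (O y) `<=` locmax ev (O y') -> spec y y'.
Proof.
move=> py py' s; have [Vy _ _] := py; have [Vy' _ _] := py'.
have hs : h y `<=` h y'.
  move=> f; have [F EF] := lift_val pi gen Ve H f.
  by move=> /(patch_locmax ch py EF)/s/(patch_locmax ch py' EF).
by move=> W; have := (chart_special ch Vy Vy').2 hs W (pts_open W).
Qed.

Lemma closed_patch_maximal y : closed [set y] -> patch y -> maximal_ideal (locmax ev (O y)).
Proof.
move=> cy py; have pP := locmax_prime (patch_loc pik ch gen Ve nH py).
have [iP P1 _] := pP; split=> // a na; apply: contrapT => no.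
have [|N [pN PN _]] := exists_maximal (idl_adjoin a iP).
  by case/adjoinP => c hc; apply: no; exists c.
have [y' [py' EN]] := patch_point pik ch gen nH pN (fun F E => PN F (@sub_adjoin _ _ a _ (locmax_ker E))).
have Ey : y' = y.
  by apply: (closed_spec cy); apply: (locmax_sub py py'); rewrite -EN => z hz; apply: PN; apply: sub_adjoin.
by apply: na; rewrite -[y]Ey -EN; apply: PN; apply: mem_adjoin.
Qed.

Lemma closed_patch_finite y : closed [set y] -> patch y -> exists d, kd (mpC k n.+1) (locmax ev (O y)) d.
Proof. by move=> cy py; apply: mp_maximal_finite; apply: closed_patch_maximal. Qed.

End ClosedPatch.
End ClosedPoints.

(** * Moving a point along a curve *)

Lemma prime_prod (A : comPzRingType) (P : set A) (I : Type) (r : seq I) (F : I -> A) :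
  is_prime P -> (forall i, ~ P (F i)) -> ~ P (\prod_(i <- r) F i).
Proof.
move=> pP h; have [_ P1 _] := pP; apply: (big_ind (fun a => ~ P a)) => // a b.
exact: primeNM.
Qed.

Lemma avoid_seq (A : comPzRingType) (T : eqType) (P : set A) (I : T -> set A) (s : seq T) : is_prime P ->
  exists c, ~ P c /\ forall y, y \in s -> is_ideal (I y) -> ~ I y `<=` P -> I y c.
Proof.
move=> pP; elim: s => [|y s [c [nc hc]]]; first by exists 1; case: pP.
have [[hI nI]|no] := pselect (is_ideal (I y) /\ ~ I y `<=` P); last first.
  exists c; split=> // y'; rewrite inE => /orP[/eqP-> hI nI|/hc//]; by case: no.
have [x nx] : exists2 x, I y x & ~ P x.
  by apply: contrapT => no; apply: nI => x Ix; apply: contrapT => nx; apply: no; exists x.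
exists (x * c); split; first exact: primeNM.
move=> y'; rewrite inE => /orP[/eqP-> _ _|ys hI' nI']; first exact: idlMr.
by apply: (idlM _ hI'); apply: hc.
Qed.

(** Replacing t by a nonconstant polynomial in t keeps R integral over k[t]; through [cr_norm] the
    parameter can thus be made a multiple of any nonzero element of R whose norm is not constant. *)
Lemma cr_comp (k K : fieldType) (kap : {rmorphism k -> K}) x n t (N : {poly k}) :
  curve_ring kap x n t -> (1 < size N)%N -> curve_ring kap x n (pev kap t N).
Proof.
move=> cr sN; have [hR inj int] := cr.
have pc p : pev kap (pev kap t N) p = pev kap t (p \Po N).
  rewrite pevE [RHS]pevE map_comp_poly horner_comp; congr (_.[_]); apply: pevE.
split=> [|p q|z Rz]; first exact: cr_pev.
  rewrite !pc => /inj/eqP; rewrite -subr_eq0 -rmorphB comp_poly_eq0 // subr_eq0; by move/eqP.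
have N0 : N != 0 by rewrite -size_poly_gt0; apply: ltnW.
have lc : lead_coef N != 0 by rewrite lead_coef_eq0.
pose q : {poly {poly k}} := map_poly polyC ((lead_coef N)^-1 *: N) - ((lead_coef N)^-1%:P * 'X)%:P.
have sq : size (map_poly polyC ((lead_coef N)^-1 *: N)) = size N.
  by rewrite size_map_poly size_scale // invr_eq0.
have mq : q \is monic.
  rewrite monicE lead_coefDl; last by rewrite sq size_polyN (leq_ltn_trans (size_polyC_leq1 _)).
  by rewrite lead_coef_map lead_coefZ mulVf.
have intt : integralOver (pev kap (pev kap t N)) t.
  exists q => //; apply/rootP; rewrite rmorphB /= map_polyC hornerD hornerN hornerC.
  rewrite -map_poly_comp (@eq_map_poly _ _ _ kap); last by move=> c /=; rewrite pev_C.
  have pz s c p : pev kap s (c *: p) = kap c * pev kap s p by rewrite -mul_polyC rmorphM pev_C.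
  apply: etrans (_ : pev kap t ((lead_coef N)^-1 *: N) - pev kap (pev kap t N) (((lead_coef N)^-1)%:P * 'X) = 0).
    by rewrite [in RHS]pevE.
  by rewrite pz rmorphM pev_C pev_X subrr.
have intp p : integralOver (pev kap (pev kap t N)) (pev kap t p).
  rewrite [X in _ X]pevE; apply: integral_horner => //; apply/integral_poly => i; rewrite coef_map.
  have E : pev kap (pev kap t N) (p`_i)%:P = kap p`_i by apply: pev_C.
  by have := integral_id (pev kap (pev kap t N)) (p`_i)%:P; rewrite E.
have [p mp rp] := int z Rz.
apply: (integral_root_monic (monic_map _ mp) rp); apply/integral_poly => i; rewrite coef_map; exact: intp.
Qed.

Section CurvePoints.
Variables (k : fieldType) (X : kScheme k).
Hypothesis X_ft : is_finite_type X.
Variables (eta : X) (K : fieldType) (pi : {rmorphism stalk eta -> K}).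
Hypothesis pis : forall c, exists a, pi a = c.
Hypothesis pik : forall a, pi a = 0 <-> nonunits a.
Local Notation O := (Oring pi).

(* The denominators in the fractions expressing that [phi] divides powers of generators
   of the ideal of [x0] are inverted. *)
Lemma adapted_patch (x0 : X) (phi : K) : closed [set x0] -> spec eta x0 -> O x0 phi -> phi != 0 ->
  (forall f, O x0 f -> ~ kunit (O x0) f -> exists n : nat, O x0 (f ^+ n / phi)) ->
  exists V h n g (Ve : pts V eta) H, [/\ chart h, @generates k X V n g, ~ h eta H, patch eta h H x0 &
    salg (kap pi) (px pi n g Ve H) n.+1 phi /\
    forall y, patch eta h H y -> ~ kunit (O y) phi -> y = x0].
Proof.
move=> cx sx Ophi phi0 div; have [V [h [n [g [Vx ch gen]]]]] := point_chart X_ft x0; have Ve := sx V Vx.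
have nH1 : ~ h eta 1 by case: (chart_prime ch Ve).
have nx1 : ~ h x0 1 by case: (chart_prime ch Vx).
pose ev1 := mpev (kap pi) (px pi n g Ve 1) n.+1.
have px1 : patch eta h 1 x0 by [].
have lO := patch_loc pik ch gen Ve nH1 px1.
have [s [f [nf E]]] := chart_Ofrac ch Ve Vx sx Ophi.
have [r [G EG]] := @mp_noetherian k n.+1 (@field_noetherian k) _ (prime_ideal (locmax_prime lO)).
have GP i : locmax ev1 (O x0) (G i) by rewrite EG; apply: sub_gen.
have evO y F : patch eta h 1 y -> O y (ev1 F) by move=> py; apply: (patch_sub pik ch nH1 py); exists F.
have /choice[w hw] (i : 'I_r) : exists w : nat * sect V * sect V,
    ~ h x0 w.2 /\ ev1 (G i) ^+ w.1.1 / phi * gval pi Ve w.2 = gval pi Ve w.1.2.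
  have [m hm] := div _ (evO _ (G i) px1) (GP i).
  by have [a [b]] := chart_Ofrac ch Ve Vx sx hm; exists (m, a, b).
pose Q := \prod_i (w i).2; pose H := f * Q.
have nQ : ~ h x0 Q by apply: prime_prod (chart_prime ch Vx) _ => i; case: (hw i).
have nH0 : ~ h x0 H by apply: primeNM (chart_prime ch Vx) nf nQ.
have nH : ~ h eta H by move=> hH; apply: nH0; exact: ((chart_spec ch Ve Vx).1 sx _ hH).
have HR a b : a * b = H -> salg (kap pi) (px pi n g Ve H) n.+1 (gval pi Ve a)^-1.
  move=> Eab; have H0 := valH0 pik ch Ve nH.
  have -> : (gval pi Ve a)^-1 = gval pi Ve b * (gval pi Ve H)^-1.
    move: H0; rewrite -Eab rmorphM mulf_eq0 => /norP[a0 b0].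
    by rewrite invfM mulrCA mulfV // mulr1.
  apply: salgM; first exact: patch_val.
  by rewrite (_ : _^-1 = px pi n g Ve H n); [apply: salg_var|rewrite /px ltnn].
have val0 a : ~ h x0 a -> gval pi Ve a != 0.
  move=> na; apply/eqP => /(chart_val0 pik ch Ve) ha; apply: na.
  exact: ((chart_spec ch Ve Vx).1 sx _ ha).
exists V, h, n, g, Ve, H; split=> //; split.
  rewrite (_ : phi = gval pi Ve s * (gval pi Ve f)^-1); last by rewrite -E mulfK // val0.
  by apply: salgM; [apply: patch_val|apply: (HR f Q)].
move=> y py nu; apply: (closed_spec cx).
have [Vy sy hy] := py.
have py1 : patch eta h 1 y by split=> //; case: (chart_prime ch Vy).
suff : ideal_gen (range G) `<=` locmax ev1 (O y) by rewrite -EG; exact: (locmax_sub ch gen px1 py1).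
apply: gen_sub.
  exact: prime_ideal (locmax_prime (patch_loc pik ch gen Ve nH1 py1)).
move=> _ [i _ <-]; change (~ kunit (O y) (ev1 (G i))) => u; apply: nu.
have sO := Oring_subring pi sy; have [hn Ei] := hw i.
have uX : kunit (O y) (ev1 (G i) ^+ (w i).1.1).
  by elim: (w i).1.1 => [|j IH]; [rewrite expr0; apply: kunit1|rewrite exprS; apply: kunitM].
move: uX; rewrite (_ : _ _ = phi * (gval pi Ve (w i).1.2 * (gval pi Ve (w i).2)^-1)); last first.
  by rewrite -Ei mulfK ?val0 // mulrCA mulfV ?mulr1.
have Rf : salg (kap pi) (px pi n g Ve H) n.+1 phi.
  rewrite (_ : phi = gval pi Ve s * (gval pi Ve f)^-1); last by rewrite -E mulfK // val0.
  by apply: salgM; [apply: patch_val|apply: (HR f Q)].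
have RO : salg (kap pi) (px pi n g Ve H) n.+1 `<=` O y := patch_sub pik ch nH py.
apply: (kunitMl sO); first exact: RO.
apply: RO; apply: salgM; first exact: patch_val.
by apply: (HR _ (f * \prod_(j < r | j != i) (w j).2)); rewrite mulrCA /H /Q [in RHS](bigD1 i).
Qed.

Section CurvePatch.
Variables (V : opens X) (h : X -> set (sect V)) (n : nat) (g : nat -> sect V).
Hypotheses (ch : chart h) (gen : @generates k X V n g) (Ve : pts V eta).
Variable H : sect V.
Hypothesis nH : ~ h eta H.
Local Notation M := (mp k n.+1).
Local Notation ka := (kap pi).
Local Notation x := (px pi n g Ve H).
Local Notation ev := (mpev ka x n.+1).
Local Notation R := (salg ka x n.+1).
Local Notation patch := (patch eta h H).

Lemma patch_R y a : patch y -> R a -> O y a.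
Proof. move=> py; apply: (patch_sub pik ch nH py). Qed.

Lemma multI_locmax y a : patch y -> R a -> ~ kunit (O y) a -> multI ka x a `<=` locmax ev (O y).
Proof.
move=> py Ra na F [q Rq E]; change (~ kunit (O y) (ev F)); rewrite E => u; apply: na.
have [_ sy _] := py; apply: (kunitMl (Oring_subring pi sy) _ _ u); apply: (patch_R py); assumption.
Qed.

Lemma locmax_multI y a : patch y -> R a -> multI ka x a `<=` locmax ev (O y) -> ~ kunit (O y) a.
Proof.
move=> py [F _ E] s; rewrite -E; apply: (s F); exists 1; [exact: salg1|by rewrite mulr1].
Qed.

Lemma multI_point a P : R a -> is_prime P -> multI ka x a `<=` P ->
  exists y, [/\ patch y, P = locmax ev (O y) & ~ kunit (O y) a].
Proof.
move=> Ra pP s; have [y [py EP]] := patch_point pik ch gen nH pP (fun F E => s F (multI_ker a E)).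
by exists y; split=> //; apply: (locmax_multI py Ra); rewrite -EP.
Qed.

(** As phi vanishes on the patch only at the closed point x0, the quotient R/phi R has finite
    dimension over k, hence is algebraic, as [curve_normalization] requires. *)
Lemma patch_curve x0 phi : closed [set x0] -> patch x0 -> R phi -> phi != 0 -> ~ kunit (O x0) phi ->
  (forall y, patch y -> ~ kunit (O y) phi -> y = x0) -> exists t, curve_ring ka x n.+1 t.
Proof.
move=> cx px0 Rf f0 nf only.
have [d hd] : exists d, kd (mpC k n.+1) (multI ka x phi : set M) d.
  apply: (kd_filtration (mp_noetherian (@field_noetherian k)) (multI_ideal ka x n.+1 phi)) => P pP sP.
  have [y [py -> /(only y py) Ey]] := multI_point Rf pP sP; subst.
  exact: (closed_patch_finite pik ch gen Ve nH cx py).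
have [|z [F _ EF]|t [Rt inj int]] := curve_normalization Rf f0.
- move=> Ri; apply: nf; split=> //; apply: (patch_R px0); assumption.
- have [c [[i ci] hc]] := kd_algebraic F (multI_ideal ka x n.+1 phi) hd.
  pose p := \poly_(j < d.+1) oapp c 0 (insub j).
  have cp (j : 'I_d.+1) : p`_j = c j by rewrite coef_poly ltn_ord valK.
  exists p; split; first by apply/eqP => E; move: ci; rewrite -cp E coef0 eqxx.
  have [q Rq Eq] := hc; suff -> : (map_poly ka p).[z] = phi * q by rewrite mulrAC mulfV // mul1r.
  rewrite -Eq (@horner_coef_wide _ d.+1); last apply: leq_trans (size_poly _ _) (size_poly _ _).
  rewrite rmorph_sum; apply: eq_bigr => j.
  by rewrite coef_map cp (rmorphM ev) rmorphXn EF mpev_mpC.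
exists t; split=> // [p q|z Rz]; first by rewrite !pev_mpev; apply: inj.
by have [p rp] := int z Rz; exists p => //; rewrite (eq_map_poly (pev_mpev ka t)).
Qed.

Section CurveRing.
Variable t : K.
Hypothesis cr : curve_ring ka x n.+1 t.

Lemma curve_prime a P : R a -> a != 0 -> is_prime P -> multI ka x a `<=` P ->
  (exists d, kd (mpC k n.+1) P d) /\ maximal_ideal P.
Proof.
move=> Ra a0 pP sP; have [d hd] := cr_finite cr Ra a0.
have [e _ he] := kd_sub (prime_ideal pP) sP hd.
by split; [exists e|apply: kd_maximal he].
Qed.

Lemma finite_points a : R a -> a != 0 ->
  exists s : seq X, forall y, patch y -> ~ kunit (O y) a -> y \in s.
Proof.
move=> Ra a0.
have [P pP sP|l hl] := finite_primes (mp_noetherian (@field_noetherian k)) (multI_ideal ka x n.+1 a).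
  by have [] := curve_prime Ra a0 pP.
have : exists s : seq X, forall y, patch y -> List.In (locmax ev (O y)) l -> y \in s.
  elim: (l) => [|P r [s hs]]; first by exists [::].
  have [[y0 [py0 E0]]|no] := pselect (exists y0, patch y0 /\ P = locmax ev (O y0)).
    exists (y0 :: s) => y py [E|/(hs y py) ys]; rewrite inE; last by rewrite ys orbT.
    by rewrite (patch_inj ch gen py py0 (etrans (esym E) E0)) eqxx.
  exists s => y py [E|/(hs y py)] //; by case: no; exists y.
move=> [s hs]; exists s => y py na; apply: hs => //; apply: hl.
  exact: locmax_prime (patch_loc pik ch gen Ve nH py).
exact: multI_locmax.
Qed.

End CurveRing.
End CurvePatch.
End CurvePoints.

Lemma generates_surj (k : fieldType) (X : kScheme k) (V : opens X) n (g : nat -> sect V) :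
  (1 : sect V) != 0 -> generates n g -> exists rho : {rmorphism mp k n -> sect V}, forall s, exists F, rho F = s.
Proof.
move=> nz gen; have sub : V `<=` opensT X by [].
pose P (A : comPzRingType) := forall (ka : {rmorphism k -> A}) (G : nat -> A), (forall S : set A,
  (forall c, S (ka c)) -> (forall i, (i < n)%N -> S (G i)) -> (forall a b, S a -> S b -> S (a + b)) ->
  (forall a b, S a -> S b -> S (a * b)) -> S = setT) ->
  exists rho : {rmorphism mp k n -> A}, forall s, exists F, rho F = s.
suff hP : forall A : comNzRingType, P A.
  have hA := comNz_transport hP nz; apply: (hA (res sub \o kstruct X) g) => S Sk.
  apply: gen => // c i; rewrite (_ : i = sub); [exact: Sk|exact: Prop_irrelevance].
move=> A ka G hG; exists (mpev ka G n) => y.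
have /seteqP[_ /(_ y I)[F EF]] : range (mpev ka G n) = setT; last by exists F.
apply: hG.
- apply: mpev_range_const.
- apply: mpev_range_var.
- by move=> _ _ [F _ <-] [F' _ <-]; exists (F + F') => //; rewrite rmorphD.
- by move=> _ _ [F _ <-] [F' _ <-]; exists (F * F') => //; rewrite rmorphM.
Qed.

Lemma sect_noetherian (k : fieldType) (X : kScheme k) (V : opens X) n (g : nat -> sect V) :
  (1 : sect V) != 0 -> generates n g -> is_noetherian (sect V).
Proof.
move=> nz gen; have [rho surj] := generates_surj nz gen.
exact: (noetherian_surj surj (mp_noetherian (@field_noetherian k))).
Qed.

Lemma chart_nontrivial (X : scheme) (V : opens X) h (x : X) : @chart X V h -> pts V x -> (1 : sect V) != 0.
Proof.
move=> ch Vx; apply/eqP => E; have [hI h1 _] := chart_prime ch Vx; apply: h1; rewrite E; apply: (idl0 hI).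
Qed.

Lemma stalk_nontrivial (X : scheme) (x : X) : (1 : stalk x) != 0.
Proof. have [l1 n1] := stalk_local x; apply/eqP => E; apply: n1; rewrite E; apply: (idl0 l1). Qed.

Lemma stalk_noetherian (k : fieldType) (X : kScheme k) (x : X) : is_finite_type X -> is_noetherian (stalk x).
Proof.
move=> X_ft; have [V [h [n [g [Vx ch gen]]]]] := point_chart X_ft x.
apply: (localization_noetherian (f := germ Vx)) (sect_noetherian (chart_nontrivial ch Vx) gen) _ => a.
have [s [f [nf E]]] := chart_frac ch Vx a.
by exists s, (germ Vx f); split=> //; apply/(chart_unit ch Vx).
Qed.

(** * The points of the curve outside the patch *)

Section CurveInfinity.
Variables (k : fieldType) (X : kScheme k).
Hypothesis X_ft : is_finite_type X.
Variables (eta : X) (K : fieldType) (pi : {rmorphism stalk eta -> K}).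
Hypothesis pis : forall c, exists a, pi a = c.
Hypothesis pik : forall a, pi a = 0 <-> nonunits a.
Local Notation O := (Oring pi).
Variables (V : opens X) (h : X -> set (sect V)) (n : nat) (g : nat -> sect V).
Hypotheses (ch : chart h) (gen : @generates k X V n g) (Ve : pts V eta).
Variable H : sect V.
Hypothesis nH : ~ h eta H.
Local Notation ka := (kap pi).
Local Notation x := (px pi n g Ve H).
Local Notation ev := (mpev ka x n.+1).
Local Notation R := (salg ka x n.+1).
Local Notation patch := (patch eta h H).
Variable t : K.
Hypothesis cr : curve_ring ka x n.+1 t.

Let fieldR := patch_field pis pik ch gen Ve H.

Lemma other_chart (V2 : opens X) (h2 : X -> set (sect V2)) n2 g2 (V2e : pts V2 eta) : chart h2 ->
  @generates k X V2 n2 g2 -> exists t2, curve_ring ka (px pi n2 g2 V2e 1) n2.+1 t2.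
Proof. move=> ch2 gen2; exact: (cr_other_chart cr fieldR (patch_field pis pik ch2 gen2 V2e 1)). Qed.

Lemma curve_local y : spec eta y -> y <> eta ->
  dim1 (O y) /\ exists2 p, p != 0 & O y p /\ ~ kunit (O y) p.
Proof.
move=> sy ne; have [V2 [h2 [n2 [g2 [V2y ch2 gen2]]]]] := point_chart X_ft y.
have V2e := sy V2 V2y.
have ne1 : ~ h2 eta 1 by case: (chart_prime ch2 V2e).
have : ~ h2 y 1 by case: (chart_prime ch2 V2y).
have [s hs ns] : exists2 s, h2 y s & ~ h2 eta s.
  apply: contrapT => no; apply: ne; apply: (chart_inj ch2 V2y V2e).
  apply/seteqP; split; last exact: ((chart_spec ch2 V2e V2y).1 sy).
  by move=> s hs; apply: contrapT => ns; apply: no; exists s.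
have p0 : gval pi V2e s != 0 by apply/eqP /(chart_val0 pik ch2 V2e).
have Op : O y (gval pi V2e s) by apply: chart_Oring.
have np : ~ kunit (O y) (gval pi V2e s) by move=> /(chart_kunit pi ch2 V2e s V2y sy).
split; last by exists (gval pi V2e s).
have [t2 cr2] := other_chart V2e ch2 gen2.
have field2 := patch_field pis pik ch2 gen2 V2e 1.
have py : [/\ pts V2 y, spec eta y & ~ h2 y 1] by [].
have RO : salg ka (px pi n2 g2 V2e 1) n2.+1 `<=` O y := patch_sub pik ch2 ne1 py.
have sO := Oring_subring pi sy.
have OP p : O y (pev ka t2 p) by apply: RO; apply: cr_pev.
suff nu : exists N : {poly k}, N != 0 /\ ~ kunit (O y) (pev ka t2 N).
  exact: (cr_dim1 cr2 field2 sO (Oring_local sy) OP nu).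
have [N [N0 ON]] := cr_alg cr2 field2 p0 sO OP Op.
by exists N; split=> // u; apply: np; apply: (kunitMl sO Op ON); rewrite mulrCA mulfV // mulr1.
Qed.

(** In each chart around eta some nonzero function f has D(f) inside D(H), so the points off the
    patch are among the finitely many zeros of f. A chart missing eta contains no specialization of
    it. *)
Lemma outside_finite : exists s : seq X, forall y, spec eta y -> ~ patch y -> y \in s.
Proof.
have [l [cov hl]] := ft_charts X_ft.
suff [s hs] : exists s : seq X, forall y, spec eta y -> ~ patch y -> (exists V2, List.In V2 l /\ pts V2 y) -> y \in s.
  by exists s => y sy ny; apply: hs.
elim: (l) hl => [|V2 l' IH] hl; first by exists [::] => y _ _ [? []].
have [|s hs] := IH; first by move=> V3 i3; apply: hl; right.
have [V2e|nV] := pselect (pts V2 eta); last first.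
  exists s => y sy ny [V3 [[E|i3] V3y]]; last by apply: hs => //; exists V3.
  by case: nV; apply: sy; rewrite E.
have [h2 [n2 [g2 [ch2 gen2]]]] := hl V2 (or_introl erefl).
have ne1 : ~ h2 eta 1 by case: (chart_prime ch2 V2e).
have [f fe fs] := chart_basis ch2 (W := chartD ch H) (conj Ve nH) V2e.
have [t2 cr2] := other_chart V2e ch2 gen2.
have f0 : gval pi V2e f != 0 by apply/eqP /(chart_val0 pik ch2 V2e); case: fe.
have [s2 hs2] := finite_points pik ch2 gen2 ne1 cr2 (patch_val pi gen2 V2e 1 f) f0.
exists (s2 ++ s) => y sy ny [V3 [[E|i3] V3y]]; rewrite mem_cat; last first.
  by apply/orP; right; apply: hs => //; exists V3.
subst V3; apply/orP; left; apply: hs2; first by split=> //; case: (chart_prime ch2 V3y).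
move=> /(chart_kunit pi ch2 V2e f V3y sy) nf; apply: ny.
by have [Vy hy] := fs y (conj V3y nf).
Qed.

Hypothesis sepX : is_separated X.

(* A local ring dominating both [O y] and [R] dominates [O y'] for its center [y'] on the
   patch, hence [y = y'] by separatedness. *)
Lemma infinity_point y r : spec eta y -> ~ patch y -> exists m0, forall m, (m0 <= m)%N ->
  [/\ O y (t ^- m), ~ kunit (O y) (t ^- m), O y (r * t ^- m) & ~ kunit (O y) (r * t ^- m)].
Proof.
move=> sy ny; have [be [beE rbe bu]] := stalk_value pi sy.
have ne : y <> eta by move=> E; apply: ny; rewrite E; split.
have [dO [p p0 [Op np]]] := curve_local sy ne.
have nz : (1 : stalk y) != 0.
  apply/eqP => E; have := oner_neq0 K; by rewrite -(rmorph1 be) E rmorph0 eqxx.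
move: be rbe (stalk_noetherian (x := y) X_ft) {beE bu}.
apply: (comNz_transport (P := fun B => forall be : {rmorphism B -> K}, range be = O y -> is_noetherian B -> _)) nz => B be rbe nB.
have lB : klocal (range be) by rewrite rbe; apply: Oring_local.
have kB c : range be (ka c) by rewrite rbe; exists (opensT X), I, I, (kstruct X c).
have fB c : exists a b, [/\ range be a, range be b, b != 0 & c * b = a] by rewrite rbe; apply: Oring_frac.
have dB : dim1 (range be) by rewrite rbe.
have nuB : exists2 p, p != 0 & range be p /\ ~ kunit (range be) p by rewrite rbe; exists p.
have [[E [sE lE OE RE dom]]|[m0 hm]] := infinity cr nB lB kB fB dB nuB r; last by exists m0; rewrite -rbe.
exfalso; rewrite rbe in OE dom.
  have EP q : E (pev ka t q) by apply: RE; apply: cr_pev.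
  have nE : ~ kunit E p by move=> /(dom _ Op).
  have [N [N0 EN]] := cr_alg cr fieldR p0 sE EP (OE _ Op).
  have dE : dim1 E.
    suff nu : exists N : {poly k}, N != 0 /\ ~ kunit E (pev ka t N).
      exact: (cr_dim1 cr fieldR sE lE EP nu).
    exists N; split=> // u; apply: nE.
    by apply: (kunitMl sE (OE _ Op) EN); rewrite mulrCA mulfV // mulr1.
  have Eev F : E (ev F) by apply: RE; exists F.
  pose q : set (mp k n.+1) := [set F | ~ kunit E (ev F)].
  have pq : is_prime q.
    split; first split.
    - by change (~ kunit E (ev 0)); rewrite rmorph0 => -[/eqP].
    - by move=> a b ha hb; change (~ kunit E (ev (a + b))); rewrite rmorphD; apply: lE.
    - move=> c a ha; change (~ kunit E (ev (c * a))); rewrite rmorphM mulrC => u; apply: ha.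
      exact: (kunitMl sE (Eev a) (Eev c) u).
    - by move=> q1; apply: q1; rewrite rmorph1; apply: kunit1.
    - move=> a b; change (~ kunit E (ev (a * b)) -> q a \/ q b); rewrite rmorphM => nab.
      have [ua|] := pselect (kunit E (ev a)); last by left.
      by right => ub; apply: nab; apply: kunitM.
  have kq F : ev F = 0 -> q F by move=> e; change (~ kunit E (ev F)); rewrite e => -[/eqP].
  have [y' [py' Eq]] := patch_point pik ch gen nH pq kq.
  have qE F : ~ kunit (O y') (ev F) <-> ~ kunit E (ev F).
    by change (locmax ev (O y') F <-> q F); rewrite Eq.
  have uE F : kunit (O y') (ev F) <-> kunit E (ev F).
    by split=> u; apply: contrapT => /qE.
  have [_ sy' _] := py'; have [_ _ EM] := sE.
  have frac c : O y' c -> exists s f, kunit (O y') (ev f) /\ c = ev s * (ev f)^-1.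
    have [_ _ _ fr] := patch_loc pik ch gen Ve nH py'.
    by move=> /fr[s [f [uf Ef]]]; exists s, f; rewrite -Ef mulfK //; case: uf.
  have OE' : O y' `<=` E.
    by move=> c /frac[s [f [/uE[_ _ uf] ->]]]; apply: EM.
  apply: ny; rewrite (separated_domination pis pik sepX sE lE dE _ sy sy' _) //.
    by exists p => //; split=> //; apply: OE.
  move=> c /frac[s [f [uf ->]]] uc; apply: kunitM (Oring_subring pi sy') _ _.
    by apply/uE; apply: (kunitMl sE (Eev s) _ uc); have /uE[] := uf.
by have [f0 f2] := uf; split; rewrite ?invr_eq0 ?invrK.
Qed.

End CurveInfinity.

Section Units.
Variables (K : fieldType) (O : set K).
Hypotheses (sO : subring O) (lO : klocal O).

Lemma kunitD a b : kunit O a -> O b -> ~ kunit O b -> kunit O (a + b).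
Proof.
move=> ua Ob nb; have [_ Oa _] := ua; apply: contrapT => n.
have := klocalB sO lO (subringD sO Oa Ob) Ob n nb; by rewrite addrK.
Qed.

Lemma nonunitM a b : O a -> O b -> ~ kunit O a -> ~ kunit O (a * b).
Proof. by move=> Oa Ob na /(kunitMl sO Oa Ob). Qed.

Lemma kmulr_unit a u : kunit O u -> kmulr O (a * u) = kmulr O a.
Proof.
move=> [u0 Ou Oi]; have [_ _ OM] := sO; apply/seteqP; split=> _ [c Oc <-].
  by exists (u * c); [apply: OM|rewrite mulrA].
by exists (u^-1 * c); [apply: OM|rewrite -mulrA mulVKf].
Qed.

End Units.

Lemma olen_unit (K : fieldType) (B : comPzRingType) (be : {rmorphism B -> K}) u :
  kunit (range be) u -> olen (range be) (kmulr (range be) u) = 0%N.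
Proof.
move=> uu; have sO := range_subring be; have [_ Ou _] := uu.
rewrite -olenE; last exact: kideal_mulr.
rewrite (_ : _ @^-1` _ = setT); first by have [] := quo_lengthT B.
apply/seteqP; split=> // b _; rewrite -[u]mul1r kmulr_unit //.
by exists (be b); [exists b|rewrite mul1r].
Qed.

Lemma eventually_all (T : eqType) (s : seq T) (P : T -> Prop) (Q : T -> nat -> Prop) :
  (forall y, P y -> exists m0, forall m, (m0 <= m)%N -> Q y m) ->
  exists m0, forall m, (m0 <= m)%N -> forall y, y \in s -> P y -> Q y m.
Proof.
move=> h; elim: s => [|y s [m1 h1]]; first by exists 0%N.
have [Py|nP] := pselect (P y); last first.
  by exists m1 => m /h1 hm y'; rewrite inE => /orP[/eqP->|/hm].
have [m2 h2] := h y Py; exists (maxn m1 m2) => m; rewrite geq_max => /andP[/h1 hm /h2 q] y'.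
by rewrite inE => /orP[/eqP->|/hm].
Qed.

(** * The divisor that moves x0 along the curve *)

Section CurveMove.
Variables (k : fieldType) (X : kScheme k).
Hypothesis X_ft : is_finite_type X.
Variables (eta : X) (K : fieldType) (pi : {rmorphism stalk eta -> K}).
Hypothesis pis : forall c, exists a, pi a = c.
Hypothesis pik : forall a, pi a = 0 <-> nonunits a.
Local Notation O := (Oring pi).

Section Patched.
Variables (V : opens X) (h : X -> set (sect V)) (n : nat) (g : nat -> sect V).
Hypotheses (ch : chart h) (gen : @generates k X V n g) (Ve : pts V eta).
Variable H : sect V.
Hypothesis nH : ~ h eta H.
Local Notation ka := (kap pi).
Local Notation x := (px pi n g Ve H).
Local Notation ev := (mpev ka x n.+1).
Local Notation R := (salg ka x n.+1).
Local Notation patch := (patch eta h H).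
Let RO y (py : patch y) : R `<=` O y := patch_sub pik ch nH py.

Lemma ext_multI y a : patch y -> R a -> ext ev (O y) (multI ka x a) = kmulr (O y) a.
Proof.
move=> py Ra; have [_ sy _] := py; have [_ _ OM] := Oring_subring pi sy.
have [_ _ _ fr] := patch_loc pik ch gen Ve nH py.
apply/seteqP; split=> c.
  move=> [b [i [[b0 _ ub] [q Rq Eq] E]]]; exists (q / ev b); first by apply: (OM) => //; apply: (RO py).
  by rewrite mulrA -Eq -E mulfK.
move=> [d Od <-]; have [s [f [uf E]]] := fr d Od; have [A _ EA] := Ra.
exists f, (A * s); split=> //; last by rewrite -mulrA E (rmorphM ev) EA.
by exists (ev s); [exists s|rewrite (rmorphM ev) EA].
Qed.

Variable t : K.
Hypothesis cr : curve_ring ka x n.+1 t.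

(* [r] is a product [c (phi - 1)] where [c] is congruent to 1 modulo [phi] at [x0] and vanishes
   at the other bad points. *)
Lemma interpolation x0 phi f : closed [set x0] -> patch x0 -> R phi -> phi != 0 -> ~ kunit (O x0) phi ->
  (forall v, O x0 v -> ~ kunit (O x0) v -> exists n : nat, O x0 (v ^+ n / phi)) ->
  R f -> f != 0 -> exists r, [/\ R r, exists2 u, kunit (O x0) u & 1 + r = phi * u &
    forall y, patch y -> y <> x0 -> ~ kunit (O y) f -> ~ kunit (O y) r].
Proof.
move=> cx px0 Rphi phi0 nphi div Rf f0.
have [s hs] := finite_points pik ch gen nH cr Rf f0.
have mx := closed_patch_maximal pik ch gen Ve nH cx px0; have [_ _ minv] := mx.
have [c [nc hc]] := avoid_seq (fun y => locmax ev (O y)) s (maximal_prime mx).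
have [d hd] := minv c nc.
have [_ sx _] := px0; have sO := Oring_subring pi sx; have := Oring_local sx; have [O1 OB OM] := sO.
pose e := ev (1 - c * d).
have Oe : O x0 e by apply: (RO px0); exists (1 - c * d).
have ne : ~ kunit (O x0) e := hd.
have [J hJ] := div e Oe ne.
(* The exponent J would already make C congruent to 1 modulo phi at x0. The additional factor e
   makes the cofactor of phi in 1 + r equal to 1 plus a nonunit, hence a unit. *)
pose C := 1 - (1 - c * d) ^+ J.+1.
have EC : ev C = 1 - e ^+ J.+1 by rewrite rmorphB rmorph1 rmorphXn.
exists (ev C * (phi - 1)); split.
- by apply: salgM; [exists C|apply: salgB => //; apply: salg1].
- exists (1 + e * (e ^+ J / phi - e ^+ J)).
    have Ow : O x0 (e ^+ J / phi - e ^+ J) by apply: (OB) => //; apply: subringX.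
    by apply: kunitD => //; [apply: kunit1|apply: OM|apply: nonunitM].
  have -> : phi * (1 + e * (e ^+ J / phi - e ^+ J)) = phi + e ^+ J.+1 * (phi / phi) - e ^+ J.+1 * phi.
    rewrite exprS; ring.
  rewrite mulfV // EC; ring.
move=> y py ny nf; have [_ sy _] := py; have sOy := Oring_subring pi sy.
have pP := locmax_prime (patch_loc pik ch gen Ve nH py).
have cP : locmax ev (O y) c.
  apply: hc; [exact: hs|exact: prime_ideal|move=> sub; apply: ny].
  apply: (patch_inj (pi := pi) ch gen py px0).
  have [_ my] := curve_prime cr Rf f0 pP (multI_locmax pik ch nH py Rf nf).
  by apply: esym; apply: maximal_sub => //; [apply: prime_ideal; apply: maximal_prime|case: mx].
have : locmax ev (O y) C.
  rewrite /C; elim: J.+1 => [|j IH]; first by rewrite subrr; apply: (idl0).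
  rewrite (_ : _ _ = (1 - (1 - c * d) ^+ j) + c * (d * (1 - c * d) ^+ j)); last by rewrite exprS; ring.
  by apply: (idlD) => //; apply: (idlMr _).
apply: (nonunitM sOy) => //; first by apply: (RO py); exists C.
apply: (RO py); apply: salgB => //; apply: salg1.
Qed.

(** The degree is controlled in all cases, principality only for separated X. Both z and its
    opposite are required to be principal because a later argument takes differences. *)
Definition moves (x0 : X) (phi : K) (U : set X) (z : X -> int) :=
  [/\ finite_set [set y | z y != 0], forall y, z y != 0 -> closed [set y] /\ (y = x0 \/ U y),
      z x0 = (olen (O x0) (kmulr (O x0) phi))%:Z, cycle_degree z = 0
    & is_separated X -> is_principal_cycle z /\ is_principal_cycle (fun y => - z y)].

Lemma residue_degree_patch y d : patch y -> kd (mpC k n.+1) (locmax ev (O y)) d ->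
  closed [set y] /\ pt_degree y = d.
Proof.
move=> py hd; have hd' := patch_degree pik ch gen nH py hd.
split; first exact: (finite_point_closed X_ft hd').
have [l1 _] := stalk_local y; exact: (residue_degreeE l1 hd').
Qed.

Lemma olen_kunit y u : spec eta y -> kunit (O y) u -> olen (O y) (kmulr (O y) u) = 0%N.
Proof. move=> /(stalk_value pi)[be [_ <- _]]; apply: olen_unit. Qed.

Lemma patched_move x0 phi f q (U : set X) : closed [set x0] -> patch x0 -> R phi -> phi != 0 ->
  ~ kunit (O x0) phi ->
  (forall v, O x0 v -> ~ kunit (O x0) v -> exists n : nat, O x0 (v ^+ n / phi)) ->
  R f -> f != 0 -> (forall y, patch y -> kunit (O y) f -> U y) -> R q -> t = phi * phi * f * q ->
  exists z, moves x0 phi U z.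
Proof.
move=> cx px0 Rphi phi0 nphi div Rf f0 fU Rq Et.
have [r [Rr [u uu Eu] rbad]] := interpolation cx px0 Rphi phi0 nphi div Rf f0.
have [s hdim] := cr_dim cr; have R1 := salg1 ka x n.+1.
have [Rt _] := cr.
have [m1 hm1] := hdim (1 + r) (salgD R1 Rr); have [m2 hm2] := hdim 1 R1.
have [out hout] := outside_finite X_ft pis pik ch gen nH cr.
have [m3 hm3] : exists m3, forall m, (m3 <= m)%N -> is_separated X -> forall y, spec eta y -> ~ patch y ->
    [/\ O y (t ^- m), ~ kunit (O y) (t ^- m), O y (r * t ^- m) & ~ kunit (O y) (r * t ^- m)].
  have [sepX|ns] := pselect (is_separated X); last by exists 0%N.
  have [m3 hm3] := @eventually_all X out (fun y => spec eta y /\ ~ patch y) (fun y m =>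
    [/\ O y (t ^- m), ~ kunit (O y) (t ^- m), O y (r * t ^- m) & ~ kunit (O y) (r * t ^- m)])
    (fun y h => let: conj sy ny := h in infinity_point X_ft pis pik ch gen nH cr sepX r sy ny).
  by exists m3 => m /hm3 hm _ y sy ny; apply: hm => //; apply: hout.
pose m := maxn m1 (maxn m2 (maxn m3 1)).
have := hm1 m (leq_maxl _ _); have := hm2 m _; have := hm3 m.
have l1 : (m1 <= m)%N by apply: leq_maxl.
have l2 : (m2 <= m)%N by rewrite /m; lia.
have l3 : (m3 <= m)%N by rewrite /m; lia.
have m0 : (0 < m)%N by rewrite /m; lia.
move=> /(_ l3) h3 /(_ l2) hb ha; move: m l1 l2 l3 m0 h3 hb ha => m _ _ _ m_gt0 h3 hb ha.
set a := t ^+ m + (1 + r); set b := t ^+ m + 1.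
have Rtm : R (t ^+ m) by apply: salgX.
have Ra : R a by apply: salgD => //; apply: salgD.
have Rb : R b by apply: salgD.
have bE : b = 1 + t ^+ m by rewrite addrC.
have aE : a = 1 + (t ^+ m + r) by rewrite addrCA.
have aE' : a = b + r by rewrite /a addrA.
have RX y z : patch y -> R z -> O y z by move=> py; apply: (RO py).
have sO y : patch y -> subring (O y) by case=> _ sy _; apply: Oring_subring.
have lO y : patch y -> klocal (O y) by case=> _ sy _; apply: Oring_local.
have tm y c : patch y -> R c -> ~ kunit (O y) c -> (exists2 d, R d & t = c * d) -> ~ kunit (O y) (t ^+ m).
  move=> py Rc nc [d Rd E]; rewrite -(prednK m_gt0) exprS E -mulrA; apply: (nonunitM (sO y py)) => //; first exact: RX.
  by apply: RX => //; apply: salgM => //; rewrite -E; apply: salgX.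
have ub0 : kunit (O x0) b.
  rewrite bE; apply: (kunitD (sO _ px0) (lO _ px0)); [exact: kunit1 (sO _ px0)|exact: RX|].
  apply: (tm _ phi) => //; exists (phi * f * q); last by rewrite !mulrA.
  by apply: salgM => //; apply: salgM.
(* This is where t has to contain phi twice: t^m/phi is still a nonunit at x0 and does not disturb
   the unit u. *)
have [u' uu' Ea0] : exists2 u', kunit (O x0) u' & a = phi * u'.
  have : R (phi * f * q * t ^+ m.-1) by apply: salgM; [apply: salgM => //; apply: salgM|apply: salgX].
  exists (u + phi * f * q * t ^+ m.-1).
    apply: (kunitD (sO _ px0) (lO _ px0)) => //; first exact: RX.
    rewrite -!mulrA; apply: (nonunitM (sO _ px0)) => //; first exact: RX.
    by apply: RX => //; apply: salgM => //; apply: salgM => //; apply: salgX.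
  rewrite /a Eu -(prednK m_gt0) exprS Et /=; ring.
have a0 : a != 0 by rewrite Ea0 mulf_neq0 //; case: uu'.
have b0 : b != 0 by case: ub0.
(* At a zero of f other than x0 both t^m and r are nonunits, so a and b are units. The support away
   from x0 therefore stays where f is invertible, that is, in U. *)
have good y : patch y -> y <> x0 -> ~ kunit (O y) f -> kunit (O y) a /\ kunit (O y) b.
  move=> py ny nf; have := rbad y py ny nf.
  have : ~ kunit (O y) (t ^+ m).
    apply: (tm y f) => //; exists (phi * phi * q); last by rewrite Et; ring.
    by apply: salgM => //; apply: salgM.
  have := kunit1 (sO y py).
  split; [rewrite aE|rewrite bE]; apply: (kunitD (sO y py) (lO y py)) => //.
  - by apply: RX => //; apply: salgD.
  - by apply: (lO y py) => //; apply: RX.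
  - exact: RX.
have [sa hsa] := finite_points pik ch gen nH cr Ra a0.
have [sb hsb] := finite_points pik ch gen nH cr Rb b0.
pose bad y := patch y /\ (~ kunit (O y) a \/ ~ kunit (O y) b).
pose ys := undup [seq y <- sa ++ sb | `[< bad y >]].
have uys : uniq ys by apply: undup_uniq.
have ysP y : y \in ys <-> bad y.
  rewrite mem_undup mem_filter mem_cat; split=> [/andP[/asboolP]|by_] //.
  apply/andP; split; first exact/asboolP.
  by have [py [/(hsa y py)->|/(hsb y py)->]] := by_; rewrite ?orbT.
pose z y : int := if y \in ys then (olen (O y) (kmulr (O y) a))%:Z - (olen (O y) (kmulr (O y) b))%:Z else 0.
have zE y : patch y -> z y = (olen (O y) (kmulr (O y) a))%:Z - (olen (O y) (kmulr (O y) b))%:Z.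
  move=> py; rewrite /z; case: ifPn => // nys; have [_ sy _] := py.
  have ua : kunit (O y) a by apply: contrapT => na; move/negP: nys; apply; apply/ysP; split=> //; left.
  have ub : kunit (O y) b by apply: contrapT => na; move/negP: nys; apply; apply/ysP; split=> //; right.
  rewrite !olen_kunit //.
have /choice[deg hdeg] y : exists d, y \in ys -> kd (mpC k n.+1) (locmax ev (O y)) d.
  have [/ysP[py na]|ny] := boolP (y \in ys); last by exists 0%N.
  have pP := locmax_prime (patch_loc pik ch gen Ve nH py).
  have [d hd] : exists d, kd (mpC k n.+1) (locmax ev (O y)) d.
    case: na => na; first by have [] := curve_prime cr Ra a0 pP (multI_locmax pik ch nH py Ra na).
    by have [] := curve_prime cr Rb b0 pP (multI_locmax pik ch nH py Rb na).
  by exists d.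
(* Applied to a and to b, which have the same codimension sm in R; the list [ys] contains the zeros
   of both, so the two sums can be subtracted term by term. *)
have degE c : R c -> c != 0 -> (forall y, patch y -> ~ kunit (O y) c -> y \in ys) ->
    kd (mpC k n.+1) (multI ka x c) (s * m) -> (\sum_(y <- ys) olen (O y) (kmulr (O y) c) * deg y)%N = (s * m)%N.
  move=> Rc c0 cys hd; apply: (kd_uniq (multI_ideal ka x n.+1 c) _ hd).
  rewrite (eq_big_seq (fun y => olen (O y) (ext ev (O y) (multI ka x c)) * deg y)%N); last first.
    by move=> y /ysP[py _]; rewrite ext_multI.
  apply: (length_degree (mp_noetherian (n := n.+1) (@field_noetherian k))) => //.
  - move=> y /ysP[py _]; exact: (patch_loc pik ch gen Ve nH py).
  - by move=> y y' /ysP[py _] /ysP[py' _]; apply: (patch_inj ch gen).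
  - exact: multI_ideal.
  - apply: multI_ker.
  - move=> P pP sP; have [y [py nc]] := multI_point pik ch gen nH Rc pP sP.
    by exists y => //; apply: cys.
have Da := degE a Ra a0 _ ha; have Db := degE.
exists z; split.
- apply: (sub_finite_set _ (finite_seq ys)) => y /=; rewrite /z; case: ifP => //.
- move=> y zy; have /ysP yb : y \in ys by move: zy; rewrite /z; case: ifP.
  have [py nab] := yb; have [cy _] := residue_degree_patch py (hdeg y ((ysP y).2 yb)).
  split=> //; have [->|ny] := pselect (y = x0); [by left|right].
  apply: (fU _ py); apply: contrapT => nf; have [ua ub] := good y py ny nf.
  by case: nab.
- have [_ sx _] := px0; rewrite zE // (olen_kunit sx ub0) subr0 Ea0 kmulr_unit //; exact: sO.
- rewrite /cycle_degree (fsbigE ys) //; last first.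
    by move=> y _ /negPf ny; rewrite /z ny.
  rewrite (eq_bigl xpredT); last by move=> y; rewrite in_setT.
  rewrite (eq_big_seq (fun y => (olen (O y) (kmulr (O y) a) * deg y)%:Z - (olen (O y) (kmulr (O y) b) * deg y)%:Z)); last first.
    move=> y yys; have /ysP[py _] := yys; have [_ ->] := residue_degree_patch py (hdeg y yys).
    by rewrite zE // mulrBl.
  rewrite big_split /= sumrN -!(big_morph Posz PoszD (erefl 0%:Z)) Da ?Db ?subrr // => y py ny; apply/ysP.
    by split=> //; right.
  by split=> //; left.
- move=> sepX.
  (* Off the patch the quotient a/b is written as (a/t^m)/(b/t^m): since 1/t^m and r/t^m are
     nonunits there, both terms are 1 plus a nonunit, so the order is 0. *)
  have loc y : spec eta y -> exists a1 b1, [/\ a1 != 0, b1 != 0, O y a1, O y b1 & a1 * b = b1 * a /\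
      z y = (olen (O y) (kmulr (O y) a1))%:Z - (olen (O y) (kmulr (O y) b1))%:Z].
    move=> sy; have [py|npy] := pselect (patch y).
      exists a, b; split=> //; [exact: RX|exact: RX|split; last exact: zE].
      exact: mulrC.
    have [tO tn rO rn] := h3 sepX y sy npy.
    have sOy := Oring_subring pi sy; have lOy := Oring_local sy.
    have tm0 : t ^+ m != 0 by apply: expf_neq0; apply: cr_t_neq0 cr.
    have ub : kunit (O y) (b * t ^- m).
      by rewrite mulrDl mulfV // mul1r; apply: kunitD => //; apply: kunit1.
    have ua : kunit (O y) (a * t ^- m).
      by rewrite aE' mulrDl; apply: kunitD.
    have [na0 aO _] := ua; have [nb0 bO _] := ub.
    exists (a * t ^- m), (b * t ^- m); split=> //; split; first ring.
    rewrite !olen_kunit // /z; case: ifP => // /ysP[] //.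
  have supp y : z y != 0 -> [/\ spec eta y, dim1 (O y) & exists2 f, f != 0 & O y f /\ ~ kunit (O y) f].
    move=> zy; have /ysP yb : y \in ys by move: zy; rewrite /z; case: ifP.
    have [py nab] := yb; have [_ sy _] := py.
    have [c [Rc c0 nc]] : exists c, [/\ R c, c != 0 & ~ kunit (O y) c].
      by case: nab => nc; [exists a|exists b].
    have ne : y <> eta.
      by move=> E; apply: nc; rewrite E; split=> //; apply: Oring_eta.
    by have [] := curve_local X_ft pis pik ch gen cr sy.
  split.
    apply: (principal_cycle pis pik (c := a / b)) supp; first by rewrite mulf_neq0 ?invr_eq0.
    move=> y /loc[a1 [b1 [a10 b10 Oa1 Ob1 [E zy]]]]; exists a1, b1.
    by rewrite mulrA -E mulfK.
  apply: (principal_cycle pis pik (c := b / a)); first by rewrite mulf_neq0 ?invr_eq0.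
    move=> y /loc[a1 [b1 [a10 b10 Oa1 Ob1 [E zy]]]]; exists b1, a1; split=> //; split; last by rewrite zy opprB.
    by rewrite mulrA E mulfK.
  move=> y; rewrite oppr_eq0; apply: supp.
Qed.

End Patched.

(** The parameter is the norm of phi^2 f, a polynomial N in a first parameter t0. N is not constant
    because a nonzero constant is a unit at x0 while phi is not. *)
Lemma curve_move x0 phi (U : set X) : closed [set x0] -> spec eta x0 -> open U -> U eta ->
  O x0 phi -> phi != 0 -> ~ kunit (O x0) phi ->
  (forall v, O x0 v -> ~ kunit (O x0) v -> exists n : nat, O x0 (v ^+ n / phi)) ->
  exists z, moves x0 phi U z.
Proof.
move=> cx sx oU Ue Ophi phi0 nphi div.
have [V [h [n [g [Ve [H [ch gen nH px0 [Rphi only]]]]]]]] := adapted_patch X_ft pik cx sx Ophi phi0 div.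
have [t0 cr0] := patch_curve pik ch gen nH cx px0 Rphi phi0 nphi only.
have [f fe fU] := chart_basis ch (W := Opens oU) Ue Ve.
have Rf := patch_val pi gen Ve H f.
have f0 : gval pi Ve f != 0 by apply/eqP /(chart_val0 pik ch Ve); case: fe.
have [||N [N0 [q Rq EN]]] := cr_norm cr0 (a := phi * phi * gval pi Ve f).
- by apply: salgM => //; apply: salgM.
- by rewrite !mulf_neq0.
have sN : (1 < size N)%N.
  rewrite ltnNge; apply/negP => /size1_polyC E; apply: nphi.
  have sO := Oring_subring pi sx.
  have RO : salg (kap pi) (px pi n g Ve H) n.+1 `<=` O x0 := patch_sub pik ch nH px0.
  have Nc : kap pi N`_0 = phi * (phi * gval pi Ve f * q) by rewrite -(pev_C _ t0) -E EN; ring.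
  have uN : kunit (O x0) (kap pi N`_0).
    have : N`_0 != 0 by apply: contra N0 => /eqP c0; rewrite E c0.
    by split; [rewrite fmorph_eq0|apply: RO; apply: salgC|rewrite -fmorphV; apply: RO; apply: salgC].
  rewrite Nc in uN; apply: (kunitMl sO Ophi _ uN).
  by apply: RO; apply: salgM => //; apply: salgM.
apply: (patched_move ch gen nH (cr_comp cr0 sN) cx px0 Rphi phi0 nphi div Rf f0 _ Rq EN).
move=> y [Vy sy _] /(chart_kunit pi ch Ve f Vy sy) nf; exact: fU.
Qed.

End CurveMove.

(** * Zero-cycles *)

Lemma local_multiplicity (A : comNzRingType) (Q J : set A) (G : int -> Prop) :
  is_noetherian A -> is_local_ring A -> is_m_primary Q -> is_ideal J -> J `<=` @nonunits A ->
  (forall P, is_prime P -> (forall P', is_prime P' -> P' `<=` P -> P' = P) -> ~ J `<=` P) ->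
  G 0 -> (forall a b, G a -> G b -> G (a + b)) -> (forall a b, G a -> G b -> G (a - b)) ->
  (forall P f, is_prime P -> ~ J `<=` P -> Q f -> ~ P f -> finl (adjoin P f) ->
    G (quo_length (adjoin P f))%:Z) ->
  G (multiplicity Q)%:Z.
Proof.
move=> nA lA [[iQ Q1 _] rQ] iJ Jm minJ G0 GD GB GL.
have mx : maximal_ideal (@nonunits A).
  split=> // [h|a na].
    by apply: h; exists 1; rewrite mulr1.
  have [b ab] : is_unit a by apply: contrapT.
  exists b; rewrite ab subrr; apply: (idl0 lA).
have proper I a : is_ideal I -> ~ I 1 -> I a -> @nonunits A a.
  by move=> hI I1 Ia [b ab]; apply: I1; rewrite -ab; apply: idlMr.
have prQ P : is_prime P -> Q `<=` P -> P = @nonunits A.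
  move=> pP QP; apply/seteqP; split=> a; first by have [hP P1 _] := pP; apply: proper.
  by rewrite -rQ => -[n Qn]; apply: (primeX pP (n := n)); apply: QP.
have finQ : finl Q.
  apply: (finl_primes nA iQ) => P pP QP; rewrite (prQ P pP QP).
  by have [] := quo_length_max mx.
have jac I : is_ideal I -> ~ I 1 -> ~ iadd I Q 1.
  move=> hI I1 [a [b [Ia Qb E]]]; have [_ m1 _] := mx; apply: m1; rewrite E; apply: (idlD lA).
    exact: proper.
  exact: proper Qb.
have h0 := is_ideal0 A.
(* Should the defining polynomial not exist, [multiplicity] has the default value 0, which lies in
   G. *)
rewrite /multiplicity; case: xgetP => [e _ [d [p [dimd [N hN] ed]]]|] //.
have sd := (krull_dim_hs nA iQ finQ jac d).1 dimd.
have Ep : hs Q [set 0] = p.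
  apply: (hs_uniq nA iQ finQ h0); exists N => n /hN ->; congr (quo_length _)%:R.
  apply/seteqP; split; first by apply: sub_iaddr.
  by apply: iadd_sub; [apply: idl_pow|move=> _ ->; apply: (idl0)|].
have prime_min P : is_prime P -> size (hs Q P) = size (hs Q [set 0]) -> ~ J `<=` P.
  move=> pP sP; apply: minJ => // P' pP' s; apply: contrapT => ne.
  have lt : (size (hs Q P) < size (hs Q P'))%N.
    by apply: prime_sub_drop => //; split=> // s'; apply: ne; apply/seteqP.
  have := hs_mono nA iQ finQ h0 (prime_ideal pP') (fun x (e : x = 0) => eq_ind_r P' (idl0 (prime_ideal pP')) e).
  by rewrite -sP leqNgt lt.
case: d dimd sd ed => [|g] dimd sd ed.
  (* Dimension zero is excluded: the maximal ideal would be a minimal prime, and it contains J. *)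
  exfalso; have [X [hX _]] := dimd.1; have pX := hX 0%N isT.
  have all P : is_prime P -> P = @nonunits A.
    move=> pP; apply: prQ => //; apply: (sub_prime_of_size1 nA iQ finQ jac pP).
    by rewrite -sd; apply: hs_mono => // _ ->; apply: (idl0).
  apply: (minJ (X 0%N)) => // [P' pP' _|]; first by rewrite (all P') // (all (X 0%N)).
  by rewrite (all (X 0%N)).
have [||z Gz Ez] := multiplicity_subgroup nA iQ finQ jac iJ G0 GD GB GL (g := g) h0.
- by rewrite sd.
- by move=> P pP _ sP; apply: prime_min => //; rewrite sP.
suff -> : e%:Z = z by [].
by apply: (@intr_inj rat); rewrite -Ez Ep mulrC.
Qed.

(** The maximal ideal of the localization at a minimal prime is nilpotent. Along a prime filtration
    of A, a factor A/N with N inside P has N = P by minimality and costs one more power of J; every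
    other factor is killed by an element outside P. *)
Lemma minimal_prime_nilpotent (A : comPzRingType) (P J : set A) : is_noetherian A -> is_prime P ->
  (forall P', is_prime P' -> P' `<=` P -> P' = P) -> J `<=` P ->
  exists n b, ~ P b /\ forall a, J a -> a ^+ n * b = 0.
Proof.
move=> nA pP mP JP.
suff [n [b [nb h]]] : exists n b, ~ P b /\ forall a, ideal_pow J n a -> [set 0] (a * b).
  by exists n, b; split=> // a Ja; apply: h; apply: mem_powX.
apply: (prime_filtration_ind nA (R := fun I => exists n b, ~ P b /\ forall a, ideal_pow J n a -> I (a * b)))
  (is_ideal0 A) => [|I x hI nx pN [n [b [nb hb]]]].
  by exists 0%N, 1; case: pP.
have [NP|nNP] := pselect (colon I x `<=` P); last first.
  have [d nd] : exists2 d, colon I x d & ~ P d.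
    by apply: contrapT => no; apply: nNP => d Nd; apply: contrapT => nd; apply: no; exists d.
  exists n, (b * d); split=> [|a /hb/adjoinP[c hc]]; first exact: primeNM.
  rewrite mulrA -(subrK (x * c) (a * b)) mulrDl; apply: (idlD hI); first exact: idlMr.
  by rewrite mulrAC; apply: idlMr.
have EN := mP _ pN NP; exists n.+1, b; split=> //; move: (idl_colon b hI) => hc Ja.
rewrite mulrC; move: Ja; apply: (mul_sub hc) => j y Jj /hb/adjoinP[c hy].
have jx : I (x * j) by have : colon I x j by rewrite EN; apply: JP.
rewrite /colon /= mulrCA (mulrC b) -(subrK (x * c) (y * b)) mulrDr; apply: (idlD hI); first exact: idlM.
by rewrite mulrCA mulrA; apply: idlMr.
Qed.

Section StalkPrimes.
Variables (X : scheme) (x0 : X) (V : opens X) (h : X -> set (sect V)).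
Hypotheses (ch : chart h) (Vx : pts V x0).

Lemma stalk_prime (P : set (stalk x0)) : is_prime P ->
  exists eta, [/\ pts V eta, spec eta x0 & forall s, h eta s <-> P (germ Vx s)].
Proof.
move=> [hP P1 PM]; have pp : is_prime (germ Vx @^-1` P).
  split; first split=> [|a b|c a] /=; rewrite ?rmorph0 ?rmorphD ?rmorphM.
  - exact: idl0.
  - exact: idlD.
  - exact: idlM.
  - by change (~ P (germ Vx 1)); rewrite rmorph1.
  - move=> a b; rewrite /= rmorphM; apply: PM.
have [eta Ve E] := chart_surj ch pp; exists eta; split=> //; last by rewrite E.
apply/(chart_spec ch Ve Vx); rewrite E => s Ps; apply: contrapT => /(chart_unit ch Vx)[b hb].
by apply: P1; rewrite -hb; apply: idlMr.
Qed.

Lemma stalk_value_ker (P : set (stalk x0)) eta (K : fieldType) (pi : {rmorphism stalk eta -> K})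
    (be : {rmorphism stalk x0 -> K}) (Ve : pts V eta) : (forall a, pi a = 0 <-> nonunits a) ->
  (forall (V : opens X) (Vt : pts V x0) (Ve : pts V eta) s, be (germ Vt s) = gval pi Ve s) ->
  is_prime P -> (forall s, h eta s <-> P (germ Vx s)) -> forall a, be a = 0 <-> P a.
Proof.
move=> pik beE pP hE a; have [s [f [nf E]]] := chart_frac ch Vx a.
have [v hv] := (chart_unit ch Vx f).2 nf.
have bf : be (germ Vx f) != 0.
  by apply/eqP => b0; have := rmorph1 be; rewrite -hv rmorphM b0 mul0r => /esym/eqP; rewrite oner_eq0.
have -> : P a <-> P (germ Vx s).
  split=> [Pa|Ps]; first by rewrite -E; apply: idlMr.
  by rewrite -[a]mulr1 -hv mulrA E; apply: idlMr.
rewrite -hE -(chart_val0 pik ch Ve) -(beE V Vx) -E rmorphM; split=> [->|/eqP]; first by rewrite mul0r.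
by rewrite mulf_eq0 (negPf bf) orbF => /eqP.
Qed.

End StalkPrimes.

Section Movable.
Variables (k : fieldType) (X : kScheme k).
Hypothesis X_ft : is_finite_type X.
Variable x0 : X.
Hypothesis cx : closed [set x0].

Lemma cycle_degreeE (z : X -> int) (s : seq X) : uniq s -> (forall y, z y != 0 -> y \in s) ->
  cycle_degree z = \sum_(y <- s) z y * (pt_degree y)%:Z.
Proof.
move=> us zs; rewrite /cycle_degree (fsbigE s) //; last first.
  by move=> y _ ny; have [->|/zs] := eqVneq (z y) 0; [rewrite mul0r|rewrite (negPf ny)].
by apply: eq_bigl => y; rewrite in_setT.
Qed.

Lemma finite_supportP (z : X -> int) : finite_set [set y | z y != 0] ->
  exists2 s : seq X, uniq s & forall y, z y != 0 -> y \in s.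
Proof.
move=> /finite_seqP[s E]; exists (undup s); first exact: undup_uniq.
by move=> y zy; rewrite mem_undup; have : [set` s] y by rewrite -E.
Qed.

Lemma cycle_degreeB (z z' : X -> int) : finite_set [set y | z y != 0] -> finite_set [set y | z' y != 0] ->
  cycle_degree (fun y => z y - z' y) = cycle_degree z - cycle_degree z'.
Proof.
move=> /finite_supportP[s us hs] /finite_supportP[s' us' hs'].
pose S := undup (s ++ s'); have uS : uniq S := undup_uniq _.
have h1 y : z y != 0 -> y \in S by move/hs; rewrite mem_undup mem_cat => ->.
have h2 y : z' y != 0 -> y \in S by move/hs'; rewrite mem_undup mem_cat => ->; rewrite orbT.
rewrite !(@cycle_degreeE _ S) //; last first.
  move=> y; have [->|/h1 //] := eqVneq (z y) 0; rewrite sub0r oppr_eq0; apply: h2.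
by rewrite -sumrB; apply: eq_bigr => y _; rewrite mulrBl.
Qed.

Lemma cycle_degree_point n : cycle_degree (fun y => n * point_cycle x0 y) = n * (pt_degree x0)%:Z.
Proof.
rewrite (@cycle_degreeE _ [:: x0]) ?big_seq1 /point_cycle ?eqxx ?mulr1 // => y.
by rewrite inE; case: (y =P x0) => // _; rewrite mulr0.
Qed.

Lemma finite_point n : finite_set [set y | n * point_cycle x0 y != 0].
Proof.
apply: (sub_finite_set _ (finite_set1 x0)) => y /=; rewrite /point_cycle.
by case: (y =P x0) => // _; rewrite mulr0.
Qed.

(** Rational equivalence allows only sums of principal cycles. Keeping both signs at hand makes
    these cycles closed under differences without ever inverting a rational function. *)
Definition trivial_cycle (w : X -> int) := exists n (v : 'I_n -> X -> int),
  (forall j, is_principal_cycle (v j) /\ is_principal_cycle (fun y => - v j y)) /\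
  forall y, w y = \sum_j v j y.

Lemma trivial_cycleB w w' : trivial_cycle w -> trivial_cycle w' -> trivial_cycle (fun y => w y - w' y).
Proof.
move=> [n [v [hv Ev]]] [n' [v' [hv' Ev']]].
exists (n + n')%N, (fun j : 'I_(n + n') => match fintype.split j with inl i => v i | inr i => fun y => - v' i y end); split.
  move=> j; case: (fintype.split j) => i; first exact: hv.
  have [p1 p2] := hv' i; by rewrite (_ : (fun y => - - v' i y) = v' i) //; apply/funext => y; rewrite opprK.
move=> y; rewrite big_split_ord Ev Ev' -sumrN; congr (_ + _); apply: eq_bigr => i _.
  by case: fintype.splitP => j /= E; [congr (v _ y); apply: val_inj|move: (ltn_ord i); rewrite E ltnNge leq_addr].
case: fintype.splitP => j E; first by move: (ltn_ord j); rewrite -E ltnNge leq_addr.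
by move/addnI: E => E; congr (- v' _ y); apply: val_inj.
Qed.

(** The n such that n[x0] can be moved into U. They form a subgroup, to which the multiplicity
    argument is applied. *)
Definition movable (U : set X) (n : int) := exists z : X -> int,
  [/\ finite_set [set y | z y != 0], forall y, z y != 0 -> closed [set y] /\ U y,
      cycle_degree z = n * (pt_degree x0)%:Z
    & is_separated X -> trivial_cycle (fun y => z y - n * point_cycle x0 y)].

Lemma movableB U m n : movable U m -> movable U n -> movable U (m - n).
Proof.
move=> [z [fz zU dz tz]] [z' [fz' zU' dz' tz']]; exists (fun y => z y - z' y); split.
- have : finite_set ([set y | z y != 0] `|` [set y | z' y != 0]) by rewrite finite_setU.
  apply: sub_finite_set => y /= zy; have [E|] := eqVneq (z y) 0; [right|by left].
  by move: zy; rewrite E sub0r oppr_eq0.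
- move=> y zy; have [E|/zU //] := eqVneq (z y) 0; apply: zU'.
  by move: zy; rewrite E sub0r oppr_eq0.
- by rewrite cycle_degreeB // dz dz' mulrBl.
- move=> /[dup] /tz t1 /tz' t2; have := trivial_cycleB t1 t2.
  congr trivial_cycle; apply/funext => y; ring.
Qed.

Lemma trivial_cycle0 : trivial_cycle (fun=> 0).
Proof. by exists 0%N, (fun=> 0); split=> [[]|y] //; rewrite big_ord0. Qed.

Lemma movable0 U : movable U 0.
Proof.
exists (fun=> 0); split=> [|y|| _].
- by apply: (sub_finite_set _ (finite_set0 X)) => y.
- by rewrite eqxx.
- rewrite (@cycle_degreeE _ [::]) ?big_nil //.
- have := trivial_cycle0; congr trivial_cycle; apply/funext => y; by rewrite mul0r.
Qed.

Lemma movableD U m n : movable U m -> movable U n -> movable U (m + n).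
Proof. move=> hm hn; rewrite -[n]opprK -[- n]sub0r; apply: movableB => //; apply: movableB => //; apply: movable0. Qed.

Lemma movable_self U n : U x0 -> movable U n.
Proof.
exists (fun y => n * point_cycle x0 y); split.
- exact: finite_point.
- by move=> y; rewrite /point_cycle; case: (y =P x0) => [->|] //; rewrite mulr0.
- exact: cycle_degree_point.
- by move=> _; have := trivial_cycle0; congr trivial_cycle; apply/funext => y; rewrite subrr.
Qed.

Section Primes.
Variables (V : opens X) (h : X -> set (sect V)) (n : nat) (g : nat -> sect V).
Hypotheses (ch : chart h) (gen : @generates k X V n g) (Vx : pts V x0).
Variable U : set X.
Hypothesis oU : open U.

Definition uideal : set (stalk x0) := ideal_gen [set germ Vx s | s in [set s | chartD ch s `<=` U]].

Lemma uideal_sub P eta : is_ideal P -> pts V eta -> (forall s, h eta s <-> P (germ Vx s)) ->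
  ~ uideal `<=` P <-> U eta.
Proof.
move=> hP Ve hE; split=> [nJ|Ue].
  apply: contrapT => nU; apply: nJ; apply: gen_sub => // _ [s sU <-]; apply/hE; apply: contrapT => ns.
  by apply: nU; apply: sU.
have [s se sU] := chart_basis ch (W := Opens oU) Ue Ve.
move=> sub; have [_ ns] := se; apply: ns; apply/hE; apply: sub; apply: sub_gen; by exists s.
Qed.

(** A minimal prime of the stalk is the generic point eta of a component through x0. Were eta
    outside U, the functions s with D(s) inside U would be nilpotent on some D(b) containing eta, so
    D(b) would miss the dense set U. *)
Lemma minimal_prime_dense P eta : dense U -> is_prime P ->
  (forall P', is_prime P' -> P' `<=` P -> P' = P) -> pts V eta -> spec eta x0 ->
  (forall s, h eta s <-> P (germ Vx s)) -> U eta.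
Proof.
move=> dU pP mP Ve sx hE; apply: contrapT => nU.
have nz := chart_nontrivial ch Vx.
have JP : [set s | chartD ch s `<=` U] `<=` h eta.
  by move=> s sU; apply: contrapT => ns; apply: nU; apply: sU.
have min q : is_prime q -> q `<=` h eta -> q = h eta.
  move=> pq sub; have [eta' Ve' Eq] := chart_surj ch pq; subst.
  have sx' : spec eta' x0.
    by apply/(chart_spec ch Ve' Vx) => s /sub; move: s; apply/(chart_spec ch Ve Vx).
  have [K [pi [pis pik]]] := residue eta'; have [be [beE _ _]] := stalk_value pi sx'.
  have pP' : is_prime (be @^-1` [set 0]).
    split; first split=> [|a b|c a] /=; rewrite ?rmorph0 ?rmorphD ?rmorphM //.
    - by move=> -> ->; rewrite addr0.
    - by move=> ->; rewrite mulr0.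
    - change (be 1 <> 0); rewrite rmorph1; apply/eqP; apply: oner_neq0.
    - by move=> a b /eqP; rewrite rmorphM mulf_eq0 => /orP[]/eqP; [left|right].
  have hE' s : h eta' s <-> be (germ Vx s) = 0 by rewrite (beE V Vx Ve'); apply: iff_sym; apply: chart_val0.
  have E : be @^-1` [set 0] = P.
    apply: mP => // a a0; have [s [f [nf E]]] := chart_frac ch Vx a.
    have [v hv] := (chart_unit ch Vx f).2 nf; have [hP _ _] := pP.
    rewrite -[a]mulr1 -hv mulrA E; apply: (idlMr _ hP); apply/hE; apply: sub; apply/hE'.
    by rewrite -E rmorphM a0 mul0r.
  apply/seteqP; split=> // s /hE; rewrite -E => b0; exact/hE'.
have [m [b [nb hb]]] := minimal_prime_nilpotent (sect_noetherian nz gen) (chart_prime ch Ve) min JP.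
have [y [[Vy hy] Uy]] := dU (chartD ch b) (ex_intro _ eta (conj Ve nb)) (pts_open (chartD ch b)).
have [s [_ ns] sU] := chart_basis ch (W := Opens oU) Uy Vy.
have pyP := chart_prime ch Vy.
have : h y (s ^+ m * b) by rewrite hb //; apply: (idl0).
by move/(primeM pyP) => [/(primeX pyP)|].
Qed.

End Primes.

(** [local_multiplicity] is used with J the ideal of the complement of U at x0 and G the movable
    integers. A prime P not containing J is a point eta of U specializing to x0. If f makes A/(P +
    fA) of finite length, the image phi of f in the residue field of eta is an input for
    [curve_move], and the length of O/phi is that of A/(P + fA). *)
Theorem movable_multiplicity U (Q : set (stalk x0)) : open U -> dense U -> is_m_primary Q ->
  movable U (multiplicity Q)%:Z.
Proof.
move=> oU dU hQ; have [Ux|nUx] := pselect (U x0); first exact: movable_self.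
have [V [h [n [g [Vx ch gen]]]]] := point_chart X_ft x0.
have [l1 n1] := stalk_local x0.
have nz := stalk_nontrivial x0.
pose T (A : comPzRingType) := forall (Q J : set A) (G : int -> Prop),
  is_noetherian A -> is_local_ring A -> is_m_primary Q -> is_ideal J -> J `<=` @nonunits A ->
  (forall P, is_prime P -> (forall P', is_prime P' -> P' `<=` P -> P' = P) -> ~ J `<=` P) ->
  G 0 -> (forall a b, G a -> G b -> G (a + b)) -> (forall a b, G a -> G b -> G (a - b)) ->
  (forall P f, is_prime P -> ~ J `<=` P -> Q f -> ~ P f -> finl (adjoin P f) ->
    G (quo_length (adjoin P f))%:Z) -> G (multiplicity Q)%:Z.
have hT : forall A : comNzRingType, T A := local_multiplicity.
have hx s : h x0 s <-> nonunits (germ Vx s).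
  split=> [hs /(chart_unit ch Vx)//|ns]; by apply: contrapT => /(chart_unit ch Vx).
have hS := comNz_transport hT nz; apply: (hS Q (uideal ch Vx U)) => //.
- exact: stalk_noetherian.
- by apply: contrapT => /(uideal_sub ch oU l1 Vx hx).
- move=> P pP mP; have [eta [Ve sx hE]] := stalk_prime ch Vx pP.
  apply/(uideal_sub ch oU (prime_ideal pP) Ve hE).
  exact: (minimal_prime_dense ch gen oU dU pP mP Ve sx hE).
- exact: movable0.
- exact: movableD.
- exact: movableB.
move=> P f pP nJ Qf nPf fin; have [eta [Ve sx hE]] := stalk_prime ch Vx pP.
have Ue := (uideal_sub ch oU (prime_ideal pP) Ve hE).1 nJ.
have [K [pi [pis pik]]] := residue eta; have [be [beE rbe bu]] := stalk_value pi sx.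
have ker := stalk_value_ker ch Ve pik beE pP hE.
have nf : nonunits f.
  move=> [b fb]; have [[iQ Q1 _] _] := hQ; by apply: Q1; rewrite -fb; apply: idlMr.
have iPf := idl_adjoin f (prime_ideal pP).
have E : adjoin P f = be @^-1` (kmulr (range be) (be f)).
  apply/seteqP; split=> a.
    move=> /adjoinP[c /ker/eqP]; rewrite rmorphB rmorphM subr_eq0 => /eqP.
    by exists (be c).
  move=> [_ [c _ <-] Ea]; apply/adjoinP; exists c; apply/ker; by rewrite rmorphB rmorphM Ea subrr.
have f0 : be f != 0 by apply/eqP /ker.
have Of : Oring pi x0 (be f) by rewrite -rbe.
have nfu : ~ kunit (Oring pi x0) (be f) by move=> /bu.
have div v : Oring pi x0 v -> ~ kunit (Oring pi x0) v -> exists n : nat, Oring pi x0 (v ^+ n / be f).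
  rewrite -rbe => -[b _ <-] nb.
  have [|m /adjoinP[c /ker/eqP]] := mem_primes_radical (stalk_noetherian X_ft) (a := b) iPf.
    move=> N pN sN.
    have mN := prime_finl_maximal pN (finl_sub iPf (prime_ideal pN) sN fin).
    apply: contrapT => nNb; have [_ _ minv] := mN; have [d hd] := minv b nNb.
    have nd : nonunits (1 - b * d).
      by move=> [e he]; have [_ N1 _] := pN; apply: N1; rewrite -he; apply: (idlMr _).
    apply: n1; rewrite -(subrK (b * d) 1); apply: (idlD l1) => //; apply: (idlMr _ l1).
    move=> ub; apply: nb; rewrite rbe; have [e he] := ub.
    have be1 : be b * be e = 1 by rewrite -rmorphM he rmorph1.
    have b0 : be b != 0 by apply/eqP => b0; move: be1; rewrite b0 mul0r => /esym/eqP; rewrite oner_eq0.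
    split=> //; rewrite -rbe; first by exists b.
    by exists e => //; apply: (mulfI b0); rewrite mulfV.
  rewrite rmorphB rmorphM rmorphXn subr_eq0 => /eqP Em.
  by exists m; rewrite Em mulrAC mulfV // mul1r.
have [z [fz zU zx dz tz]] := curve_move X_ft pis pik cx sx oU Ue Of f0 nfu div.
have olenf : olen (Oring pi x0) (kmulr (Oring pi x0) (be f)) = quo_length (adjoin P f).
  by rewrite E olenE rbe //; apply: kideal_mulr => //; apply: Oring_subring.
rewrite olenf in zx; set m := (quo_length _)%:Z.
exists (fun y => m * point_cycle x0 y - z y); split.
- have : finite_set ([set y | m * point_cycle x0 y != 0] `|` [set y | z y != 0]).
    rewrite finite_setU; split=> //; apply: finite_point.
  apply: sub_finite_set => y /= my; have [E0|] := eqVneq (z y) 0; [left|by right].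
  by move: my; rewrite E0 subr0.
- move=> y; have [->|ne] := eqVneq y x0.
    by rewrite /point_cycle eqxx mulr1 zx subrr.
  rewrite /point_cycle (negPf ne) mulr0 sub0r oppr_eq0 => /zU[cy [E0|//]].
  by move: ne; rewrite E0 eqxx.
- rewrite cycle_degreeB ?cycle_degree_point ?dz ?subr0 //; apply: finite_point.
- move=> /tz[p1 p2]; exists 1%N, (fun=> fun y => - z y); split=> [j|y].
    by split=> //; rewrite (_ : (fun y => - - z y) = z) //; apply/funext => y; rewrite opprK.
  rewrite big_ord1; ring.
Qed.

End Movable.

(** * Derivations *)

Section Functional.
Variables (k K : fieldType) (kap : {rmorphism k -> K}).

(** A subspace maximal among those not containing e has codimension one, and la is the coordinate
    along e modulo it. *)
Lemma linear_functional (e : K) : e != 0 -> exists la : K -> k,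
  [/\ la e = 1, forall v w, la (v + w) = la v + la w & forall c v, la (kap c * v) = c * la v].
Proof.
move=> e0; pose P := [set H : set K | [/\ H 0, forall v w, H v -> H w -> H (v + w),
  forall c v, H v -> H (kap c * v) & ~ H e]].
have [||H [[H0 HD HZ He] _ mH]] := @zorn_sets K P [set 0].
- split=> // [_ _ -> ->|c _ ->|]; rewrite ?addr0 ?mulr0 //; exact/eqP.
- move=> F [H FH] FP tF; split.
  + by exists H; have [] := FP H.
  + move=> v w [H1 F1 h1] [H2 F2 h2]; have [s|s] := tF H1 H2 F1 F2.
      by exists H2 => //; have [_ + _ _] := FP H2 F2; apply=> //; apply: s.
    by exists H1 => //; have [_ + _ _] := FP H1 F1; apply=> //; apply: s.
  + by move=> c v [H1 F1 h1]; exists H1 => //; have [_ _ + _] := FP H1 F1; apply.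
  + by move=> [H1 F1 h1]; have [_ _] := FP H1 F1.
have HB v w : H v -> H w -> H (v - w).
  by move=> hv hw; apply: HD => //; rewrite -mulN1r -(rmorph1 kap) -rmorphN; apply: HZ.
have uniq v c c' : H (v - kap c * e) -> H (v - kap c' * e) -> c = c'.
  move=> h h'; apply/eqP; rewrite -subr_eq0; apply: contrapT => /negP n0.
  have := HZ (c - c')^-1 _ (HB _ _ h' h).
  rewrite (_ : _ _ - _ = kap (c - c') * e); last by rewrite rmorphB; ring.
  by rewrite fmorphV mulKf // fmorph_eq0.
have ex v : exists c, H (v - kap c * e).
  have [Hv|nHv] := pselect (H v); first by exists 0; rewrite rmorph0 mul0r subr0.
  pose H' := [set w | exists h c, H h /\ w = h + kap c * v].
  have [h [c [Hh E]]] : H' e.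
    apply: contrapT => ne; have EH : H' = H.
      apply: mH; last by move=> h Hh; exists h, 0; rewrite rmorph0 mul0r addr0.
      split=> // [|_ _ [h [c [Hh ->]]] [h' [c' [Hh' ->]]]|c _ [h [c' [Hh ->]]]].
      - by exists 0, 0; rewrite rmorph0 mul0r addr0.
      - by exists (h + h'), (c + c'); split; [apply: HD|rewrite rmorphD; ring].
      - by exists (kap c * h), (c * c'); split; [apply: HZ|rewrite rmorphM; ring].
    by apply: nHv; rewrite -EH; exists 0, 1; rewrite rmorph1 mul1r add0r.
  have : kap c != 0.
    by apply/eqP => c0; apply: He; rewrite E c0 mul0r addr0.
  exists c^-1; rewrite (_ : _ _ = kap (- c^-1) * h); first exact: HZ.
  rewrite E rmorphN fmorphV mulrDr mulKf //; ring.
have [la hla] := choice ex; exists la; split.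
- by apply: (uniq e) => //; rewrite rmorph1 mul1r subrr.
- move=> v w; apply: (uniq) => //.
  by rewrite (_ : _ _ = (v - kap (la v) * e) + (w - kap (la w) * e)); [apply: HD|ring].
- move=> c v; apply: (uniq) => //.
  by rewrite rmorphM -mulrA -mulrBr; apply: HZ.
Qed.

End Functional.

Section PthPowers.
Variables (K : fieldType) (p : nat).
Hypothesis charp : p \in [pchar K].
Implicit Types (E L : set K) (F G q : {poly K}).

Let p_prime : prime p := pcharf_prime charp.

Definition coefs_in E F := forall i, E F`_i.

Section CoefsIn.
Variable E : set K.
Hypothesis sE : subring E.

Lemma coefs_inB F G : coefs_in E F -> coefs_in E G -> coefs_in E (F - G).
Proof. by move=> hF hG i; rewrite coefB; have [_ + _] := sE; apply. Qed.

Lemma coefs_inM F G : coefs_in E F -> coefs_in E G -> coefs_in E (F * G).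
Proof.
move=> hF hG i; rewrite coefM; apply: (big_ind E); [exact: subring0|by move=> *; apply: subringD|].
by move=> j _; have [_ _] := sE; apply.
Qed.

Lemma coefs_inC c : E c -> coefs_in E c%:P.
Proof. by move=> hc i; rewrite coefC; case: eqP => // _; apply: subring0. Qed.

Lemma coefs_inXn n : coefs_in E 'X^n.
Proof. by move=> i; rewrite coefXn; have [E1 _ _] := sE; case: eqP => // _; apply: subring0. Qed.

Lemma coefs_in_deriv F : coefs_in E F -> coefs_in E F^`().
Proof.
move=> hF i; rewrite coef_deriv; have := hF i.+1; move: F`_i.+1 => c Ec; elim: i.+1 => [|n IH].
  by rewrite mulr0n; apply: subring0.
by rewrite mulrS; apply: subringD.
Qed.

Lemma XsubC_pow b : ('X - b%:P) ^+ p = 'X^p - (b ^+ p)%:P :> {poly K}.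
Proof.
have cp : p \in [pchar {poly K}] by rewrite pchar_poly.
rewrite rmorphXn -!(pFrobenius_autE cp) pFrobenius_autB_comm //; apply: mulrC.
Qed.

Lemma coefs_in_pow b : E (b ^+ p) -> coefs_in E (('X - b%:P) ^+ p).
Proof. by move=> Eb; rewrite XsubC_pow; apply: coefs_inB; [apply: coefs_inXn|apply: coefs_inC]. Qed.

Lemma coefs_in_rem b F : E (b ^+ p) -> coefs_in E F ->
  exists r, [/\ coefs_in E r, (size r <= p)%N & ('X - b%:P) ^+ p %| F - r].
Proof.
move=> Eb; have [n] := ubnP (size F); elim: n F => // n IH F; rewrite ltnS => sF hF.
have [le|lt] := leqP (size F) p; first by exists F; rewrite subrr.
pose F' := F - (lead_coef F)%:P * 'X^(size F - p.+1) * ('X - b%:P) ^+ p.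
have hF' : coefs_in E F'.
  apply: coefs_inB => //; apply: coefs_inM; last exact: coefs_in_pow.
  apply: coefs_inM; [apply: coefs_inC; apply: hF|apply: coefs_inXn].
have F0 : F != 0 by rewrite -size_poly_gt0; apply: leq_ltn_trans lt.
have sF' : (size F' < size F)%N.
  rewrite /F'; set G := _ * _.
  have G0 : lead_coef G = lead_coef F.
    by rewrite !lead_coefM lead_coefC lead_coefXn lead_coef_exp lead_coefXsubC expr1n !mulr1.
  have sG : size G = size F.
    rewrite size_Mmonic ?monic_exp ?monicXsubC //; last first.
      by rewrite mulf_neq0 ?polyC_eq0 ?lead_coef_eq0 // -size_poly_eq0 size_polyXn.
    rewrite size_Mmonic ?monicXn ?polyC_eq0 ?lead_coef_eq0 // size_polyC lead_coef_eq0 size_polyXn size_exp_XsubC; lia.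
  have [m sm] : exists m, size F = m.+1 by exists (size F).-1; rewrite prednK // size_poly_gt0.
  rewrite sm ltnS; apply/leq_sizeP => j; rewrite leq_eqVlt => /orP[/eqP<-|lj].
    by move: G0; rewrite !lead_coefE sG sm coefB => ->; rewrite subrr.
  by rewrite coefB !nth_default ?subrr ?sG ?sm.
have [r [hr sr dr]] := IH F' (leq_trans sF' sF) hF'.
exists r; have := dvdp_add dr (dvdp_mull ((lead_coef F)%:P * 'X^(size F - p.+1)) (dvdpp (('X - b%:P) ^+ p))).
by rewrite addrAC subrK.
Qed.

Hypothesis invE : forall c, E c -> E c^-1.

(* The minimal polynomial over [E] of [b], a root of [(X - b)^p], is a power of [X - b], and only
   its [p]-th power has vanishing derivative at [b] and is not of degree one. *)
Lemma insep_dvd b F : ~ E b -> E (b ^+ p) -> coefs_in E F -> F.[b] = 0 -> ('X - b%:P) ^+ p %| F.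
Proof.
move=> nb Eb.
pose good q := [/\ q != 0, coefs_in E q & q.[b] = 0].
have exg : exists n, `[< exists q, good q /\ size q = n >].
  exists (size (('X - b%:P) ^+ p)); apply/asboolP; exists (('X - b%:P) ^+ p); split=> //; split.
  - by rewrite expf_neq0 // polyXsubC_eq0.
  - exact: coefs_in_pow.
  - by rewrite horner_exp hornerXsubC subrr expr0n; have := p_prime; case: (p).
case: (ex_minnP exg) => n /asboolP[q [[q0 hq qb] sq]] minq.
have min G : coefs_in E G -> G.[b] = 0 -> (size G < size q)%N -> G = 0.
  move=> hG Gb sG; apply: contrapT => /eqP G0.
  have := minq (size G); rewrite -sq leqNgt sG => h; by have /h : `[< exists q, good q /\ size q = size G >] by apply/asboolP; exists G.
have lq0 : lead_coef q != 0 by rewrite lead_coef_eq0.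
have dvdq G : coefs_in E G -> G.[b] = 0 -> q %| G.
  have [m] := ubnP (size G); elim: m G => // m IH G; rewrite ltnS => sG hG Gb.
  have [lt|le] := ltnP (size G) (size q); first by rewrite (min G).
  have [->|G0] := eqVneq G 0; first exact: dvdp0.
  pose H := (lead_coef G / lead_coef q)%:P * 'X^(size G - size q) * q.
  have hH : coefs_in E H.
    apply: coefs_inM => //; apply: coefs_inM; last exact: coefs_inXn.
    apply: coefs_inC; have [_ _ EM] := sE; apply: EM; [apply: hG|apply: invE; apply: hq].
  have lc0 : lead_coef G / lead_coef q != 0 by rewrite mulf_neq0 ?invr_eq0 ?lead_coef_eq0.
  have lH : lead_coef H = lead_coef G.
    by rewrite !lead_coefM lead_coefC lead_coefXn mulr1 mulfVK.
  have sH : size H = size G.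
    rewrite size_mul ?mulf_neq0 ?polyC_eq0 -?size_poly_eq0 ?size_polyXn //; last by rewrite size_poly_eq0.
    rewrite size_mul ?polyC_eq0 -?size_poly_eq0 ?size_polyXn // size_polyC lc0.
    by rewrite /= subnK.
  rewrite -(subrK H G) dvdp_add //; last exact: dvdp_mull.
  apply: IH; last by rewrite hornerD hornerN hornerM qb mulr0 subr0.
    apply: leq_trans sG; have [j sj] : exists j, size G = j.+1 by exists (size G).-1; rewrite prednK // size_poly_gt0.
    rewrite sj ltnS; apply/leq_sizeP => i; rewrite leq_eqVlt => /orP[/eqP<-|li].
      by move: lH; rewrite !lead_coefE sH sj coefB => ->; rewrite subrr.
    by rewrite coefB !nth_default ?subrr ?sH ?sj.
  exact: coefs_inB.
move=> hF Fb; apply: dvdp_trans (dvdq F hF Fb).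
have /dvdp_exp_XsubCP[d dp Ed] : q %| ('X - b%:P) ^+ p.
  apply: dvdq; first exact: coefs_in_pow.
  by rewrite horner_exp hornerXsubC subrr expr0n; have := p_prime; case: (p).
have [c c0 Eq] : exists2 c, c != 0 & q = c *: ('X - b%:P) ^+ d.
  exists (lead_coef q) => //; have /eqpfP := Ed.
  by rewrite lead_coef_exp lead_coefXsubC expr1n ?divr1.
have d0 : (0 < d)%N.
  by case: (d) Eq => // Eq; move: qb; rewrite Eq hornerZ hornerC mulr1 => /eqP; rewrite (negPf c0).
have [Edp|dnp] := eqVneq d p; first by rewrite -Edp Eq dvdpZr.
have ltd : (d < p)%N by rewrite ltn_neqAle dnp.
have dK : d%:R != 0 :> K.
  apply/negP; rewrite -(dvdn_pcharf charp) => /(dvdn_leq d0); by rewrite leqNgt ltd.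
have lq : lead_coef q = c by rewrite Eq lead_coefZ lead_coef_exp lead_coefXsubC expr1n mulr1.
have sqd : size q = d.+1 by rewrite Eq size_scale // size_exp_XsubC.
have [d1|d1] := leqP d 1.
  have Ed1 : d = 1%N by apply/eqP; rewrite eqn_leq d1.
  have := hq 0%N; rewrite Eq Ed1 coefZ coefB coefX coefC sub0r mulrN => h.
  have [_ _ EM] := sE; have := EM _ _ (invE (hq d)) (subringN sE h).
  rewrite opprK (_ : q`_d = c) ?mulKf //; by rewrite -lq lead_coefE sqd.
have : q^`() = 0.
  apply: min; first exact: coefs_in_deriv.
    rewrite Eq derivZ deriv_exp derivXsubC mul1r hornerZ hornerMn horner_exp hornerXsubC subrr expr0n.
    by case: (d) d1 => [|[|]] //*; rewrite mul0rn mulr0.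
  by apply: lt_size_deriv.
move=> /(congr1 (fun F => F`_d.-1)); rewrite coef0 coef_deriv prednK // => /eqP.
have -> : q`_d = c by rewrite -lq lead_coefE sqd.
by rewrite -mulr_natr mulf_eq0 (negPf c0) (negPf dK).
Qed.

End CoefsIn.

(** Take E maximal among the rings between L^p and L that do not contain a; such rings are fields,
    since c^-1 = c^(p-1) (c^-1)^p. Then L = E[a] with minimal polynomial (X - a)^p, whose derivative
    vanishes, so d/dX descends to L and sends a to 1. *)
Lemma derivation_exists L a : subring L -> (forall c, L c -> L c^-1) -> L a ->
  (forall b, L b -> b ^+ p != a) -> exists D : K -> K,
  [/\ forall b c, L b -> L c -> D (b + c) = D b + D c,
      forall b c, L b -> L c -> D (b * c) = b * D c + c * D b,
      D a = 1 & forall b, L b -> L (D b)].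
Proof.
move=> sL iL La na; have [L1 LB LM] := sL.
pose P := [set E : set K | [/\ subring E, forall b, L b -> E (b ^+ p), E `<=` L & ~ E a]].
have frB (b c : K) : (b - c) ^+ p = b ^+ p - c ^+ p.
  rewrite -!(pFrobenius_autE charp) pFrobenius_autB_comm //; apply: mulrC.
have [||E [[sE Ep EL Ea] _ mE]] := @zorn_sets K P [set b ^+ p | b in L].
- split; first split.
  + by exists 1; rewrite ?expr1n.
  + by move=> _ _ [b Lb <-] [c Lc <-]; exists (b - c); [apply: LB|apply: frB].
  + by move=> _ _ [b Lb <-] [c Lc <-]; exists (b * c); [apply: LM|rewrite exprMn].
  + by move=> b Lb; exists b.
  + by move=> _ [b Lb <-]; apply: subringX.
  + by move=> [b Lb E]; have := na b Lb; rewrite E eqxx.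
- move=> F [H FH] FP tF; split; first split.
  + by exists H; have [[]] := FP H FH.
  + move=> v w [H1 F1 h1] [H2 F2 h2]; have [s|s] := tF H1 H2 F1 F2.
      by exists H2 => //; have [[_ + _] _ _ _] := FP H2 F2; apply=> //; apply: s.
    by exists H1 => //; have [[_ + _] _ _ _] := FP H1 F1; apply=> //; apply: s.
  + move=> v w [H1 F1 h1] [H2 F2 h2]; have [s|s] := tF H1 H2 F1 F2.
      by exists H2 => //; have [[_ _ +] _ _ _] := FP H2 F2; apply=> //; apply: s.
    by exists H1 => //; have [[_ _ +] _ _ _] := FP H1 F1; apply=> //; apply: s.
  + by move=> Lb; exists H => //; have [_ + _ _] := FP H FH; apply.
  + by move=> v [H1 F1 h1]; have [_ _ + _] := FP H1 F1; apply.
  + by move=> [H1 F1 h1]; have [_ _] := FP H1 F1.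
have inv E' : subring E' -> (forall b, L b -> E' (b ^+ p)) -> E' `<=` L -> forall c, E' c -> E' c^-1.
  move=> sE' E'p E'L c E'c; have [->|c0] := eqVneq c 0; first by rewrite invr0; apply: subring0.
  have -> : c^-1 = c ^+ p.-1 * c^-1 ^+ p.
    by rewrite -{2}(prednK (prime_gt0 p_prime)) exprS mulrCA -exprMn mulfV // expr1n mulr1.
  by have [_ _ EM] := sE'; apply: EM; [apply: subringX|apply: E'p; apply: iL; apply: E'L].
pose adj b := [set F.[b] | F in [set F | coefs_in E F]].
have adjP b : L b -> [/\ subring (adj b), E `<=` adj b, adj b `<=` L & adj b b].
  split.
  - split; first by exists 1; [apply: (coefs_inC sE); have [] := sE|rewrite hornerC].
      by move=> _ _ [F hF <-] [G hG <-]; exists (F - G); [apply: coefs_inB|rewrite hornerD hornerN].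
    by move=> _ _ [F hF <-] [G hG <-]; exists (F * G); [apply: coefs_inM|rewrite hornerM].
  - by move=> c Ec; exists c%:P; [apply: coefs_inC|rewrite hornerC].
  - move=> _ [F hF <-]; rewrite horner_coef; apply: (big_ind L); [exact: subring0|by move=> *; apply: subringD|].
    by move=> i _; apply: LM; [apply: EL; apply: hF|apply: subringX].
  - by exists 'X; [have := coefs_inXn sE 1; rewrite expr1|rewrite hornerX].
have [sA EA AL Aa] := adjP a La.
have Ap b : L b -> adj a (b ^+ p) by move=> Lb; apply: EA; apply: Ep.
(* For b outside E[a], maximality puts a into E[b], say a = r(b) with deg r < p over E. As b has
   degree p over E[a], the polynomial r - a is zero and a lies in E. *)
have full b : L b -> adj a b.
  move=> Lb; apply: contrapT => nb; have [sB EB BL Bb] := adjP b Lb.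
  have [F hF Fa] : adj b a.
    apply: contrapT => nab; apply: nb; apply: EA; rewrite -(mE (adj b)) //.
    by split=> // c Lc; apply: EB; apply: Ep.
  have [r [hr sr dr]] := coefs_in_rem sE (Ep b Lb) hF.
  have rb : r.[b] = a.
    rewrite -Fa; apply/eqP; rewrite eq_sym -subr_eq0 -hornerN -hornerD.
    have : root (F - r) b by apply: root_dvdp dr _; rewrite /root horner_exp hornerXsubC subrr expr0n; have := p_prime; case: (p).
    by [].
  have : ('X - b%:P) ^+ p %| r - a%:P.
    apply: (insep_dvd sA (inv _ sA Ap AL) nb (Ap b Lb)).
      by apply: coefs_inB => //; [move=> i; apply: EA|apply: coefs_inC].
    by rewrite hornerD hornerN hornerC rb subrr.
  move=> dv; have r0 : r - a%:P = 0.
    apply: contrapT => /eqP r0; have := dvdp_leq r0 dv; rewrite size_exp_XsubC ltnNge.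
    rewrite (leq_trans (size_polyD _ _)) // geq_max sr size_polyN (leq_trans (size_polyC_leq1 _)) //.
    exact: prime_gt0.
  by apply: Ea; have := hr 0%N; have /eqP := r0; rewrite subr_eq0 => /eqP ->; rewrite coefC.
have wd F G : coefs_in E F -> coefs_in E G -> F.[a] = G.[a] -> F^`().[a] = G^`().[a].
  move=> hF hG e; apply/eqP; rewrite -subr_eq0 -hornerN -hornerD -derivN -derivD.
  have /dvdpP[q ->] : ('X - a%:P) ^+ p %| F - G.
    apply: (insep_dvd sE (inv _ sE Ep EL) Ea (Ep a La)); first exact: coefs_inB.
    by rewrite hornerD hornerN e subrr.
  rewrite derivM hornerD !hornerM deriv_exp derivXsubC mul1r hornerMn !horner_exp hornerXsubC subrr !expr0n.
  by have := p_prime; case: (p) => [|[|q']] //_; rewrite mul0rn !mulr0 addr0.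
have /choice[f hf] b : exists F, L b -> coefs_in E F /\ F.[a] = b.
  have [/full[F Fb]|nL] := pselect (L b); first by exists F.
  by exists 0.
exists (fun b => (f b)^`().[a]); split.
- move=> b c Lb Lc; have [f1 f2] := hf b Lb; have [g1 g2] := hf c Lc.
  have [h1 h2] := hf (b + c) (subringD sL Lb Lc).
  rewrite -hornerD -derivD; apply: wd => //; last by rewrite hornerD f2 g2.
  by rewrite -[f c]opprK; apply: coefs_inB => //; rewrite -sub0r; apply: coefs_inB => // i; rewrite coef0; apply: subring0.
- move=> b c Lb Lc; have [f1 f2] := hf b Lb; have [g1 g2] := hf c Lc.
  have [h1 h2] := hf (b * c) (LM _ _ Lb Lc).
  rewrite (wd _ (f b * f c)) ?hornerM ?f2 ?g2 //; last exact: coefs_inM.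
  by rewrite derivM hornerD !hornerM f2 g2 addrC (mulrC c).
- have [f1 f2] := hf a La; rewrite (wd _ 'X) ?derivX ?hornerC ?hornerX //.
  by have := coefs_inXn sE 1.
- move=> b Lb; have [f1 f2] := hf b Lb; apply: AL; exists (f b)^`() => //; exact: coefs_in_deriv.
Qed.

End PthPowers.

Lemma big1_In (V : nmodType) (I : Type) (r : seq I) (F : I -> V) :
  (forall i, List.In i r -> F i = 0) -> \sum_(i <- r) F i = 0.
Proof.
elim: r => [|i r IH] h; first by rewrite big_nil.
by rewrite big_cons h ?IH ?addr0 //; [move=> j hj; apply: h; right|left].
Qed.

Lemma eq_big_In (V : nmodType) (I : Type) (r : seq I) (F G : I -> V) :
  (forall i, List.In i r -> F i = G i) -> \sum_(i <- r) F i = \sum_(i <- r) G i.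
Proof.
elim: r => [|i r IH] h; first by rewrite !big_nil.
by rewrite !big_cons h ?IH //; [move=> j hj; apply: h; right|left].
Qed.

Section Der.
Variables (A B : comPzRingType) (f : {rmorphism A -> B}).

Definition is_der (D : A -> B) := (forall a b, D (a + b) = D a + D b) /\
  forall a b, D (a * b) = f a * D b + f b * D a.

Variable D : A -> B.
Hypothesis dD : is_der D.

Lemma der0 : D 0 = 0.
Proof. by have [DD _] := dD; apply: (addrI (D 0)); rewrite -DD !addr0. Qed.

Lemma der_sum (I : Type) (r : seq I) (P : pred I) (F : I -> A) :
  D (\sum_(i <- r | P i) F i) = \sum_(i <- r | P i) D (F i).
Proof. have [DD _] := dD; apply: (big_morph D DD der0). Qed.

End Der.

Lemma ker_is_ideal (A B : comPzRingType) (f : {rmorphism A -> B}) : is_ideal [set a | f a = 0].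
Proof.
split=> [|a b ha hb|c a ha]; first exact: rmorph0.
  by change (f (a + b) = 0); rewrite rmorphD hb addr0.
by change (f (c * a) = 0); rewrite rmorphM ha mulr0.
Qed.

Section DerPoly.
Variable A : comNzRingType.

Lemma deriv_der : @is_der {poly A} {poly A} idfun (@deriv A).
Proof. by split=> a b; rewrite ?derivD // derivM addrC [X in _ + X]mulrC. Qed.

Variable D : A -> A.
Hypothesis dD : is_der idfun D.

Lemma coef_der (F : {poly A}) i : (map_poly D F)`_i = D F`_i.
Proof. rewrite coef_map_id0 //; apply: der0 dD. Qed.

Lemma map_der : @is_der {poly A} {poly A} idfun (map_poly D).
Proof.
have [DD DM] := dD; split=> F G; apply/polyP => i.
  by rewrite !(coefD, coef_der).
rewrite [G * _]mulrC coefD !coefM coef_der coefM (der_sum dD) -big_split; apply: eq_bigr => j /=.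
by rewrite !coef_der [X in _ + X]mulrC.
Qed.

Lemma map_derC c : map_poly D c%:P = (D c)%:P.
Proof. apply/polyP => i; rewrite coef_der !coefC; case: eqP => // _; apply: der0 dD. Qed.

End DerPoly.

Section Span.
Variables (k K : fieldType) (kap : {rmorphism k -> K}).

(** Agreement is asked on a finite set only. This suffices, since only the generators of an ideal
    and the coefficients of one polynomial are differentiated, and it lets the construction
    terminate. *)
Definition spans (A : comPzRingType) (f : {rmorphism A -> K}) (D : A -> K) (s : seq A) :=
  exists l : seq ((A -> A) * K), (forall p, List.In p l -> is_der idfun p.1) /\
  forall a, a \in s -> D a = \sum_(p <- l) p.2 * f (p.1 a).

(* Subtracting [e * (la o D)] with [la (D c) = 1] makes [D c] vanish. *)
Lemma span_field (D : k -> K) s : is_der kap D -> spans kap D s.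
Proof.
have [m] := ubnP (count (fun c => D c != 0) s); elim: m D => // m IH D; rewrite ltnS => sm [DD DM].
have [h|/hasPn nh] := boolP (has (fun c => D c != 0) s); last first.
  by exists [::]; split=> // a /nh/negbNE/eqP ->; rewrite big_nil.
have /hasP[c sc c0] := h; have [la [la1 laD laZ]] := linear_functional kap c0.
have : is_der idfun (la \o D).
  by split=> a b; rewrite /= ?DD // DM laD !laZ.
have [||l [hl El]] := IH (fun a => D a - D c * kap (la (D a))).
- have la0 : la 0 = 0 by apply: (addrI (la 0)); rewrite -laD !addr0.
  apply: leq_trans sm; have sub b : (D b - D c * kap (la (D b)))%R != 0 -> D b != 0.
    by apply: contra => /eqP ->; rewrite la0 rmorph0 mulr0 subrr.
  elim: (s) sc => //= b r IHr; rewrite inE => /orP[/eqP <-|/IHr lt].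
    by rewrite la1 rmorph1 mulr1 subrr eqxx c0 ltnS; apply: sub_count.
  by apply: lt|| (rewrite -addnS; apply: leq_add => //; case: (D b - _ =P 0) => [|/eqP/sub ->]).
- split=> a b; first by rewrite DD laD rmorphD; ring.
  rewrite DM laD !laZ rmorphD !rmorphM; ring.
exists ((la \o D, D c) :: l); split=> [q [<-|/hl]|a sa] //.
by rewrite big_cons -(El a sa) addrC subrK.
Qed.

(** d/dX accounts for D X; the derivations found for the coefficient ring are extended
    coefficientwise. *)
Lemma span_poly (R : comNzRingType) (f : {rmorphism {poly R} -> K}) (g : {rmorphism R -> K}) :
  (forall c, f c%:P = g c) -> (forall D s, is_der g D -> spans g D s) ->
  forall D s, is_der f D -> spans f D s.
Proof.
move=> fC IH D s dD; have [DD DM] := dD.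
have dC : is_der g (fun c => D c%:P).
  by split=> a b; [rewrite polyCD DD|rewrite polyCM DM !fC].
have [l [hl El]] := IH _ (flatten (map (fun F : {poly R} => polyseq F) s)) dC.
exists ((@deriv R, D 'X) :: [seq (map_poly p.1, p.2) | p <- l]); split.
  move=> p [<-|/In_mapP[q ql ->]]; first exact: deriv_der.
  exact: map_der (hl q ql).
move=> F sF; rewrite big_cons big_map /=.
have hF i : D (F`_i)%:P = \sum_(p <- l) p.2 * g (p.1 F`_i).
  have [lt|le] := ltnP i (size F).
    by apply: El; apply/flatten_mapP; exists F => //; apply: mem_nth.
  rewrite nth_default // (der0 dC) big1_In // => p pl.
  by rewrite (der0 (hl p pl)) rmorph0 mulr0.
elim/poly_ind: F hF {sF} => [|p c IHp] hF.
  rewrite (der0 dD) deriv0 rmorph0 mulr0 add0r big1_In // => q.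
  by rewrite map_poly0 rmorph0 mulr0.
have hp i : D (p`_i)%:P = \sum_(q <- l) q.2 * g (q.1 p`_i).
  by have := hF i.+1; rewrite coefD coefMX coefC addr0.
have hc : D c%:P = \sum_(q <- l) q.2 * g (q.1 c).
  by have := hF 0%N; rewrite coefD coefMX coefC add0r.
rewrite DD DM (IHp hp) hc derivD derivM derivX derivC.
rewrite [in RHS](eq_big_In (G := fun q => f 'X * (q.2 * f (map_poly q.1 p)) + q.2 * g (q.1 c))); last first.
  move=> q ql; have E : map_poly q.1 (p * 'X + c%:P) = map_poly q.1 p * 'X + (q.1 c)%:P.
    apply/polyP => i; rewrite (coef_der (hl q ql)) !(coefD, coefMX, coefC) (coef_der (hl q ql)).
    by case: i => [|i] /=; rewrite ?add0r ?addr0.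
  apply: etrans (congr1 (fun z => q.2 * f z) E) _.
  rewrite rmorphD fC; ring.
rewrite big_split /= -mulr_sumr; ring.
Qed.

Lemma der_span x n (D : mp k n -> K) s : is_der (mpev kap x n) D -> spans (mpev kap x n) D s.
Proof.
elim: n D s => [|n IH]; first exact: span_field.
exact: (span_poly (mpev_C kap x (n := n)) IH).
Qed.

End Span.
(** ** Jacobian presentations of prime ideals *)

Lemma size_subl (R : nzRingType) (F G : {poly R}) : F != 0 -> size G = size F ->
  lead_coef G = lead_coef F -> (size (F - G)%R < size F)%N.
Proof.
move=> F0 sG lG; have [m sm] : exists m, size F = m.+1.
  by exists (size F).-1; rewrite prednK // size_poly_gt0.
rewrite sm ltnS; apply/leq_sizeP => j; rewrite leq_eqVlt => /orP[/eqP<-|lj].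
  by move: lG; rewrite !lead_coefE sG sm coefB => ->; rewrite subrr.
by rewrite coefB !nth_default ?subrr ?sG ?sm.
Qed.

Section PolyIdeals.
Variables (R : comNzRingType).
Implicit Types (F G : {poly R}).

Definition pext (p : set R) : set {poly R} := [set F | forall i, p F`_i].

Lemma pext_ideal p : is_ideal p -> is_ideal (pext p).
Proof.
move=> hp; split=> [i|F G hF hG i|F G hG i]; first by rewrite coef0; apply: (idl0 hp).
  by rewrite coefD; apply: (idlD hp).
by rewrite coefM; apply: idl_sum => // j _; apply: (idlM _ hp).
Qed.

Lemma pext_sub p (I : set {poly R}) : is_ideal I -> (forall c, p c -> I c%:P) -> pext p `<=` I.
Proof.
move=> hI h F; elim/poly_ind: F => [|F c IH] hF; first exact: idl0.
apply: (idlD hI); last by apply: h; have := hF 0%N; rewrite coefD coefMX coefC add0r.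
by apply: (idlMr _ hI); apply: IH => i; have := hF i.+1; rewrite coefD coefMX coefC addr0.
Qed.

Lemma pext_trunc p F : is_ideal p -> ~ pext p F ->
  exists G, [/\ (size G <= size F)%N, ~ p (lead_coef G) & pext p (F - G)].
Proof.
move=> hp; have [n] := ubnP (size F); elim: n F => // n IH F; rewrite ltnS => sF nF.
have [pl|npl] := pselect (p (lead_coef F)); last first.
  exists F; split=> // i; rewrite subrr coef0; apply: (idl0 hp).
have F0 : F != 0 by apply/eqP => E; apply: nF => i; rewrite E coef0; apply: (idl0 hp).
pose H := (lead_coef F)%:P * 'X^((size F).-1).
have pH : pext p H by move=> i; rewrite coefCM; apply: (idlMr _ hp).
have l0 : lead_coef F != 0 by rewrite lead_coef_eq0.
have sF' : (size (F - H)%R < size F)%N.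
  apply: size_subl => //; last by rewrite lead_coef_Mmonic ?monicXn // lead_coefC.
  by rewrite size_Mmonic ?monicXn ?polyC_eq0 // size_polyC l0 size_polyXn prednK // size_poly_gt0.
have [|G [sG pG]] := IH _ (leq_trans sF' sF).
  by move=> h; apply: nF; rewrite -(subrK H F); apply: (idlD (pext_ideal hp)).
exists G; split=> //; first by apply: leq_trans (ltnW sF').
by rewrite (_ : F - G = F - H - G + H); [apply: (idlD (pext_ideal hp))|ring].
Qed.

Lemma pext_prime p : is_prime p -> is_prime (pext p).
Proof.
move=> pp; have [hp p1 _] := pp; split; first exact: pext_ideal.
  by move=> /(_ 0%N); rewrite coef1.
move=> F G hFG; apply: contrapT => /not_orP[nF nG].
have [F1 [_ lF dF]] := pext_trunc hp nF; have [G1 [_ lG dG]] := pext_trunc hp nG.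
have hx := pext_ideal hp.
have : pext p (F1 * G1).
  rewrite (_ : F1 * G1 = F * G - (F - F1) * G - F1 * (G - G1)); last ring.
  by apply: (idlB hx); [apply: (idlB hx) => //; apply: (idlMr _ hx)|apply: (idlM _ hx)].
have nl : ~ p (lead_coef F1 * lead_coef G1) by apply: primeNM.
move=> /(_ (size (F1 * G1)).-1); rewrite -lead_coefE lead_coef_proper_mul //.
apply/eqP => E; apply: nl; rewrite E; apply: (idl0 hp).
Qed.

Section Minimal.
Variables (p : set R) (I : set {poly R}).
Hypotheses (hp : is_ideal p) (hI : is_ideal I) (pI : pext p `<=` I).

(** When p is the kernel of the evaluation on the coefficients, G is a denominator-free minimal
    polynomial of the last variable. *)
Definition min_in G := [/\ I G, ~ p (lead_coef G) & forall F, I F -> (size F < size G)%N -> pext p F].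

Lemma min_exists : ~ I `<=` pext p -> exists G, min_in G.
Proof.
move=> nI; have ex : exists n, `[< exists G, [/\ I G, ~ p (lead_coef G) & size G = n] >].
  have [F IF nF] : exists2 F, I F & ~ pext p F.
    by apply: contrapT => no; apply: nI => F IF; apply: contrapT => nF; apply: no; exists F.
  have [G [_ dG]] := pext_trunc hp nF.
  exists (size G); apply/asboolP; exists G; split=> //.
  by rewrite -[G](subKr F); apply: (idlB hI) => //; apply: pI.
case: (ex_minnP ex) => n /asboolP[G [IG lG sG]] min; exists G; split=> // F IF lt; apply: contrapT => nF.
have [F1 [sF1 lF dF]] := pext_trunc hp nF.
have : (n <= size F1)%N.
  apply: min; apply/asboolP; exists F1; split=> //.
  by rewrite -[F1](subKr F); apply: (idlB hI) => //; apply: pI.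
by rewrite leqNgt -sG (leq_ltn_trans sF1 lt).
Qed.

Lemma min_division G F : min_in G -> I F -> exists N q, pext p ((lead_coef G ^+ N)%:P * F - q * G).
Proof.
move=> [IG lG min]; have [n] := ubnP (size F); elim: n F => // n IH F; rewrite ltnS => sF IF.
have [lt|le] := ltnP (size F) (size G).
  by exists 0%N, 0; rewrite mul1r mul0r subr0; apply: min.
have [->|F0] := eqVneq F 0; first by exists 0%N, 0; rewrite mulr0 mul0r subr0; apply: (idl0 (pext_ideal hp)).
pose H := (lead_coef F)%:P * 'X^(size F - size G) * G.
have G0 : G != 0 by apply/eqP => E; apply: lG; rewrite E lead_coef0; apply: (idl0 hp).
have sFH : (size ((lead_coef G)%:P * F - H)%R < size F)%N.
  have [m sm] : exists m, size F = m.+1 by exists (size F).-1; rewrite prednK // size_poly_gt0.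
  have [l sl] : exists l, size G = l.+1 by exists (size G).-1; rewrite prednK // size_poly_gt0.
  rewrite sm ltnS; apply/leq_sizeP => j lj.
  rewrite coefB coefCM /H -mulrA coefCM coefXnM sm sl ltnNge.
  rewrite (leq_trans (leq_subr _ _) lj).
  move: lj; rewrite leq_eqVlt => /orP[/eqP<-|lj].
    have -> : F`_m = lead_coef F by rewrite lead_coefE sm.
    have -> : G`_(m - (m - l)) = lead_coef G.
      by rewrite lead_coefE subKn //; move: le; rewrite sm sl.
    by rewrite mulrC subrr.
  rewrite !nth_default ?mulr0 ?subrr ?sm //.
  rewrite sl; lia.
have [|N [q hq]] := IH _ (leq_trans sFH sF).
  by apply: (idlB hI); apply: (idlM _ hI).
exists N.+1, (q + (lead_coef G ^+ N)%:P * ((lead_coef F)%:P * 'X^(size F - size G))).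
have -> : (lead_coef G ^+ N.+1)%:P = (lead_coef G ^+ N)%:P * (lead_coef G)%:P by rewrite -polyCM exprSr.
move: hq; rewrite /H; congr pext; ring.
Qed.

End Minimal.
End PolyIdeals.

(** The determinant of the block matrix is det A times the Schur complement of A. *)
Lemma det_border (K : fieldType) c (A : 'M[K]_c) (u : 'cV_c) (r : 'rV_c) (w : 'M_1) :
  \det A != 0 -> \det (block_mx A u r w) = 0 -> w = r *m invmx A *m u.
Proof.
move=> dA d0; have uA : A \in unitmx by rewrite unitmxE unitfE.
have E : block_mx A u r w *m block_mx 1%:M (- (invmx A *m u)) 0 1%:M =
    block_mx A 0 r (w - r *m invmx A *m u).
  by rewrite mulmx_block !mulmx0 !mulmx1 !addr0 !mulmxN mulmxA mulmxV // mul1mx addNr mulmxA addrC.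
have := congr1 (fun M => \det M) E; rewrite det_mulmx d0 mul0r det_lblock => /esym/eqP.
rewrite mulf_eq0 (negPf dA) [w - _]mx11_scalar det_scalar1 => /eqP w0.
apply/eqP; rewrite -subr_eq0; apply/eqP/matrixP => i j; by rewrite !ord1 w0 mxE.
Qed.

Section Jacobian.
Variables (k K : fieldType) (kap : {rmorphism k -> K}) (x : nat -> K).
Local Notation ev n := (mpev kap x n).

(** After f is inverted, the kernel of the evaluation is generated by c elements whose Jacobian with
    respect to c derivations is nonzero in K. The derivations need not be trivial on k, which is
    what makes the criterion available over imperfect fields. *)
Definition jacobian n c (g : 'I_c -> mp k n) (d : 'I_c -> mp k n -> mp k n) (f : mp k n) :=
  [/\ forall i, is_der idfun (d i), forall j, ev n (g j) = 0, ev n f != 0,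
      forall F, ev n F = 0 -> exists N : nat, ideal_gen (range g) (f ^+ N * F)
    & \det (\matrix_(i, j) ev n (d i (g j))) != 0].

Section Step.
Variables (n c : nat) (g : 'I_c -> mp k n) (d : 'I_c -> mp k n -> mp k n) (f : mp k n).
Hypothesis jac : jacobian g d f.
Local Notation R := (mp k n).
Local Notation e := (ev n).
Let E : {rmorphism {poly R} -> K} := ev n.+1.
Local Notation ker := [set F : R | e F = 0].
Local Notation Ker := [set F : {poly R} | E F = 0].

Let EC a : E a%:P = e a. Proof. exact: mpev_C. Qed.

Let ker_ideal : is_ideal ker := ker_is_ideal e.

Let Ker_ideal : is_ideal Ker := ker_is_ideal E.

Let ker_Ker : pext ker `<=` Ker.
Proof. by apply: (pext_sub Ker_ideal) => a ea; change (E a%:P = 0); rewrite EC. Qed.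

Lemma pext_power (I : set {poly R}) F : is_ideal I -> (forall j, I (g j)%:P) -> pext ker F ->
  exists N : nat, I (f%:P ^+ N * F).
Proof.
move=> hI gI; elim/poly_ind: F => [|F a IH] hF; first by exists 0%N; rewrite mulr0; apply: (idl0 hI).
have [|N hN] := IH; first by move=> i; have := hF i.+1; rewrite coefD coefMX coefC addr0.
have [_ _ _ hf _] := jac; have [|M hM] := hf a.
  by have := hF 0%N; rewrite coefD coefMX coefC add0r.
have : I (f ^+ M * a)%:P.
  have hJ : is_ideal [set b : R | I b%:P].
    split=> [|b b'|b b'] /=; rewrite ?polyCD ?polyCM; [apply: (idl0 hI)|apply: (idlD hI)|apply: (idlM _ hI)].
  have sub : ideal_gen (range g) `<=` [set b : R| I b%:P] by apply: gen_sub => // _ [j _ <-].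
  exact: (sub _ hM).
exists (N + M)%N; rewrite mulrDr; apply: (idlD hI).
  by rewrite (_ : _ _ = f%:P ^+ N * F * (f%:P ^+ M * 'X)); [apply: (idlMr _ hI)|rewrite exprD; ring].
rewrite (_ : _ _ = (f ^+ M * a)%:P * f%:P ^+ N); first exact: (idlMr _ hI).
rewrite polyCM (rmorphXn polyC) exprD; ring.
Qed.

(* [x n] is transcendental over the fraction field of the previous variables *)
Lemma jac_transcendental : Ker `<=` pext ker ->
  jacobian (n := n.+1) (fun j => (g j)%:P : {poly R}) (fun i => map_poly (d i)) (f%:P : {poly R}).
Proof.
move=> KK; have [hd hdet] := jac; split.
- by move=> i; apply: map_der.
- by move=> j; rewrite EC.
- by rewrite EC.
- move=> F /KK hF; apply: pext_power hF; first exact: idl_gen.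
  by move=> j; apply: sub_gen.
- rewrite (_ : \matrix_(i, j) _ = \matrix_(i, j) e (d i (g j))) //.
  by apply/matrixP => i j; rewrite !mxE map_derC.
Qed.

Variable G : {poly R}.
Hypothesis minG : min_in ker Ker G.

Local Notation lc := (lead_coef G).
Let g' (j : 'I_(c + 1)) : {poly R} := match fintype.split j with inl j => (g j)%:P | inr _ => G end.

Lemma jac_algebraic (D : {poly R} -> {poly R}) : is_der idfun D ->
  \det (block_mx (\matrix_(i, j) e (d i (g j))) (\col_i E (map_poly (d i) G))
    (\row_j E (D (g j)%:P)) (E (D G))%:M) != 0 ->
  exists d', jacobian (n := n.+1) g' d' ((f * lc)%:P : {poly R}).
Proof.
have [hd hdet] := jac; have [IG lG _] := minG.
exists (fun i => match fintype.split i with inl i => map_poly (d i)| _ => D end); split.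
- by move=> i; case: (fintype.split i) => j //; apply: map_der.
- by move=> j; rewrite /g'; case: (fintype.split j) => i //; rewrite EC.
- rewrite EC rmorphM mulf_neq0 //; exact/eqP.
- move=> F hF; have [N [q hq]] := min_division ker_ideal Ker_ideal minG hF.
  have hI' := @idl_gen {poly R} (range g').
  have gI j : ideal_gen (range g') (g j)%:P.
    by apply: sub_gen; exists (lshift 1 j) => //; rewrite /g' (unsplitK (inl j)).
  have [M hM] := pext_power hI' gI hq.
  have gG : ideal_gen (range g') G.
    by apply: sub_gen; exists (rshift c ord0) => //; rewrite /g' (unsplitK (inr ord0)).
  have : ideal_gen (range g') (f%:P ^+ M * (lc ^+ N)%:P * F).
    rewrite (_ : _ F = f%:P ^+ M * ((lc ^+ N)%:P * F - q * G) + f%:P ^+ M * q * G); last ring.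
    by apply: (idlD hI') => //; apply: (idlM _ hI').
  exists (M + N)%N; rewrite (_ : _ F = lc%:P ^+ M * f%:P ^+ N * (f%:P ^+ M * (lc ^+ N)%:P * F)).
    exact: (idlM _ hI').
  rewrite polyCM (rmorphXn polyC) exprMn !exprD; ring.
- rewrite (_ : \matrix_(i, j) _ = block_mx (\matrix_(i, j) e (d i (g j))) (\col_i E (map_poly (d i) G))
    (\row_j E (D (g j)%:P)) (E (D G))%:M) //.
  apply/matrixP => i j; rewrite !mxE /g'.
  case: (fintype.split i) => i'; rewrite !mxE; case: (fintype.split j) => j'; rewrite !mxE //.
    by rewrite map_derC.
  by rewrite !ord1.
Qed.

(** d/dX kills the old generators, so the extended Jacobian is block triangular with the nonzero
    entry G'(x_n) in the corner. *)
Lemma jac_separable : E G^`() != 0 -> exists d' f', jacobian (n := n.+1) g' d' f'.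
Proof.
move=> sep; have [hd hg hf hI hdet] := jac.
have [||d' jd] := @jac_algebraic (@deriv R); first exact: deriv_der.
  rewrite (_ : \row_j _ = 0); last by apply/rowP => j; rewrite !mxE derivC rmorph0.
  by rewrite det_ublock mulf_neq0 // det_scalar1.
by exists d', (f * lc)%:P.
Qed.

Section Inseparable.
Hypothesis insep : E G^`() = 0.

Let xi := x n.
Let EE (F : {poly R}) r : (size F <= r)%N -> E F = \sum_(l < r) e F`_l * xi ^+ l.
Proof.
move=> sF; rewrite [LHS](mpevS kap x F) (@horner_coef_wide _ r); last first.
  exact: leq_trans (size_poly _ _) sF.
by apply: eq_bigr => i _; rewrite coef_map.
Qed.

(** The fraction field of k[x_0, ..., x_(n-1)] inside K. *)
Let L := [set b : K | exists F H, e H != 0 /\ b = e F / e H].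

Lemma frac_subring : subring L.
Proof.
split.
- by exists 1, 1; rewrite rmorph1 oner_neq0 divr1.
- move=> _ _ [F [H [h ->]]] [F' [H' [h' ->]]]; exists (F * H' - F' * H), (H * H').
  by rewrite !rmorphM mulf_neq0 // rmorphB !rmorphM; split=> //; field; apply/andP.
- move=> _ _ [F [H [h ->]]] [F' [H' [h' ->]]]; exists (F * F'), (H * H').
  by rewrite !rmorphM mulf_neq0 // mulf_div.
Qed.

Lemma frac_inv b : L b -> L b^-1.
Proof.
move=> [F [H [h ->]]]; have [F0|F0] := eqVneq (e F) 0; last by exists H, F; rewrite invf_div.
by rewrite F0 mul0r invr0; exists 0, 1; rewrite rmorph1 oner_neq0 rmorph0 mul0r.
Qed.

Lemma frac_ev F : L (e F). Proof. by exists F, 1; rewrite rmorph1 oner_neq0 divr1. Qed.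

Lemma common_frac r (b : nat -> K) : (forall l, (l < r)%N -> L (b l)) ->
  exists s (F : nat -> R), e s != 0 /\ forall l, (l < r)%N -> e (F l) = e s * b l.
Proof.
elim: r => [|r IH] h; first by exists 1, (fun=> 0); rewrite rmorph1 oner_neq0.
have [|s [F [s0 hF]]] := IH; first by move=> l lr; apply: h; apply: leqW.
have [F1 [H1 [h1 E1]]] := h r (ltnSn r).
exists (s * H1), (fun l => if l == r then s * F1 else F l * H1); rewrite rmorphM mulf_neq0 //; split=> // l.
rewrite ltnS leq_eqVlt; case: eqVneq => [-> _|_ lr]; rewrite rmorphM.
  by rewrite E1 -mulrA (mulrCA (e H1)) mulfV // mulr1.
by rewrite hF // mulrAC.
Qed.

Lemma min_frac r (b : nat -> K) : (r < size G)%N -> (forall l, (l < r)%N -> L (b l)) ->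
  \sum_(l < r) b l * xi ^+ l = 0 -> forall l, (l < r)%N -> b l = 0.
Proof.
move=> rG hb sum l lr; have [s [F [s0 hF]]] := common_frac hb; have [_ _ min] := minG.
have sP : (size (\poly_(i < r) F i) <= r)%N by apply: size_poly.
have : pext ker (\poly_(i < r) F i).
  apply: min; last exact: leq_ltn_trans.
  change (E (\poly_(i < r) F i) = 0); rewrite (EE sP) (eq_bigr (fun i : 'I_r => e s * (b i * xi ^+ i))).
    by rewrite -mulr_sumr sum mulr0.
  by move=> i _; rewrite coef_poly ltn_ord hF // mulrA.
move=> /(_ l) /=; rewrite coef_poly lr hF // => /eqP.
by rewrite mulf_eq0 (negPf s0) => /eqP.
Qed.

Let m := (size G).-1.
Let elc0 : e lc != 0. Proof. by have [_ /eqP] := minG. Qed.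
Let G0 : G != 0.
Proof. by apply/eqP => G0; move: elc0; rewrite G0 lead_coef0 rmorph0 eqxx. Qed.
Let sG : size G = m.+1. Proof. by rewrite prednK // size_poly_gt0. Qed.
(** The coefficients of the minimal polynomial of [xi] over [L], of degree m. *)
Let a l := e G`_l / e lc.
Let aL l : L (a l).
Proof. by have [_ _ LM] := frac_subring; apply: LM; [apply: frac_ev|apply: frac_inv; apply: frac_ev]. Qed.
Let am : a m = 1. Proof. by rewrite /a -[G`_m]/(lead_coef G) mulfV. Qed.
Let sum_a : \sum_(l < m.+1) a l * xi ^+ l = 0.
Proof.
have [IG _ _] := minG; have : E G = 0 := IG; rewrite (EE (r := m.+1)) ?sG // => h.
rewrite (eq_bigr (fun l : 'I_m.+1 => (e lc)^-1 * (e G`_l * xi ^+ l))); first by rewrite -mulr_sumr h mulr0.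
by move=> l _; rewrite /a; ring.
Qed.

Let m_gt0 : (0 < m)%N.
Proof.
rewrite lt0n; apply/eqP => m0; have := sum_a; have := am; rewrite m0 => a01.
by rewrite big_ord1 expr0 mulr1 a01 => /eqP; rewrite oner_eq0.
Qed.

Lemma insep_coef l : (0 < l)%N -> e G`_l *+ l = 0.
Proof.
case: l => // l _; have [_ _ min] := minG.
by have := min G^`() insep (lt_size_deriv G0) l; rewrite /= coef_deriv rmorphMn.
Qed.

Lemma insep_char : exists p, p \in [pchar K].
Proof.
apply: (natf0_pchar m_gt0); have /eqP := insep_coef m_gt0.
by rewrite -[G`_m]/(lead_coef G) -mulr_natr mulf_eq0 (negPf elc0).
Qed.

Lemma sum_multiples (p m' : nat) (F : nat -> K) : (0 < p)%N -> (forall l, ~~ (p %| l)%N -> F l = 0) ->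
  \sum_(l < (p * m').+1) F l = \sum_(i < m'.+1) F (p * i)%N.
Proof.
move=> p0 hF; elim: m' => [|m' IH]; first by rewrite muln0 !big_ord1 muln0.
rewrite [RHS]big_ord_recr -IH mulnS addnC.
rewrite -(big_mkord xpredT F) -(big_mkord xpredT F) (@big_cat_nat _ _ _ (p * m').+1) //; last first.
  by rewrite leq_addr.
congr (_ _); rewrite big_nat_recr /=; last by rewrite -addn1 leq_add2l.
rewrite big_nat big1 ?add0r // => l /andP[l1 l2]; apply: hF; apply/negP => /dvdnP[q Eq]; subst.
have h1 : (p * m' < p * q)%N by rewrite [(p * q)%N]mulnC.
have h2 : (p * q < p * m'.+1)%N by rewrite mulnS mulnC addnC.
by move: h1 h2; rewrite !ltn_pmul2l // => h /(leq_trans h); rewrite ltnn.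
Qed.

(** By inseparability only exponents divisible by p occur. If all coefficients were p-th powers in
    L, the minimal polynomial would take at [xi] the p-th power of the value of a polynomial over L
    of degree m/p; that value would be 0, against minimality. *)
Lemma insep_nonpower p : p \in [pchar K] -> exists2 l, (l < m)%N & forall b, L b -> b ^+ p != a l.
Proof.
move=> cp; have pp := pcharf_prime cp; apply: contrapT => no.
have /choice[b hb] l : exists b, (l <= m)%N -> L b /\ b ^+ p = a l.
  have [lm|lm] := ltnP l m; last first.
    by exists 1 => lm'; rewrite (anti_leq (introT andP (conj lm' lm))) expr1n; have [] := frac_subring.
  apply: contrapT => nb; apply: no; exists l => // b Lb; apply/eqP => Eb; apply: nb; by exists b.
have a0 l : ~~ (p %| l)%N -> a l = 0.
  move=> npl; have l0 : (0 < l)%N by case: l npl => //; rewrite dvdn0.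
  have /eqP := insep_coef l0; rewrite -mulr_natr mulf_eq0 => /orP[/eqP E0|]; first by rewrite /a E0 mul0r.
  by rewrite -(dvdn_pcharf cp) (negPf npl).
have /dvdnP[m' Em] : (p %| m)%N.
  by apply: contrapT => /negP /a0; rewrite am => /eqP; rewrite oner_eq0.
have m'0 : (0 < m')%N by move: m_gt0; rewrite Em; case: (m').
have sumB : \sum_(i < m'.+1) b (p * i)%N * xi ^+ i = 0.
  have frD (u v : K) : (u + v) ^+ p = u ^+ p + v ^+ p.
    rewrite -!(pFrobenius_autE cp) pFrobenius_autD_comm //; apply: mulrC.
  have p0 : (0 : K) ^+ p = 0 by rewrite expr0n; have := pp; case: (p).
  have : (\sum_(i < m'.+1) b (p * i)%N * xi ^+ i) ^+ p = 0.
    have mE (F : nat -> K) : \sum_(l < m.+1) F l = \sum_(l < (p * m').+1) F l by rewrite Em mulnC.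
    rewrite (big_morph (fun u => u ^+ p) frD p0) -[RHS]sum_a (mE (fun l => a l * xi ^+ l)).
    rewrite (@sum_multiples p m' (fun l => a l * xi ^+ l)) ?prime_gt0 //; last first.
      by move=> l /a0 ->; rewrite mul0r.
    apply: eq_bigr => i _; rewrite exprMn -exprM [(i * p)%N]mulnC.
    by have [|_ ->] := hb (p * i)%N => //; rewrite Em mulnC leq_mul2r -ltnS ltn_ord orbT.
  by move=> /eqP; rewrite expf_eq0 => /andP[_ /eqP].
have := @min_frac m'.+1 (fun i => b (p * i)%N) _ _ sumB m' (ltnSn m').
have [] := hb m (leqnn m); rewrite {1 2}Em mulnC => _ Eb h.
have : b (p * m')%N = 0.
  apply: h => [|l lm].
    rewrite sG Em ltnS mulnC; apply: leq_trans (leq_mul (prime_gt1 pp) (leqnn m')); by rewrite mul2n -addnn -addn1 leq_add2l.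
  by have [|] := hb (p * l)%N => //; rewrite Em mulnC leq_mul2r -ltnS lm orbT.
move=> b0; move: Eb; rewrite b0 am expr0n; have := pp; case: (p) => //q _ /esym/eqP.
by rewrite oner_eq0.
Qed.

(** A derivation D of L taking the value 1 on a coefficient that is not a p-th power replaces d/dX:
    differentiating the coefficients of G yields a value w that is not 0. By [der_span] D is a
    combination of derivations of the polynomial ring. If none of these could border the Jacobian,
    [det_border] would express w linearly in the values D(g_j), which are all 0. *)
Lemma jac_inseparable : exists d' f', jacobian (n := n.+1) g' d' f'.
Proof.
have [p cp] := insep_char; have [l0 ltl0 nl0] := insep_nonpower cp.
have [D [DD DM Da DL]] := derivation_exists cp frac_subring frac_inv (aL l0) nl0.
have [hd hg hf hI hdet] := jac.
have D1 : D 1 = 0.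
  have [L1 _] := frac_subring; have := DM 1 1 L1 L1; rewrite !mul1r.
  by move=> /eqP; rewrite -subr_eq0 opprD addrA subrr sub0r oppr_eq0 => /eqP.
have dDe : is_der e (D \o e).
  split=> u v; rewrite /= ?rmorphD ?rmorphM; [apply: DD|apply: DM]; apply: frac_ev.
have [l [hl El]] := der_span (polyseq G ++ [seq g j | j <- enum 'I_c]) dDe.
pose w := \sum_(q <- l) q.2 * E (map_poly q.1 G).
have Ew : w = \sum_(i < m.+1) D (e G`_i) * xi ^+ i.
  rewrite /w (eq_big_In (G := fun q => \sum_(i < m.+1) q.2 * e (q.1 G`_i) * xi ^+ i)); last first.
    move=> q ql; rewrite (EE (r := m.+1)) ?mulr_sumr; last by rewrite -sG; apply: size_poly.
    by apply: eq_bigr => i _; rewrite (coef_der (hl q ql)) mulrA.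
  rewrite exchange_big; apply: eq_bigr => i _; rewrite -mulr_suml -El //.
  by rewrite mem_cat mem_nth // sG.
have w0 : w != 0.
  (* Since D(a_m) = D(1) = 0, the vanishing of w is a relation for [xi] of degree less than m, and
     minimality contradicts D(a_l0) = 1. *)
  apply/eqP => E0; have sumD : \sum_(i < m) D (a i) * xi ^+ i = 0.
    have : \sum_(i < m.+1) D (a i) * xi ^+ i = 0.
      apply: (mulfI elc0); rewrite mulr0 -[RHS]E0 mulr_sumr.
      apply: etrans (_ : \sum_(i < m.+1) (D (e G`_i) * xi ^+ i - D (e lc) * (a i * xi ^+ i)) = _); last first.
        by rewrite sumrB -mulr_sumr sum_a mulr0 subr0.
      apply: eq_bigr => i _; have -> : e G`_i = e lc * a i by rewrite mulrC mulfVK.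
      rewrite (DM (e lc)); [|exact: frac_ev|exact: aL].
      ring.
    by rewrite big_ord_recr /= am D1 mul0r addr0.
  have := @min_frac m (fun i => D (a i)) _ _ sumD l0 ltl0; rewrite Da => h.
  have : (1 : K) = 0 by apply: h => [|i _]; [rewrite sG|apply: DL].
  by move/eqP; rewrite oner_eq0.
pose A := \matrix_(i, j) e (d i (g j)); pose u := \col_i E (map_poly (d i) G).
have [[q [ql hq]]|no] := pselect (exists q, List.In q l /\
    \det (block_mx A u (\row_j E (map_poly q.1 (g j)%:P)) (E (map_poly q.1 G))%:M) != 0).
  have [|d' jd] := jac_algebraic (map_der (hl q ql)); first exact: hq.
  by exists d', (f * lc)%:P.
move/eqP: w0.
have bord q : List.In q l -> (E (map_poly q.1 G))%:M = (\row_j E (map_poly q.1 (g j)%:P)) *m invmx A *m u.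
  move=> ql; apply: det_border => //; apply: contrapT => /eqP nd; apply: no; by exists q.
have : w%:M = (\sum_(q <- l) q.2 *: (\row_j E (map_poly q.1 (g j)%:P))) *m invmx A *m u.
  rewrite !mulmx_suml (raddf_sum); apply: eq_big_In => q ql.
  by rewrite -!scalemxAl -bord // scale_scalar_mx.
rewrite (_ : \sum_(q <- l) _ = 0).
  by rewrite !mul0mx => /matrixP/(_ ord0 ord0); rewrite !mxE.
apply/rowP => j; rewrite summxE !mxE.
apply: etrans (_ : (D \o e) (g j) = _); last first.
  by have := der0 dDe; rewrite /= rmorph0 hg.
rewrite El; last by rewrite mem_cat map_f ?orbT // mem_enum.
by apply: eq_big_In => q ql; rewrite !mxE (map_derC (hl q ql)) EC.
Qed.

End Inseparable.
End Step.

Lemma jacobian_exists n : exists c (g : 'I_c -> mp k n) d f, jacobian g d f.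
Proof.
elim: n => [|n [c [g [d [f jac]]]]].
  exists 0%N, (fun=> 0), (fun=> idfun), 1; split=> [[]|[]|||] //.
  - by rewrite rmorph1 oner_neq0.
  - move=> F /eqP; rewrite fmorph_eq0 => /eqP ->; exists 0%N; rewrite mulr0.
    exact: (idl0).
  - by rewrite det_mx00 oner_neq0.
pose E : {rmorphism {poly mp k n} -> K} := ev n.+1.
pose I := [set F : {poly mp k n} | E F = 0]; pose p := [set F : mp k n | ev n F = 0].
have [sub|nsub] := pselect (I `<=` pext p).
  do 4!eexists; apply: (jac_transcendental jac sub).
have hp : is_ideal p := ker_is_ideal _.
have hI : is_ideal I := ker_is_ideal _.
have pI : pext p `<=` I by apply: (pext_sub hI) => a pa; apply: etrans pa; apply: mpev_C.
have [G minG] := min_exists hp hI pI nsub.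
have [sep|insep] := eqVneq (E G^`()) 0.
  have [d' [f' jd]] := jac_inseparable jac minG sep; do 4!eexists; apply: jd.
have [d' [f' jd]] := jac_separable jac minG insep; do 4!eexists; apply: jd.
Qed.

End Jacobian.

(** * Regular points *)

Section MaximalIdeals.
Variable k : fieldType.

(** Modulo N every element is algebraic over k, so nonzero values of the coefficient ring have
    inverses in its image. An equation for the variable modulo N has constant coefficients, not all
    zero, and thus lies outside the extension of the contracted ideal. *)
Lemma maximal_polyC n (N : set (mp k n.+1)) : maximal_ideal N ->
  maximal_ideal [set a : mp k n | N (a%:P : {poly mp k n})] /\
  ~ N `<=` pext [set a : mp k n | N (a%:P : {poly mp k n})].
Proof.
move=> mN; have [d hd] := mp_maximal_finite mN; have [hN N1 Ni] := mN.
have [K [rho [rs rk]]] := residue_field hN N1 Ni.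
pose N' := [set a : mp k n | N (a%:P : {poly mp k n})].
have alg (F : mp k n.+1) : exists2 c : nat -> k, exists2 i, (i < d.+1)%N & c i != 0 &
    N (\sum_(i < d.+1) mpC k n.+1 (c i) * F ^+ i).
  have [c [[i ci] hc]] := kd_algebraic F hN hd.
  exists (fun i => oapp c 0 (insub i)); first by exists i => //; rewrite valK.
  by move: hc; congr N; apply: eq_bigr => j _; rewrite valK.
have : is_ideal N'.
  split; first by rewrite /N' /= polyC0; apply: (idl0 hN).
    move=> a b; rewrite /N' /= polyCD; apply: (idlD hN).
  move=> a b; rewrite /N' /= polyCM; apply: (idlM _ hN).
split; first split=> // a na.
  have [c [i id ci] hc] := alg (a%:P : {poly mp k n}).
  pose p := \poly_(j < d.+1) c j.
  pose e : {rmorphism mp k n -> K} := [the {rmorphism mp k n -> K} of (rho : {rmorphism {poly mp k n} -> K}) \o polyC].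
  have ea : e a != 0 by apply/eqP /rk.
  have [||||||b _ Eb] := @const_dvd k K (rho \o mpC k n.+1) (range e) (e a) p.
  + exact: range_subring.
  + by move=> c0.
  + by exists a.
  + exact: ea.
  + apply/eqP => E; move: ci; have : p`_i = c i by rewrite coef_poly id.
    by rewrite E coef0 => <-; rewrite eqxx.
  + rewrite (@horner_coef_wide _ d.+1); last apply: leq_trans (size_poly _ _) (size_poly _ _).
    have /rk := hc; rewrite rmorph_sum => E; rewrite -[RHS]E; apply: eq_bigr => j.
    by rewrite coef_map coef_poly ltn_ord rmorphM rmorphXn.
  exists b; apply/rk; change (e (1 - a * b) = 0).
  by rewrite rmorphB rmorph1 rmorphM Eb mulfV // subrr.
move=> sub; have [c [i id ci] hc] := alg ('X : {poly mp k n}).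
have := sub _ hc i; rewrite (_ : _`_i = mpC k n (c i)).
  move=> hci; apply: N1; rewrite (_ : 1 = mpC k n.+1 (c i)^-1 * (mpC k n (c i))%:P).
    exact: idlM.
  by rewrite -[(mpC k n (c i))%:P]/(mpC k n.+1 (c i)) -rmorphM mulVf // rmorph1.
rewrite coef_sum (bigD1 (Ordinal id)) //= coefCM coefXn eqxx mulr1 big1 ?addr0 // => j ji.
by rewrite coefCM coefXn; case: eqP => [E|]; rewrite ?mulr0 //; move/eqP: ji; case; apply: val_inj.
Qed.

(** One generator per variable: the new one lifts, up to a unit, the minimal polynomial of the last
    variable over the residue field of the contraction. *)
Lemma maximal_gens n (N : set (mp k n)) : maximal_ideal N -> exists z : 'I_n -> mp k n, N = ideal_gen (range z).
Proof.
elim: n N => [|n IH] N mN.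
  exists (fun=> 0); apply/seteqP; split=> F; last first.
    have [hN _ _] := mN; have sub0 : [set (0 : mp k 0) | _ in [set: 'I_0]] `<=` N by move=> F1 [[]].
    exact: (gen_sub hN sub0).
  move=> NF; have [hN N1 _] := mN; have [F0|F0] := eqVneq (F : k) 0.
    by rewrite F0; apply: (idl0).
  by exfalso; apply: N1; rewrite -[1](mulVf F0); apply: idlM.
have [mN' nsub] := maximal_polyC mN; set N' := [set a| _] in mN'.
have [hN _] := mN; have [hN' _ N'i] := mN'; have [z Ez] := IH _ mN'.
have subN : pext N' `<=` N by apply: pext_sub.
have [G minG] := min_exists hN' hN subN nsub; have [NG lG _] := minG.
pose z' (j : 'I_(n + 1)) : {poly mp k n} := match fintype.split j with inl j => (z j)%:P| _ => G end.
suff EN : N = ideal_gen (range z').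
  by exists (fun j : 'I_n.+1 => z' (cast_ord (esym (addn1 n)) j)); rewrite EN; congr ideal_gen;
    apply/seteqP; split=> [_ [j _ <-]|_ [j _ <-]]; [exists (cast_ord (addn1 n) j) => //; rewrite cast_ordK|exists (cast_ord (esym (addn1 n)) j)].
have hI := @idl_gen {poly mp k n} (range z').
have zI : pext N' `<=` ideal_gen (range z').
  apply: (pext_sub hI) => a; rewrite Ez; move: a.
  apply: (@gen_sub _).
    split=> [|a b|a b] /=; rewrite ?polyCD ?polyCM; [apply: (idl0 hI)|apply: (idlD hI)|apply: (idlM _ hI)].
  by move=> _ [j _ <-]; apply: sub_gen; exists (lshift 1 j) => //; rewrite /z' (unsplitK (inl j)).
have GI : ideal_gen (range z') G.
  by apply: sub_gen; exists (rshift n ord0) => //; rewrite /z' (unsplitK (inr ord0)).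
apply/seteqP; split; last first.
  apply: gen_sub => // _ [j _ <-]; rewrite /z'; case: (fintype.split j) => i //.
  by have : N' (z i) by rewrite Ez; apply: sub_gen.
move=> F NF; have [M [q hq]] := min_division hN' hN minG NF.
have [b hb] : exists b, N' (1 - lead_coef G ^+ M * b).
  apply: N'i => h; apply: lG; apply: (primeX (maximal_prime mN') h).
have -> : F = b%:P * ((lead_coef G ^+ M)%:P * F - q * G) + b%:P * q * G + (1 - lead_coef G ^+ M * b)%:P * F :> {poly mp k n}.
  ring.
apply: (idlD hI); first by apply: (idlD hI); apply: (idlM _ hI) => //; apply: zI.
apply: (idlMr _ hI); apply: zI => i; rewrite coefC; case: eqP => // _; exact: (idl0 hN').
Qed.

Lemma maximal_chain n (N : set (mp k n)) : maximal_ideal N -> exists X : nat -> set (mp k n),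
  [/\ forall i, (i <= n)%N -> is_prime (X i), forall i, (i < n)%N -> X i `<` X i.+1 & X n = N].
Proof.
elim: n N => [|n IH] N mN; first by exists (fun=> N); split=> // i _; apply: maximal_prime.
have [mN' nsub] := maximal_polyC mN.
have [hN _] := mN; have [X [pX iX EX]] := IH _ mN'.
exists (fun i => if (i <= n)%N then pext (X i) else N); split=> [i _|i|]; last by rewrite ltnn.
  by case: leqP => le; [apply: pext_prime; apply: pX|apply: maximal_prime].
rewrite ltnS leq_eqVlt => /orP[/eqP->|lt].
  by rewrite eqxx ltnn EX; split=> //; apply: pext_sub.
rewrite lt orbT; have [s ns] := iX i lt; split; first by move=> F hF j; apply: s.
move=> s'; apply: ns => a ha; have := s' a%:P; rewrite /= => h; have := h _ 0%N; rewrite coefC; apply.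
move=> j; rewrite coefC; case: eqP => // _; exact: (idl0).
Qed.

End MaximalIdeals.

(** * Dimension bounds at a maximal ideal of a ring that need not be local *)

Section HilbertSamuelChains.
Variables (A : comNzRingType) (Q : set A).
Hypotheses (nA : is_noetherian A) (idQ : is_ideal Q) (finQ : finl Q).

Lemma hs_adjoin_seq I (s : seq A) : is_ideal I -> (forall a, a \in s -> Q a) ->
  (size (hs Q I) <= size s + size (hs Q (foldl (@adjoin A) I s)))%N.
Proof.
elim: s I => //= a s IH I hI sQ.
have := hs_lower nA idQ finQ hI (sQ a (mem_head a s)).
have := IH _ (idl_adjoin a hI) (fun b bs => sQ b (mem_behead (s := a :: s) bs)).
move: (size) => w; lia.
Qed.

Lemma foldl_adjoin (I : set A) (s : seq A) : is_ideal I ->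
  [/\ is_ideal (foldl (@adjoin A) I s), I `<=` foldl (@adjoin A) I s,
      forall a, a \in s -> foldl (@adjoin A) I s a
    & forall J, is_ideal J -> I `<=` J -> (forall a, a \in s -> J a) -> foldl (@adjoin A) I s `<=` J].
Proof.
elim: s I => [|a s IH] I hI /=; first by split.
have [h1 h2 h3 h4] := IH _ (idl_adjoin a hI); split=> //.
- by move=> b hb; apply: h2; apply: sub_adjoin.
- move=> b; rewrite inE => /orP[/eqP->|/h3//]; by apply: h2; apply: mem_adjoin.
- move=> J hJ IJ sJ; apply: h4 => // [|b bs]; last by apply: sJ; rewrite inE bs orbT.
  apply: adjoin_sub => //; apply: sJ; apply: mem_head.
Qed.

Hypothesis Q1 : ~ Q 1.

(** The ring will be a polynomial ring, where Q is not in the Jacobson radical; that the chain ends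
    inside Q keeps all the quotients in question nonzero. *)
Lemma hs_chain g (X : nat -> set A) : (forall i, (i <= g)%N -> is_prime (X i)) ->
  (forall i, (i < g)%N -> X i `<` X i.+1) -> X g `<=` Q -> (g < size (hs Q (X 0%N)))%N.
Proof.
have pos I : is_ideal I -> I `<=` Q -> (0 < size (hs Q I))%N.
  move=> hI IQ; rewrite size_poly_gt0; apply/eqP => E.
  have [N hN] := evn_and (hsP nA idQ finQ hI) (evn_ge 1).
  have [] := hN N (leqnn N); rewrite E horner0 => /esym/eqP; rewrite pnatr_eq0 => /eqP E0 N0.
  have hIN := idl_iadd hI (idl_pow Q N).
  have ET : iadd I (ideal_pow Q N) = setT.
    apply: (quo_length_eq hIN) => //; first exact: finIQ.
    by case: (quo_lengthT A) => _ ->.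
  apply: Q1; have : iadd I (ideal_pow Q N) 1 by rewrite ET.
  by apply: iadd_sub => // a; rewrite -{2}(pow1 idQ); apply: pow_leq.
elim: g X => [|g IH] X pX iX XQ; first by apply: pos => //; apply: prime_ideal; apply: pX.
have [s ns] := iX 0%N isT; have [f X1f nf] : exists2 f, X 1%N f & ~ X 0%N f.
  by apply: contrapT => no; apply: ns => f Xf; apply: contrapT => nf; apply: no; exists f.
have : (g < size (hs Q (X 1%N)))%N.
  by apply: (IH (fun i => X i.+1)) => [i hi|i hi|//]; [apply: pX|apply: iX].
have hX i : (i <= g.+1)%N -> is_ideal (X i) by move=> hi; apply: prime_ideal; apply: pX.
have : (size (hs Q (X 1%N)) <= size (hs Q (adjoin (X 0%N) f)))%N.
  by apply: hs_mono => //; [apply: idl_adjoin; apply: hX|apply: hX|apply: adjoin_sub => //; apply: hX].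
have := hs_drop nA idQ finQ (pX 0%N isT) nf.
lia.
Qed.

End HilbertSamuelChains.

Section LocalRegularity.
Variables (k : fieldType) (n : nat) (B : comNzRingType) (psi : {rmorphism mp k n -> B}).
Local Notation S := (mp k n).
Hypothesis noethB : is_noetherian B.
Hypothesis locB : is_local_ring B.
Hypothesis frac : forall b, exists F u, is_unit (psi u) /\ b * psi u = psi F.
Local Notation N := [set F : S | nonunits (psi F)].
Hypothesis maxN : maximal_ideal N.
Variables (c : nat) (g : 'I_c -> S) (d : 'I_c -> S -> S) (f : S).
Hypothesis dd : forall i, is_der idfun (d i).
Hypothesis kerg : forall j, psi (g j) = 0.
Hypothesis unitf : is_unit (psi f).
Hypothesis ker : forall F, psi F = 0 -> exists M : nat, ideal_gen (range g) (f ^+ M * F).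
Hypothesis unit_det : is_unit (psi (\det (\matrix_(i, j) d i (g j)))).

Let hN : is_ideal N. Proof. by have [] := maxN. Qed.
Let noethS : is_noetherian S := mp_noetherian (n := n) (@field_noetherian k).

Let notN F : ~ N F -> is_unit (psi F). Proof. by move=> nF; apply: contrapT. Qed.

(* The differentials of the [g j] are independent at [N], so by the Leibniz rule their classes in
   [N / N^2] are, and [n - c] elements generate the maximal ideal of [B]. *)
Lemma regular_generators : exists m (w : 'I_m -> B), (c + m)%N = n /\ @nonunits B = ideal_gen (range w).
Proof.
have [_ N1 Ni] := maxN; have [K [rho [rs rk]]] := residue_field hN N1 Ni.
have [z Ez] := maximal_gens maxN.
have zN i : N (z i) by rewrite Ez; apply: sub_gen.
have rz i : rho (z i) = 0 by apply/rk.
have /choice[a0 ha0] j : exists a : 'I_n -> S, g j = \sum_i a i * z i.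
  apply/gen_rangeP; rewrite -Ez /= kerg => u.
  by have [b] := u; rewrite mul0r => /esym/eqP; rewrite oner_eq0.
pose a : 'M[S]_(c, n) := \matrix_(j, i) a0 j i.
pose P := \matrix_(l < c, i < n) rho (d l (z i)).
have EM : map_mx rho (\matrix_(i, j) d i (g j)) = P *m (map_mx rho a)^T.
  apply/matrixP => l j; rewrite !mxE ha0 (der_sum (dd l)) rmorph_sum; apply: eq_bigr => i.
  by have [_ DM] := dd l; rewrite !mxE DM rmorphD !rmorphM rz mul0r addr0 mulrC.
have uM : map_mx rho (\matrix_(i, j) d i (g j)) \in unitmx.
  by rewrite unitmxE unitfE det_map_mx; apply/eqP /rk.
have freeA : row_free (map_mx rho a).
  apply/row_freeP; exists (P^T *m invmx (map_mx rho (\matrix_(i, j) d i (g j)))^T).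
  rewrite mulmxA (_ : map_mx rho a *m P^T = (map_mx rho (\matrix_(i, j) d i (g j)))^T).
    by rewrite mulmxV // unitmx_tr.
  by rewrite EM trmx_mul trmxK.
pose A := map_mx rho a; pose m := \rank (A^C)%MS; pose T := row_base (A^C)%MS.
have fullAT : row_full (col_mx A T).
  rewrite -sub1mx; apply: submx_trans (_ : (1%:M <= A + A^C)%MS) _; first by rewrite sub1mx addsmx_compl_full.
  by rewrite -addsmxE addsmxS // eq_row_base.
pose L := pinvmx (col_mx A T).
have LAT : L *m col_mx A T = 1%:M by apply: mulVpmx.
have : (c + m)%N = n.
  rewrite /m mxrank_compl; have /eqP -> := freeA; rewrite subnKC //.
  by have := rank_leq_col A; have /eqP -> := freeA.
have [s hs] := choice rs.
pose T' : 'M[S]_(m, n) := map_mx s T; pose L' : 'M[S]_(n, c + m) := map_mx s L.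
have sK p q (X : 'M[K]_(p, q)) : map_mx rho (map_mx s X) = X by apply/matrixP => i j; rewrite !mxE.
pose E0 := L' *m col_mx a T'.
have rE0 : map_mx rho E0 = 1%:M by rewrite map_mxM map_col_mx !sK.
have udet : is_unit (psi (\det E0)).
  apply: notN => /rk; rewrite -det_map_mx rE0 det1 => /eqP; by rewrite oner_eq0.
pose zB : 'cV[B]_n := \col_i psi (z i); pose w := map_mx psi T' *m zB.
have az : map_mx psi a *m zB = 0.
  apply/colP => j; rewrite !mxE -[RHS](kerg j) ha0 rmorph_sum; apply: eq_bigr => i.
  by rewrite !mxE rmorphM.
have Ew : psi (\det E0) *: zB = \adj (map_mx psi E0) *m map_mx psi L' *m col_mx 0 w.
  rewrite -[in RHS]az -mul_col_mx -map_col_mx -!mulmxA (mulmxA (map_mx psi L')) -map_mxM.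
  by rewrite mulmxA mul_adj_mx det_map_mx mul_scalar_mx.
have hJ := idl_gen (range (fun i => w i ord0)).
have wJ i j : (ideal_gen (range (fun i => w i ord0))) (col_mx (0 : 'cV_c) w i j).
  rewrite (ord1 j) mxE; case: (fintype.split i) => l; first by rewrite mxE; apply: (idl0 hJ).
  by apply: sub_gen.
have zJ i : ideal_gen (range (fun i => w i ord0)) (psi (z i)).
  have [v hv] := udet; have /matrixP/(_ i ord0) := Ew; rewrite !mxE => Ei.
  rewrite -[psi (z i)]mul1r -hv mulrAC mulrC; apply: (idlM _ hJ); rewrite Ei.
  by apply: idl_sum => // l _; apply: (idlM _ hJ).
have zU i : nonunits (psi (z i)) := zN i.
exists m, (fun i => w i ord0); split=> //; apply/seteqP; split; last first.
  apply: gen_sub => // _ [i _ <-]; rewrite mxE; apply: (idl_sum _) => // j _.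
  by rewrite [X in _ * X]mxE; apply: (idlM _ locB).
move=> b nb; have [F [u [[v uv] E]]] := frac b.
have NF : N F.
  by move=> uF; move: uF; rewrite -E => /is_unitM[].
rewrite -[b]mulr1 -uv mulrA E; apply: (idlMr _ hJ).
move: NF; rewrite Ez => /gen_rangeP[q ->]; rewrite rmorph_sum; apply: idl_sum => // i _.
by rewrite rmorphM; apply: (idlM _ hJ).
Qed.

Local Notation Ig := (foldl (@adjoin S) [set 0] [seq g j | j <- enum 'I_c]).

(** Extension of ideals from S to B is strictly increasing on ideals containing Ig + N^j: if the
    extensions of I and J agree, each F in J satisfies f^M u F in I with f^M u outside N, and such
    an element is invertible modulo N^j. Chains are thus carried over. *)
Lemma chi_local j : (0 < j)%N -> finl N -> finl (@nonunits B) -> (chi N Ig j <= chi (@nonunits B) (@set1 B 0%R) j)%N.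
Proof.
move=> j0 fN fB.
have [hI _ gI _] := foldl_adjoin [seq g j | j <- enum 'I_c] (is_ideal0 S).
have gI' i : Ig (g i) by apply: gI; rewrite map_f // mem_enum.
pose ex (I : set S) : set B := [set b | exists F u, [/\ I F, is_unit (psi u) & b * psi u = psi F]].
have u1 : is_unit (1 : B) by exists 1; rewrite mulr1.
have exI I : is_ideal I -> is_ideal (ex I).
  move=> hI'; split.
  - exists 0, 1; rewrite rmorph1 rmorph0 mul0r; split=> //; apply: (idl0 hI').
  - move=> b b' [F [u [IF uu E]]] [F' [u' [IF' uu' E']]]; exists (F * u' + F' * u), (u * u'); split.
    + by apply: (idlD hI'); apply: (idlMr _ hI').
    + by rewrite rmorphM; apply/is_unitM.
    + rewrite rmorphD !rmorphM -E -E'; ring.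
  - move=> b b' [F [u [IF uu E]]]; have [F' [u' [uu' E']]] := frac b; exists (F' * F), (u' * u); split.
    + exact: (idlM _ hI').
    + by rewrite rmorphM; apply/is_unitM.
    + rewrite !rmorphM -E -E'; ring.
have expow : ideal_pow (@nonunits B) j `<=` ex (ideal_pow N j).
  elim: (j) => [|i IH]; first by move=> b _; have [F [u [uu E]]] := frac b; exists F, u.
  apply: mul_sub => [|b y nb /IH[F' [u' [IF' uu' E']]]]; first by apply: exI.
  have [F [u [uu E]]] := frac b; exists (F * F'), (u * u'); split.
  - by apply: powSmul => //uF; move: uF; rewrite -E => /is_unitM[].
  - by rewrite rmorphM; apply/is_unitM.
  - rewrite !rmorphM -E -E'; ring.
have finB : finl (iadd [set 0] (ideal_pow (@nonunits B) j)).
  exact: (finIQ _).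
have finS : finl (iadd Ig (ideal_pow N j)) := finIQ noethS hN fN j hI.
have [chS _] := quo_lengthP finS; have [_ nchB] := quo_lengthP finB.
rewrite leqNgt; apply/negP => lt; apply: nchB; apply: has_chain_leq lt _.
move: chS; apply: (has_chain_map) => [I [hI' sI _]|I J [hI1 sI _] [hJ _ _] [s ns]].
  split=> //.
  apply: iadd_sub; first exact: exI.
    by move=> _ ->; apply: (idl0).
  by move=> b /expow[F [u [IF E]]]; exists F, u; split=> //; apply: sI; apply: sub_iaddr.
split; first by move=> b [F [u [IF E]]]; exists F, u; split=> //; apply: s.
move=> s'; apply: ns => F JF.
have [F0 [u [IF0 uu E]]] : ex I (psi F) by apply: s'; exists F, 1; rewrite rmorph1 mulr1.
have [M hM] : exists M : nat, ideal_gen (range g) (f ^+ M * (F * u - F0)).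
  by apply: ker; rewrite rmorphB rmorphM E subrr.
have IM : I (f ^+ M * (F * u - F0)).
  apply: sI; apply: sub_iaddl; first exact: idl_pow.
  by move: hM; apply: gen_sub => // _ [i _ <-].
have IF : I (f ^+ M * u * F).
  rewrite (_ : _ F = f ^+ M * (F * u - F0) + f ^+ M * F0); last ring.
  by apply: (idlD hI1) => //; apply: (idlM _ hI1).
have [_ N1 Ni] := maxN.
have [v hv] : exists v, N (1 - f ^+ M * u * v).
  apply: Ni => /=; apply; rewrite rmorphM rmorphXn; apply/is_unitM; split=> //; exact: is_unitX.
have [q hq] : exists q, (1 - f ^+ M * u * v) ^+ j = 1 - f ^+ M * u * q.
  elim: (j) => [|i [q Eq]]; first by exists 0; rewrite mulr0 subr0.
  exists (q + v * (1 - f ^+ M * u * q)); rewrite exprS Eq; ring.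
have I1 : I (1 - f ^+ M * u * q).
  by rewrite -hq; apply: sI; apply: sub_iaddr => //; apply: mem_powX.
rewrite (_ : F = (1 - f ^+ M * u * q) * F + f ^+ M * u * F * q); last ring.
by apply: (idlD hI1); apply: (idlMr _ hI1).
Qed.

(** The m generators bound the dimension above. Below, S has dimension at least n at N by
    [maximal_chain], each of the c equations lowers it by at most one, and n - c = m. *)
Lemma local_regular : is_regular_local_ring B.
Proof.
have [m [w [cm Ew]]] := regular_generators.
split=> //; exists m, w; split=> //.
have B1 : ~ @nonunits B 1 by apply; exists 1; rewrite mulr1.
have mB : maximal_ideal (@nonunits B).
  split=> // b nb; have [e be] : is_unit b by apply: contrapT.
  exists e; rewrite be subrr; apply: (idl0 locB).
have [fB _] := quo_length_max mB; have [fN _] := quo_length_max maxN.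
have proper I b : is_ideal I -> ~ I 1 -> I b -> @nonunits B b.
  by move=> hI I1 Ib [e be]; apply: I1; rewrite -be; apply: idlMr.
have jac I : is_ideal I -> ~ I 1 -> ~ iadd I (@nonunits B) 1.
  move=> hI I1 [a [b [Ia Qb E]]]; apply: B1; rewrite E; apply: (idlD locB) => //.
  exact: proper.
apply/(krull_dim_hs noethB locB fB jac); apply/eqP; rewrite eqn_leq; apply/andP; split.
  have wU b : b \in [seq w i | i <- enum 'I_m] -> @nonunits B b.
    by move=> /mapP[i _ ->]; rewrite Ew; apply: sub_gen.
  apply: leq_trans (hs_adjoin_seq noethB locB fB (is_ideal0 B) wU) _.
  rewrite size_map size_enum_ord -addn1 leq_add2l.
  have [hI _ wI _] := foldl_adjoin [seq w i | i <- enum 'I_m] (is_ideal0 B).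
  apply: leq_trans (_ : size (hs (@nonunits B) (@nonunits B)) <= 1)%N; last first.
    by apply: (size1_of_sub noethB locB fB).
  apply: hs_mono => //; rewrite Ew; apply: gen_sub => // _ [i _ <-].
  by apply: wI; rewrite map_f // mem_enum.
have [X [pX iX EX]] := maximal_chain maxN.
have N1 : ~ N 1 by have [] := maxN.
have lt := hs_chain noethS hN fN N1 pX iX.
have {}lt : (n < size (hs N (@set1 S 0%R)))%N.
  apply: leq_trans (lt _) _; first by rewrite EX.
  apply: hs_mono => //; first exact: prime_ideal (pX 0%N isT).
  move=> _ ->; apply: (idl0 (prime_ideal (pX 0%N isT))).
have gN b : b \in [seq g i | i <- enum 'I_c] -> N b.
  by move=> /mapP[i _ ->]; rewrite /= kerg => -[e]; rewrite mul0r => /esym/eqP; rewrite oner_eq0.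
have := leq_trans lt (hs_adjoin_seq noethS hN fN (is_ideal0 S) gN).
rewrite size_map size_enum_ord.
set u := size (hs N _) => h; have {}h : (m < u)%N by move: h; rewrite -cm -addnS leq_add2l.
apply: leq_trans h _.
have [hI _ _ _] := foldl_adjoin [seq g j | j <- enum 'I_c] (is_ideal0 S).
apply: size_le_large.
apply: evn_imp (evn_and (hsP noethS hN fN hI) (evn_and (hsP noethB locB fB (is_ideal0 B)) (evn_ge 1))) => j [-> [-> j0]].
by rewrite ler0n ler_nat; apply: chi_local.
Qed.

End LocalRegularity.

(** * Regular points are dense on a reduced scheme *)

Section RegularLocus.
Variables (k : fieldType) (X : kScheme k).
Hypothesis X_ft : is_finite_type X.

Lemma closed_chart_maximal (V : opens X) (h : X -> set (sect V)) (y : X) : chart h -> pts V y ->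
  closed [set y] -> maximal_ideal (h y).
Proof.
move=> ch Vy cy; have [iP P1 _] := chart_prime ch Vy; split=> // a na; apply: contrapT => no.
have [|N [pN PN _]] := exists_maximal (idl_adjoin a iP).
  by case/adjoinP => c hc; apply: no; exists c.
have [y' Vy' EN] := chart_surj ch pN.
have sy : spec y y'.
  move=> W; have sub : h y `<=` h y' by rewrite EN => s hs; apply: PN; apply: sub_adjoin.
  exact: ((chart_special ch Vy Vy').2 sub W (pts_open W)).
by apply: na; rewrite -(closed_spec cy sy) EN; apply: PN; apply: mem_adjoin.
Qed.

Hypothesis redX : is_reduced X.

(** P is the annihilator of H = a s0 and is prime; H lies outside P because X is reduced. On D(H)
    the elements of P vanish, so the local rings there are localizations of the domain O(V)/P, and
    inverting f and the Jacobian determinant of a presentation of P makes them regular at closed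
    points. *)
Lemma regular_nonempty (O : set X) : open O -> O !=set0 -> exists W : set X,
  [/\ open W, W !=set0, W `<=` O & forall y, W y -> closed [set y] -> is_regular_local_ring (stalk y)].
Proof.
move=> oO [x Ox]; have [V [h [n [g [Vx ch gen]]]]] := point_chart X_ft x.
have nz := chart_nontrivial ch Vx; have nA := sect_noetherian nz gen.
have [s0 [_ ns0] s0O] := chart_basis ch (W := Opens oO) Ox Vx.
have h0 := is_ideal0 (sect V).
have [|a [na pP]] := colon_prime nA (idl_colon s0 h0).
  move=> E; apply: ns0; have -> : s0 = 0 by rewrite -[s0]mulr1.
  exact: (idl0 (prime_ideal (chart_prime ch Vx))).
set P := colon _ _ in pP; pose H := a * s0.
have HP s : P s -> H * s = 0 by move=> hs; rewrite mulrAC mulrC.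
have nH : ~ P H.
  by move=> /HP; rewrite -expr2 => /redX H0; apply: na; rewrite /colon /= mulrC.
have [eta Ve Eeta] := chart_surj ch pP.
have [rho surj] := generates_surj nz gen; have [K [pi [pis pik]]] := residue eta.
have [xs hxs] := mp_morphism (gval pi Ve \o rho).
have evE F : gval pi Ve (rho F) = mpev ((gval pi Ve \o rho) \o mpC k n) xs n F := hxs F.
have [c [gs [d [f [dd ker0 f0 ker det0]]]]] := jacobian_exists ((gval pi Ve \o rho) \o mpC k n) xs n.
have ev0 F : mpev ((gval pi Ve \o rho) \o mpC k n) xs n F = 0 <-> P (rho F).
  by rewrite -evE -Eeta; apply: chart_val0.
pose M := \matrix_(i, j) d i (gs j).
have nM : ~ P (rho (\det M)).
  move/ev0 => E; move/eqP: det0; apply; rewrite -[RHS]E -det_map_mx; congr (\det _).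
  by apply/matrixP => i j; rewrite !mxE.
have nf : ~ P (rho f) by move/ev0 => E; rewrite E eqxx in f0.
pose T := H * rho f * rho (\det M).
have : ~ P T by apply: primeNM => //; apply: primeNM.
exists (chartD ch T); split; [exact: pts_open|by exists eta; split=> //; rewrite Eeta| |].
  move=> y [Vy nTy]; apply: s0O; split=> // hs; apply: nTy.
  by rewrite /T -!mulrA mulrCA; apply: (idlMr _ (prime_ideal (chart_prime ch Vy))).
move=> y [Vy nTy] cy; have py := chart_prime ch Vy; have iy := prime_ideal py.
have nHy : ~ h y H by move=> h1; apply: nTy; do 2!apply: (idlMr _ iy).
have nfy : ~ h y (rho f) by move=> h1; apply: nTy; apply: (idlMr _ iy); apply: (idlM _ iy).
have nMy : ~ h y (rho (\det M)) by move=> h1; apply: nTy; apply: (idlM _ iy).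
pose psi : {rmorphism mp k n -> stalk y} := germ Vy \o rho.
have gP s : P s -> germ Vy s = 0.
  move=> /HP E; have [v hv] := (chart_unit ch Vy H).2 nHy.
  by rewrite -[germ Vy s]mul1r -hv mulrAC -rmorphM E rmorph0 mul0r.
have Pg s : germ Vy s = 0 -> P s.
  move=> /(chart_ker ch)[f' nf' E]; have [_ _ PM] := pP.
  have [/gP g0|//] : P f' \/ P s by apply: PM; rewrite E; apply: (idl0).
  have [v] := (chart_unit ch Vy f').2 nf'; rewrite g0 mul0r => /esym/eqP.
  by rewrite (negPf (stalk_nontrivial y)).
have [ly _] := stalk_local y.
have mN : maximal_ideal [set F | nonunits (psi F)].
  have my := closed_chart_maximal ch Vy cy.
  have NE F : nonunits (psi F) <-> h y (rho F).
    split=> [nu|hF /(chart_unit ch Vy)//]; by apply: contrapT => /(chart_unit ch Vy).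
  have [_ h1 hi] := my; split; first split.
  - apply/NE; rewrite rmorph0; apply: (idl0 iy).
  - by move=> F G /NE hF /NE hG; apply/NE; rewrite rmorphD; apply: (idlD iy).
  - by move=> F G /NE hG; apply/NE; rewrite rmorphM; apply: (idlM _ iy).
  - by move/NE; rewrite rmorph1.
  - move=> F nF; have [|b hb] := hi (rho F); first by move=> h2; apply: nF; apply/NE.
    by have [G EG] := surj b; exists G; apply/NE; rewrite rmorphB rmorph1 rmorphM EG.
pose reg (B : comPzRingType) := forall p : {rmorphism mp k n -> B}, is_noetherian B -> is_local_ring B ->
  (forall b, exists F u, is_unit (p u) /\ b * p u = p F) -> maximal_ideal [set F | nonunits (p F)] ->
  (forall j, p (gs j) = 0) -> is_unit (p f) ->
  (forall F, p F = 0 -> exists M : nat, ideal_gen (range gs) (f ^+ M * F)) ->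
  is_unit (p (\det M)) -> is_regular_local_ring B.
have hreg : forall B : comNzRingType, reg B.
  move=> B p nB lB fr mx kg uf kp ud; apply: (local_regular nB lB fr mx dd kg uf kp ud).
have hS := comNz_transport hreg (stalk_nontrivial y); apply: (hS psi) => //.
- exact: stalk_noetherian.
- move=> b; have [s [u [nu E]]] := chart_frac ch Vy b.
  have [F EF] := surj s; have [G EG] := surj u; exists F, G; rewrite /= EF EG.
  by split=> //; apply/(chart_unit ch Vy).
- by move=> j; apply: gP; apply/ev0.
- exact/(chart_unit ch Vy).
- by move=> F /Pg/ev0/ker.
- exact/(chart_unit ch Vy).
Qed.

(** Regularity is asserted at closed points only, which is all that the supports of zero-cycles
    require. *)
Lemma regular_dense : exists U : set X, [/\ open U, dense U &
  forall y, U y -> closed [set y] -> is_regular_local_ring (stalk y)].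
Proof.
pose good (W : set X) := open W /\ forall y, W y -> closed [set y] -> is_regular_local_ring (stalk y).
exists (\bigcup_(W in good) W); split.
- by apply: bigcup_open => W [].
- move=> O O0 oO; have [W [oW [y Wy] WO hW]] := regular_nonempty oO O0.
  by exists y; split; [apply: WO|exists W].
- by move=> y [W [_ hW] Wy]; apply: hW.
Qed.

End RegularLocus.

(** Unless S contains only 0, the least positive gcd of a finite subfamily divides every element of
    S: adjoining an element cannot lower it. *)
Lemma gcd_setE (S : set nat) : (forall e, S e -> (gcd_set S %| e)%N) /\
  exists2 l : seq nat, (forall e, e \in l -> S e) & gcd_set S = \big[gcdn/0%N]_(e <- l) e.
Proof.
pose G l := \big[gcdn/0%N]_(e <- l) e.
have Gdvd l m : (m %| G l)%N <-> forall e, e \in l -> (m %| e)%N.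
  rewrite /G; elim: l => [|a l IH]; first by rewrite big_nil.
  rewrite big_cons dvdn_gcd; split=> [/andP[ma /IH h] e|h].
    by rewrite inE => /orP[/eqP->|/h].
  by rewrite h ?mem_head //; apply/IH => e el; apply: h; rewrite inE el orbT.
suff [l lS hl] : exists2 l : seq nat, (forall e, e \in l -> S e) & forall e, S e -> (G l %| e)%N.
  suff E : gcd_set S = G l by rewrite E; split=> //; exists l.
  rewrite /gcd_set; case: xgetP => [d _ hd|/(_ (G l)) no].
    have dG : (d %| G l)%N by apply/Gdvd => e /lS; apply: (hd d).1.
    by apply/eqP; rewrite eqn_dvd dG; apply/(hd).
  exfalso; apply: no => m; split=> [mG e /hl|h]; first exact: dvdn_trans.
  apply/Gdvd => e /lS; apply: h.
have [all0|/existsNP[e0 /not_implyP[Se0 e0n]]] := pselect (forall e, S e -> e = 0%N).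
  by exists [::] => // e /all0 ->.
have ex : exists n, `[< exists l, [/\ forall e, e \in l -> S e, G l = n & (0 < n)%N] >].
  exists e0; apply/asboolP; exists [:: e0]; split; first by move=> e; rewrite inE => /eqP->.
    by rewrite /G big_seq1.
  by rewrite lt0n; apply/eqP.
case: (ex_minnP ex) => n /asboolP[l [lS Gl n0]] min; exists l => // e Se.
have h : G (e :: l) = gcdn e n by rewrite /G big_cons -[X in gcdn e X]/(G l) Gl.
have le : (n <= gcdn e n)%N.
  apply: min; apply/asboolP; exists (e :: l); split=> //; last by rewrite gcdn_gt0 n0 orbT.
  by move=> e'; rewrite inE => /orP[/eqP->|/lS].
have -> : G l = gcdn e n by rewrite Gl; apply/eqP; rewrite eqn_leq le dvdn_leq ?dvdn_gcdr.
exact: dvdn_gcdl.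
Qed.

Lemma dvdn_gcd_set (S : set nat) i c : (forall e, S e -> (i %| e * c)%N) -> (i %| gcd_set S * c)%N.
Proof.
have [_ [l lS ->]] := gcd_setE S; move=> h; elim: l lS => [|e l IH] lS; first by rewrite big_nil.
rewrite big_cons muln_gcdl dvdn_gcd h ?IH //; last by apply: lS; rewrite mem_head.
by move=> e' el; apply: lS; rewrite inE el orbT.
Qed.

Theorem corollary6p7 (k : fieldType) (X : kScheme k) (x0 : X)
    (X_ft : is_finite_type X) (x0_closed : closed [set x0]) :
  (forall (U : set X) (Q : set (stalk x0)),
     open U -> dense U -> is_m_primary Q ->
     (exists Z : X -> int,
        [/\ is_zero_cycle Z, supported_in Z U
          & cycle_degree Z = (multiplicity Q * pt_degree x0)%:Z]) /\
     (is_separated X ->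
      exists Z : X -> int,
        [/\ is_zero_cycle Z, supported_in Z U,
            cycle_degree Z = (multiplicity Q * pt_degree x0)%:Z
          & rationally_equivalent Z
              (fun x => (multiplicity Q)%:Z * point_cycle x0 x)])) /\
  (is_reduced X ->
     (scheme_index (reg_locus (X := X)) %| gamma (stalk x0) * pt_degree x0)%N).
Proof.
split=> [U Q oU dU hQ|redX].
  have [z [fz zU dz tz]] := movable_multiplicity X_ft x0_closed oU dU hQ.
  have zz : is_zero_cycle z by split=> // y /zU[].
  have zs : supported_in z U by move=> y /zU[].
  split=> [|sepX]; exists z; rewrite ?PoszM //; split=> //.
  by have [n [v [hv Ev]]] := tz sepX; exists n, v; split=> // j; have [] := hv j.
have [U [oU dU hU]] := regular_dense X_ft redX.
apply: dvdn_gcd_set => e [Q hQ ->].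
have [z [fz zU dz _]] := movable_multiplicity X_ft x0_closed oU dU hQ.
have [s us hs] := finite_supportP fz.
suff : (Posz (scheme_index (reg_locus (X := X))) %| (multiplicity Q)%:Z * (pt_degree x0)%:Z)%Z by rewrite -PoszM.
rewrite -dz (cycle_degreeE us hs); apply: (big_ind (fun a => (Posz (scheme_index (reg_locus (X := X))) %| a)%Z)).
- exact: dvdz0.
- by move=> a b; apply: rpredD.
move=> y _; have [->|/zU[cy Uy]] := eqVneq (z y) 0; first by rewrite mul0r dvdz0.
apply: dvdz_mull; rewrite dvdzE /=; apply: (gcd_setE _).1; exists y; split=> //.
  by apply: hU.
by rewrite -(closure_id _).1 // => y' [].
Qed.
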